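(* Let $\Omega\Subset\Omega'\subset\mathbb R^n$, $n\ge2$, be open bounded sets with smooth boundary, and assume $-S'<0<T<T'$. Define $M:=[0,T]\times\overline\Omega$ and $M':=[-S',T']\times\overline{\Omega'}$. Let $c_1,c_2\in C^\infty(\mathbb R^n)$ be positive functions with $c_1=c_2$ in $\overline{\Omega'}\setminus\Omega$, such that for $j=1,2$ the following hold, where $g_0$ is the Euclidean metric: (A1) the Riemannian manifold $(\overline\Omega,c_j(x)^{-1}g_0)$ is strictly convex; (A2) if $n=2$, $(\overline\Omega,c_j(x)^{-1}g_0)$ is a simple manifold; (A3) if $n\ge3$, $(\overline\Omega,c_j(x)^{-1}g_0)$ is foliated by strictly convex hypersurfaces. Let $G_1,G_2\in C^\infty(\overline{\Omega'}\times[0,S'+T'])$ be real valued memory kernels such that $G_1(x,t)=G_2(x,t)$ for all $x\in\overline{\Omega'}\setminus\Omega$ and all $t$. Let $\mathcal S_1,\mathcal S_2$ be the source-to-solution maps corresponding to $(c_1,G_1)$ and $(c_2,G_2)$ respectively, and assume $$\mathcal S_1(f)=\mathcal S_2(f)\qquad\text{for all } f\in C_c^\infty(M'\setminus M).$$ Then $c_1=c_2$ in $\Omega$, and $\partial_t^jG_1|_{t=0}=\partial_t^jG_2|_{t=0}$ in $\Omega$ for all $j\in\mathbb N$ (including $j=0$).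
   Context: For a wave speed coefficient $c$ and memory kernel $G$, the viscoacoustic operator on $M'$ is $$Pu(x,t)=-\tfrac12\Big(\partial_t^2u(x,t)-\nabla\cdot(c(x)\nabla u(x,t))+\int_{-S'}^t\nabla\cdot\big(G(x,t-s)\nabla u(x,s)\big)\,ds\Big).$$ For $f\in C_c^\infty(M'\setminus M)$ let $u\in L^2([-S',T'],H^1_0(\Omega'))\cap H^1([-S',T'],L^2(\Omega'))$ be the unique (generalized) solution of $Pu=f$ in $M'$, $u(-S')=\partial_tu(-S')=0$ in $\Omega'$. The source-to-solution map is $\mathcal S(f):=u|_{M'\setminus M}$. Geometric notions for a compact Riemannian manifold $(N,g)$ with smooth boundary. It is strictly convex if the second fundamental form of $\partial N$ is positive definite (with respect to the convention in which Euclidean balls are strictly convex). It is simple if it is strictly convex, nontrapping (every maximal geodesic has finite length) and has no conjugate points. It is foliated by strictly convex hypersurfaces (in the sense of Stefanov–Uhlmann–Vasy) if there are a smooth function $\rho:N\to[0,\infty)$ and a finite $T_0>0$ such that, with $\Sigma_r:=\rho^{-1}(r)$: $\Sigma_0=\partial N$; for each $r\in[0,T_0)$, $d\rho\neq0$ on $\Sigma_r$ and $\Sigma_r$ is strictly convex viewed from $\rho^{-1}((0,r))$, i.e. for every unit vector $v$ tangent to $\Sigma_r$ the Hessian satisfies $\mathrm{Hess}_g\rho(v,v)<0$; and $N\setminus\bigcup_{r\in[0,T_0)}\Sigma_r$ has empty interior. *)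

(* Defs.v *)
From HB Require Import structures.
From mathcomp Require Import all_boot all_order all_algebra.
From mathcomp Require Import all_classical all_reals all_analysis.
Set Implicit Arguments.
Unset Strict Implicit.
Unset Printing Implicit Defensive.
Import Order.TTheory GRing.Theory Num.Theory.
Import numFieldNormedType.Exports.
Local Open Scope classical_set_scope.
Local Open Scope ring_scope.

(* The library has no measurable structure on ['rV[R]_n]: take the
   sigma-algebra generated by the coordinates, i.e. the Borel sets of R^n. *)
Definition rv_display : measure_display.
Proof. exact: default_measure_display. Qed.

Section rv_measurable.
Context (R : realType) (n : nat).

Definition rv_coord (i : 'I_n) (v : 'rV[R]_n) : measurableTypeR R := v ord0 i.

Let rv_set0 : g_sigma_preimage rv_coord set0.
Proof. exact: sigma_algebra0. Qed.

Let rv_setC A : g_sigma_preimage rv_coord A -> g_sigma_preimage rv_coord (~` A).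
Proof. exact: sigma_algebraC. Qed.

Let rv_bigcup (F : (set 'rV[R]_n)^nat) :
  (forall i, g_sigma_preimage rv_coord (F i)) ->
  g_sigma_preimage rv_coord (\bigcup_i (F i)).
Proof. exact: sigma_algebra_bigcup. Qed.

HB.instance Definition _ := @isMeasurable.Build rv_display 'rV[R]_n
  (g_sigma_preimage rv_coord) rv_set0 rv_setC rv_bigcup.

Lemma measurable_rv_coord i : measurable_fun [set: 'rV[R]_n] (rv_coord i).
Proof.
move=> _ Y mY; rewrite setTI; apply: sub_sigma_algebra => /=.
rewrite -bigcup_seq/=; exists i => /=; first by rewrite mem_index_enum.
by exists Y => //; rewrite setTI.
Qed.

Lemma measurable_fun_rv d (T : measurableType d) (f : T -> 'rV[R]_n) :
  (forall i, measurable_fun [set: T] (rv_coord i \o f)) ->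
  measurable_fun [set: T] f.
Proof.
move=> mf _ A mA; rewrite setTI.
suff : g_sigma_preimage rv_coord `<=` [set B | measurable (f @^-1` B)] by apply.
apply: smallest_sub.
  split=> /= [|B mB|F mF].
  - by rewrite preimage_set0.
  - by rewrite setTD preimage_setC; exact: measurableC.
  - by rewrite preimage_bigcup; exact: bigcupT_measurable.
rewrite -bigcup_seq; apply: bigcup_sub => i _ B [C mC <-] /=.
by rewrite setTI -[X in measurable X]setTI; exact: mf.
Qed.

End rv_measurable.

Lemma product_sigma_finite d1 d2 (T1 : measurableType d1)
    (T2 : measurableType d2) (R : realType)
    (m1 : {sigma_finite_measure set T1 -> \bar R})
    (m2 : {sigma_finite_measure set T2 -> \bar R}) :
  sigma_finite setT (m1 \x m2)%E.
Proof.
have /sigma_finiteP[F [TF ndF Foo]] := sigma_finiteT m1.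
have /sigma_finiteP[G [TG ndG Goo]] := sigma_finiteT m2.
exists (fun n => F n `*` G n).
  rewrite -setXTT TF TG predeqE => -[x y]; split.
    move=> [/= [n _ Fnx] [k _ Gky]]; exists (maxn n k) => //; split.
    - by move: x Fnx; exact/subsetPset/ndF/leq_maxl.
    - by move: y Gky; exact/subsetPset/ndG/leq_maxr.
  by move=> [n _ []/= ? ?]; split; exists n.
move=> k; have [? ?] := Foo k; have [? ?] := Goo k.
split; first exact: measurableX.
by rewrite product_measure1E// lte_mul_pinfty// ge0_fin_numE.
Qed.

Section lebesgue_rv.
Context (R : realType).

Definition rv_cons n (z : measurableTypeR R * 'rV[R]_n) : 'rV[R]_n.+1 :=
  \row_i oapp (z.2 ord0) z.1 (unlift ord0 i).

Definition rv_uncons n (v : 'rV[R]_n.+1) : measurableTypeR R * 'rV[R]_n :=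
  (v ord0 ord0, \row_i v ord0 (lift ord0 i)).

Lemma rv_consK n : cancel (@rv_cons n) (@rv_uncons n).
Proof.
case=> x v; rewrite /rv_uncons mxE unlift_none /=; congr pair.
by apply/rowP => i; rewrite !mxE liftK.
Qed.

Lemma measurable_rv_cons n : measurable_fun setT (@rv_cons n).
Proof.
apply: measurable_fun_rv => i.
case: (unliftP ord0 i) => [j|] ->.
  rewrite (_ : _ \o _ = @rv_coord R n j \o snd).
    by apply: measurableT_comp => //; exact: measurable_rv_coord.
  by apply/funext => z; rewrite /= /rv_coord mxE liftK.
rewrite (_ : _ \o _ = fst) //.
by apply/funext => z; rewrite /= /rv_coord mxE unlift_none.
Qed.

Lemma measurable_rv_uncons n : measurable_fun setT (@rv_uncons n).
Proof.
apply: measurable_fun_pair; first exact: measurable_rv_coord.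
apply: measurable_fun_rv => i.
rewrite (_ : _ \o _ = @rv_coord R n.+1 (lift ord0 i)).
  exact: measurable_rv_coord.
by apply/funext => v; rewrite /= /rv_coord mxE.
Qed.

Section step.
Context (n : nat) (m : {sigma_finite_measure set 'rV[R]_n -> \bar R}).

Definition lebesgue_rv_step : set 'rV[R]_n.+1 -> \bar R :=
  pushforward (@lebesgue_measure R \x m)%E (@rv_cons n).

Let step0 : lebesgue_rv_step set0 = 0%E.
Proof. by rewrite /lebesgue_rv_step /pushforward preimage_set0 measure0. Qed.

Let step_ge0 A : (0 <= lebesgue_rv_step A)%E.
Proof. exact: (@measure_ge0 _ _ _ (@lebesgue_measure R \x m)%E). Qed.

Let step_sigma_additive : semi_sigma_additive lebesgue_rv_step.
Proof.
move=> F mF tF mUF; rewrite /lebesgue_rv_step /pushforward preimage_bigcup.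
apply: (@measure_semi_sigma_additive _ _ _ (@lebesgue_measure R \x m)%E).
- move=> i; rewrite -[X in measurable X]setTI; exact: measurable_rv_cons.
- apply/trivIsetP => /= i j _ _ ij; rewrite -preimage_setI.
  by move/trivIsetP : tF => /(_ _ _ _ _ ij) ->//; rewrite preimage_set0.
- rewrite -preimage_bigcup -[X in measurable X]setTI; exact: measurable_rv_cons.
Qed.

HB.instance Definition _ := isMeasure.Build _ _ _ lebesgue_rv_step
  step0 step_ge0 step_sigma_additive.

Let step_sigma_finite : sigma_finite setT lebesgue_rv_step.
Proof.
have [F FT Foo] := product_sigma_finite (@lebesgue_measure R) m.
exists (fun i => @rv_uncons n @^-1` F i).
  by rewrite -preimage_bigcup -FT preimage_setT.
move=> i; have [mFi Fioo] := Foo i; split.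
  by rewrite -[X in measurable X]setTI; exact: measurable_rv_uncons.
rewrite /lebesgue_rv_step /pushforward -comp_preimage.
rewrite (_ : _ @^-1` _ = F i) //; apply/seteqP.
by split=> z /=; rewrite rv_consK.
Qed.

HB.instance Definition _ := Measure_isSigmaFinite.Build _ _ _ lebesgue_rv_step
  step_sigma_finite.

End step.

(* Lebesgue measure on R^n, as the n-fold product of [lebesgue_measure]. *)
Fixpoint lebesgue_rv n : {sigma_finite_measure set 'rV[R]_n -> \bar R} :=
  if n is n'.+1 then lebesgue_rv_step (lebesgue_rv n') else \d_(0 : 'rV[R]_0).

End lebesgue_rv.

Section smooth_functions.
Context (R : realType) (W : normedModType R).

Definition iter_derive (s : seq W) (f : W -> R) : W -> R :=
  foldr (fun v g => 'D_v g) f s.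

Definition smooth_on (U : set W) (f : W -> R) :=
  forall (s : seq W) (x : W), U x ->
    {for x, continuous (iter_derive s f)} /\
    (forall v, derivable (iter_derive s f) x v).

(* C^oo(K) for a closed set K with (piecewise) smooth boundary: the functions
   which are smooth up to the boundary are the restrictions of smooth functions
   on the whole space. *)
Definition smooth_closed (K : set W) (f : W -> R) :=
  exists2 F : W -> R, smooth_on setT F & forall x, K x -> f x = F x.

(* C_c^oo(U) for an open set U *)
Definition test_function (U : set W) (phi : W -> R) :=
  [/\ smooth_on setT phi, compact (closure [set x | phi x != 0]) &
      closure [set x | phi x != 0] `<=` U].

(* C_c^oo(K \ A) for K closed: K \ A is only relatively open in K, so the
   support may meet the boundary of K, but not A. *)
Definition test_function_closed (K A : set W) (f : W -> R) :=
  let S := closure (K `&` [set x | f x != 0]) in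
  [/\ smooth_closed K f, compact S & S `<=` K `\` A].

End smooth_functions.

Section geometry.
Context (R : realType) (n : nat).
Local Notation V := 'rV[R]_n.
Local Notation e_ i := (delta_mx ord0 i : V).

Definition boundary (A : set V) : set V := closure A `\` interior A.

(* psi is a defining function of Omega near x: Omega lies locally on the side
   psi < 0, so that the gradient of psi points outwards *)
Definition defining_function (Omega : set V) (x : V) (psi : V -> R) :=
  exists U : set V, [/\ open_nbhs x U, smooth_on U psi,
    (forall y, U y -> (Omega y <-> psi y < 0)) &
    (exists v, 'D_v psi x != 0)].

Definition smooth_boundary (Omega : set V) :=
  forall x, boundary Omega x -> exists psi, defining_function Omega x psi.

(* A metric on R^n, as the field of its Gram matrices in the standard basis. *)
Variable g : V -> 'M[R]_n.

Definition metric (x v w : V) : R := (v *m g x *m w^T) ord0 ord0.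

Definition metric_norm (x v : V) : R := Num.sqrt (metric x v v).

(* Gamma^k_ij *)
Definition christoffel (k i j : 'I_n) (x : V) : R :=
  2^-1 * \sum_l invmx (g x) k l *
    ('D_(e_ i) (fun y => g y j l) x + 'D_(e_ j) (fun y => g y i l) x
     - 'D_(e_ l) (fun y => g y i j) x).

Definition Gamma (x v w : V) : V :=
  \row_k \sum_i \sum_j christoffel k i j x * v ord0 i * w ord0 j.

(* Levi-Civita connection: derivative of the vector field X along v at x *)
Definition nabla (v : V) (X : V -> V) (x : V) : V :=
  'D_v X x + Gamma x v (X x).

Definition gradient (f : V -> R) (x : V) : V :=
  \row_k \sum_l invmx (g x) k l * 'D_(e_ l) f x.

Definition hessian (f : V -> R) (x v w : V) : R :=
  'D_v ('D_w f) x - 'D_(Gamma x v w) f x.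

(* R^l_ijk, with R(X,Y)Z = nabla_X nabla_Y Z - nabla_Y nabla_X Z - nabla_[X,Y] Z
   and R(e_i,e_j)e_k = \sum_l R^l_ijk e_l *)
Definition curvature_coef (l i j k : 'I_n) (x : V) : R :=
  'D_(e_ i) (christoffel l j k) x - 'D_(e_ j) (christoffel l i k) x
  + \sum_m (christoffel l i m x * christoffel m j k x
            - christoffel l j m x * christoffel m i k x).

Definition curvature (x u v w : V) : V :=
  \row_l \sum_i \sum_j \sum_k
    curvature_coef l i j k x * u ord0 i * v ord0 j * w ord0 k.

Definition unit_normal (psi : V -> R) (x : V) : V :=
  (metric_norm x (gradient psi x))^-1 *: gradient psi x.

(* II(v,w) = g(nabla_v nu, w) with nu the outward unit normal: positive definite
   for Euclidean balls *)
Definition second_fundamental_form (psi : V -> R) (x v w : V) : R :=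
  metric x (nabla v (unit_normal psi) x) w.

(* Below, the manifold is (closure Omega, g) with boundary [boundary Omega]. *)

Definition strictly_convex (Omega : set V) :=
  forall (x : V) (psi : V -> R),
    boundary Omega x -> defining_function Omega x psi ->
    forall v : V, 'D_v psi x = 0 -> v != 0 ->
      0 < second_fundamental_form psi x v v.

Definition covariant_derive (gamma X : R -> V) (t : R) : V :=
  X^`()%classic t + Gamma (gamma t) (gamma^`()%classic t) (X t).

(* A curve on I is given by a curve on R, required to be differentiable near I
   and to solve the equation and stay in N on I only: a geodesic of
   N `<=` R^n reaching the boundary extends as a geodesic of (R^n, g). *)
Definition geodesic (N : set V) (I : set R) (gamma : R -> V) :=
  forall t, I t ->
    [/\ N (gamma t),
        (\forall s \near t, derivable gamma s 1),
        derivable gamma^`()%classic t 1 &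
        covariant_derive gamma gamma^`()%classic t = 0].

Definition maximal_geodesic (N : set V) (I : interval R) (gamma : R -> V) :=
  geodesic N [set` I] gamma /\
  forall (J : interval R) (delta : R -> V),
    [set` I] `<=` [set` J] -> geodesic N [set` J] delta ->
    (forall t, t \in I -> delta t = gamma t) -> [set` J] `<=` [set` I].

Definition curve_length (I : interval R) (gamma : R -> V) : \bar R :=
  (\int[lebesgue_measure]_(t in [set` I])
     (metric_norm (gamma t) (gamma^`()%classic t))%:E)%E.

Definition nontrapping (N : set V) :=
  forall (I : interval R) (gamma : R -> V),
    maximal_geodesic N I gamma -> (curve_length I gamma < +oo)%E.

(* Jacobi equation J'' + R(J, gamma')gamma' = 0, on I *)
Definition jacobi_field (I : set R) (gamma J : R -> V) :=
  forall t, I t ->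
    [/\ (\forall s \near t, derivable J s 1),
        derivable (covariant_derive gamma J) t 1 &
        covariant_derive gamma (covariant_derive gamma J) t
        + curvature (gamma t) (J t) (gamma^`()%classic t) (gamma^`()%classic t)
        = 0].

Definition no_conjugate_points (N : set V) :=
  forall (a b : R) (gamma J : R -> V), a < b ->
    geodesic N `[a, b] gamma -> jacobi_field `[a, b] gamma J ->
    J a = 0 -> J b = 0 -> forall t, t \in `[a, b] -> J t = 0.

Definition simple (Omega : set V) :=
  [/\ strictly_convex Omega, nontrapping (closure Omega) &
      no_conjugate_points (closure Omega)].

(* As Omega is dense in closure Omega, a subset of closure Omega has empty
   interior in closure Omega iff it has empty interior in R^n. *)
Definition foliated_by_strictly_convex (Omega : set V) :=
  exists (rho : V -> R) (T0 : R),
    let Sigma r := closure Omega `&` [set x | rho x = r] in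
    [/\ smooth_on setT rho, (forall x, closure Omega x -> 0 <= rho x), 0 < T0,
        Sigma 0 = boundary Omega &
        (forall r x, 0 <= r < T0 -> Sigma r x ->
           (exists v, 'D_v rho x != 0) /\
           (forall v, 'D_v rho x = 0 -> metric x v v = 1 ->
              hessian rho x v v < 0)) /\
        interior (closure Omega `\` \bigcup_(r in `[0, T0[) Sigma r) = set0].

End geometry.

(* c^-1 g_0 *)
Definition conformal_metric (R : realType) (n : nat) (c : 'rV[R]_n -> R)
  (x : 'rV[R]_n) : 'M[R]_n := ((c x)^-1)%:M.

Section viscoacoustic.
Context (R : realType) (n : nat).
Local Notation V := 'rV[R]_n.
Local Notation X := (V * R)%type.
Local Notation e_ i := (delta_mx ord0 i : V).
Local Notation mux := (lebesgue_rv R n).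
Local Notation mut := (@lebesgue_measure R).
Local Notation muxt := (lebesgue_rv R n \x @lebesgue_measure R)%E.

Definition Dx (i : 'I_n) (phi : X -> R) : X -> R := 'D_((e_ i, 0) : X) phi.
Definition Dt (phi : X -> R) : X -> R := 'D_((0, 1) : X) phi.

Definition mem_L2 d (T : measurableType d) (mu : {measure set T -> \bar R})
    (D : set T) (f : T -> R) :=
  measurable_fun D f /\ (\int[mu]_(x in D) (f x ^+ 2)%:E < +oo)%E.

(* w is in H^1_0(Omega), the H^1-closure of C_c^oo(Omega), with gradient p *)
Definition H10 (Omega : set V) (w : V -> R) (p : V -> V) :=
  [/\ mem_L2 mux Omega w,
      (forall i, mem_L2 mux Omega (fun x => p x ord0 i)) &
      exists2 phi : nat -> V -> R, (forall k, test_function Omega (phi k)) &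
        (fun k => \int[mux]_(x in Omega)
           ((phi k x - w x) ^+ 2
            + \sum_i ('D_(e_ i) (phi k) x - p x ord0 i) ^+ 2)%:E)%E
          @ \oo --> 0%E].

(* u is in L^2([a,b], H^1_0(Omega)) and H^1([a,b], L^2(Omega)), with
   p = \nabla u and q = \partial_t u; L^2([a,b], L^2(Omega)) is read as
   L^2(Omega x [a,b]) and elements of the Bochner spaces as jointly measurable
   functions. The representative of u is the one which
   is continuous in time with values in L^2(Omega), so that u(t) makes sense
   for every t. *)
Definition energy_space (Omega : set V) (a b : R)
    (u : X -> R) (p : X -> V) (q : X -> R) :=
  let Q := Omega `*` `[a, b] in
  [/\ mem_L2 muxt Q u,
      (forall i, mem_L2 muxt Q (fun z => p z ord0 i)) /\
      {ae mut, forall t, t \in `[a, b] ->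
         H10 Omega (fun x => u (x, t)) (fun x => p (x, t))},
      mem_L2 muxt Q q,
      (forall phi, test_function (Omega `*` `]a, b[) phi ->
         \int[muxt]_(z in Q) (u z * Dt phi z)
         = - \int[muxt]_(z in Q) (q z * phi z)) &
      (forall t, t \in `[a, b] ->
         mem_L2 mux Omega (fun x => u (x, t)) /\
         (fun s => \int[mux]_(x in Omega) ((u (x, s) - u (x, t)) ^+ 2)%:E)%E
           @ within `[a, b] (nbhs t) --> 0%E)].

(* P u = f in Omega x ]a,b[ in the sense of distributions, for u with
   \nabla u = p; P is the viscoacoustic operator with initial time a *)
Definition viscoacoustic_eq (c : V -> R) (G : X -> R) (Omega : set V) (a b : R)
    (f : X -> R) (u : X -> R) (p : X -> V) :=
  forall phi, test_function (Omega `*` `]a, b[) phi ->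
    let Q := Omega `*` `[a, b] in
    - 2^-1 *
      (\int[muxt]_(z in Q) (u z * Dt (Dt phi) z)
       + \int[muxt]_(z in Q) (c z.1 * \sum_i p z ord0 i * Dx i phi z)
       - \int[muxt]_(z in Q) \sum_i Dx i phi z *
           \int[mut]_(s in `[a, z.2]) (G (z.1, z.2 - s) * p (z.1, s) ord0 i))
    = \int[muxt]_(z in Q) (f z * phi z).

(* The condition on \partial_t u(a) is understood in the sense of
   distributions on Omega: given the equation, t |-> <u(t), psi> is C^1. *)
Definition zero_initial_data (Omega : set V) (a : R) (u : X -> R) :=
  {ae mux, forall x, Omega x -> u (x, a) = 0} /\
  forall psi, test_function Omega psi ->
    (h^-1 * \int[mux]_(x in Omega) ((u (x, a + h) - u (x, a)) * psi x))
      @[h --> 0^'+] --> 0.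

Definition generalized_solution (c : V -> R) (G : X -> R) (Omega : set V)
    (a b : R) (f u : X -> R) :=
  exists (p : X -> V) (q : X -> R),
    [/\ energy_space Omega a b u p q, viscoacoustic_eq c G Omega a b f u p &
        zero_initial_data Omega a u].

(* The generalized solution exists and is unique up to a null set; [xget] picks
   a representative. *)
Definition the_solution (c : V -> R) (G : X -> R) (Omega : set V) (a b : R)
    (f : X -> R) : X -> R :=
  xget (fun=> 0) [set u | generalized_solution c G Omega a b f u].

Definition source_to_solution (c : V -> R) (G : X -> R) (Omega : set V)
    (a b : R) (E : set X) (f : X -> R) : X -> R :=
  the_solution c G Omega a b f \_ E.

End viscoacoustic.

(* d/dt from the right, so that it makes sense at t = 0 for functions on
   [0, +oo[ *)
Definition right_derive (R : realType) (f : R -> R) (t : R) : R :=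
  lim ((h^-1 * (f (t + h) - f t)) @[h --> 0^'+]).

(* Main.v *)
(* The source-to-solution map is measured on all of Omega' at times in ]T, T'],
   so the coefficients can be probed directly there.  Let u(x, t) = psi(x) al(t)
   for bump functions psi on Omega' and al on ]T, T'[.  Then f = P_1 u is smooth
   and vanishes before some time > T, so it is an admissible source, and by
   uniqueness u is its solution for (c_1, G_1).  The solution for (c_2, G_2)
   agrees with u after T by hypothesis, and vanishes before T by uniqueness on
   [-S', T]; hence u solves both equations.  Subtracting them and testing with
   psi(x) th(t) gives, for every t,
     int |grad psi|^2 ((c_1 - c_2)(x) al(t)
                       - int (G_1 - G_2)(x, r) al(t - r) dr) dx = 0.
   With al concentrated near T and t beyond its support this forces G_1 = G_2 at
   all times in [0, T' - T[, and then c_1 = c_2.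

   For uniqueness, let A be the second time primitive of grad u.  The weak
   equation makes <u(t), psi> minus the pairing of grad psi with
   c A - int G(t - s) A(s) ds.  Take for psi the time primitive U of u and integrate
   in t: the terms u U and c A . A' are exact derivatives, the memory is of lower
   order, and Gronwall's lemma applied to int |A(t)|^2 gives A = 0. *)
Require Import Defs.
From HB Require Import structures.
From mathcomp Require Import all_boot all_order all_algebra.
From mathcomp Require Import all_classical all_reals all_analysis.
From mathcomp Require Import measurable_realfun.
From mathcomp Require Import ring lra.
Import Order.TTheory GRing.Theory Num.Theory.
Import numFieldNormedType.Exports.
Local Open Scope classical_set_scope.
Local Open Scope ring_scope.
Set Implicit Arguments.
Unset Strict Implicit.
Unset Printing Implicit Defensive.

(** * Smooth functions and bump functions *)

(** The energy argument uses twice integrated quantities because a generalized solution has a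
    gradient that is merely square integrable in time. Its time derivative is not an admissible
    multiplier, whereas [A] is continuously differentiable in time. Three more obstacles shape the
    proof. The weak equation contains a gradient given as separate data, while two solutions are
    compared only almost everywhere; membership in the closure of the test functions is therefore
    kept in dual form, which transfers vanishing from [u] to its gradient. Finally, coefficients are
    bounded only over the bounded set Omega'; elsewhere the speed is replaced by 1 and the kernel by
    0, which test functions supported in Omega' do not see. Space points with a bad time section
    form a null set, which is discarded once and for all in [energy_class]. *)

Section smooth_calculus.
Context {R : realType}.
Implicit Types W : normedModType R.

Lemma iter_derive_rcons W (s : seq W) v (f : W -> R) :
  iter_derive s ('D_v f) = iter_derive (rcons s v) f.
Proof. by rewrite /iter_derive foldr_rcons. Qed.

Lemma smooth_derive W v (f : W -> R) :
  smooth_on setT f -> smooth_on setT ('D_v f).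
Proof. by move=> sf s x _; rewrite iter_derive_rcons; exact: sf. Qed.

Lemma smooth_continuous W (f : W -> R) : smooth_on setT f -> continuous f.
Proof. by move=> sf x; exact: (sf [::] x I).1. Qed.

Lemma smooth_derivable W (f : W -> R) x v : smooth_on setT f -> derivable f x v.
Proof. by move=> sf; exact: (sf [::] x I).2. Qed.

Lemma smooth_is_derive W (f : W -> R) x v : smooth_on setT f ->
  is_derive x v f ('D_v f x).
Proof. by move=> sf; exact: (derivableP (@smooth_derivable W f x v sf)). Qed.

(** Every iterated derivative of a member stays in the class, by induction on the list of
    directions. Smoothness proofs below thus reduce to naming a class [C] stable under
    differentiation. *)
Lemma smooth_class W (C : (W -> R) -> Prop) :
  (forall f, C f -> [/\ continuous f, forall x v, derivable f x v &
     forall v, C ('D_v f)]) ->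
  forall f, C f -> smooth_on setT f.
Proof.
move=> CP f Cf s x _.
have : C (iter_derive s f) by elim: s => //= v s IHs; have [_ _] := CP _ IHs.
by move=> /CP[cf df _]; split; [exact: cf|exact: df].
Qed.

Lemma smooth_cst W (k : R) : smooth_on setT (fun _ : W => k).
Proof.
apply: (@smooth_class W (fun f => exists k, f = cst k)); last by exists k.
move=> _ [k1 ->]; split; [exact: cst_continuous|by move=> x v; exact: derivable_cst|].
by move=> v; exists 0; apply/funext => x; rewrite derive_cst.
Qed.

Lemma smoothD W (f g : W -> R) : smooth_on setT f -> smooth_on setT g ->
  smooth_on setT (fun x => f x + g x).
Proof.
move=> sf sg; apply: (@smooth_class W (fun h => exists f g,
  [/\ smooth_on setT f, smooth_on setT g & h = f + g])); last by exists f, g.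
move=> _ [f1 [g1 [sf1 sg1 ->]]]; split.
- by move=> x; apply: cvgD; exact: smooth_continuous.
- by move=> x v; apply: derivableD; exact: smooth_derivable.
- move=> v; exists ('D_v f1), ('D_v g1); split; try exact: smooth_derive.
  by apply/funext => x; rewrite deriveD//; exact: smooth_derivable.
Qed.

(** The product rule leads from one product to a sum of two, so products alone are not stable under
    differentiation; their finite sums are. *)
Inductive sum_of_smooth_products W : (W -> R) -> Prop :=
| SumSmoothM f g : smooth_on setT f -> smooth_on setT g ->
    sum_of_smooth_products (f * g)
| SumSmoothD f g : sum_of_smooth_products f -> sum_of_smooth_products g ->
    sum_of_smooth_products (f + g).

Lemma smoothM W (f g : W -> R) : smooth_on setT f -> smooth_on setT g ->
  smooth_on setT (fun x => f x * g x).
Proof.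
move=> sf sg; apply: (@smooth_class W (@sum_of_smooth_products W)); last first.
  exact: SumSmoothM.
move=> h; elim => {h}[f1 g1 sf1 sg1|f1 g1 _ [cf df Df] _ [cg dg Dg]].
  split.
  - by move=> x; apply: cvgM; exact: smooth_continuous.
  - by move=> x v; apply: derivableM; exact: smooth_derivable.
  - move=> v; rewrite (_ : 'D_v _ = f1 * 'D_v g1 + g1 * 'D_v f1).
      exact: (SumSmoothD (SumSmoothM sf1 (smooth_derive v sg1))
        (SumSmoothM sg1 (smooth_derive v sf1))).
    by apply/funext => x; rewrite deriveM//; exact: smooth_derivable.
split.
- by move=> x; apply: cvgD; [exact: cf|exact: cg].
- by move=> x v; apply: derivableD.
- move=> v; rewrite (_ : 'D_v _ = 'D_v f1 + 'D_v g1); first exact: SumSmoothD.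
  by apply/funext => x; rewrite deriveD.
Qed.

Lemma smoothN W (f : W -> R) : smooth_on setT f ->
  smooth_on setT (fun x => - f x).
Proof.
move=> sf; rewrite (_ : (fun x => - f x) = (fun x => -1 * f x)).
  exact: (smoothM (@smooth_cst W (-1)) sf).
by apply/funext => x; rewrite mulN1r.
Qed.

Lemma smoothB W (f g : W -> R) : smooth_on setT f -> smooth_on setT g ->
  smooth_on setT (fun x => f x - g x).
Proof. by move=> sf sg; exact: (smoothD sf (smoothN sg)). Qed.

Lemma smooth_sum W (I : finType) (f : I -> W -> R) :
  (forall i, smooth_on setT (f i)) -> smooth_on setT (fun x => \sum_i f i x).
Proof.
move=> sf; elim: (index_enum I) => [|i s IHs].
  by under [X in smooth_on _ X]eq_fun do rewrite big_nil; exact: smooth_cst.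
have -> : (fun x => \sum_(j <- i :: s) f j x) = (fun x => f i x + \sum_(j <- s) f j x).
  by apply/funext => x; rewrite big_cons.
exact: (smoothD (sf i) IHs).
Qed.

Lemma smooth_prod W (I : finType) (f : I -> W -> R) :
  (forall i, smooth_on setT (f i)) -> smooth_on setT (fun x => \prod_i f i x).
Proof.
move=> sf; elim: (index_enum I) => [|i s IHs].
  by under [X in smooth_on _ X]eq_fun do rewrite big_nil; exact: smooth_cst.
have -> : (fun x => \prod_(j <- i :: s) f j x) = (fun x => f i x * \prod_(j <- s) f j x).
  by apply/funext => x; rewrite big_cons.
exact: (smoothM (sf i) IHs).
Qed.

Section affine.
Context W W' (L L0 : W' -> W).
Hypothesis Laff : forall h v x, L (h *: v + x) = h *: L0 v + L x.

(** For an affine map with linear part [L0], the difference quotient of the composite is literally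
    that of [f] in the direction [L0 v]. No chain rule, and hence no differentiability of [f], is
    involved. *)
Lemma derive_affine (f : W -> R) v x : 'D_v (f \o L) x = 'D_(L0 v) f (L x).
Proof.
rewrite /derive /=; under eq_fun do rewrite Laff.
by [].
Qed.

Lemma derivable_affine (f : W -> R) v x :
  derivable f (L x) (L0 v) -> derivable (f \o L) x v.
Proof.
rewrite /derivable /= => df.
by under eq_fun do rewrite Laff.
Qed.

Lemma smooth_affine (f : W -> R) : continuous L -> smooth_on setT f ->
  smooth_on setT (f \o L).
Proof.
move=> cL sf; apply: (@smooth_class W' (fun h => exists2 f,
  smooth_on setT f & h = f \o L)); last by exists f.
move=> _ [f1 sf1 ->]; split.
- by move=> x; apply: continuous_comp; [exact: cL|exact: smooth_continuous].
- by move=> x v; apply: derivable_affine; exact: smooth_derivable.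
- move=> v; exists ('D_(L0 v) f1); first exact: smooth_derive.
  by apply/funext => x; rewrite /= derive_affine.
Qed.

End affine.

Lemma smooth_fst W W' (f : W -> R) :
  smooth_on setT f -> smooth_on setT (fun z : W * W' => f z.1).
Proof.
move=> sf; apply: (@smooth_affine W (W * W')%type fst fst) => // x.
exact: cvg_fst.
Qed.

Lemma smooth_snd W W' (f : W' -> R) :
  smooth_on setT f -> smooth_on setT (fun z : W * W' => f z.2).
Proof.
move=> sf; apply: (@smooth_affine W' (W * W')%type snd snd) => // x.
exact: cvg_snd.
Qed.

End smooth_calculus.

(** * Flat functions exp(-1/t) and bump functions on the line *)

Section bumps.
Context {R : realType}.

Lemma derive_scalar (f : R -> R) (v x : R) : derivable f x 1 ->
  derivable f x v /\ 'D_v f x = v * 'D_1 f x.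
Proof.
move=> /derivable1_diffP df; split; first exact: diff_derivable.
by rewrite !deriveE// -[v in LHS]mulr1 linearZ.
Qed.

(** Each monomial satisfies y^i / i! <= exp y for y >= 0, which explains the weights i! in the
    constant. *)
Lemma horner_le_expR (p : {poly R}) :
  exists2 C, 0 <= C & forall y, 0 <= y -> `|p.[y]| <= C * expR y.
Proof.
exists (\sum_(i < size p) `|p`_i| * i`!%:R).
  by apply: sumr_ge0 => i _; rewrite mulr_ge0.
move=> y y0; rewrite horner_coef (le_trans (ler_norm_sum _ _ _))// mulr_suml.
apply: ler_sum => i _; rewrite normrM -mulrA ler_wpM2l// normrX ger0_norm//.
case: (nat_of_ord i) => [|k].
  by rewrite expr0 fact0 mul1r -[leLHS]expR0 ler_expR.
rewrite mulrC -ler_pdivrMr ?ltr0n ?fact_gt0//.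
by rewrite (le_trans _ (expR_ge1Dxn k y0))// lerDr.
Qed.

(* A class stable under differentiation, containing [exp (- 1/t)]. *)
Definition flat_poly (p : {poly R}) (t : R) : R :=
  if 0 < t then p.[t^-1] * expR (- t^-1) else 0.

(** The exponential bound is applied to [p * 'X] at y = 1/t; the spare factor 1/t becomes the factor
    [|t|] on the right. *)
Lemma flat_poly_le (p : {poly R}) :
  exists2 C, 0 <= C & forall t, `|flat_poly p t| <= C * `|t|.
Proof.
have [C C0 HC] := horner_le_expR (p * 'X); exists C => // t.
rewrite /flat_poly; case: ifPn => [t0|_]; last by rewrite normr0 mulr_ge0.
have /HC : 0 <= t^-1 by rewrite invr_ge0 ltW.
rewrite hornerMX normrM (gtr0_norm (_ : 0 < t^-1)) ?invr_gt0// => H.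
rewrite normrM (gtr0_norm (expR_gt0 _)) expRN ler_pdivrMr ?expR_gt0//.
by rewrite (gtr0_norm t0) mulrAC -ler_pdivrMr.
Qed.

Lemma flat_poly_cvg0 (p : {poly R}) : flat_poly p @ (0:R) --> (0:R).
Proof.
have [C C0 HC] := flat_poly_le p.
apply/cvgr0Pnorm_le => e e0.
have Cp : 0 < C + 1 by rewrite ltr_wpDl.
near=> t; rewrite (le_trans (HC _))//.
apply: (@le_trans _ _ ((C + 1) * `|t|)); first by rewrite ler_wpM2r// lerDl.
rewrite mulrC -ler_pdivlMr//; near: t; apply: (@nbhs0_le _ R); exact: divr_gt0.
Unshelve. all: end_near. Qed.

(** Away from 0 this is the chain rule, with t^-2 absorbed as ['X^2]. At 0 the difference quotient
    of [flat_poly p] is [flat_poly (p * 'X)], which tends to 0. *)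
Lemma is_derive_flat_poly (p : {poly R}) (t : R) :
  is_derive t 1 (flat_poly p) (flat_poly ('X^2 * (p - p^`())) t).
Proof.
have [t0|t0|->] := ltgtP t 0.
- apply: (@near_eq_is_derive _ _ _ (cst 0)); last first.
    by rewrite /flat_poly ltNge ltW//=; exact: is_derive_cst.
  near=> s; rewrite /flat_poly ifF//; apply/negbTE; rewrite -leNgt ltW//.
  by near: s; exact: lt_nbhsl.
- apply: (@near_eq_is_derive R R^o R^o (fun t : R => p.[t^-1] * expR (- t^-1))); last first.
    have t00 : t != 0 by rewrite gt_eqF.
    have dV : is_derive t 1 (fun s : R => s^-1) (- t ^- 2 *: 1).
      by apply: is_deriveV.
    have dp : is_derive (t^-1) 1 (horner p) (p^`().[t^-1]).
      rewrite -[p^`().[_]]/(horner p^`() _) derivE derive1E; apply: derivableP.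
      exact: derivable_horner.
    have d1 : is_derive t 1 (fun s => p.[s^-1]) ((- t ^- 2) * p^`().[t^-1]).
      rewrite mulrC -[X in _ * X]mulr1; exact: (is_derive1_comp dp dV).
    have dN : is_derive t 1 (fun s : R => - s^-1) (t ^- 2).
      by apply: is_derive_eq; rewrite scaler1 opprK.
    have d2 : is_derive t 1 (fun s : R => expR (- s^-1)) (expR (- t^-1) * t ^- 2).
      exact: (is_derive1_comp (is_derive_expR _) dN).
    apply: (is_derive_eq (is_deriveM d1 d2)).
    rewrite /flat_poly t0 !hornerE /= /GRing.scale /=.
    rewrite exprVn; ring.
  near=> s; rewrite /flat_poly ifT//.
  by near: s; exact: lt_nbhsr.
- have d0 : h^-1 *: (flat_poly p (h *: 1 + 0) - flat_poly p 0) @[h --> 0^'] --> (0:R).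
    have -> : (fun h => h^-1 *: (flat_poly p (h *: 1 + 0) - flat_poly p 0)) =
              flat_poly (p * 'X).
      apply/funext => h; rewrite addr0 scaler1 /flat_poly ltxx subr0.
      by case: ifP => _; rewrite ?scaler0// hornerMX /GRing.scale /=; ring.
    apply: cvg_within_filter; exact: flat_poly_cvg0.
  split; first by apply/cvg_ex; exists 0.
  rewrite /flat_poly ltxx; apply: cvg_lim => //.
Unshelve. all: end_near. Qed.

Lemma smooth_flat_poly (p : {poly R}) : smooth_on setT (flat_poly p).
Proof.
apply: (@smooth_class R R (fun f => exists p, f = flat_poly p)); last by exists p.
move=> _ [q ->].
have dq t : derivable (flat_poly q) t 1 by have [] := is_derive_flat_poly q t.
split.
- by move=> t; apply/differentiable_continuous/derivable1_diffP.
- by move=> t v; have [] := derive_scalar v (dq t).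
- move=> v; exists (v *: ('X^2 * (q - q^`()))); apply/funext => t.
  have [_ ->] := derive_scalar v (dq t).
  have [_ ->] := is_derive_flat_poly q t.
  by rewrite /flat_poly; case: ifP; rewrite ?mulr0// hornerZ mulrA.
Qed.

(** A product of two factors exp(-1/s), where s is the distance to an end of ]x - r, x + r[. The
    mass is not normalized, so it appears explicitly in later estimates. *)
Definition bump (x r t : R) : R :=
  flat_poly 1 (t - (x - r)) * flat_poly 1 (x + r - t).

Lemma smooth_bump x r : smooth_on setT (bump x r).
Proof.
apply: smoothM.
  apply: (@smooth_affine _ _ _ (fun t => t - (x - r)) id).
  - by move=> h v y; rewrite addrA.
  - by move=> y; apply: cvgB => //; exact: cvg_cst.
  - exact: smooth_flat_poly.
apply: (@smooth_affine _ _ _ (fun t => x + r - t) -%R).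
- by move=> h v y; rewrite scalerN opprD addrCA.
- by move=> y; apply: cvgB => //; exact: cvg_cst.
- exact: smooth_flat_poly.
Qed.

Lemma bump_ge0 x r t : 0 <= bump x r t.
Proof.
by apply: mulr_ge0; rewrite /flat_poly; case: ifP => // _;
  rewrite hornerC mul1r expR_ge0.
Qed.

Lemma bump_gt0 x r t : `|t - x| < r -> 0 < bump x r t.
Proof.
rewrite ltr_norml => /andP[h1 h2].
by rewrite /bump /flat_poly !hornerC !mul1r ifT ?ifT ?mulr_gt0 ?expR_gt0//; lra.
Qed.

Lemma bump_eq0 x r t : r <= `|t - x| -> bump x r t = 0.
Proof.
rewrite ler_normr /bump /flat_poly => /orP[h|h].
  by rewrite [X in _ * X]ifF ?mulr0//; apply/negbTE; rewrite -leNgt; lra.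
by rewrite ifF ?mul0r//; apply/negbTE; rewrite -leNgt; lra.
Qed.

End bumps.

(** * Integrable real-valued functions *)

Section rintegrable.
Context d (T : measurableType d) (R : realType).
Variable mu : {measure set T -> \bar R}.
Implicit Types (D : set T) (f g : T -> R).

Definition rintegrable D f := mu.-integrable D (EFin \o f).

Lemma rintegrable_meas D f : rintegrable D f -> measurable_fun D f.
Proof. by move=> /measurable_int /measurable_EFinP. Qed.

Lemma rintegrable_le D f g : measurable D -> measurable_fun D f ->
  (forall x, D x -> `|f x| <= g x) -> rintegrable D g -> rintegrable D f.
Proof.
move=> mD mf fg ig; apply: (le_integrable mD _ _ ig); first exact/measurable_EFinP.
by move=> x Dx /=; rewrite lee_fin (le_trans (fg _ Dx))// ler_norm.
Qed.

Lemma eq_rintegrable D f g : measurable D -> {in D, f =1 g} ->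
  rintegrable D f -> rintegrable D g.
Proof. by move=> mD fg; apply: eq_integrable => // x Dx /=; rewrite fg. Qed.

Lemma rintegrableD D f g : measurable D -> rintegrable D f -> rintegrable D g ->
  rintegrable D (fun x => f x + g x).
Proof. by move=> mD iF ig; have := integrableD mD iF ig. Qed.

Lemma rintegrableB D f g : measurable D -> rintegrable D f -> rintegrable D g ->
  rintegrable D (fun x => f x - g x).
Proof. by move=> mD iF ig; have := integrableB mD iF ig. Qed.

Lemma rintegrableZl D k f : measurable D -> rintegrable D f ->
  rintegrable D (fun x => k * f x).
Proof. by move=> mD iF; have := integrableZl mD k iF. Qed.

Lemma rintegrable_norm D f : rintegrable D f -> rintegrable D (fun x => `|f x|).
Proof. by move=> iF; have := integrable_abse iF. Qed.

Lemma rintegrable_sum D (I : finType) (f : I -> T -> R) : measurable D ->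
  (forall i, rintegrable D (f i)) -> rintegrable D (fun x => \sum_i f i x).
Proof.
move=> mD iF; rewrite /rintegrable.
rewrite (_ : EFin \o _ = fun x => (\sum_(i in I) (EFin \o f i) x)%E).
  by apply: integrable_sum => // i _; exact: iF.
by apply/funext => x /=; rewrite sumEFin.
Qed.

Lemma Rintegral_sum D (I : finType) (f : I -> T -> R) : measurable D ->
  (forall i, rintegrable D (f i)) ->
  \int[mu]_(x in D) (\sum_i f i x) = \sum_i \int[mu]_(x in D) f i x.
Proof.
move=> mD iF; elim: (index_enum I) => [|i s IHs].
  under eq_Rintegral do rewrite big_nil.
  by rewrite big_nil Rintegral_cst// mul0r.
under eq_Rintegral do rewrite big_cons.
rewrite RintegralD ?IHs ?big_cons//; first exact: iF.
rewrite (_ : EFin \o _ = fun x => (\sum_(j <- s) (EFin \o f j) x)%E).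
  by apply: integrable_sum => // j _; exact: iF.
by apply/funext => x /=; rewrite sumEFin.
Qed.

Lemma rintegrableS D E f : measurable D -> measurable E -> D `<=` E ->
  rintegrable E f -> rintegrable D f.
Proof. by move=> mD mE DE; apply: integrableS. Qed.

Lemma rintegrable_cst D k : measurable D -> (mu D < +oo)%E ->
  rintegrable D (fun=> k).
Proof.
move=> mD Doo; apply: measurable_bounded_integrable => //.
by exists `|k|; split => // M kM x _ /=; exact: ltW.
Qed.

Lemma rintegrable_mkcond D f : measurable D ->
  rintegrable D f <-> rintegrable setT (f \_ D).
Proof.
move=> mD; rewrite /rintegrable (_ : EFin \o (f \_ D) = (EFin \o f) \_ D).
  exact: integrable_mkcond.
by apply/funext => x; rewrite /= !patchE; case: ifP.
Qed.

Lemma ae_eq_Rintegral D f g : measurable D -> measurable_fun D f ->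
  measurable_fun D g -> {ae mu, forall x, D x -> f x = g x} ->
  \int[mu]_(x in D) f x = \int[mu]_(x in D) g x.
Proof.
move=> mD mf mg fg; congr fine; apply: ae_eq_integral => //.
- exact/measurable_EFinP.
- exact/measurable_EFinP.
- by apply: filterS fg => x fgx Dx /=; rewrite fgx.
Qed.

Lemma Rintegral_ae0 D f : measurable D -> rintegrable D f ->
  (forall x, D x -> 0 <= f x) -> \int[mu]_(x in D) f x = 0 ->
  {ae mu, forall x, D x -> f x = 0}.
Proof.
move=> mD iF f0 int0.
have iE : (\int[mu]_(x in D) `|(EFin \o f) x| = 0)%E.
  rewrite (@eq_integral _ _ _ mu D (EFin \o f)); last first.
    by move=> x /[!inE] Dx /=; rewrite ger0_norm// f0.
  by rewrite -[LHS](fineK (integrable_fin_num mD iF)); congr EFin.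
have /(ae_eq_integral_abs mu mD (measurable_int _ iF)) := iE.
by apply: filterS => x H Dx; have := H Dx => /= -[].
Qed.

End rintegrable.

(** * Fubini's theorem for real-valued integrals over rectangles *)

Section fubini.
Context d1 d2 (T1 : measurableType d1) (T2 : measurableType d2) (R : realType).
Variable m1 : {sigma_finite_measure set T1 -> \bar R}.
Variable m2 : {sigma_finite_measure set T2 -> \bar R}.
Implicit Types (f : (T1 * T2)%type -> R).
Local Notation m12 := (m1 \x m2)%E.

(** Tonelli applies to the positive and negative parts of the extended integral, and [fine] is
    measurable; hence sections need not be integrable. *)
Lemma measurable_Rintegral2 f (D2 : set T2) : measurable D2 -> measurable_fun setT f ->
  measurable_fun setT (fun x => \int[m2]_(y in D2) f (x, y)).
Proof.
move=> mD2 mf.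
have mD : measurable ([set: T1] `*` D2) by exact: measurableX.
have mg := (measurable_restrictT f mD).1 (measurable_funTS mf).
set g := f \_ _ in mg.
rewrite (_ : (fun _ => _) = fun x => fine (\int[m2]_y (g (x, y))%:E)%E); last first.
  apply/funext => x; rewrite Rintegral_mkcond; congr fine; apply: eq_integral => y _.
  by rewrite /g !patchE in_setX/= in_setT.
rewrite (_ : (fun _ => _) = fun x => fine
  (\int[m2]_y ((EFin \o g)^\+ (x, y)) - \int[m2]_y ((EFin \o g)^\- (x, y)))%E); last first.
  apply/funext => x; rewrite [X in fine X = _]integralE.
  by congr (fine (_ - _)%E); apply: eq_integral => y _; rewrite ?funeposE ?funenegE.
apply: measurableT_comp => //; apply: emeasurable_funB.
  apply: (@measurable_fun_fubini_tonelli_F _ _ T1 T2 R m2 (fun z => (EFin \o g)^\+ z)%E).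
    by apply: measurable_funepos; exact/measurable_EFinP.
  by move=> z; exact: funepos_ge0.
apply: (@measurable_fun_fubini_tonelli_F _ _ T1 T2 R m2 (fun z => (EFin \o g)^\- z)%E).
  by apply: measurable_funeneg; exact/measurable_EFinP.
by move=> z; exact: funeneg_ge0.
Qed.

Lemma rintegrable_prod f (D1 : set T1) (D2 : set T2) (N : T1 -> R) : measurable D1 -> measurable D2 ->
  measurable_fun (D1 `*` D2) f ->
  (forall x, D1 x -> rintegrable m2 D2 (fun y => f (x, y))) ->
  (forall x, D1 x -> \int[m2]_(y in D2) `|f (x, y)| <= N x) ->
  rintegrable m1 D1 N -> rintegrable m12 (D1 `*` D2) f.
Proof.
move=> mD1 mD2 mf if2 fN iN.
have mD : measurable (D1 `*` D2) by exact: measurableX.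
apply/rintegrable_mkcond => //.
have mg := (measurable_restrictT f mD).1 mf.
apply/integrable12ltyP; first exact/measurable_EFinP.
move/rintegrable_mkcond : iN => /(_ mD1) iN.
apply: (@le_lt_trans _ _ (\int[m1]_x `|((N \_ D1) x)%:E|)%E); last first.
  by have /integrableP[_] := iN.
apply: ge0_le_integral => //.
- by move=> x _; exact: integral_ge0.
- apply: (measurable_fun_fubini_tonelli_F (fun z => `|((f \_ (D1 `*` D2)) z)%:E|)%E).
    by apply: measurableT_comp => //; exact/measurable_EFinP.
  by move=> z.
- by apply: measurableT_comp => //; have /integrableP[] := iN.
move=> x _; have [D1x|nD1x] := pselect (D1 x); last first.
  rewrite (eq_integral (fun=> 0%E)) ?integral0// => y _.
  by rewrite /= patchE ifF ?normr0//; apply/negbTE; rewrite notin_setE => -[].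
rewrite patchE mem_set// [leLHS](_ : _ = (\int[m2]_(y in D2) `|(EFin \o fun y => f (x, y)) y|)%E).
  have ix := if2 _ D1x; have /fineK <- := integrable_fin_num mD2 (integrable_abse ix).
  by rewrite lee_fin (le_trans (fN _ D1x))// ler_norm.
rewrite [RHS]integral_mkcond; apply: eq_integral => y _; rewrite !patchE.
by rewrite /= patchE in_setX/= (mem_set D1x)/=; case: ifP; rewrite ?normr0.
Qed.

Lemma Fubini_Rintegral12 f (D1 : set T1) (D2 : set T2) : measurable D1 -> measurable D2 ->
  rintegrable m12 (D1 `*` D2) f ->
  \int[m1]_(x in D1) \int[m2]_(y in D2) f (x, y) = \int[m12]_(z in D1 `*` D2) f z.
Proof.
move=> mD1 mD2; have mD : measurable (D1 `*` D2) by exact: measurableX.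
move=> /(rintegrable_mkcond _ _ mD).1; rewrite [RHS]Rintegral_mkcond.
set g := f \_ _ => ig; rewrite [RHS]/Rintegral -(integral12_prod_meas1 ig).
rewrite Rintegral_mkcond /Rintegral; congr fine.
(* The inner real integral is [fine] of the extended one. Sections are integrable for almost every
   point only, and there [fine] loses nothing. *)
transitivity (\int[m1]_x (fine (fubini_F m2 (EFin \o g) x))%:E)%E.
  apply: eq_integral => x _; congr EFin; rewrite patchE; case: ifPn => D1x.
    congr fine; rewrite integral_mkcond /fubini_F; apply: eq_integral => y _.
    by rewrite /= /g !patchE in_setX/= D1x /=; case: ifP.
  rewrite /fubini_F (eq_integral (fun=> 0%E)) ?integral0// => y _.
  by rewrite /= /g patchE in_setX/= (negbTE D1x).
have mF := measurable_fubini_F ig.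
apply: ae_eq_integral => //.
  by apply/measurable_EFinP; exact: measurableT_comp.
by apply: filterS (ae_integrable1 ig) => x ix _ /=; rewrite fineK// integrable_fin_num.
Qed.

Lemma Fubini_Rintegral21 f (D1 : set T1) (D2 : set T2) : measurable D1 -> measurable D2 ->
  rintegrable m12 (D1 `*` D2) f ->
  \int[m2]_(y in D2) \int[m1]_(x in D1) f (x, y) = \int[m12]_(z in D1 `*` D2) f z.
Proof.
move=> mD1 mD2; have mD : measurable (D1 `*` D2) by exact: measurableX.
move=> /(rintegrable_mkcond _ _ mD).1; rewrite [RHS]Rintegral_mkcond.
set g := f \_ _ => ig; rewrite [RHS]/Rintegral -(integral21_prod_meas1 ig).
rewrite Rintegral_mkcond /Rintegral; congr fine.
transitivity (\int[m2]_y (fine (fubini_G m1 (EFin \o g) y))%:E)%E.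
  apply: eq_integral => y _; congr EFin; rewrite patchE; case: ifPn => D2y.
    congr fine; rewrite integral_mkcond /fubini_G; apply: eq_integral => x _.
    by rewrite /= /g !patchE in_setX/= D2y andbT /=; case: ifP.
  rewrite /fubini_G (eq_integral (fun=> 0%E)) ?integral0// => x _.
  by rewrite /= /g patchE in_setX/= (negbTE D2y) andbF.
have mG := measurable_fubini_G ig.
apply: ae_eq_integral => //.
  by apply/measurable_EFinP; exact: measurableT_comp.
by apply: filterS (ae_integrable2 ig) => x ix _ /=; rewrite fineK// integrable_fin_num.
Qed.

Let fine_le (x : \bar R) : (`|(fine x)%:E| <= `|x|)%E.
Proof. by case: x => [r| |] /=; rewrite ?normr0 ?leey. Qed.

Lemma rintegrable_Rintegral12 f (D1 : set T1) (D2 : set T2) :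
  measurable D1 -> measurable D2 -> rintegrable m12 (D1 `*` D2) f ->
  rintegrable m1 D1 (fun x => \int[m2]_(y in D2) f (x, y)).
Proof.
move=> mD1 mD2; have mD : measurable (D1 `*` D2) by exact: measurableX.
move=> /(rintegrable_mkcond _ _ mD).1; set g := f \_ _ => ig.
have mF := measurable_fubini_F ig.
have iF : rintegrable m1 setT (fun x => fine (fubini_F m2 (EFin \o g) x)).
  apply: (le_integrable measurableT _ _ (integrable_fubini_F ig)).
    by apply/measurable_EFinP; exact: measurableT_comp.
  by move=> x _; exact: fine_le.
apply: (eq_rintegrable mD1 _ (rintegrableS mD1 measurableT _ iF)) => // x D1x.
congr fine; rewrite [RHS]integral_mkcond /fubini_F; apply: eq_integral => y _.
by rewrite /= /g !patchE in_setX/= D1x /=; case: ifP.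
Qed.

Lemma rintegrable_Rintegral21 f (D1 : set T1) (D2 : set T2) :
  measurable D1 -> measurable D2 -> rintegrable m12 (D1 `*` D2) f ->
  rintegrable m2 D2 (fun y => \int[m1]_(x in D1) f (x, y)).
Proof.
move=> mD1 mD2; have mD : measurable (D1 `*` D2) by exact: measurableX.
move=> /(rintegrable_mkcond _ _ mD).1; set g := f \_ _ => ig.
have mG := measurable_fubini_G ig.
have mg := measurable_int _ ig.
have mga : measurable_fun setT (abse \o (EFin \o g)) by exact: measurableT_comp.
have ga0 (z : T1 * T2) : (0 <= (abse \o (EFin \o g)) z)%E by exact: abse_ge0.
have ia : m2.-integrable setT (fubini_G m1 (abse \o (EFin \o g))).
  apply/integrableP; split; first exact: measurable_fun_fubini_tonelli_G.
  under eq_integral do rewrite gee0_abs ?integral_ge0//.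
  by rewrite -fubini_tonelli2//; have /integrableP[] := ig.
have iG : rintegrable m2 setT (fun y => fine (fubini_G m1 (EFin \o g) y)).
  apply: (le_integrable measurableT _ _ ia).
    by apply/measurable_EFinP; exact: measurableT_comp.
  move=> y _; apply: le_trans (fine_le _) _.
  rewrite [leRHS]gee0_abs ?integral_ge0// /fubini_G le_abse_integral//.
  exact: (measurableT_comp mg).
apply: (eq_rintegrable mD2 _ (rintegrableS mD2 measurableT _ iG)) => // y D2y.
congr fine; rewrite [RHS]integral_mkcond /fubini_G; apply: eq_integral => x _.
by rewrite /= /g !patchE in_setX/= D2y andbT /=; case: ifP.
Qed.

Lemma Fubini_Rintegral f (D1 : set T1) (D2 : set T2) : measurable D1 -> measurable D2 ->
  rintegrable m12 (D1 `*` D2) f ->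
  \int[m1]_(x in D1) \int[m2]_(y in D2) f (x, y) =
  \int[m2]_(y in D2) \int[m1]_(x in D1) f (x, y).
Proof. by move=> *; rewrite Fubini_Rintegral12// Fubini_Rintegral21. Qed.

End fubini.

(** * Lebesgue measure on R^n and on R *)

Section rv_space.
Context (R : realType).

Lemma rv_ballP n (x y : 'rV[R]_n) (r : R) : 0 < r ->
  ball x r y <-> forall i, `|x ord0 i - y ord0 i| < r.
Proof.
move=> r0; split=> [[_ H] i|H]; first exact: H.
by split=> // i j; rewrite !ord1; exact: H.
Qed.

Lemma continuous_rv (T : topologicalType) n (f : T -> 'rV[R]_n) (x : T) :
  (forall i, f t ord0 i @[t --> x] --> f x ord0 i) ->
  {for x, continuous f}.
Proof.
move=> cf; apply/cvg_ballP => e e0.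
have : \forall t \near x, forall i, ball (f x ord0 i) e (f t ord0 i).
  by apply: filter_forall => i; exact: (cvg_ballP _ _).1 (cf i) e e0.
by apply: filterS => t Ht; split=> // i j; rewrite ord1; exact: Ht.
Qed.

Let round k (x : R) : R := (Num.floor (x * k.+1%:R))%:~R / k.+1%:R.

Let round_cvg x : round k x @[k --> \oo] --> x.
Proof.
apply/cvgrPdist_le => e e0; near=> k.
have k0 : 0 < k.+1%:R :> R by [].
have := floor_itv (x * k.+1%:R) => /andP[h1 h2].
have -> : x - round k x = (x * k.+1%:R - (Num.floor (x * k.+1%:R))%:~R) / k.+1%:R.
  by rewrite mulrBl mulfK// gt_eqF.
rewrite ger0_norm ?divr_ge0 ?subr_ge0// ler_pdivrMr//.
apply: (@le_trans _ _ 1); first by rewrite lerBlDr addrC -[X in _ + X]/(1%:~R) -intrD ltW.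
rewrite -ler_pdivrMr// div1r ltW//; near: k.
exact: (near_infty_natSinv_lt (PosNum e0)).
Unshelve. all: end_near. Qed.

(** The sigma-algebra is generated by the coordinates, so preimages of open sets are not measurable
    by definition. Rounding every coordinate down to a multiple of 1/(k+1) gives maps with countably
    many values, whose level sets are finite intersections of coordinate conditions, and [f] is the
    pointwise limit of its values at the rounded points. *)
Lemma measurable_continuous n (f : 'rV[R]_n * R -> R) :
  continuous f -> measurable_fun [set: 'rV[R]_n * measurableTypeR R] f.
Proof.
move=> cf.
pose h k (z : 'rV[R]_n * measurableTypeR R) : R :=
  f (\row_i round k (z.1 ord0 i), round k z.2).
apply: (@measurable_fun_cvg _ _ _ _ h).
  move=> k _ Y mY; rewrite setTI.
  pose F (c : {ffun 'I_n -> int} * int) : set ('rV[R]_n * measurableTypeR R) :=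
    if `[< Y (f (\row_i ((c.1 i)%:~R / k.+1%:R), c.2%:~R / k.+1%:R)) >] then
    [set z : 'rV[R]_n * measurableTypeR R | (forall i, Num.floor (z.1 ord0 i * k.+1%:R) = c.1 i) /\
             Num.floor (z.2 * k.+1%:R) = c.2] else set0.
  rewrite (_ : _ @^-1` _ = \bigcup_c F c); last first.
    apply/seteqP; split=> [z Yz|z [c _]].
      exists ([ffun i => Num.floor (z.1 ord0 i * k.+1%:R)], Num.floor (z.2 * k.+1%:R)) => //.
      rewrite /F /= asboolT; first by split=> // i; rewrite ffunE.
      rewrite [X in f (X, _)](_ : _ = \row_i round k (z.1 ord0 i))//.
      by apply/rowP => i; rewrite !mxE ffunE.
    rewrite /F; case: asboolP => // Yc [h1 h2].
    rewrite /h /= /round h2; under eq_mx do rewrite h1.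
    exact: Yc.
  apply: countable_bigcupT_measurable => [|c]; first exact: countableP.
  rewrite /F; case: ifP => // _.
  have mfl (g : 'rV[R]_n * measurableTypeR R -> R) (j : int) :
      measurable_fun setT g -> measurable [set z | Num.floor (g z * k.+1%:R) = j].
    move=> mg; rewrite (_ : [set _ | _] = g @^-1` `[j%:~R / k.+1%:R, (j + 1)%:~R / k.+1%:R[).
      by rewrite -[X in measurable X]setTI; exact: mg.
    apply/seteqP; split=> z /=.
      move=> <-; rewrite in_itv/= ler_pdivrMr// ltr_pdivlMr//.
      by have := floor_itv (g z * k.+1%:R).
    rewrite in_itv/= ler_pdivrMr// ltr_pdivlMr// => H.
    exact: floor_def.
  rewrite (_ : [set _ | _] = (\bigcap_(i in [set: 'I_n])
    [set z : 'rV[R]_n * measurableTypeR R | Num.floor (z.1 ord0 i * k.+1%:R) = c.1 i]) `&`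
    [set z | Num.floor (z.2 * k.+1%:R) = c.2]); last first.
    by apply/seteqP; split=> z /= [h1 h2]; split=> // i; [move=> _|]; exact: h1.
  apply: measurableI; last by apply: mfl; exact: measurable_snd.
  apply: fin_bigcap_measurable => // i _; apply: (mfl (fun z => z.1 ord0 i)).
  exact: (measurableT_comp (@measurable_rv_coord R n i) measurable_fst).
move=> z _; apply: continuous_cvg; first exact: cf.
apply: (@cvg_pair _ _ _ \oo (nbhs z.1) (nbhs z.2)); last exact: round_cvg.
apply/cvg_ballP => e e0.
have : \forall k \near \oo, forall i, ball (z.1 ord0 i) e (round k (z.1 ord0 i)).
  by apply: filter_forall => i; exact: (cvg_ballP _ _).1 (@round_cvg _) e e0.
by apply: filterS => k Hk; split=> // i j; rewrite ord1 mxE; exact: Hk.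
Qed.

Lemma measurable_continuous_rv n (f : 'rV[R]_n -> R) :
  continuous f -> measurable_fun setT f.
Proof.
move=> cf; have : measurable_fun [set: 'rV[R]_n * measurableTypeR R] (f \o fst).
  by apply: measurable_continuous => z; apply: continuous_comp; [exact: cvg_fst|exact: cf].
by move=> /(@measurable_fun_pair1 _ _ _ _ _ _ _ (0 : R)).
Qed.

Lemma measurable_rv_ball n (x : 'rV[R]_n) r : measurable (ball x r).
Proof.
have [r0|r0] := ltP 0 r; last first.
  rewrite (_ : ball x r = set0)//; apply/seteqP; split=> // y [].
  by rewrite ltNge r0.
rewrite (_ : ball x r = \bigcap_(i in [set: 'I_n]) (@rv_coord R n i) @^-1` ball (x ord0 i) r).
  apply: fin_bigcap_measurable => // i _; rewrite -[X in measurable X]setTI.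
  by apply: measurable_rv_coord => //; exact: measurable_ball.
by apply/seteqP; split=> y; rewrite rv_ballP// => H i; [move=> _|]; exact: H.
Qed.

(** Balls of the matrix norm are cubes, and [rv_cons] splits a cube into an interval and a cube of
    one dimension less. *)
Lemma lebesgue_rv_ball n (x : 'rV[R]_n) r : 0 < r ->
  lebesgue_rv R n (ball x r) = ((r *+ 2) ^+ n)%:E.
Proof.
move=> r0; elim: n x => [|n IHn] x.
  rewrite /= expr0 diracE mem_set//.
  by apply/rv_ballP => // -[].
rewrite [LHS]/= /lebesgue_rv_step /pushforward.
rewrite (_ : _ @^-1` _ = ball (x ord0 ord0) r `*` ball (\row_i x ord0 (lift ord0 i)) r).
  rewrite product_measure1E; [|exact: measurable_ball|exact: measurable_rv_ball].
  by rewrite IHn [X in (X * _)%E]lebesgue_measure_ball ?ltW// -EFinM exprS.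
apply/seteqP; split=> -[t v] /=.
  move=> /rv_ballP-/(_ r0) H; split.
    by have := H ord0; rewrite mxE unlift_none.
  by apply/rv_ballP => // i; have := H (lift ord0 i); rewrite !mxE liftK.
case=> H1 /rv_ballP-/(_ r0) H2; apply/rv_ballP => // i; rewrite mxE.
by case: unliftP => [j ->|->] //=; have := H2 j; rewrite mxE.
Qed.

End rv_space.

Section bounded_support.
Context d (T : measurableType d) (R : realType).
Variable mu : {measure set T -> \bar R}.

Lemma Rintegral_supp (D : set T) (f : T -> R) : (forall x, ~ D x -> f x = 0) ->
  \int[mu]_x f x = \int[mu]_(x in D) f x.
Proof.
move=> f0; rewrite [RHS]Rintegral_mkcond; apply: eq_Rintegral => x _.
by rewrite patchE; case: ifPn => //; rewrite notin_setE => /f0.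
Qed.

Lemma rintegrable_supp (D : set T) (f : T -> R) : measurable D ->
  (forall x, ~ D x -> f x = 0) -> rintegrable mu D f -> rintegrable mu setT f.
Proof.
move=> mD f0 /rintegrable_mkcond -/(_ mD); apply: eq_rintegrable => // x _.
by rewrite patchE; case: ifPn => //; rewrite notin_setE => /f0.
Qed.

Lemma rintegrable_bounded (D : set T) (f : T -> R) (M : R) : measurable D ->
  (mu D < +oo)%E -> measurable_fun D f -> (forall x, D x -> `|f x| <= M) ->
  rintegrable mu D f.
Proof.
move=> mD Doo mf fM; apply: measurable_bounded_integrable => //.
exists M; split; first exact: num_real.
by move=> K MK x /fM /= fxM; exact: (le_trans fxM (ltW MK)).
Qed.

End bounded_support.

Section real_line.
Context {R : realType}.
Local Notation mu := (@lebesgue_measure R).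

Lemma lebesgue_itv_lty (a b : R) : (mu `[a, b] < +oo)%E.
Proof. by rewrite lebesgue_measure_itv/=; case: ifP => _; rewrite ?ltry// -EFinB ltry. Qed.

Lemma FTC2 (F : R -> R) a b : a <= b -> (forall x, derivable F x 1) ->
  continuous ('D_1 F) -> \int[mu]_(x in `[a, b]) 'D_1 F x = F b - F a.
Proof.
rewrite le_eqVlt => /predU1P[->|ab] dF cF.
  by rewrite set_itv1 Rintegral_set1 subrr.
have cFF : continuous F by move=> x; apply/differentiable_continuous/derivable1_diffP.
rewrite /Rintegral (@continuous_FTC2 _ ('D_1 F) F)//.
- exact: continuous_subspaceT.
- split; [by move=> x _|exact/cvg_at_right_filter/cFF|exact/cvg_at_left_filter/cFF].
- by move=> x _; rewrite derive1E.
Qed.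

Lemma Rintegration_by_parts_C1 (F f G g : R -> R) (a b : R) : a <= b ->
  (forall x : R, is_derive x 1 F (f x)) -> continuous f ->
  (forall x : R, is_derive x 1 G (g x)) -> continuous g ->
  \int[mu]_(x in `[a, b]) (F x * g x) =
  F b * G b - F a * G a - \int[mu]_(x in `[a, b]) (f x * G x).
Proof.
rewrite le_eqVlt => /predU1P[->|ab] dF cf dG cg.
  by rewrite set_itv1 !Rintegral_set1 !subrr.
have dF1 x : derivable F x 1 by have [] := dF x.
have dG1 x : derivable G x 1 by have [] := dG x.
have cFF : continuous F by move=> x; apply/differentiable_continuous/derivable1_diffP.
have cGG : continuous G by move=> x; apply/differentiable_continuous/derivable1_diffP.
have lF : derivable_oo_LRcontinuous F a b.
  split; [by move=> x _|exact/cvg_at_right_filter/cFF|exact/cvg_at_left_filter/cFF].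
have lG : derivable_oo_LRcontinuous G a b.
  split; [by move=> x _|exact/cvg_at_right_filter/cGG|exact/cvg_at_left_filter/cGG].
have eF : {in `]a, b[, F^`()%classic =1 f}.
  by move=> x _; rewrite derive1E; have [] := dF x.
have eG : {in `]a, b[, G^`()%classic =1 g}.
  by move=> x _; rewrite derive1E; have [] := dG x.
exact: (Rintegration_by_parts ab (continuous_subspaceT cf) lF eF
  (continuous_subspaceT cg) lG eG).
Qed.

Lemma Rintegral_reflect (f : R -> R) a b : a <= b -> continuous f ->
  \int[mu]_(x in `[a, b]) f (a + b - x) = \int[mu]_(x in `[a, b]) f x.
Proof.
rewrite le_eqVlt => /predU1P[->|ab] cf.
  by rewrite set_itv1 !Rintegral_set1.
have dF x : is_derive x (1 : R) (fun x : R => a + b - x) (-1).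
  by have := is_deriveB (is_derive_cst (a + b) x 1) (is_derive_id x 1); rewrite sub0r.
have DF : (fun x => a + b - x)^`()%classic = cst (-1).
  by apply/funext => x; rewrite derive1E; have [_ ->] := dF x.
have cF : continuous (fun x => a + b - x).
  by move=> x; apply/differentiable_continuous/derivable1_diffP; have [] := dF x.
have := @integration_by_substitution_decreasing R (fun x => a + b - x) f a b (ltW ab).
have -> : a + b - b = a by ring.
have -> : a + b - a = b by ring.
move=> H; rewrite /Rintegral [in RHS]H.
- congr fine; apply: eq_integral => x _ /=.
  by rewrite !fctE DF opprK /cst mulr1.
- by move=> x y _ _ xy; rewrite ltrD2l ltrN2.
- by rewrite DF => x _; exact: cst_continuous.
- by rewrite DF; exact: is_cvg_cst.
- by rewrite DF; exact: is_cvg_cst.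
- split; [by move=> x _; have [] := dF x|exact/cvg_at_right_filter/cF|exact/cvg_at_left_filter/cF].
- exact: continuous_subspaceT.
Qed.

Lemma ball0P (B x : R) : ball 0 B x <-> `|x| < B.
Proof. by rewrite /ball/= sub0r normrN. Qed.

Lemma continuous_rintegrable (f : R -> R) a b : continuous f ->
  rintegrable mu `[a, b] f.
Proof.
move=> cf; apply: continuous_compact_integrable; first exact: segment_compact.
exact: continuous_subspaceT.
Qed.

Lemma Rintegral_derive0 (h : R -> R) (B : R) : (forall x, derivable h x 1) ->
  continuous ('D_1 h) -> (forall x, B <= `|x| -> h x = 0) ->
  \int[mu]_x 'D_1 h x = 0.
Proof.
(* [C] is strictly larger than [B], so [h] vanishes in a neighbourhood of every point outside
   [-C, C] and its derivative is 0 there. *)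
move=> dh ch h0; pose C := `|B| + 1.
have BC : B < C by rewrite /C; apply: le_lt_trans (ler_norm _) _; rewrite ltrDl.
have C0 : 0 < C by rewrite ltr_wpDl.
rewrite (@Rintegral_supp _ _ _ mu `[- C, C]%classic ('D_1 h)).
  rewrite FTC2//; last by lra.
  by rewrite !h0 ?subrr// ?normrN ger0_norm// ltW.
move=> x /=; rewrite in_itv/= => /negP; rewrite -ler_norml -ltNge => Cx.
rewrite (@near_eq_derive _ _ _ h (cst 0)) ?derive_cst//.
near=> y; apply: h0; rewrite ltW// (lt_trans BC)//.
have H : `|x - y| < `|x| - C.
  by near: y; apply: (@nbhsx_ballx R R x (`|x| - C)); rewrite subr_gt0.
by have := ler_normD (x - y) y; rewrite subrK; lra.
Unshelve. all: end_near. Qed.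

End real_line.

Section rv_integrals.
Context {R : realType}.
Local Notation mu := (@lebesgue_measure R).

Lemma continuous_bounded_ball n (h : 'rV[R]_n * R -> R) (B : R) : continuous h ->
  exists2 M : R, 0 <= M & forall z, ball 0 B z -> `|h z| <= M.
Proof.
move=> ch.
pose K := [set v : 'rV[R]_n | forall i, `[- B, B]%classic (v ord0 i)] `*` `[- B, B]%classic.
have cK : compact K.
  apply: compact_setX; last exact: segment_compact.
  by apply: (@rV_compact R n (fun=> `[- B, B]%classic)) => i; exact: segment_compact.
have := compact_bounded (continuous_compact (continuous_subspaceT ch) cK).
move=> [M [Mr HM]]; exists (`|M| + 1); first by rewrite addr_ge0.
move=> -[v t] [/= /rv_ballP bv /ball0P bt].
have B0 : 0 < B by apply: le_lt_trans bt.
apply: (HM (`|M| + 1)); first by apply: le_lt_trans (ler_norm _) _; rewrite ltrDl.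
exists (v, t) => //; split=> [i|] /=; rewrite in_itv/= -ler_norml; last exact: ltW.
by have := bv B0 i; rewrite mxE sub0r normrN => /ltW.
Qed.

Lemma rintegrable_bsupp_prod n (h : 'rV[R]_n * R -> R) (B : R) : continuous h ->
  (forall z, ~ ball 0 B z -> h z = 0) -> rintegrable (lebesgue_rv R n \x mu)%E setT h.
Proof.
move=> ch h0; have [M M0 HM] := continuous_bounded_ball B ch.
have mB : measurable (ball (0 : 'rV[R]_n) B `*` (ball (0 : R) B : set (measurableTypeR R))).
  by apply: measurableX; [exact: measurable_rv_ball|exact: measurable_ball].
apply: (rintegrable_supp mB); first by move=> z /h0.
apply: (rintegrable_bounded mB (M := M)) => //; last first.
  by apply: measurable_funTS; exact: measurable_continuous.
rewrite [X in (X < _)%E](@product_measure1E _ _ _ _ R (lebesgue_rv R n) mu _ _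
  (measurable_rv_ball 0 B) (measurable_ball 0 B)).
have [B0|B0] := ltP 0 B; last first.
  rewrite (_ : ball (0 : R) B = set0) ?measure0 ?mule0//.
  apply/seteqP; split=> // x /ball0P; rewrite ltNge => /negP; apply.
  exact: le_trans B0 _.
by rewrite [X in (X * _)%E](lebesgue_rv_ball 0 B0) [X in (_ * X)%E]lebesgue_measure_ball ?ltW// -EFinM ltry.
Qed.

Lemma rintegrable_bsupp_rv n (h : 'rV[R]_n -> R) (B : R) : continuous h ->
  (forall z, ~ ball 0 B z -> h z = 0) -> rintegrable (lebesgue_rv R n) setT h.
Proof.
move=> ch h0.
have ch1 : continuous (fun z : 'rV[R]_n * R => h z.1).
  by move=> z; apply: continuous_comp; [exact: cvg_fst|exact: ch].
have [B0|B0] := ltP 0 B; last first.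
  have -> : h = fun=> 0.
    apply/funext => v; apply: h0 => -[]; by rewrite ltNge B0.
  exact: integrable0.
have [M M0 HM] := continuous_bounded_ball B ch1.
have mB := measurable_rv_ball (0 : 'rV[R]_n) B.
apply: (rintegrable_supp mB) => //.
apply: (rintegrable_bounded mB (M := M)).
- by rewrite [X in (X < _)%E](lebesgue_rv_ball 0 B0) ltry.
- by apply: measurable_funTS; exact: measurable_continuous_rv.
- by move=> v bv; apply: (HM (v, 0)); split => //; exact: ballxx.
Qed.

Lemma continuous_rv_cons n (t : R) : continuous (fun v : 'rV[R]_n => rv_cons (t, v)).
Proof.
move=> v; apply: continuous_rv => i.
under eq_fun do rewrite mxE; rewrite mxE.
case: unliftP => [j _|_]; first exact: coord_continuous.
exact: (@cst_continuous _ _ t v).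
Qed.

Lemma continuous_rv_cons1 n (v : 'rV[R]_n) : continuous (fun t : R => rv_cons (t, v)).
Proof.
move=> t; apply: continuous_rv => i.
under eq_fun do rewrite mxE; rewrite mxE.
case: unliftP => [j _|_]; last exact: cvg_id.
exact: (@cst_continuous _ _ (v ord0 j) t).
Qed.

Lemma ball_rv_cons n (t : R) (v : 'rV[R]_n) (B : R) : 0 < B ->
  ball 0 B (rv_cons (t, v)) <-> ball 0 B t /\ ball 0 B v.
Proof.
move=> B0; rewrite !rv_ballP//; split=> [H|[Ht Hv] i].
  split=> [|i]; first by have := H ord0; rewrite !mxE unlift_none.
  by have := H (lift ord0 i); rewrite !mxE liftK.
by rewrite !mxE; case: unliftP => [j _|_] //=; have := Hv j; rewrite mxE.
Qed.

Lemma Rintegral_rv_cons n (f : 'rV[R]_n.+1 -> R) (B : R) : 0 < B -> continuous f ->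
  (forall v, ~ ball 0 B v -> f v = 0) ->
  \int[lebesgue_rv R n.+1]_v f v = \int[(mu \x lebesgue_rv R n)%E]_z f (rv_cons z) /\
  rintegrable (mu \x lebesgue_rv R n)%E setT (f \o @rv_cons R n).
Proof.
move=> B0 cf f0.
have cf1 : continuous (fun z : 'rV[R]_n.+1 * R => f z.1).
  by move=> z; apply: continuous_comp; [exact: cvg_fst|exact: cf].
have [M M0 HM] := continuous_bounded_ball B cf1.
have mf := measurable_continuous_rv cf.
have ifc : rintegrable (mu \x lebesgue_rv R n)%E setT (f \o @rv_cons R n).
  have mB : measurable ((ball (0 : R) B : set (measurableTypeR R)) `*` ball (0 : 'rV[R]_n) B).
    by apply: measurableX; [exact: measurable_ball|exact: measurable_rv_ball].
  apply: (rintegrable_supp mB).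
    by move=> [t v] H; apply: f0; rewrite ball_rv_cons.
  apply: (rintegrable_bounded mB (M := M)).
  - rewrite [X in (X < _)%E](@product_measure1E _ _ _ _ R mu (lebesgue_rv R n) _ _
      (measurable_ball 0 B) (measurable_rv_ball 0 B)).
    by rewrite [X in (_ * X)%E](lebesgue_rv_ball 0 B0) [X in (X * _)%E]lebesgue_measure_ball ?ltW// -EFinM ltry.
  - apply: measurable_funTS; apply: measurableT_comp => //; exact: measurable_rv_cons.
  - move=> [t v] [bt bv]; apply: (HM (rv_cons (t, v), 0)); split; last exact: ballxx.
    exact/ball_rv_cons.
split=> //; rewrite /Rintegral; congr fine.
rewrite -(@integral_pushforward _ _ _ _ _ _ (@measurable_rv_cons R n) _ setT (EFin \o f))//.
exact/measurable_EFinP.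
Qed.

(** Fubini isolates one coordinate. If i is the first coordinate the inner integral is that of a
    derivative on the line; otherwise the induction hypothesis applies to the sections with the
    first coordinate fixed. *)
Lemma Rintegral_rv_derive0 n (h : 'rV[R]_n -> R) (i : 'I_n) (B : R) : smooth_on setT h ->
  (forall v, ~ ball 0 B v -> h v = 0) ->
  \int[lebesgue_rv R n]_v 'D_(delta_mx ord0 i) h v = 0.
Proof.
wlog B0 : B / 0 < B.
  move=> H sh h0; have B1 : 0 < `|B| + 1 by rewrite ltr_wpDl.
  apply: (H _ B1 sh) => v nb; apply: h0 => bv; apply: nb; apply: le_ball bv.
  by rewrite (le_trans (ler_norm _))// lerDl.
elim: n h i => [|n IHn] h i sh h0; first by case: i.
have sD := smooth_derive (delta_mx ord0 i) sh.
have D0 v : ~ ball 0 (B + 1) v -> 'D_(delta_mx ord0 i) h v = 0.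
  move=> nb; rewrite (@near_eq_derive _ _ _ h (cst 0)) ?derive_cst//.
  near=> w; apply: h0 => bw; apply: nb.
  apply: ball_triangle bw _; apply: ball_sym.
  by near: w; exact: nbhsx_ballx.
have B10 : 0 < B + 1 by rewrite ltr_wpDl// ltW.
have [-> ic] := Rintegral_rv_cons B10 (smooth_continuous sD) D0.
rewrite -[X in \int[_]_(z in X) _]setXTT.
case: (unliftP ord0 i) => [j|] iE.
  rewrite -Fubini_Rintegral12 ?setXTT// /Rintegral (eq_integral (fun=> 0%E)) ?integral0// => t _.
  pose ht := h \o (fun v : 'rV[R]_n => rv_cons (t, v)).
  have aff c (v w : 'rV[R]_n) :
      rv_cons (t, c *: v + w) = c *: rv_cons (0, v) + rv_cons (t, w).
    by apply/rowP => k; rewrite !mxE; case: unliftP => [k' _|_] /=; rewrite ?mxE// mulr0 add0r.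
  have e_ : rv_cons (0, delta_mx ord0 j : 'rV[R]_n) = delta_mx ord0 i.
    apply/rowP => k; rewrite !mxE iE.
    case: unliftP => [k' ->|->]; last by rewrite (negbTE (neq_lift _ _)).
    by rewrite /= mxE (inj_eq lift_inj).
  have sht : smooth_on setT ht := smooth_affine aff (@continuous_rv_cons n t) sh.
  have := IHn ht j sht _.
  rewrite /Rintegral; under eq_integral do rewrite (derive_affine aff) e_.
  move=> ->// v nb; apply: h0; rewrite ball_rv_cons//.
  by case.
rewrite -Fubini_Rintegral21 ?setXTT// /Rintegral (eq_integral (fun=> 0%E)) ?integral0// => v _.
pose hv := h \o (fun t : R => rv_cons (t, v)).
have aff c (s t : R) :
    rv_cons (c *: s + t, v) = c *: rv_cons (s, 0 : 'rV[R]_n) + rv_cons (t, v).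
  by apply/rowP => k; rewrite !mxE; case: unliftP => [k' _|_] /=; rewrite ?mxE// mulr0 add0r.
have e_ : rv_cons (1, 0 : 'rV[R]_n) = delta_mx ord0 i.
  apply/rowP => k; rewrite !mxE iE.
  case: unliftP => [k' ->|->]; last by rewrite eqxx.
  by rewrite /= mxE.
have shv : smooth_on setT hv := smooth_affine aff (@continuous_rv_cons1 n v) sh.
have := @Rintegral_derive0 R hv B (fun x => @smooth_derivable _ _ _ x 1 shv)
  (smooth_continuous (smooth_derive _ shv)).
rewrite /Rintegral; under eq_integral do rewrite (derive_affine aff) e_.
move=> ->// t Bt; apply: h0; rewrite ball_rv_cons// => -[/ball0P].
by rewrite ltNge Bt.
Unshelve. all: end_near. Qed.

End rv_integrals.

(** * Primitives and convolutions in time *)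

Section variable_range.
Context d (T : measurableType d) (R : realType).
Local Notation mu := (@lebesgue_measure R).

(** The moving end points enter the integrand as an indicator that is measurable in both
    variables. *)
Lemma measurable_Rintegral_itv (k : T * measurableTypeR R -> R) (al be : T -> R) :
  measurable_fun setT k -> measurable_fun setT al -> measurable_fun setT be ->
  measurable_fun setT (fun x => \int[mu]_(s in `[al x, be x]) k (x, s)).
Proof.
move=> mk mal mbe.
pose k' (z : T * measurableTypeR R) : R :=
  if (al z.1 <= z.2) && (z.2 <= be z.1) then k z else 0.
have mk' : measurable_fun setT k'.
  apply: measurable_fun_ifT => //; apply: measurable_and; apply: measurable_fun_ler.
  - exact: (measurableT_comp mal measurable_fst).
  - exact: measurable_snd.
  - exact: measurable_snd.
  - exact: (measurableT_comp mbe measurable_fst).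
have := @measurable_Rintegral2 _ _ T _ R mu k' setT measurableT mk'.
congr measurable_fun; apply/funext => x.
rewrite [RHS]Rintegral_mkcond; apply: eq_Rintegral => s _.
rewrite /k' patchE /=; case: ifPn; case: ifPn => //.
  by rewrite notin_setE /= in_itv/= => /negP/negbTE ->.
by move=> /set_mem /=; rewrite in_itv/= => ->.
Qed.

End variable_range.

(** * Causal functions, their time primitives and Volterra convolutions *)

Section volterra.
Context {R : realType}.
Local Notation mu := (@lebesgue_measure R).
Local Notation mu2 := (@lebesgue_measure R \x @lebesgue_measure R)%E.

(** Cauchy-Schwarz against the constant 1, read off from the nonnegative integral of (|h| - l)^2
    with [l] the mean value of |h|. *)
Lemma Rintegral_sqr_le (h : R -> R) (a b : R) : a <= b -> measurable_fun `[a, b] h ->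
  rintegrable mu `[a, b] (fun t => h t ^+ 2) ->
  rintegrable mu `[a, b] h /\
  (\int[mu]_(t in `[a, b]) `|h t|) ^+ 2 <= (b - a) * \int[mu]_(t in `[a, b]) h t ^+ 2.
Proof.
move=> ab mh ih2.
have mD : measurable (`[a, b]%classic : set (measurableTypeR R)) by [].
have i1 k : rintegrable mu `[a, b] (fun=> k : R).
  by apply: rintegrable_cst => //; exact: lebesgue_itv_lty.
have ih : rintegrable mu `[a, b] h.
  apply: (rintegrable_le mD mh _ (rintegrableD mD (i1 1) ih2)) => t _.
  by rewrite -real_normK ?num_real//; have := normr_ge0 (h t); nra.
split=> //; move: ab; rewrite le_eqVlt => /predU1P[->|ab].
  by rewrite set_itv1 !Rintegral_set1 expr0n mulr0.
have L0 : 0 < b - a by rewrite subr_gt0.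
set N := \int[mu]_(t in _) `|h t|; set S := \int[mu]_(t in _) _.
pose l := N / (b - a).
have ihn := rintegrable_norm ih.
have : 0 <= \int[mu]_(t in `[a, b]) (`|h t| - l) ^+ 2.
  by apply: Rintegral_ge0 => t _; exact: sqr_ge0.
have -> : \int[mu]_(t in `[a, b]) (`|h t| - l) ^+ 2 = S - 2 * l * N + l ^+ 2 * (b - a).
  transitivity (\int[mu]_(t in `[a, b]) (h t ^+ 2 - 2 * l * `|h t| + l ^+ 2)).
    apply: eq_Rintegral => t _; rewrite -[h t ^+ 2]real_normK ?num_real//; ring.
  rewrite RintegralD//; last 2 first.
  - exact: (rintegrableB mD ih2 (rintegrableZl _ mD ihn)).
  - exact: i1.
  rewrite RintegralB//; last exact: (rintegrableZl _ mD ihn).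
  rewrite RintegralZl// Rintegral_cst//; congr (_ + _ * _).
  by rewrite [X in fine X]lebesgue_measure_itv/= lte_fin ab.
have -> : S - 2 * l * N + l ^+ 2 * (b - a) = S - N ^+ 2 / (b - a).
  by rewrite /l; field; rewrite gt_eqF.
by rewrite subr_ge0 ler_pdivrMr// mulrC.
Qed.

Lemma Rintegral_triangle (k : R * R -> R) a b :
  rintegrable mu2 (`[a, b] `*` `[a, b]) k ->
  \int[mu]_(t in `[a, b]) \int[mu]_(s in `[a, t]) k (t, s) =
  \int[mu]_(s in `[a, b]) \int[mu]_(t in `[s, b]) k (t, s).
Proof.
move=> ik.
have mD : measurable (`[a, b]%classic : set (measurableTypeR R)) by [].
have mDD := measurableX mD mD.
pose P := [set z : measurableTypeR R * measurableTypeR R | z.2 <= z.1].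
have mP : measurable P.
  rewrite -[P]setTI; apply: measurable_fun_le => //; exact: measurable_snd.
have ik' : rintegrable mu2 (`[a, b] `*` `[a, b]) (k \_ P).
  apply: (rintegrable_le mDD _ _ (rintegrable_norm ik)).
    apply/(measurable_restrict _ mP mDD).
    apply: measurable_funS (rintegrable_meas ik) => //; exact: subIsetl.
  by move=> z _; rewrite patchE; case: ifP => //; rewrite normr0.
transitivity (\int[mu]_(t in `[a, b]) \int[mu]_(s in `[a, b]) (k \_ P) (t, s)).
  apply: eq_Rintegral => t /set_mem /=; rewrite in_itv/= => /andP[at_ tb].
  rewrite (_ : `[a, t]%classic = `[a, b]%classic `&` [set s | s <= t]).
    rewrite Rintegral_mkcondr; apply: eq_Rintegral => s _; rewrite !patchE.
    by congr (if _ then _ else _); apply/idP/idP => /set_mem ?; exact/mem_set.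
  apply/seteqP; split=> s /=; rewrite !in_itv/=.
    by move=> /andP[as_ st]; rewrite as_ (le_trans st tb).
  by move=> [/andP[-> _] ->].
rewrite (Fubini_Rintegral mD mD ik').
apply: eq_Rintegral => s /set_mem /=; rewrite in_itv/= => /andP[as_ sb].
rewrite (_ : `[s, b]%classic = `[a, b]%classic `&` [set t | s <= t]).
  rewrite Rintegral_mkcondr; apply: eq_Rintegral => t _; rewrite !patchE.
  by congr (if _ then _ else _); apply/idP/idP => /set_mem ?; exact/mem_set.
apply/seteqP; split=> t /=; rewrite !in_itv/=.
  by move=> /andP[st tb]; rewrite tb (le_trans as_ st).
by move=> [/andP[_ ->] ->].
Qed.

(* The lower end [a - 1] avoids a boundary point at [a], where the primitives of
   [h] from [a] are still differentiable. *)
Definition causal a (h : R -> R) :=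
  [/\ measurable_fun setT (h : measurableTypeR R -> R),
      forall t, t < a -> h t = 0 & forall b, rintegrable mu `[a - 1, b] h].

Definition prim a (h : R -> R) t := \int[mu]_(s in `[a, t]) h s.

Lemma causal_rintegrable_base a h b : causal a h -> rintegrable mu `[a - 1, b] h.
Proof. by case. Qed.

Lemma causal_rintegrable a h b c : causal a h -> a <= b -> rintegrable mu `[b, c] h.
Proof.
move=> [_ _ ih] ab; apply: rintegrableS (ih c) => //.
by apply: subset_itvr; rewrite bnd_simp; lra.
Qed.

Lemma prim_base a h t : causal a h -> prim a h t = \int[mu]_(s in `[a - 1, t]) h s.
Proof.
move=> [_ h0 _]; rewrite /prim Rintegral_mkcond [RHS]Rintegral_mkcond.
apply: eq_Rintegral => s _; rewrite !patchE !mem_setE.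
have [sa|sa] := ltP s a; last by rewrite !in_itv/= sa (_ : a - 1 <= s)//; lra.
by rewrite h0// !if_same.
Qed.

Lemma prim0 a h t : t < a -> prim a h t = 0.
Proof. by move=> ta; rewrite /prim set_itv_ge ?Rintegral_set0// bnd_simp -ltNge. Qed.

Lemma prim_le a h t b : causal a h -> t <= b ->
  `|prim a h t| <= \int[mu]_(s in `[a, b]) `|h s|.
Proof.
move=> ch tb; have ih := causal_rintegrable _ ch (lexx a).
apply: le_trans (le_normr_Rintegral _ (ih t)) _ => //.
rewrite Rintegral_mkcond [leRHS]Rintegral_mkcond; apply: le_Rintegral => //.
- exact: (rintegrable_mkcond _ _ _).1 (rintegrable_norm (ih t)).
- exact: (rintegrable_mkcond _ _ _).1 (rintegrable_norm (ih b)).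
move=> s _; rewrite !patchE !mem_setE !in_itv/=.
case: (leP a s) => //= _; case: (leP s t) => st.
  by rewrite (le_trans st tb).
by case: ifP => _; [exact: normr_ge0|exact: lexx].
Qed.

Lemma continuous_prim a h : causal a h -> continuous (prim a h).
Proof.
move=> ch t; have [ta|ta] := ltP t a.
  apply: (@cvg_trans _ (cst (0 : R) @ t)); last first.
    by rewrite prim0//; exact: (@cst_continuous _ _ (0 : R) t).
  apply: near_eq_cvg; near=> s; rewrite prim0//.
  by near: s; exact: lt_nbhsl.
have at1 : a - 1 < t + 1 by lra.
have tin : t \in `]a - 1, t + 1[ by rewrite in_itv/=; apply/andP; split; lra.
have := parameterized_integral_continuous (ltW at1) (causal_rintegrable_base (t + 1) ch).
move=> /(within_continuous_continuous at1)/(_ tin).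
rewrite (_ : (fun x => _) = prim a h)//.
by apply/funext => s; rewrite prim_base.
Unshelve. all: end_near. Qed.

Lemma causal_prim a h : causal a h -> causal a (prim a h).
Proof.
move=> ch; split.
  by apply: continuous_measurable_fun; exact: continuous_prim.
  by move=> t; exact: prim0.
by move=> b; apply: continuous_rintegrable; exact: continuous_prim.
Qed.

Lemma is_derive_prim a h (t : R) : causal a h -> continuous h ->
  is_derive t 1 (prim a h) (h t).
Proof.
move=> ch cth; have [ta|ta] := ltP t a.
  apply: (@near_eq_is_derive _ _ _ (cst 0)); last first.
    by case: ch => _ -> // _; exact: is_derive_cst.
  near=> s; rewrite prim0//.
  by near: s; exact: lt_nbhsl.
have at1 : a - 1 < t by lra.
have tt1 : t < t + 1 by lra.
have [dt Dt] := continuous_FTC1_closed tt1 (causal_rintegrable_base _ ch) at1 (cth t).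
have E : (fun x => \int[mu]_(s in `[a - 1, x]) h s) = prim a h.
  by apply/funext => s; rewrite prim_base.
by rewrite E derive1E in dt Dt; split.
Unshelve. all: end_near. Qed.

Lemma rintegrable_square (k : R * R -> R) a b (M : R) : measurable_fun setT k ->
  (forall t s, a <= t <= b -> a <= s <= b -> `|k (t, s)| <= M) ->
  rintegrable mu2 (`[a, b] `*` `[a, b]) k.
Proof.
move=> mk kM.
have mD : measurable (`[a, b]%classic : set (measurableTypeR R)) by [].
apply: (rintegrable_bounded (measurableX mD mD) (M := M)).
- rewrite [X in (X < _)%E](@product_measure1E _ _ _ _ R mu mu _ _ mD mD).
  by rewrite lte_mul_pinfty ?lebesgue_itv_lty// ge0_fin_numE ?lebesgue_itv_lty.
- exact: measurable_funTS.
- by move=> [t s] [/=]; rewrite !in_itv/=; exact: kM.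
Qed.

(* Symmetrizing the double integral of [h t * h s] over [s <= t]. *)
Lemma Rintegral_mul_prim_ge0 a h b : causal a h ->
  0 <= \int[mu]_(t in `[a, b]) (h t * prim a h t).
Proof.
move=> ch.
have ih := causal_rintegrable b ch (lexx a).
have mD : measurable (`[a, b]%classic : set (measurableTypeR R)) by [].
have mh := rintegrable_meas ih.
have cP := continuous_prim ch.
have mP : measurable_fun setT (prim a h) by exact: continuous_measurable_fun.
have ihP : rintegrable mu `[a, b] (fun t => h t * prim a h t).
  pose N := \int[mu]_(s in `[a, b]) `|h s|.
  apply: (rintegrable_le mD _ _ (rintegrableZl N mD (rintegrable_norm ih))).
    by apply: measurable_funM => //; exact: measurable_funTS.
  move=> t /=; rewrite in_itv/= => /andP[_ tb].
  by rewrite normrM mulrC ler_wpM2r//; exact: prim_le.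
pose k (z : R * R) := h z.1 * h z.2.
have ik : rintegrable mu2 (`[a, b] `*` `[a, b]) k.
  pose N := \int[mu]_(s in `[a, b]) `|h s|.
  apply: (rintegrable_prod mD mD _ _ _ (rintegrableZl N mD (rintegrable_norm ih))).
  - apply: measurable_funM.
      apply: (@measurable_comp _ _ _ _ _ _ `[a, b]%classic) => //.
        by move=> _ [z [? ?] <-].
      exact: measurable_funTS.
    apply: (@measurable_comp _ _ _ _ _ _ `[a, b]%classic) => //.
      by move=> _ [z [? ?] <-].
    exact: measurable_funTS.
  - by move=> t _; exact: (rintegrableZl (h t) mD ih).
  - move=> t _; under eq_Rintegral do rewrite /k/= normrM.
    by rewrite RintegralZl ?(mulrC `|h t|)//; exact: rintegrable_norm.
have E1 : \int[mu]_(t in `[a, b]) (h t * prim a h t) =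
    \int[mu]_(t in `[a, b]) \int[mu]_(s in `[a, t]) k (t, s).
  apply: eq_Rintegral => t /set_mem /=; rewrite in_itv/= => /andP[at_ tb].
  by rewrite /k/= RintegralZl//; exact: (causal_rintegrable _ ch).
have E2 : \int[mu]_(t in `[a, b]) (h t * prim a h t) =
    \int[mu]_(t in `[a, b]) (h t * (prim a h b - prim a h t)).
  rewrite E1 (Rintegral_triangle ik); apply: eq_Rintegral => s /set_mem /=.
  rewrite in_itv/= => /andP[as_ sb]; rewrite /k/=.
  have ihs := causal_rintegrable b ch as_.
  rewrite RintegralZr// mulrC; congr (_ * _).
  rewrite /prim (@Rintegral_itvB R h (BLeft a) (BRight b) s ih) ?bnd_simp//.
  rewrite Rintegral_itv_obnd_cbnd//.
  by apply: rintegrableS ihs => //; apply: subset_itvr; rewrite bnd_simp.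
have : \int[mu]_(t in `[a, b]) (h t * prim a h t) *+ 2 = prim a h b ^+ 2.
  rewrite mulr2n {2}E2.
  rewrite -RintegralD//; last first.
    apply: (eq_rintegrable mD _ (rintegrableB mD (rintegrableZl (prim a h b) mD ih) ihP)).
    by move=> t _; ring.
  transitivity (\int[mu]_(t in `[a, b]) (prim a h b * h t)).
    by apply: eq_Rintegral => t _; ring.
  by rewrite RintegralZl// expr2.
move=> H; rewrite -(@pmulrn_lge0 _ _ 2)// H; exact: sqr_ge0.
Qed.

Lemma continuous_bounded_itv (F : R -> R) (a b : R) : continuous F ->
  exists2 M : R, 0 <= M & forall x, a <= x <= b -> `|F x| <= M.
Proof.
move=> cF; have := compact_bounded (continuous_compact (continuous_subspaceT cF)
  (@segment_compact R a b)).
move=> [M [Mr HM]]; exists (`|M| + 1); first by rewrite addr_ge0.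
move=> x ax; apply: (HM (`|M| + 1)); first by apply: le_lt_trans (ler_norm _) _; rewrite ltrDl.
by exists x.
Qed.

Lemma rintegrable_kernel (f : measurableTypeR R * measurableTypeR R -> R) (h : R -> R) a b (M : R) :
  measurable_fun setT f ->
  (forall t s, a <= t <= b -> a <= s <= b -> `|f (t, s)| <= M) ->
  rintegrable mu `[a, b] h ->
  rintegrable mu2 (`[a, b] `*` `[a, b]) (fun z => f z * h z.2).
Proof.
move=> mf fM ih.
have mD : measurable (`[a, b]%classic : set (measurableTypeR R)) by [].
have mh2 : measurable_fun (`[a, b]%classic `*` `[a, b]%classic :
    set (measurableTypeR R * measurableTypeR R)) (fun z => h z.2).
  apply: (@measurable_comp _ _ _ _ _ _ `[a, b]%classic) => //.
    by move=> _ [z [? ?] <-].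
    exact: (rintegrable_meas ih).
  by apply: measurable_funTS; exact: measurable_snd.
have fx t : `[a, b]%classic t -> rintegrable mu `[a, b] (fun s => f (t, s) * h s).
  move=> tab; apply: (rintegrable_le mD _ _ (rintegrableZl M mD (rintegrable_norm ih))).
    apply: measurable_funM; last exact: (rintegrable_meas ih).
    by apply: measurable_funTS; exact: (measurable_fun_pair2 t mf).
  by move=> s sab; rewrite normrM ler_wpM2r// fM.
apply: (@rintegrable_prod _ _ _ _ R mu mu (fun z => f z * h z.2) _ _
  (fun=> M * \int[mu]_(s in `[a, b]) `|h s|) mD mD _ fx).
- by apply: measurable_funM => //; exact: measurable_funTS.
- move=> t tab; rewrite -RintegralZl//; last exact: rintegrable_norm.
  apply: le_Rintegral => //.
  + exact: (rintegrable_norm (fx t tab)).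
  + exact: (rintegrableZl _ mD (rintegrable_norm ih)).
  + by move=> s sab; rewrite normrM ler_wpM2r// fM.
- by apply: rintegrable_cst => //; exact: lebesgue_itv_lty.
Qed.

Lemma measurable_conv_kernel (F : R -> R) : continuous F ->
  measurable_fun [set: measurableTypeR R * measurableTypeR R] (fun z => F (z.1 - z.2)).
Proof.
move=> cF; apply: (measurableT_comp (f := F)); first exact: continuous_measurable_fun.
by apply: measurable_funB.
Qed.

Lemma rintegrable_conv (F h : R -> R) a t : continuous F -> causal a h ->
  rintegrable mu `[a, t] (fun s => F (t - s) * h s).
Proof.
move=> cF ch; have [M M0 HM] := continuous_bounded_itv 0 (t - a) cF.
have ih := causal_rintegrable t ch (lexx a).
apply: (rintegrable_le _ _ _ (rintegrableZl M _ (rintegrable_norm ih))) => //.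
  apply: measurable_funM; last exact: (rintegrable_meas ih).
  apply: measurable_funTS; apply: (measurableT_comp (f := F)).
    exact: continuous_measurable_fun.
  exact: measurable_funB.
move=> s /=; rewrite in_itv/= => sab; rewrite normrM ler_wpM2r// HM//; lra.
Qed.

Lemma causal_conv a (F h : R -> R) : continuous F -> causal a h ->
  causal a (fun t => \int[mu]_(s in `[a, t]) (F (t - s) * h s)).
Proof.
move=> cF ch.
have mc : measurable_fun setT
    (fun t : measurableTypeR R => \int[mu]_(s in `[a, t]) (F (t - s) * h s)).
  apply: (@measurable_Rintegral_itv _ (measurableTypeR R) R (fun z => F (z.1 - z.2) * h z.2) (fun=> a) id) => //.
  apply: measurable_funM; first exact: measurable_conv_kernel.
  by case: ch => mh _ _; exact: (measurableT_comp mh measurable_snd).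
split=> //.
  by move=> t ta; rewrite set_itv_ge ?Rintegral_set0// bnd_simp -ltNge.
move=> b; have [M M0 HM] := continuous_bounded_itv 0 (b - a) cF.
apply: (rintegrable_bounded (M := M * \int[mu]_(s in `[a, b]) `|h s|)) => //.
- exact: lebesgue_itv_lty.
- exact: measurable_funTS.
move=> t /=; rewrite in_itv/= => /andP[_ tb].
have ih := causal_rintegrable b ch (lexx a).
have iht := causal_rintegrable t ch (lexx a).
apply: le_trans (le_normr_Rintegral _ (rintegrable_conv _ cF ch)) _ => //.
apply: (@le_trans _ _ (\int[mu]_(s in `[a, t]) (M * `|h s|))).
  apply: le_Rintegral => //.
  - exact: (rintegrable_norm (rintegrable_conv _ cF ch)).
  - exact: (rintegrableZl _ _ (rintegrable_norm iht)).
  - move=> s /=; rewrite in_itv/= => sab; rewrite normrM ler_wpM2r// HM//; lra.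
rewrite RintegralZl//; last exact: rintegrable_norm.
rewrite ler_wpM2l// Rintegral_mkcond [leRHS]Rintegral_mkcond; apply: le_Rintegral => //.
- exact: (rintegrable_mkcond _ _ _).1 (rintegrable_norm iht).
- exact: (rintegrable_mkcond _ _ _).1 (rintegrable_norm ih).
move=> s _; rewrite !patchE !mem_setE !in_itv/=.
case: (leP a s) => //= _; case: (leP s t) => st.
  by rewrite (le_trans st tb).
by case: ifP => _; [exact: normr_ge0|exact: lexx].
Qed.

(** Integration in time commutes with convolution. After exchanging the order of integration, [h s]
    is weighted on the two sides by the integrals over [s, b] of F (t - s) and of F (b - t), and the
    reflection of [s, b] identifies them. *)
Lemma prim_conv a (F h : R -> R) b : continuous F -> causal a h -> a <= b ->
  prim a (fun t => \int[mu]_(s in `[a, t]) (F (t - s) * h s)) b =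
  \int[mu]_(s in `[a, b]) (F (b - s) * prim a h s).
Proof.
move=> cF ch ab; have ih := causal_rintegrable b ch (lexx a).
have [M M0 HM] := continuous_bounded_itv (a - b) (b - a) cF.
rewrite /prim (Rintegral_triangle (k := fun z => F (z.1 - z.2) * h z.2)); last first.
  apply: (rintegrable_kernel (M := M)) => //; first exact: measurable_conv_kernel.
  by move=> t s /= tab sab; apply: HM; lra.
rewrite [RHS](_ : _ = \int[mu]_(s in `[a, b]) \int[mu]_(r in `[a, s])
    ((fun z : R * R => F (b - z.1) * h z.2) (s, r))); last first.
  apply: eq_Rintegral => s _; rewrite /= RintegralZl//.
  exact: (causal_rintegrable s ch (lexx a)).
rewrite (Rintegral_triangle (k := fun z => F (b - z.1) * h z.2)); last first.
  apply: (rintegrable_kernel (f := fun z => F (b - z.1)) (M := M)) => //.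
    apply: (measurableT_comp (f := F)); first exact: continuous_measurable_fun.
    by apply: measurable_funB.
  by move=> t s /= tab sab; apply: HM; lra.
apply: eq_Rintegral => s /set_mem /=; rewrite in_itv/= => /andP[as_ sb].
have cF1 : continuous (fun t => F (t - s)).
  by move=> t; apply: continuous_comp; [apply: cvgB => //; exact: cvg_cst|exact: cF].
have cF2 : continuous (fun t => F (b - t)).
  by move=> t; apply: continuous_comp; [apply: cvgB => //; exact: cvg_cst|exact: cF].
rewrite RintegralZr//; last exact: continuous_rintegrable.
rewrite RintegralZr//; last exact: continuous_rintegrable.
congr (_ * _); rewrite -(Rintegral_reflect sb cF1).
by apply: eq_Rintegral => t _; congr F; ring.
Qed.

(* Integrating by parts in time turns the memory term into lower order terms. *)
Lemma memory_energy (F : R -> R) (c c0 M a b L : R) (h : R -> R) : 0 < c0 <= c ->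
  0 <= L -> b - a <= L ->
  (forall t, derivable F t 1) -> continuous ('D_1 F) ->
  (forall t, 0 <= t <= L -> `|F t| <= M /\ `|'D_1 F t| <= M) ->
  causal a h -> a <= b ->
  c0 / 4 * prim a (prim a h) b ^+ 2 -
    (M + M * L + M ^+ 2 * L / c0) * \int[mu]_(t in `[a, b]) prim a (prim a h) t ^+ 2 <=
  \int[mu]_(t in `[a, b]) ((c * prim a (prim a h) t -
    \int[mu]_(s in `[a, t]) (F (t - s) * prim a (prim a h) s)) * prim a h t).
Proof.
move=> /andP[c0gt0 c0c] L0 baL dF cDF FM ch ab.
set H := prim a h; set A := prim a H.
have cF : continuous F by move=> x; apply/differentiable_continuous/derivable1_diffP.
have mD : measurable (`[a, b]%classic : set (measurableTypeR R)) by [].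
have cH : continuous H := continuous_prim ch.
have chH := causal_prim ch.
have cA : continuous A := continuous_prim chH.
have chA := causal_prim chH.
have dA (t : R) : is_derive t 1 A (H t) := is_derive_prim t chH cH.
have Aa : A a = 0 by rewrite /A/prim set_itv1 Rintegral_set1.
have M0 : 0 <= M by have [|+ _] := FM 0; [rewrite lexx|apply: le_trans].
have icont (f : R -> R) : continuous f -> rintegrable mu `[a, b] f.
  by move=> ?; exact: continuous_rintegrable.
have cA2 : continuous (fun t => A t ^+ 2) by move=> t; exact: cvgM (cA t) (cA t).
set S := \int[mu]_(t in _) A t ^+ 2.
set N := \int[mu]_(t in `[a, b]) `|A t|.
have S0 : 0 <= S by apply: Rintegral_ge0 => t _; exact: sqr_ge0.
have N0 : 0 <= N by apply: Rintegral_ge0 => t _; exact: normr_ge0.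
have NS : N ^+ 2 <= L * S.
  have [_ h2] := @Rintegral_sqr_le A a b ab (rintegrable_meas (icont _ cA)) (icont _ cA2).
  by apply: le_trans h2 _; rewrite ler_wpM2r.
have kin : \int[mu]_(t in `[a, b]) (A t * H t) = A b ^+ 2 / 2.
  have := Rintegration_by_parts_C1 ab dA cH dA cH; rewrite Aa mul0r subr0 -expr2 => E.
  have E2 : \int[mu]_(t in `[a, b]) (H t * A t) = \int[mu]_(t in `[a, b]) (A t * H t).
    by apply: eq_Rintegral => t _; rewrite mulrC.
  by move: E; rewrite E2; clear; lra.
pose k (z : R * R) := F (z.1 - z.2) * A z.2 * H z.1.
have [MA MA0 HMA] := continuous_bounded_itv a b cA.
have [MH MH0 HMH] := continuous_bounded_itv a b cH.
have [MF MF0 HMF] := continuous_bounded_itv (a - b) (b - a) cF.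
have mk : measurable_fun [set: measurableTypeR R * measurableTypeR R] k.
  apply: measurable_funM; last first.
    apply: (measurableT_comp (f := H)); first exact: continuous_measurable_fun.
    exact: measurable_fst.
  apply: measurable_funM; first exact: measurable_conv_kernel.
  apply: (measurableT_comp (f := A)); first exact: continuous_measurable_fun.
  exact: measurable_snd.
have ik : rintegrable mu2 (`[a, b] `*` `[a, b]) k.
  apply: (rintegrable_square (M := MF * MA * MH)) => // t s tab sab.
  rewrite /k/= !normrM ler_pM ?mulr_ge0 ?HMH// ler_pM ?HMA// HMF//; lra.
(* The integral of F (t - s) H(t) over [s, b], integrated by parts with A' = H, leaves the boundary
   terms F (b - s) A(b) and F 0 A(s); [g] is the result multiplied by A(s). *)
pose g s := A s * (F (b - s) * A b - F 0 * A s -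
  \int[mu]_(t in `[s, b]) ('D_1 F (t - s) * A t)).
pose V t := \int[mu]_(s in `[a, t]) (F (t - s) * A s).
have cV : causal a V by exact: causal_conv.
have iVH : rintegrable mu `[a, b] (fun t => V t * H t).
  have iV := causal_rintegrable b cV (lexx a).
  apply: (rintegrable_le mD _ _ (rintegrableZl MH mD (rintegrable_norm iV))).
    apply: measurable_funM; first exact: (rintegrable_meas iV).
    exact: (rintegrable_meas (icont _ cH)).
  by move=> t; rewrite /= in_itv/= => tab; rewrite normrM mulrC ler_wpM2r// HMH.
have mem : \int[mu]_(t in `[a, b]) (V t * H t) = \int[mu]_(s in `[a, b]) g s.
  transitivity (\int[mu]_(t in `[a, b]) \int[mu]_(s in `[a, t]) k (t, s)).
    apply: eq_Rintegral => t _; rewrite /k /V /= RintegralZr//.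
    exact: rintegrable_conv.
  rewrite Rintegral_triangle//; apply: eq_Rintegral => s /set_mem /=.
  rewrite in_itv/= => /andP[as_ sb].
  have dFs (t : R) : is_derive t 1 (fun t : R => F (t - s)) ('D_1 F (t - s)).
    have d1 : is_derive (t - s) 1 F ('D_1 F (t - s)) by exact: derivableP.
    have d2 : is_derive t 1 (fun t : R => t - s) 1.
      by have := is_deriveB (is_derive_id t 1) (is_derive_cst s t 1); rewrite subr0.
    by have := @is_derive1_comp _ F (fun t : R => t - s) t _ _ d1 d2; rewrite mulr1.
  have cDFs : continuous (fun t => 'D_1 F (t - s)).
    move=> t; apply: (@continuous_comp _ _ _ (fun t : R => t - s) ('D_1 F)); last exact: cDF.
    by apply: cvgB => //; exact: cvg_cst.
  have cFs : continuous (fun t => F (t - s)).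
    by move=> t; apply: continuous_comp; [apply: cvgB => //; exact: cvg_cst|exact: cF].
  transitivity (\int[mu]_(t in `[s, b]) (A s * (F (t - s) * H t))).
    by apply: eq_Rintegral => t _; rewrite /k/=; ring.
  rewrite RintegralZl//; last first.
    by apply: continuous_rintegrable => t; exact: cvgM (cFs t) (cH t).
  congr (_ * _).
  have := Rintegration_by_parts_C1 sb dFs cDFs dA cH.
  by rewrite subrr.
have mg : measurable_fun setT (g : measurableTypeR R -> R).
  have mA : measurable_fun setT (A : measurableTypeR R -> R).
    exact: continuous_measurable_fun.
  apply: measurable_funM => //; apply: measurable_funB; first apply: measurable_funB.
  - apply: measurable_funM => //; apply: (measurableT_comp (f := F)).
      exact: continuous_measurable_fun.
    exact: measurable_funB.
  - exact: measurable_funM.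
  apply: (@measurable_Rintegral_itv _ (measurableTypeR R) R (fun z => 'D_1 F (z.2 - z.1) * A z.2) id (fun=> b)) => //.
  apply: measurable_funM; last exact: (measurableT_comp mA measurable_snd).
  apply: (measurableT_comp (f := 'D_1 F)); first exact: continuous_measurable_fun.
  by apply: measurable_funB.
have ibound : rintegrable mu `[a, b]
    (fun s => M * (`|A b| + N) * `|A s| + M * A s ^+ 2).
  apply: rintegrableD => //; apply: rintegrableZl => //.
    by apply: rintegrable_norm; exact: icont.
  exact: icont.
have gM s : `[a, b]%classic s -> `|g s| <= M * (`|A b| + N) * `|A s| + M * A s ^+ 2.
  rewrite /= in_itv/= => /andP[as_ sb]; rewrite /g normrM.
  have F1 : `|F (b - s)| <= M.
    by apply: (FM _ _).1; rewrite subr_ge0 sb; exact: le_trans (lerB (lexx b) as_) baL.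
  have F2 : `|F 0| <= M by apply: (FM _ _).1; rewrite lexx.
  have cDFs : continuous (fun t => 'D_1 F (t - s) * A t).
    move=> t; apply: cvgM; last exact: cA.
    apply: (@continuous_comp _ _ _ (fun t : R => t - s) ('D_1 F)); last exact: cDF.
    by apply: cvgB => //; exact: cvg_cst.
  have F3 : `|\int[mu]_(t in `[s, b]) ('D_1 F (t - s) * A t)| <= M * N.
    have iD : rintegrable mu `[s, b] (fun t => 'D_1 F (t - s) * A t).
      exact: continuous_rintegrable.
    have iA := rintegrable_norm (icont _ cA).
    have iAs := rintegrable_norm (@continuous_rintegrable _ A s b cA).
    apply: le_trans (le_normr_Rintegral _ iD) _ => //.
    apply: (@le_trans _ _ (\int[mu]_(t in `[s, b]) (M * `|A t|))).
      apply: le_Rintegral => //.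
      - exact: (rintegrable_norm iD).
      - exact: rintegrableZl.
      move=> t /=; rewrite in_itv/= => /andP[st tb]; rewrite normrM ler_wpM2r//.
      by apply: (FM _ _).2; rewrite subr_ge0 st; exact: le_trans (lerB tb as_) baL.
    rewrite RintegralZl// ler_wpM2l// /N Rintegral_mkcond [leRHS]Rintegral_mkcond.
    apply: le_Rintegral => //.
    - exact: (rintegrable_mkcond _ _ _).1 iAs.
    - exact: (rintegrable_mkcond _ _ _).1 iA.
    move=> t _; rewrite !patchE !mem_setE !in_itv/=.
    case: (leP s t) => //= st; first by rewrite (le_trans as_ st).
    by case: ifP => _; [exact: normr_ge0|exact: lexx].
  have -> : M * (`|A b| + N) * `|A s| + M * A s ^+ 2 =
      `|A s| * (M * `|A b| + M * `|A s| + M * N).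
    rewrite -[A s ^+ 2]real_normK ?num_real//; ring.
  rewrite ler_wpM2l// (le_trans (ler_normB _ _))// lerD// (le_trans (ler_normB _ _))//.
  by rewrite !normrM lerD// ler_wpM2r.
have ig : rintegrable mu `[a, b] g.
  by apply: (rintegrable_le mD _ gM ibound); exact: measurable_funTS.
have memle : `|\int[mu]_(s in `[a, b]) g s| <= M * (`|A b| + N) * N + M * S.
  apply: le_trans (le_normr_Rintegral mD ig) _.
  apply: (@le_trans _ _ (\int[mu]_(s in `[a, b])
     (M * (`|A b| + N) * `|A s| + M * A s ^+ 2))).
    by apply: le_Rintegral => //; exact: rintegrable_norm.
  rewrite RintegralD//.
  - by rewrite !RintegralZl//; [exact: icont|exact: (rintegrable_norm (icont _ cA))].
  - by apply: rintegrableZl => //; exact: (rintegrable_norm (icont _ cA)).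
  - by apply: rintegrableZl => //; exact: icont.
have -> : \int[mu]_(t in `[a, b]) ((c * A t - V t) * H t) =
    c * (A b ^+ 2 / 2) - \int[mu]_(s in `[a, b]) g s.
  rewrite -mem -kin -RintegralZl//; last by apply: icont => t; exact: cvgM (cA t) (cH t).
  rewrite -RintegralB//.
    by apply: eq_Rintegral => t _; ring.
  by apply: rintegrableZl => //; apply: icont => t; exact: cvgM (cA t) (cH t).
move: memle; rewrite ler_norml => /andP[_ memle].
(* The kinetic term is at least c0/2 A(b)^2, and half of it is spent here, which leaves c0/4. The
   price M^2/c0 N^2, together with M N^2 and M S, gives the constant of the statement once N^2 <= L
   S is used. *)
have young : M * `|A b| * N <= c0 / 4 * A b ^+ 2 + M ^+ 2 / c0 * N ^+ 2.
  have := sqr_ge0 (c0 / 2 * `|A b| - M * N); rewrite sqrrB !exprMn real_normK ?num_real//.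
  move=> Hs; rewrite -(ler_pM2l c0gt0) mulrDr.
  have -> : c0 * (M ^+ 2 / c0 * N ^+ 2) = M ^+ 2 * N ^+ 2 by field; rewrite gt_eqF.
  by move: Hs; clear; lra.
have h1 : M ^+ 2 / c0 * N ^+ 2 <= M ^+ 2 / c0 * (L * S).
  by rewrite ler_wpM2l// divr_ge0 ?sqr_ge0// ltW.
have h2 : M * N ^+ 2 <= M * (L * S) by rewrite ler_wpM2l.
have h3 : c0 * (A b ^+ 2 / 2) <= c * (A b ^+ 2 / 2).
  by rewrite ler_wpM2r// divr_ge0// sqr_ge0.
have E1 : (M + M * L + M ^+ 2 * L / c0) * S = M * S + M * (L * S) + M ^+ 2 / c0 * (L * S).
  by ring.
by rewrite E1; move: memle young h1 h2 h3; clear; lra.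
Qed.

End volterra.

(** * Scalar equations g'' + m = 0 in the sense of distributions *)

Section weak_second_primitive.
Context {R : realType}.
Local Notation mu := (@lebesgue_measure R).

Lemma is_derive_translate (F f : R -> R) (x : R) :
  (forall t : R, is_derive t 1 F (f t)) ->
  forall t : R, is_derive t 1 (fun t : R => F (t - x)) (f (t - x)).
Proof.
move=> dF t; have d2 : is_derive t 1 (fun t : R => t - x) 1.
  by have := is_deriveB (is_derive_id t 1) (is_derive_cst x t 1); rewrite subr0.
by have := @is_derive1_comp _ F (fun t : R => t - x) t _ _ (dF (t - x)) d2; rewrite mulr1.
Qed.

Lemma continuous_translate (f : R -> R) (x : R) : continuous f ->
  continuous (fun t => f (t - x)).
Proof.
move=> cf t; apply: (@continuous_comp _ _ _ (fun t : R => t - x) f); last exact: cf.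
by apply: cvgB => //; exact: cvg_cst.
Qed.

Lemma smooth_antiderivative (f g : R -> R) :
  (forall x : R, is_derive x 1 f (g x)) -> smooth_on setT g -> smooth_on setT f.
Proof.
move=> df sg; apply: (@smooth_class R R (fun h => smooth_on setT h \/ h = f)); last by right.
have df1 (x : R) : derivable f x 1 by have [] := df x.
move=> f0 [h|->].
  split; first exact: smooth_continuous.
    by move=> x v; exact: smooth_derivable.
  by move=> v; left; exact: smooth_derive.
split.
- by move=> t; apply/differentiable_continuous/derivable1_diffP.
- by move=> t v; have [] := derive_scalar v (df1 t).
- move=> v; left; rewrite (_ : 'D_v f = fun x => v * g x).
    exact: (smoothM (@smooth_cst _ _ v) sg).
  apply/funext => x; have [_ ->] := derive_scalar v (df1 x).
  by have [_ ->] := df x.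
Qed.

Lemma causal_continuous (a : R) (h : R -> R) : continuous h ->
  (forall t, t < a -> h t = 0) -> causal a h.
Proof.
move=> ch h0; split => //; first exact: continuous_measurable_fun.
by move=> b; exact: continuous_rintegrable.
Qed.

Lemma test_function_itv (th : R -> R) (a b x z : R) : a < x -> z < b ->
  smooth_on setT th -> (forall t, t <= x -> th t = 0) ->
  (forall t, z <= t -> th t = 0) -> test_function `]a, b[%classic th.
Proof.
move=> ax zb sth th0 th1.
have sub : closure [set t | th t != 0] `<=` `[x, z]%classic.
  have /closure_id -> : closed (`[x, z]%classic : set R) by exact: itv_closed.
  apply: closure_subset => t /= tht; rewrite in_itv/=.
  have [tx|xt] := ltP t x; first by rewrite th0 ?eqxx// ltW in tht.
  have [zt|tz] := ltP z t; first by rewrite th1 ?eqxx// ltW in tht.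
  by [].
split=> //.
  apply: (subclosed_compact _ (@segment_compact R x z) sub); exact: closed_closure.
move=> t /sub /=; rewrite !in_itv/= => /andP[xt tz].
by rewrite (lt_le_trans ax xt) (le_lt_trans tz zb).
Qed.

Lemma rintegrable_mul_continuous (h f : R -> R) (a b : R) : continuous f ->
  rintegrable mu `[a, b] h -> rintegrable mu `[a, b] (fun t => h t * f t).
Proof.
move=> cf ih; have [M M0 HM] := continuous_bounded_itv a b cf.
apply: (rintegrable_le _ _ _ (rintegrableZl M _ (rintegrable_norm ih))) => //.
  apply: measurable_funM; first exact: (rintegrable_meas ih).
  by apply: measurable_funTS; exact: continuous_measurable_fun.
by move=> t /=; rewrite in_itv/= => tab; rewrite normrM mulrC ler_wpM2r// HM.
Qed.

Section mollifier.
Variable e : R.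
Hypothesis e0 : 0 < e.

Let be : R -> R := bump 0 e.
Let P := prim (- e) be.
Let Q := prim (- e) P.

Let cbe : continuous be. Proof. exact: smooth_continuous (smooth_bump 0 e). Qed.

Let chbe : causal (- e) be.
Proof.
apply: causal_continuous => // t te; apply: bump_eq0; rewrite subr0 ler_normr.
by apply/orP; right; lra.
Qed.

Let chP : causal (- e) P := causal_prim chbe.

Let dP (t : R) : is_derive t 1 P (be t) := is_derive_prim t chbe cbe.

Let cP : continuous P := continuous_prim chbe.

Let dQ (t : R) : is_derive t 1 Q (P t) := is_derive_prim t chP cP.

Let sQ : smooth_on setT Q.
Proof.
apply: (smooth_antiderivative dQ); apply: (smooth_antiderivative dP).
exact: smooth_bump.
Qed.

Let P_const t : e <= t -> P t = P e.
Proof.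
move=> et; rewrite /P /prim Rintegral_mkcond [RHS]Rintegral_mkcond.
apply: eq_Rintegral => s _; rewrite !patchE !mem_setE !in_itv/=.
have [se|es] := ltP s e; first by rewrite (ltW se) (ltW (lt_le_trans se et)).
by rewrite /be bump_eq0 ?if_same// subr0 ler_normr es.
Qed.

(** If the mass were 0, the nondecreasing primitive [P] would vanish on ]-e, e[, and so would its
    derivative at 0, which is the positive value [be 0]. *)
Let Pe_gt0 : 0 < P e.
Proof.
rewrite lt_neqAle; apply/andP; split; last by apply: Rintegral_ge0 => t _; exact: bump_ge0.
apply/eqP => P0.
have incP s t : s <= t -> P s <= P t.
  move=> st; apply: (@ger0_derive1_ndecr R P s t) => //.
  - by move=> x _; have [] := dP x.
  - by move=> x _; rewrite derive1E; have [_ ->] := dP x; exact: bump_ge0.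
  - exact: continuous_subspaceT.
have PE s : - e < s < e -> P s = 0.
  move=> /andP[h1 h2]; apply/eqP; rewrite eq_le; apply/andP; split.
    by rewrite [leRHS]P0; apply: incP; exact: ltW.
  by rewrite /P /prim; apply: Rintegral_ge0 => t _; exact: bump_ge0.
have D0 : 'D_1 P 0 = 0.
  rewrite (@near_eq_derive _ _ _ P (cst 0)) ?derive_cst//.
  near=> s; rewrite PE//; apply/andP; split; near: s.
  - by apply: lt_nbhsr; rewrite oppr_lt0.
  - exact: lt_nbhsl.
have := @bump_gt0 R 0 e 0; rewrite subr0 normr0 => /(_ e0).
by rewrite -/be -(@derive_val _ _ _ _ _ _ _ (dP 0)) D0 ltxx.
Unshelve. all: end_near. Qed.

Let Q_affine t : e <= t -> Q t = Q e + P e * (t - e).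
Proof.
move=> et; apply/eqP; rewrite addrC -subr_eq; apply/eqP.
have D1 : 'D_1 Q = P by apply/funext => s; have [] := dQ s.
rewrite -FTC2//; last 2 first.
- by move=> s; have [] := dQ s.
- by rewrite D1.
transitivity (\int[mu]_(s in `[e, t]) P e).
  apply: eq_Rintegral => s /set_mem /=; rewrite in_itv/= => /andP[es _].
  by have [_ ->] := dQ s; rewrite P_const.
rewrite Rintegral_cst//; congr (_ * _).
rewrite [X in fine X]lebesgue_measure_itv/= lte_fin; case: ltgtP et => // ->.
by rewrite subrr.
Qed.

(** The test function is Q(t - x) - 2 Q(t - y) + Q(t - z), where Q'' is the bump [be]. To the right
    of the bumps each term is affine with the same slope up to its weight, so x + z = 2y makes the
    combination vanish there, and its support is compact. Pairing its second derivative with [w]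
    gives the mollified second difference, which differs from the pointwise one by at most (1 + 2 +
    1) d times the mass [I] of the bump. *)
Lemma mollified_second_difference (w : R -> R) (a b x y z : R) :
  a < x - e -> x < y -> y < z -> z + e < b -> x + z = y * 2 ->
  rintegrable mu `[a, b] w ->
  (forall th, test_function `]a, b[%classic th ->
    \int[mu]_(t in `[a, b]) (w t * 'D_1 ('D_1 th) t) = 0) ->
  exists2 I : R, 0 < I & forall d,
    (forall t, `|t - x| < e -> `|w t - w x| <= d) ->
    (forall t, `|t - y| < e -> `|w t - w y| <= d) ->
    (forall t, `|t - z| < e -> `|w t - w z| <= d) ->
    I * `|w x - 2 * w y + w z| <= I * (4 * d).
Proof.
move=> ax xy yz zb xz iw weak; exists (P e) => // d wx wy wz.
have [[axe xbe] [aye ybe] [aze zbe]] : [/\ a + e <= x /\ x <= b - e, a + e <= y /\ y <= b - e &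
    a + e <= z /\ z <= b - e].
  by split; split; lra.
have mD : measurable (`[a, b]%classic : set (measurableTypeR R)) by [].
pose th t := Q (t - x) - 2 * Q (t - y) + Q (t - z).
have sQx u : smooth_on setT (fun t => Q (t - u)).
  apply: (@smooth_affine _ _ _ (fun t => t - u) id); last exact: sQ.
    by move=> h v s; rewrite addrA.
  by move=> s; apply: cvgB => //; exact: cvg_cst.
have sth : smooth_on setT th.
  exact: (smoothD (smoothB (sQx x) (smoothM (@smooth_cst _ _ 2) (sQx y))) (sQx z)).
have Q0 t : t <= - e -> Q t = 0.
  rewrite le_eqVlt => /predU1P[->|te]; last exact: prim0.
  by rewrite /Q /prim set_itv1 Rintegral_set1.
have tth : test_function `]a, b[%classic th.
  apply: (test_function_itv ax zb sth) => t ht.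
    by rewrite /th !Q0; [ring|lra|lra|lra].
  have yx : x + z - 2 * y = 0 by rewrite xz; ring.
  have qx : e <= t - x by lra.
  have qy : e <= t - y by lra.
  have qz : e <= t - z by lra.
  rewrite /th (Q_affine qx) (Q_affine qy) (Q_affine qz).
  transitivity (P e * - (x + z - 2 * y)); first by ring.
  by rewrite yx; ring.
have comb (F f : R -> R) : (forall t : R, is_derive t 1 F (f t)) ->
    forall t : R, is_derive t 1 (fun t : R => F (t - x) - 2 * F (t - y) + F (t - z))
      (f (t - x) - 2 * f (t - y) + f (t - z)).
  move=> dF t; have dx := is_derive_translate x dF t.
  have dy := is_derive_translate y dF t; have dz := is_derive_translate z dF t.
  have := is_deriveD (is_deriveB dx (is_deriveM (is_derive_cst (2 : R) t 1) dy)) dz.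
  by rewrite scaler0 addr0.
have D1 : 'D_1 th = fun t => P (t - x) - 2 * P (t - y) + P (t - z).
  by apply/funext => t; have [] := comb _ _ dQ t.
have D2 t : 'D_1 ('D_1 th) t = be (t - x) - 2 * be (t - y) + be (t - z).
  by rewrite D1; have [] := comb _ _ dP t.
have := weak _ tth; under eq_Rintegral do rewrite D2.
move=> weak0.
have bei u : rintegrable mu `[a, b] (fun t => be (t - u)).
  by apply: continuous_rintegrable; exact: continuous_translate.
have [M M0 HM] : exists2 M : R, 0 <= M & forall t, `|be t| <= M.
  have [M M0 HM] := continuous_bounded_itv (- e) e cbe; exists M => // t.
  have [te|et] := leP `|t| e; first by apply: HM; rewrite -ler_norml.
  by rewrite /be bump_eq0 ?normr0// subr0 ltW.
have wbei u : rintegrable mu `[a, b] (fun t => w t * be (t - u)).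
  apply: (rintegrable_le mD _ _ (rintegrableZl M mD (rintegrable_norm iw))).
    apply: measurable_funM; [exact: (rintegrable_meas iw)|exact: (rintegrable_meas (bei u))].
  by move=> t _; rewrite normrM mulrC ler_wpM2r.
have mass u : a + e <= u -> u <= b - e -> \int[mu]_(t in `[a, b]) be (t - u) = P e.
  move=> au ub; have dPu := is_derive_translate u dP.
  have DPu : 'D_1 (fun t => P (t - u)) = fun t => be (t - u).
    by apply/funext => t; have [] := dPu t.
  have ab : a <= b by move: e0; lra.
  transitivity (\int[mu]_(t in `[a, b]) 'D_1 (fun t : R => P (t - u)) t).
    by apply: eq_Rintegral => t _; have [_ ->] := dPu t.
  have dPu1 (t : R) : derivable (fun t : R => P (t - u)) t 1 by have [] := dPu t.
  have cDPu : continuous ('D_1 (fun t : R => P (t - u))).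
    by rewrite DPu; exact: continuous_translate.
  rewrite (FTC2 ab dPu1 cDPu).
  rewrite P_const; last by lra.
  have : a - u <= - e by lra.
  rewrite le_eqVlt => /predU1P[->|ae]; last by rewrite {2}/P prim0// subr0.
  by rewrite {2}/P /prim set_itv1 Rintegral_set1 subr0.
have approx u : a + e <= u -> u <= b - e ->
    (forall t, `|t - u| < e -> `|w t - w u| <= d) ->
    `|\int[mu]_(t in `[a, b]) (w t * be (t - u)) - P e * w u| <= P e * d.
  move=> au ub wu.
  have -> : P e * w u = \int[mu]_(t in `[a, b]) (w u * be (t - u)).
    by rewrite (RintegralZl _ mD (bei u)) (mass u au ub) mulrC.
  rewrite -(RintegralB mD (wbei u) (rintegrableZl _ mD (bei u))).
  have iB : rintegrable mu `[a, b] (fun t => w t * be (t - u) - w u * be (t - u)).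
    by apply: rintegrableB => //; exact: rintegrableZl.
  apply: le_trans (le_normr_Rintegral mD iB) _.
  have -> : P e * d = \int[mu]_(t in `[a, b]) (d * be (t - u)).
    by rewrite (RintegralZl _ mD (bei u)) (mass u au ub) mulrC.
  apply: le_Rintegral => //; [exact: (rintegrable_norm iB)|exact: rintegrableZl|].
  move=> t _; rewrite -mulrBl normrM (ger0_norm (bump_ge0 _ _ _)).
  have [tu|ut] := ltP `|t - u| e; first by rewrite ler_wpM2r ?bump_ge0// wu.
  by rewrite /be bump_eq0 ?mulr0// subr0.
have Ax := approx x axe xbe wx; have Ay := approx y aye ybe wy; have Az := approx z aze zbe wz.
have : \int[mu]_(t in `[a, b]) (w t * be (t - x)) -
       2 * \int[mu]_(t in `[a, b]) (w t * be (t - y)) +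
       \int[mu]_(t in `[a, b]) (w t * be (t - z)) = 0.
  have i2 := rintegrableZl 2 mD (wbei y).
  rewrite -[RHS]weak0 -(RintegralZl _ mD (wbei y)) -(RintegralB mD (wbei x) i2).
  rewrite -(RintegralD mD (rintegrableB mD (wbei x) i2) (wbei z)).
  by apply: eq_Rintegral => t _; ring.
set Ix := \int[mu]_(t in _) (w t * be (t - x)) in Ax *.
set Iy := \int[mu]_(t in _) (w t * be (t - y)) in Ay *.
set Iz := \int[mu]_(t in _) (w t * be (t - z)) in Az *.
move=> H0; rewrite -{1}(gtr0_norm Pe_gt0) -normrM.
have -> : P e * (w x - 2 * w y + w z) =
    - ((Ix - P e * w x) - 2 * (Iy - P e * w y) + (Iz - P e * w z)).
  by rewrite -[LHS]subr0 -H0; ring.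
rewrite normrN (le_trans (ler_normD _ _))//.
have : `|Ix - P e * w x - 2 * (Iy - P e * w y)| <= P e * d + 2 * (P e * d).
  rewrite (le_trans (ler_normB _ _))// lerD// normrM (ger0_norm (ler0n _ 2)).
  by rewrite ler_wpM2l.
by move=> Hxy; lra.
Qed.

End mollifier.

(** Continuity at the three points makes the error [d] of the mollified second difference
    arbitrarily small. The midpoint identity is the only consequence of affinity that is used
    later. *)
Lemma weak_affine_midpoint (w : R -> R) (a b x z : R) : a < x -> x < z -> z < b ->
  {in `]a, b[, continuous w} -> rintegrable mu `[a, b] w ->
  (forall th, test_function `]a, b[%classic th ->
    \int[mu]_(t in `[a, b]) (w t * 'D_1 ('D_1 th) t) = 0) ->
  w x + w z = 2 * w ((x + z) / 2).
Proof.
move=> ax xz zb cw iw weak; set y := (x + z) / 2.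
have y2 : x + z = y * 2 by rewrite /y; field.
have [xy yz] : x < y /\ y < z by split; lra.
apply/eqP; rewrite -subr_eq0 -normr_le0; apply/ler_addgt0Pr => d d0; rewrite add0r.
have d4 : 0 < d / 4 by rewrite divr_gt0.
have cont u : a < u < b -> \forall e \near 0^'+, forall t, `|t - u| < e -> `|w t - w u| <= d / 4.
  move=> aub; have := cw u; rewrite inE => /(_ aub).
  move=> /cvgrPdist_le /(_ _ d4) /nbhs_ballP[r /= r0 Hr].
  near=> e => t tu; rewrite distrC; apply: Hr; rewrite /ball/= distrC (lt_trans tu)//.
have ax2 : 0 < x - a by lra.
have zb2 : 0 < b - z by lra.
have /filter_ex[e [[e0 [e1 e2]] [ex [ey ez]]]] : \forall e \near 0^'+,
    (0 < e /\ (e < x - a /\ e < b - z)) /\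
    ((forall t, `|t - x| < e -> `|w t - w x| <= d / 4) /\
     ((forall t, `|t - y| < e -> `|w t - w y| <= d / 4) /\
      (forall t, `|t - z| < e -> `|w t - w z| <= d / 4))).
  near=> e; split; [split; [|split]|split; [|split]]; near: e.
  - exact: nbhs_right_gt.
  - exact: nbhs_right_lt.
  - exact: nbhs_right_lt.
  - by apply: cont; rewrite ax/=; lra.
  - by apply: cont; apply/andP; split; lra.
  - by apply: cont; rewrite zb andbT; lra.
have axe : a < x - e by lra.
have zeb : z + e < b by lra.
have [I I0 /(_ _ ex ey ez)] :=
  mollified_second_difference e0 axe xy yz zeb y2 iw weak.
rewrite ler_pM2l// => H; rewrite (_ : _ - _ = w x - 2 * w y + w z); last by ring.
by apply: le_trans H _; lra.
Unshelve. all: end_near. Qed.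

(** Letting x tend to a in the midpoint identity gives w(z) = 2 w((a + z)/2). Iterating, w(z) is 2^k
    w(a + (z - a)/2^k), and the vanishing right derivative at a sends this to 0. *)
Lemma weak_affine_eq0 (w : R -> R) (a b : R) : a < b ->
  {within `[a, b], continuous w} -> w a = 0 ->
  h^-1 * w (a + h) @[h --> 0^'+] --> (0 : R) ->
  (forall th, test_function `]a, b[%classic th ->
    \int[mu]_(t in `[a, b]) (w t * 'D_1 ('D_1 th) t) = 0) ->
  forall t, a <= t <= b -> w t = 0.
Proof.
move=> ab cw wa w0 weak.
have iw : rintegrable mu `[a, b] w.
  by apply: continuous_compact_integrable => //; exact: segment_compact.
have [cw1 cwa cwb] := (continuous_within_itvP _ ab).1 cw.
have half z : a < z < b -> w z = 2 * w ((a + z) / 2).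
  move=> /andP[az zb].
  have lim1 : w x + w z @[x --> a^'+] --> w a + w z by apply: cvgD => //; exact: cvg_cst.
  have lim2 : 2 * w ((x + z) / 2) @[x --> a^'+] --> 2 * w ((a + z) / 2).
    apply: cvgM; first exact: cvg_cst.
    apply: (@cvg_comp _ _ _ (fun x : R => (x + z) / 2) w _ (nbhs ((a + z) / 2))).
      apply: cvg_at_right_filter; apply: cvgM; last exact: cvg_cst.
      by apply: cvgD => //; exact: cvg_cst.
    by apply: cw1; rewrite in_itv/=; apply/andP; split; lra.
  have : w x + w z @[x --> a^'+] --> 2 * w ((a + z) / 2).
    apply: cvg_trans lim2; apply: near_eq_cvg; near=> x.
    by rewrite (@weak_affine_midpoint w a b x z).
  by move=> /(cvg_unique (@norm_hausdorff _ _) lim1); rewrite wa add0r.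
have halves z k : a < z < b -> w z = 2 ^+ k * w (a + (z - a) / 2 ^+ k).
  move=> azb; elim: k => [|k ->].
    by rewrite expr0 divr1 mul1r addrC subrK.
  have k0 : 0 < 2 ^+ k :> R by rewrite exprn_gt0.
  have k1 : 1 <= 2 ^+ k :> R by rewrite exprn_ege1// ler1n.
  have [az zb] := andP azb.
  rewrite half; last first.
    rewrite ltrDl divr_gt0 ?subr_gt0//=.
    apply: le_lt_trans zb; rewrite -lerBrDl ler_pdivrMr// ler_peMr// subr_ge0 ltW//.
  rewrite exprS -mulrA [RHS]mulrCA; congr (_ * (_ * w _)).
  by field; rewrite gt_eqF.
have inner z : a < z < b -> w z = 0.
  move=> azb; have [az zb] := andP azb; have za : 0 < z - a by rewrite subr_gt0.
  apply/eqP; rewrite -normr_le0; apply/ler_addgt0Pr => d d0; rewrite add0r.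
  have d1 : 0 < d / (z - a) by rewrite divr_gt0.
  move/cvgr0Pnorm_le : w0 => /(_ _ d1) [r /= r0 Hr].
  pose k := Num.bound ((z - a) / r).
  have k2 : (z - a) / r < 2 ^+ k.
    apply: lt_trans (archi_boundP _) _; first by rewrite divr_ge0// ltW.
    by rewrite -natrX ltr_nat ltn_expl.
  have p2 : 0 < 2 ^+ k :> R by rewrite exprn_gt0.
  have h0 : 0 < (z - a) / 2 ^+ k by rewrite divr_gt0.
  have := Hr ((z - a) / 2 ^+ k); rewrite /ball/= sub0r normrN (gtr0_norm h0).
  rewrite ltr_pdivrMr// mulrC -ltr_pdivrMr// => /(_ k2 h0).
  rewrite (halves z k azb) !normrM (gtr0_norm p2) (@gtr0_norm _ _^-1) ?invr_gt0//.
  rewrite invf_div mulrAC ler_pdivrMr// mulrC => H.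
  by move: H; rewrite mulfVK ?gt_eqF.
move=> t /andP[]; rewrite le_eqVlt => /predU1P[<- //|at_].
rewrite le_eqVlt => /predU1P[->|tb]; last by apply: inner; rewrite at_.
apply: (cvg_unique (@norm_hausdorff _ _) cwb) => //.
apply: (@cvg_trans _ (cst (0 : R) @ b^'-)); last exact: cvg_cst.
  apply: near_eq_cvg; near=> s; by rewrite inner//; apply/andP; split.
Unshelve. all: end_near. Qed.

(** Two integrations by parts show that g plus the double primitive of m has zero second derivative
    as a distribution; the vanishing value and right derivative at a then exclude nonzero affine
    functions. *)
Lemma weak_second_primitive (g m : R -> R) (a b : R) : a < b ->
  {within `[a, b], continuous g} -> g a = 0 ->
  h^-1 * g (a + h) @[h --> 0^'+] --> (0 : R) -> causal a m ->
  (forall th, test_function `]a, b[%classic th ->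
    \int[mu]_(t in `[a, b]) (g t * 'D_1 ('D_1 th) t) +
    \int[mu]_(t in `[a, b]) (m t * th t) = 0) ->
  forall t, a <= t <= b -> g t = - prim a (prim a m) t.
Proof.
move=> ab cg ga g0 cm weak t atb.
have mD : measurable (`[a, b]%classic : set (measurableTypeR R)) by [].
have im := causal_rintegrable b cm (lexx a).
have cM := causal_prim cm; have ccM := continuous_prim cm.
have dG (s : R) : is_derive s 1 (prim a (prim a m)) (prim a m s) := is_derive_prim s cM ccM.
have cG := continuous_prim cM.
pose w s := g s + prim a (prim a m) s.
suff : w t = 0 by move/eqP; rewrite addr_eq0 => /eqP.
have ig : rintegrable mu `[a, b] g.
  by apply: continuous_compact_integrable => //; exact: segment_compact.
apply: (@weak_affine_eq0 w a b) => //.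
- move=> s; apply: cvgD; first exact: cg.
  by apply: continuous_subspaceT.
- by rewrite /w ga /prim set_itv1 Rintegral_set1 addr0.
- rewrite -[X in _ --> X]addr0; under eq_fun do rewrite /w mulrDr.
  apply: cvgD => //.
  have : h^-1 *: (prim a (prim a m) (h *: 1 + a) - prim a (prim a m) a) @[h --> 0^'] --> prim a m a.
    by have [dGa <-] := dG a; exact: dGa.
  have -> : prim a m a = 0 by rewrite /prim set_itv1 Rintegral_set1.
  have -> : prim a (prim a m) a = 0 by rewrite /prim set_itv1 Rintegral_set1.
  move=> /cvg_dnbhs_at_right H; apply: cvg_trans H.
  apply: near_eq_cvg; near=> h; rewrite subr0 /GRing.scale /= mulr1.
  by rewrite [h + a]addrC.
move=> th tth; have [sth _ sub] := tth.
have th_out s : ~ `]a, b[%classic s -> th s = 0.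
  move=> ns; apply/eqP/negP => /negP ths; apply: ns; apply: sub.
  exact: subset_closure.
have tha : th a = 0 by apply: th_out; rewrite /= in_itv/= ltxx.
have thb : th b = 0 by apply: th_out; rewrite /= in_itv/= ltxx andbF.
have sD1 := smooth_derive (1 : R) sth; have sD2 := smooth_derive (1 : R) sD1.
have cth := smooth_continuous sth; have cD1 := smooth_continuous sD1.
have cD2 := smooth_continuous sD2.
have dth (s : R) : is_derive s 1 th ('D_1 th s).
  exact: (smooth_is_derive s 1 sth).
have dth1 (s : R) : is_derive s 1 ('D_1 th) ('D_1 ('D_1 th) s).
  exact: (smooth_is_derive s 1 sD1).
have thD (s : R) : derivable th s 1 by exact: smooth_derivable.
have out_near s : ~ closure [set x | th x != 0] s -> 'D_1 th s = 0.
  move=> ns; rewrite (@near_eq_derive _ _ _ th (cst 0)) ?derive_cst//.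
  have : nbhs s (~` closure [set x | th x != 0]).
    apply: open_nbhs_nbhs; split => //; apply: closed_openC; exact: closed_closure.
  apply: filterS => x nx; apply/eqP/negP => /negP thx; apply: nx.
  exact: subset_closure.
have D1a : 'D_1 th a = 0 by apply: out_near => /sub; rewrite /= in_itv/= ltxx.
have D1b : 'D_1 th b = 0 by apply: out_near => /sub; rewrite /= in_itv/= ltxx andbF.
have [M M0 HM] := continuous_bounded_itv a b cD1.
(* [m] is only integrable, so its primitive need not be differentiable everywhere. The integration
   by parts is done by writing [th] as minus the integral of its derivative over [s, b] and
   exchanging the order of integration on a triangle. *)
have step1 : \int[mu]_(s in `[a, b]) (m s * th s) =
    - \int[mu]_(s in `[a, b]) ('D_1 th s * prim a m s).
  transitivity (- \int[mu]_(s in `[a, b]) \int[mu]_(r in `[s, b]) ('D_1 th r * m s)).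
    rewrite -[LHS]opprK; congr (- _); rewrite -mulN1r -RintegralZl//; last first.
      exact: rintegrable_mul_continuous.
    apply: eq_Rintegral => s /set_mem /=; rewrite in_itv/= => /andP[as_ sb].
    rewrite RintegralZr//; last exact: continuous_rintegrable.
    by rewrite (FTC2 sb thD cD1) thb; clear; ring.
  congr (- _).
  rewrite -(Rintegral_triangle (k := fun z => 'D_1 th z.1 * m z.2)); last first.
    apply: (rintegrable_kernel (f := fun z => 'D_1 th z.1) (M := M)) => //.
      apply: (measurableT_comp (f := 'D_1 th)); last exact: measurable_fst.
      exact: continuous_measurable_fun.
    by move=> r s rab _; exact: HM.
  apply: eq_Rintegral => s _; rewrite /= RintegralZl//.
  exact: (causal_rintegrable s cm (lexx a)).
have step2 : \int[mu]_(s in `[a, b]) ('D_1 th s * prim a m s) =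
    - \int[mu]_(s in `[a, b]) ('D_1 ('D_1 th) s * prim a (prim a m) s).
  rewrite (Rintegration_by_parts_C1 (ltW ab) dth1 cD2 dG ccM).
  by rewrite D1a D1b; clear; ring.
have := weak _ tth; rewrite step1 step2 opprK -RintegralD//; last 2 first.
- exact: (rintegrable_mul_continuous cD2 ig).
- by apply: continuous_rintegrable => s; apply: cvgM; [exact: cD2|exact: cG].
by move=> <-; apply: eq_Rintegral => s _; rewrite /w; ring.
Unshelve. all: end_near. Qed.

End weak_second_primitive.

(** * Uniqueness by an energy argument *)

Section gronwall.
Context {R : realType}.
Local Notation mu := (@lebesgue_measure R).

Lemma gronwall_eq0 (y : R -> R) (a b B D : R) : 0 <= D ->
  measurable_fun `[a, b] (y : measurableTypeR R -> R) ->
  (forall t, a <= t <= b -> 0 <= y t <= B) ->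
  (forall t, a <= t <= b -> y t <= D * \int[mu]_(s in `[a, t]) y s) ->
  forall t, a <= t <= b -> y t = 0.
Proof.
move=> D0 my yB yD.
(* [D] may be 0; the shift keeps the rate of the exponential positive, so that dividing by it is
   legitimate. *)
pose E := D + 1; have E0 : 0 < E by rewrite ltr_wpDl.
have iy t : a <= t <= b -> rintegrable mu `[a, t] y.
  move=> /andP[at_ tb]; apply: (rintegrable_bounded (M := B)) => //.
  - exact: lebesgue_itv_lty.
  - by apply: measurable_funS my => //; apply: subset_itvl; rewrite bnd_simp.
  - move=> s /=; rewrite in_itv/= => /andP[as_ st].
    have /andP[y0 yb] : 0 <= y s <= B by apply: yB; rewrite as_ (le_trans st tb).
    by rewrite ger0_norm.
have dexp (t : R) : is_derive t 1 (fun t : R => expR (2 * E * (t - a))) (2 * E * expR (2 * E * (t - a))).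
  have d1 : is_derive t 1 (fun t : R => 2 * E * (t - a)) (2 * E).
    have d0 := is_deriveB (is_derive_id t 1) (is_derive_cst a t 1).
    have := is_deriveM (is_derive_cst (2 * E) t 1) d0.
    by rewrite subr0 scaler0 addr0 /GRing.scale /= mulr1.
  have H := @is_derive1_comp _ expR (fun t : R => 2 * E * (t - a)) t _ _ (is_derive_expR _) d1.
  by rewrite [X in is_derive _ _ _ X](mulrC (2 * E)); exact: H.
have cexp : continuous (fun t : R => expR (2 * E * (t - a))).
  by move=> t; apply/differentiable_continuous/derivable1_diffP; have [] := dexp t.
have intexp t : a <= t ->
    \int[mu]_(s in `[a, t]) (2 * E * expR (2 * E * (s - a))) = expR (2 * E * (t - a)) - 1.
  move=> at_.
  transitivity (\int[mu]_(s in `[a, t]) 'D_1 (fun t : R => expR (2 * E * (t - a))) s).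
    by apply: eq_Rintegral => s _; have [_ ->] := dexp s.
  rewrite (FTC2 at_ (fun s => @ex_derive _ _ _ _ _ _ _ (dexp s))); first by rewrite subrr mulr0 expR0.
  rewrite (_ : 'D_(1 : R) _ = fun s : R => 2 * E * expR (2 * E * (s - a))).
    by move=> s; apply: cvgM; [exact: cvg_cst|exact: cexp].
  by apply/funext => s; have [_ ->] := dexp s.
have bound k t : a <= t <= b -> y t <= B / 2 ^+ k * expR (2 * E * (t - a)).
  elim: k t => [|k IHk] t atb.
    have /andP[y0 yb] := yB t atb; rewrite expr0 divr1 (le_trans yb)//.
    rewrite ler_peMr ?(le_trans y0)//.
    rewrite -[leLHS]expR0 ler_expR; apply: mulr_ge0; first by rewrite mulr_ge0// ltW.
    by rewrite subr_ge0; case/andP: atb.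
  have /andP[at_ tb] := atb.
  have y0 := proj1 (andP (yB t atb)).
  apply: (le_trans (yD t atb)).
  have ie : rintegrable mu `[a, t] (fun s => 2 * E * expR (2 * E * (s - a))).
    by apply: continuous_rintegrable => s; apply: cvgM; [exact: cvg_cst|exact: cexp].
  have h1 : \int[mu]_(s in `[a, t]) y s <=
      B / 2 ^+ k / (2 * E) * (expR (2 * E * (t - a)) - 1).
    rewrite -intexp// -RintegralZl//; apply: le_Rintegral => //.
    - exact: iy.
    - exact: rintegrableZl.
    move=> s /=; rewrite in_itv/= => /andP[as_ st].
    have asb : a <= s <= b by rewrite as_ (le_trans st tb).
    rewrite (le_trans (IHk s asb))// le_eqVlt; apply/orP; left; apply/eqP.
    by field; rewrite !gt_eqF ?exprn_gt0.
  have B0 : 0 <= B by have /andP[+ +] := yB t atb; exact: le_trans.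
  have x1 : 0 <= expR (2 * E * (t - a)) - 1.
    rewrite subr_ge0 -[leLHS]expR0 ler_expR; apply: mulr_ge0.
      by rewrite mulr_ge0// ltW.
    by rewrite subr_ge0.
  apply: (@le_trans _ _ (E * (B / 2 ^+ k / (2 * E) * (expR (2 * E * (t - a)) - 1)))).
    apply: (@le_trans _ _ (D * (B / 2 ^+ k / (2 * E) * (expR (2 * E * (t - a)) - 1)))).
      by rewrite ler_wpM2l.
    rewrite ler_wpM2r ?lerDl//; apply: mulr_ge0 => //; apply: divr_ge0.
      by rewrite divr_ge0// exprn_ge0.
    by rewrite mulr_ge0// ltW.
  have -> : E * (B / 2 ^+ k / (2 * E) * (expR (2 * E * (t - a)) - 1)) =
      B / 2 ^+ k.+1 * (expR (2 * E * (t - a)) - 1).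
    by rewrite exprS; field; rewrite !gt_eqF ?exprn_gt0.
  by rewrite ler_wpM2l ?gerBl// divr_ge0// exprn_ge0.
move=> t atb; apply/eqP; rewrite eq_le; apply/andP; split; last first.
  by have /andP[] := yB t atb.
apply/ler_addgt0Pr => d d0; rewrite add0r.
have /andP[y0 yb] := yB t atb; have B0 : 0 <= B by exact: le_trans yb.
pose Z := B * expR (2 * E * (t - a)).
have Z0 : 0 <= Z by rewrite mulr_ge0// expR_ge0.
pose k := Num.bound (Z / d).
have k2 : Z / d < 2 ^+ k.
  apply: lt_trans (archi_boundP _) _; first by rewrite divr_ge0// ltW.
  by rewrite -natrX ltr_nat ltn_expl.
apply: le_trans (bound k t atb) _; rewrite mulrAC ler_pdivrMr ?exprn_gt0//.
by rewrite -/Z [leRHS]mulrC -ler_pdivrMr// ltW.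
Qed.

End gronwall.

(** * The energy estimate over an abstract space with an abstract class of test pairs *)

Section energy_uniqueness.
Context d (X : measurableType d) (R : realType).
Variable m : {sigma_finite_measure set X -> \bar R}.
Local Notation mu := (@lebesgue_measure R).
Local Notation XR := (X * measurableTypeR R)%type.
Local Notation mxt := (m \x @lebesgue_measure R)%E.
Variables (n : nat) (a b : R).
Hypothesis ab : a < b.

Definition primx (f : XR -> R) (z : XR) : R := prim a (fun s => f (z.1, s)) z.2.

Definition convx (F h : XR -> R) (z : XR) : R :=
  \int[mu]_(s in `[a, z.2]) (F (z.1, z.2 - s) * h (z.1, s)).

Lemma measurable_swap_time (f : XR -> R) : measurable_fun setT f ->
  measurable_fun [set: XR * measurableTypeR R] (fun z => f (z.1.1, z.2)).
Proof.
move=> mf; apply: (measurableT_comp (f := f) mf).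
apply: measurable_fun_pair; last exact: measurable_snd.
exact: (measurableT_comp measurable_fst measurable_fst).
Qed.

Lemma measurable_primx (f : XR -> R) : measurable_fun setT f ->
  measurable_fun setT (primx f).
Proof.
move=> mf.
apply: (@measurable_Rintegral_itv _ XR R (fun z => f (z.1.1, z.2)) (fun=> a) snd) => //.
exact: measurable_swap_time.
Qed.

Lemma measurable_convx (F h : XR -> R) : measurable_fun setT F ->
  measurable_fun setT h -> measurable_fun setT (convx F h).
Proof.
move=> mF mh.
apply: (@measurable_Rintegral_itv _ XR R
  (fun z => F (z.1.1, z.1.2 - z.2) * h (z.1.1, z.2)) (fun=> a) snd) => //.
apply: measurable_funM; last exact: measurable_swap_time.
apply: (measurableT_comp (f := F) mF); apply: measurable_fun_pair.
  exact: (measurableT_comp measurable_fst measurable_fst).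
apply: measurable_funB; last exact: measurable_snd.
exact: (measurableT_comp measurable_snd measurable_fst).
Qed.

Variables (u : XR -> R) (p : 'I_n -> XR -> R) (N c : X -> R) (F : XR -> R).
Variables (c0 c1 M L : R).
Hypothesis mu_ : measurable_fun setT u.
Hypothesis mp : forall i, measurable_fun setT (p i).
Hypothesis mN : measurable_fun setT N.
Hypothesis mc : measurable_fun setT c.
Hypothesis mF : measurable_fun setT F.
Hypothesis cu : forall x, causal a (fun t => u (x, t)).
Hypothesis cp : forall i x, causal a (fun t => p i (x, t)).
Hypothesis uN : forall x, \int[mu]_(t in `[a, b]) `|u (x, t)| <= N x.
Hypothesis pN : forall i x, \int[mu]_(t in `[a, b]) `|p i (x, t)| <= N x.
Hypothesis iN : rintegrable m setT (fun x => N x ^+ 2).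
Hypothesis iu : forall t, a <= t <= b -> rintegrable m setT (fun x => u (x, t) ^+ 2).
Hypothesis c0_gt0 : 0 < c0.
Hypothesis c01 : forall x, c0 <= c x <= c1.
Hypothesis L0 : 0 <= L.
Hypothesis baL : b - a <= L.
Hypothesis dF : forall x t, derivable (fun t : R => F (x, t)) t 1.
Hypothesis cDF : forall x, continuous ('D_1 (fun t : R => F (x, t))).
Hypothesis FM : forall x t, 0 <= t <= L ->
  `|F (x, t)| <= M /\ `|'D_1 (fun t : R => F (x, t)) t| <= M.

(** The viscoacoustic operator is -1/2 times the second time derivative minus the divergence of this
    map applied to the gradient: the memory enters with the sign opposite to the speed. *)
Definition memory_op (h : XR -> R) (z : XR) : R := c z.1 * h z - convx F h z.

(** The vector field whose weak divergence is u(t), obtained by integrating the homogeneous equation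
    twice in time from zero initial data. *)
Definition flux i := memory_op (primx (primx (p i))).

Variable test : (X -> R) -> ('I_n -> X -> R) -> Prop.
Hypothesis test_L2 : forall psi w, test psi w ->
  [/\ measurable_fun setT psi, rintegrable m setT (fun x => psi x ^+ 2),
      forall i, measurable_fun setT (w i) &
      forall i, rintegrable m setT (fun x => w i x ^+ 2)].

(* [u] and [p] act on the pairs [(a0, al)] orthogonal to all [(psi, w)] as
   [test] functions and their gradients do: this is how membership of [u r] in
   the closure of the test functions is used. *)
Hypothesis dual : {ae mu, forall r, a <= r <= b ->
  forall (a0 : X -> R) (al : 'I_n -> X -> R),
    measurable_fun setT a0 -> rintegrable m setT (fun x => a0 x ^+ 2) ->
    (forall i, measurable_fun setT (al i)) ->
    (forall i, rintegrable m setT (fun x => al i x ^+ 2)) ->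
    (forall psi w, test psi w ->
       \int[m]_x (a0 x * psi x) = - \sum_i \int[m]_x (al i x * w i x)) ->
    \int[m]_x (a0 x * u (x, r)) = - \sum_i \int[m]_x (al i x * p i (x, r))}.

Hypothesis initial : forall psi w, test psi w ->
  [/\ {within `[a, b], continuous (fun t => \int[m]_x (u (x, t) * psi x))},
      \int[m]_x (u (x, a) * psi x) = 0 &
      h^-1 * \int[m]_x (u (x, a + h) * psi x) @[h --> 0^'+] --> (0 : R)].

Hypothesis equation : forall psi w th, test psi w -> test_function `]a, b[%classic th ->
  \int[mu]_(t in `[a, b]) (\int[m]_x (u (x, t) * psi x) * 'D_1 ('D_1 th) t) +
  \int[mu]_(t in `[a, b]) ((\sum_i \int[m]_x (memory_op (p i) (x, t) * w i x)) * th t) = 0.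

Let N0 x : 0 <= N x.
Proof. by apply: le_trans (uN x); apply: Rintegral_ge0 => t _; exact: normr_ge0. Qed.

Let M0 (x : X) : 0 <= M.
Proof. by have [|+ _] := @FM x 0; [rewrite lexx|apply: le_trans]. Qed.

Let cFx x : continuous (fun t : R => F (x, t)).
Proof. by move=> t; apply/differentiable_continuous/derivable1_diffP. Qed.

Let primx_le i x t : t <= b -> `|primx (p i) (x, t)| <= N x.
Proof. by move=> tb; apply: le_trans (pN i x); exact: prim_le. Qed.

Let length_itv (t : R) : a <= t -> fine (mu `[a, t]) = t - a.
Proof.
move=> at_; rewrite lebesgue_measure_itv/= lte_fin; case: ltgtP at_ => // ->.
by rewrite subrr.
Qed.

Let int_le_const (f : R -> R) (K t : R) : a <= t <= b -> 0 <= K ->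
  rintegrable mu `[a, t] f -> (forall s, a <= s <= t -> `|f s| <= K) ->
  \int[mu]_(s in `[a, t]) `|f s| <= L * K.
Proof.
move=> /andP[at_ tb] K0 iF fK.
apply: (@le_trans _ _ (\int[mu]_(s in `[a, t]) K)).
  apply: le_Rintegral => //; first exact: (rintegrable_norm iF).
    by apply: rintegrable_cst => //; exact: lebesgue_itv_lty.
rewrite Rintegral_cst// length_itv// mulrC ler_wpM2r//; move: baL tb; lra.
Qed.

Let primxx_le i x t : a <= t <= b -> `|primx (primx (p i)) (x, t)| <= L * N x.
Proof.
move=> atb; have chp := causal_prim (cp i x).
apply: le_trans (prim_le chp (lexx t)) _.
apply: int_le_const => //; first exact: (causal_rintegrable _ chp).
by move=> s /andP[_ st]; apply: primx_le; apply: le_trans st _; case/andP: atb.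
Qed.

Let chA i x : causal a (fun t => primx (primx (p i)) (x, t)).
Proof. exact: causal_prim (causal_prim (cp i x)). Qed.

(** The double primitive of a component of the gradient is at most L N. The speed contributes c1 L,
    and the convolution with a kernel bounded by M over a time at most L contributes M L L. *)
Let K := c1 * L + M * L * L.

Let flux_le i x t : a <= t <= b -> `|flux i (x, t)| <= K * N x.
Proof.
move=> atb; have /andP[at_ tb] := atb.
rewrite /flux /memory_op /= (le_trans (ler_normB _ _))// /K mulrDl lerD//.
  have /andP[cx0 cx1] := c01 x.
  rewrite normrM gtr0_norm ?(lt_le_trans c0_gt0)// -mulrA ler_pM//.
    exact: ltW (lt_le_trans c0_gt0 cx0).
  exact: primxx_le.
rewrite /convx /=; have ic := rintegrable_conv t (@cFx x) (chA i x).
apply: le_trans (le_normr_Rintegral _ ic) _ => //.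
rewrite [leRHS](_ : _ = L * (M * (L * N x))); last by ring.
apply: int_le_const => //; first by rewrite !mulr_ge0// (M0 x).
move=> s /andP[as_ st]; rewrite normrM ler_pM//.
  by apply: (@FM x (t - s) _).1; move: baL st as_ tb; lra.
by apply: primxx_le; rewrite as_ (le_trans st tb).
Qed.

Let mA i : measurable_fun setT (primx (primx (p i))).
Proof. by apply: measurable_primx; exact: measurable_primx. Qed.

Let mflux i : measurable_fun setT (flux i).
Proof.
apply: measurable_funB; last exact: measurable_convx.
by apply: measurable_funM => //; exact: (measurableT_comp mc measurable_fst).
Qed.

Let itv_meas (t : R) : measurable (`[a, t]%classic : set (measurableTypeR R)).
Proof. by []. Qed.

Let section_meas (f : XR -> R) (t : R) : measurable_fun setT f ->
  measurable_fun setT (fun x => f (x, t)).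
Proof.
move=> mf; apply: (measurableT_comp (f := f) mf); exact: measurable_fun_pair.
Qed.

Let prod_int (f : XR -> R) (G : X -> R) (t : R) : measurable_fun setT f ->
  rintegrable m setT G ->
  (forall x, rintegrable mu `[a, t] (fun s => f (x, s)) /\
     \int[mu]_(s in `[a, t]) `|f (x, s)| <= G x) ->
  rintegrable mxt (setT `*` `[a, t]) f.
Proof.
move=> mf iG fG; apply: (rintegrable_prod measurableT (itv_meas t) _ _ _ iG).
- exact: measurable_funTS.
- by move=> x _; have [] := fG x.
- by move=> x _; have [] := fG x.
Qed.

Let int_le_sub (f : R -> R) t : causal a f -> t <= b ->
  \int[mu]_(s in `[a, t]) `|f s| <= \int[mu]_(s in `[a, b]) `|f s|.
Proof.
move=> cf tb; rewrite Rintegral_mkcond [leRHS]Rintegral_mkcond.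
apply: le_Rintegral => //.
- exact: (rintegrable_mkcond _ _ _).1 (rintegrable_norm (causal_rintegrable _ cf (lexx a))).
- exact: (rintegrable_mkcond _ _ _).1 (rintegrable_norm (causal_rintegrable _ cf (lexx a))).
move=> s _; rewrite !patchE !mem_setE !in_itv/=.
case: (leP a s) => //= _; case: (leP s t) => st.
  by rewrite (le_trans st tb).
by case: ifP => _; [exact: normr_ge0|exact: lexx].
Qed.

Let iuN t : a <= t <= b -> rintegrable m setT (fun x => `|u (x, t)| * N x).
Proof.
move=> atb; apply: (rintegrable_le measurableT _ _ (rintegrableD measurableT (iu atb) iN)).
  apply: measurable_funM => //; apply: measurableT_comp => //; exact: section_meas.
move=> x _; rewrite ger0_norm ?mulr_ge0//.
have := sqr_ge0 (`|u (x, t)| - N x); rewrite sqrrB real_normK ?num_real//.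
by have := sqr_ge0 (u (x, t)); have := sqr_ge0 (N x); nra.
Qed.

Let mmem h : measurable_fun setT h -> measurable_fun setT (memory_op h).
Proof.
move=> mh; apply: measurable_funB; last exact: measurable_convx.
by apply: measurable_funM => //; exact: (measurableT_comp mc measurable_fst).
Qed.

Let int_mul (f g : X -> R) : measurable_fun setT f -> measurable_fun setT g ->
  rintegrable m setT (fun x => f x ^+ 2) -> rintegrable m setT (fun x => g x ^+ 2) ->
  rintegrable m setT (fun x => f x * g x).
Proof.
move=> mf mg i_f ig.
apply: (rintegrable_le measurableT _ _ (rintegrableD measurableT i_f ig)).
  exact: measurable_funM.
move=> x _; rewrite normrM; have := sqr_ge0 (`|f x| - `|g x|).
rewrite sqrrB !real_normK ?num_real// => H.
by have := sqr_ge0 (f x); have := sqr_ge0 (g x); nra.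
Qed.

Section memory_op_integral.
Variables (h : XR -> R) (k : R) (w : X -> R).
Hypotheses (mh : measurable_fun setT h) (ch : forall x, causal a (fun t => h (x, t))).
Hypothesis k0 : 0 <= k.
Hypothesis hN : forall x, \int[mu]_(t in `[a, b]) `|h (x, t)| <= k * N x.
Hypotheses (mw : measurable_fun setT w) (iw : rintegrable m setT (fun x => w x ^+ 2)).

Let iconv x t : rintegrable mu `[a, t] (fun s => convx F h (x, s)).
Proof. exact: (causal_rintegrable _ (causal_conv (@cFx x) (ch x))). Qed.

Let conv_le x s : a <= s <= b -> `|convx F h (x, s)| <= M * (k * N x).
Proof.
move=> /andP[as_ sb]; have ic := rintegrable_conv s (@cFx x) (ch x).
apply: le_trans (le_normr_Rintegral _ ic) _ => //.
have ih := causal_rintegrable s (ch x) (lexx a).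
apply: (@le_trans _ _ (\int[mu]_(r in `[a, s]) (M * `|h (x, r)|))).
  apply: le_Rintegral => //; first exact: (rintegrable_norm ic).
    exact: (rintegrableZl M _ (rintegrable_norm ih)).
  move=> r /=; rewrite in_itv/= => /andP[ar rs]; rewrite normrM ler_wpM2r//.
  by apply: (@FM x (s - r) _).1; move: baL ar rs as_ sb; lra.
rewrite (RintegralZl _ (itv_meas s) (rintegrable_norm ih)) ler_wpM2l ?(M0 x)//.
by apply: le_trans (hN x); exact: int_le_sub.
Qed.

Lemma rintegrable_memory_op t : a <= t <= b ->
  rintegrable mxt (setT `*` `[a, t]) (fun z => memory_op h z * w z.1).
Proof.
move=> atb; have /andP[at_ tb] := atb.
have iNw : rintegrable m setT (fun x => N x * `|w x|).
  apply: int_mul => //; first exact: measurableT_comp.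
  by under eq_fun do rewrite real_normK ?num_real//.
apply: (prod_int _ (rintegrableZl (c1 * k + L * M * k) measurableT iNw)).
  apply: measurable_funM; first exact: mmem.
  exact: (measurableT_comp mw measurable_fst).
move=> x; have ih := causal_rintegrable t (ch x) (lexx a).
have io : rintegrable mu `[a, t] (fun s => memory_op h (x, s)).
  exact: (rintegrableB (itv_meas t) (rintegrableZl (c x) (itv_meas t) ih) (iconv x t)).
split=> /=.
  have := rintegrableZl (w x) (itv_meas t) io; apply: eq_rintegrable => // s _.
  by rewrite mulrC.
have -> : \int[mu]_(s in `[a, t]) `|memory_op h (x, s) * w x| =
    `|w x| * \int[mu]_(s in `[a, t]) `|memory_op h (x, s)|.
  rewrite -(RintegralZl _ (itv_meas t) (rintegrable_norm io)).
  by apply: eq_Rintegral => s _; rewrite normrM mulrC.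
rewrite [leRHS](_ : _ = `|w x| * (c1 * (k * N x) + L * (M * (k * N x)))); last by ring.
rewrite ler_wpM2l//.
have i1 := rintegrableZl (c x) (itv_meas t) (rintegrable_norm ih).
have i2 := rintegrable_norm (iconv x t).
apply: (@le_trans _ _ (\int[mu]_(s in `[a, t]) (c x * `|h (x, s)| + `|convx F h (x, s)|))).
  apply: le_Rintegral => //; [exact: (rintegrable_norm io)|exact: (rintegrableD (itv_meas t) i1 i2)|].
  move=> s _; rewrite /memory_op /= (le_trans (ler_normB _ _))// normrM ger0_norm//.
  by case/andP: (c01 x) => /(le_trans (ltW c0_gt0)).
rewrite (RintegralD (itv_meas t) i1 i2) (RintegralZl _ (itv_meas t) (rintegrable_norm ih)).
have /andP[cx0 cx1] := c01 x; apply: lerD.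
  apply: ler_pM => //; first exact: le_trans (ltW c0_gt0) cx0.
    by apply: Rintegral_ge0 => s _; exact: normr_ge0.
  by apply: le_trans (hN x); exact: int_le_sub.
apply: int_le_const => //; first by rewrite !mulr_ge0// (M0 x).
by move=> s /andP[as_ st]; apply: conv_le; rewrite as_ (le_trans st tb).
Qed.

Let integrable_in_time :
  rintegrable mu `[a, b] (fun s => \int[m]_x (memory_op h (x, s) * w x)).
Proof.
have abb : a <= b <= b by rewrite lexx ltW.
exact: (rintegrable_Rintegral21 measurableT (itv_meas b) (rintegrable_memory_op abb)).
Qed.

Let prim_memory_op t : a <= t <= b ->
  \int[mu]_(s in `[a, t]) \int[m]_x (memory_op h (x, s) * w x) =
  \int[m]_x (memory_op (primx h) (x, t) * w x).
Proof.
move=> atb; have /andP[at_ tb] := atb.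
rewrite -(Fubini_Rintegral measurableT (itv_meas t) (rintegrable_memory_op atb)).
apply: eq_Rintegral => x _ /=; have ih := causal_rintegrable t (ch x) (lexx a).
have i1 := rintegrableZl (c x) (itv_meas t) ih.
have io : rintegrable mu `[a, t] (fun s => memory_op h (x, s)).
  exact: (rintegrableB (itv_meas t) i1 (iconv x t)).
rewrite (RintegralZr _ (itv_meas t) io); congr (_ * _).
rewrite /memory_op /= (RintegralB (itv_meas t) i1 (iconv x t)).
rewrite (RintegralZl _ (itv_meas t) ih); congr (_ - _).
exact: (prim_conv (@cFx x) (ch x) at_).
Qed.

Definition memory_op_integral := (integrable_in_time, prim_memory_op).

End memory_op_integral.

(** For a fixed test pair the equation is scalar in time, so [weak_second_primitive] applies. Since
    [memory_op] commutes with time primitives, the double primitive of the pairing is the pairing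
    with [flux]. *)
Let test_flux psi w t : test psi w -> a <= t <= b ->
  \int[m]_x (u (x, t) * psi x) = - \sum_i \int[m]_x (flux i (x, t) * w i x).
Proof.
move=> Tw atb; have [mpsi ipsi mw iw] := test_L2 Tw.
have [gc ga g0] := initial Tw.
have pN1 i x : \int[mu]_(s in `[a, b]) `|p i (x, s)| <= 1 * N x by rewrite mul1r.
have L0' : 0 <= L by [].
have abb : a <= b <= b by rewrite lexx ltW.
have PN i x : \int[mu]_(s in `[a, b]) `|primx (p i) (x, s)| <= L * N x.
  apply: int_le_const => //; first exact: (causal_rintegrable _ (causal_prim (cp i x)) (lexx a)).
  by move=> s /andP[_ sb]; exact: primx_le.
have mP i := measurable_primx (mp i).
have cP i x : causal a (fun s => primx (p i) (x, s)) := causal_prim (cp i x).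
have M1 i := memory_op_integral (mp i) (cp i) ler01 (pN1 i) (mw i) (iw i).
have M2 i := memory_op_integral (mP i) (cP i) L0' (PN i) (mw i) (iw i).
(* Cut off after [b]: the estimates hold on [a, b] only, whereas [causal] asks for integrability up
   to every time. *)
pose mm s := if s <= b then \sum_i \int[m]_x (memory_op (p i) (x, s) * w i x) else 0.
have mm_out s : s \notin `[a, b] -> mm s = 0.
  rewrite in_itv/= negb_and -!ltNge /mm => /orP[sa|sb]; last by rewrite leNgt sb.
  case: ifP => // _; rewrite big1// => i _.
  rewrite (@eq_Rintegral _ _ _ m setT (fun=> 0)) ?Rintegral_cst ?mul0r// => x _.
  have [_ c0' _] := cp i x; rewrite /memory_op /convx /= c0'// mulr0 sub0r.
  by rewrite set_itv_ge ?Rintegral_set0 ?oppr0 ?mul0r// bnd_simp -ltNge.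
have imm : rintegrable mu setT (mm : measurableTypeR R -> R).
  have im0 : rintegrable mu `[a, b] (mm : measurableTypeR R -> R).
    apply: (eq_rintegrable _ _ (rintegrable_sum (itv_meas b) (fun i => (M1 i).1))) => //.
    by move=> s /set_mem /=; rewrite in_itv/= /mm => /andP[_ ->].
  have := (rintegrable_mkcond mu mm (itv_meas b)).1 im0.
  apply: eq_rintegrable => // s _; rewrite patchE mem_setE; case: ifPn => // /mm_out ->.
  by [].
have cmm : causal a mm.
  split; first exact: (rintegrable_meas imm).
    by move=> s sa; apply: mm_out; rewrite in_itv/= leNgt sa.
  by move=> s; apply: rintegrableS imm.
have eqmm th : test_function `]a, b[%classic th ->
    \int[mu]_(t in `[a, b]) (\int[m]_x (u (x, t) * psi x) * 'D_1 ('D_1 th) t) +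
    \int[mu]_(t in `[a, b]) (mm t * th t) = 0.
  move=> Tth; rewrite -(equation Tw Tth); congr (_ + _); apply: eq_Rintegral => s.
  by move=> /set_mem /=; rewrite in_itv/= /mm => /andP[_ ->].
rewrite (weak_second_primitive ab gc ga g0 cmm eqmm atb); congr (- _).
have pmm s : a <= s <= b -> prim a mm s = \sum_i \int[m]_x (memory_op (primx (p i)) (x, s) * w i x).
  move=> asb; have /andP[as_ sb] := asb; rewrite /prim.
  transitivity (\int[mu]_(r in `[a, s]) \sum_i \int[m]_x (memory_op (p i) (x, r) * w i x)).
    apply: eq_Rintegral => r /set_mem /=; rewrite in_itv/= /mm => /andP[_ rs].
    by rewrite (le_trans rs sb).
  rewrite (Rintegral_sum (itv_meas s)).
    by apply: eq_bigr => i _; exact: (M1 i).2.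
  move=> i; apply: rintegrableS (M1 i).1 => //.
  by apply: subset_itvl; rewrite bnd_simp.
have /andP[at_ tb] := atb; rewrite /prim.
transitivity (\int[mu]_(r in `[a, t]) \sum_i \int[m]_x (memory_op (primx (p i)) (x, r) * w i x)).
  apply: eq_Rintegral => r /set_mem /=; rewrite in_itv/= => /andP[ar rt].
  by rewrite -pmm// ar (le_trans rt tb).
rewrite (Rintegral_sum (itv_meas t)).
  by apply: eq_bigr => i _; exact: (M2 i).2.
move=> i; apply: rintegrableS (M2 i).1 => //.
by apply: subset_itvl; rewrite bnd_simp.
Qed.

Let iflux2 i t : a <= t <= b -> rintegrable m setT (fun x => flux i (x, t) ^+ 2).
Proof.
move=> atb; apply: (rintegrable_le measurableT _ _ (rintegrableZl (K ^+ 2) measurableT iN)).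
  by apply: measurable_funX; exact: section_meas.
move=> x _; rewrite normrX -exprMn lerXn2r ?nnegrE ?flux_le//.
exact: le_trans (flux_le i x atb).
Qed.

(** By [test_flux] the pair (u(t), flux(t)) satisfies the orthogonality hypothesis of [dual], which
    therefore holds against u(r). Two times are needed: t is arbitrary, while u(r) lies in the
    closure of the test functions for almost every r. *)
Let weak t : a <= t <= b -> {ae mu, forall r, a <= r <= b ->
  \int[m]_x (u (x, t) * u (x, r)) = - \sum_i \int[m]_x (flux i (x, t) * p i (x, r))}.
Proof.
move=> atb; have := dual.
apply: (@filterS _ _ (ae_filter_ringOfSetsType mu)) => r Hr arb.
exact: (Hr arb (fun x => u (x, t)) (fun i x => flux i (x, t)) (section_meas t mu_)
  (iu atb) (fun i => section_meas t (mflux i)) (fun i => iflux2 i atb)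
  (fun psi w Tw => test_flux Tw atb)).
Qed.

Let mtime (f g : XR -> R) (t : R) : measurable_fun setT f -> measurable_fun setT g ->
  measurable_fun setT (fun r : measurableTypeR R => \int[m]_x (f (x, t) * g (x, r))).
Proof.
move=> mf mg.
apply: (@measurable_Rintegral2 _ _ (measurableTypeR R) X R m
  (fun z => f (z.2, t) * g (z.2, z.1)) setT measurableT).
apply: measurable_funM.
  by apply: (measurableT_comp (f := f) mf); apply: measurable_fun_pair.
by apply: (measurableT_comp (f := g) mg); apply: measurable_fun_pair.
Qed.

(** Integrating [weak] in r over [a, t] replaces the solution at almost every time by its primitive
    at time t; the exceptional set of times disappears. *)
Let fixed_time t : a <= t <= b ->
  \int[m]_x (u (x, t) * primx u (x, t)) = - \sum_i \int[m]_x (flux i (x, t) * primx (p i) (x, t)).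
Proof.
move=> atb; have /andP[at_ tb] := atb.
have iuu : rintegrable mxt (setT `*` `[a, t]) (fun z => u (z.1, t) * u z).
  apply: (prod_int _ (iuN atb)).
    apply: measurable_funM => //; apply: (measurableT_comp (f := fun x => u (x, t))).
      exact: section_meas.
    exact: measurable_fst.
  move=> x; have ix := causal_rintegrable t (cu x) (lexx a); split=> /=.
    exact: rintegrableZl.
  under eq_Rintegral do rewrite normrM.
  rewrite RintegralZl//; last exact: rintegrable_norm.
  by rewrite ler_wpM2l// (le_trans _ (uN x))// int_le_sub.
have ijp i : rintegrable mxt (setT `*` `[a, t]) (fun z => flux i (z.1, t) * p i z).
  apply: (prod_int _ (rintegrableZl K measurableT iN)).
    apply: measurable_funM => //; apply: (measurableT_comp (f := fun x => flux i (x, t))).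
      exact: section_meas.
    exact: measurable_fst.
  move=> x; have ix := causal_rintegrable t (cp i x) (lexx a); split=> /=.
    exact: rintegrableZl.
  under eq_Rintegral do rewrite normrM.
  rewrite RintegralZl//; last exact: rintegrable_norm.
  rewrite expr2 mulrA ler_pM ?flux_le//.
    by apply: Rintegral_ge0 => s _; exact: normr_ge0.
  by rewrite (le_trans _ (pN i x))// int_le_sub.
transitivity (\int[mu]_(r in `[a, t]) \int[m]_x (u (x, t) * u (x, r))).
  rewrite -(Fubini_Rintegral measurableT (itv_meas t) iuu).
  apply: eq_Rintegral => x _; rewrite /primx /prim /= RintegralZl//.
  exact: (causal_rintegrable _ (cu x)).
transitivity (\int[mu]_(r in `[a, t]) - \sum_i \int[m]_x (flux i (x, t) * p i (x, r))).
  apply: ae_eq_Rintegral => //.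
  - exact: measurable_funTS (mtime _ _ _).
  - apply: measurable_funTS; apply: measurableT_comp => //.
    by apply: measurable_sum => i; exact: mtime.
  - have := weak atb; apply: (@filterS _ _ (ae_filter_ringOfSetsType mu)) => r Hr; rewrite /= in_itv/= => /andP[ar rt].
    by apply: Hr; rewrite ar (le_trans rt tb).
have ig i : rintegrable mu `[a, t] (fun r => \int[m]_x (flux i (x, t) * p i (x, r))).
  exact: (rintegrable_Rintegral21 measurableT (itv_meas t) (ijp i)).
rewrite -[RHS]mulN1r; under eq_Rintegral do rewrite -mulN1r.
rewrite RintegralZl//; last exact: rintegrable_sum.
rewrite Rintegral_sum//; congr (_ * _); apply: eq_bigr => i _.
rewrite -(Fubini_Rintegral measurableT (itv_meas t) (ijp i)).
apply: eq_Rintegral => x _; rewrite /primx /prim /= RintegralZl//.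
exact: (causal_rintegrable _ (cp i x)).
Qed.

Let C := M + M * L + M ^+ 2 * L / c0.

Let y t := \sum_i \int[m]_x (primx (primx (p i)) (x, t) ^+ 2).

Let iA2 i t : a <= t <= b -> rintegrable m setT (fun x => primx (primx (p i)) (x, t) ^+ 2).
Proof.
move=> atb; apply: (rintegrable_le measurableT _ _ (rintegrableZl (L ^+ 2) measurableT iN)).
  by apply: measurable_funX; exact: section_meas.
move=> x _; rewrite normrX -exprMn lerXn2r ?nnegrE ?mulr_ge0//.
exact: primxx_le.
Qed.

Let y_bound t : a <= t <= b -> 0 <= y t <= n%:R * (L ^+ 2 * \int[m]_x (N x ^+ 2)).
Proof.
move=> atb; apply/andP; split.
  by apply: sumr_ge0 => i _; apply: Rintegral_ge0 => x _; exact: sqr_ge0.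
rewrite -[X in X%:R * _]card_ord mulr_natl -sumr_const; apply: ler_sum => i _.
rewrite -RintegralZl//; apply: le_Rintegral => //; first exact: iA2.
  exact: (rintegrableZl _ measurableT iN).
move=> x _; rewrite -exprMn -[leLHS]real_normK ?num_real// lerXn2r ?nnegrE ?mulr_ge0//.
exact: primxx_le.
Qed.

Let iA2t i t : a <= t <= b ->
  rintegrable mxt (setT `*` `[a, t]) (fun z => primx (primx (p i)) z ^+ 2).
Proof.
move=> atb; have /andP[at_ tb] := atb.
apply: (prod_int _ (rintegrableZl (L * L ^+ 2) measurableT iN)).
  exact: measurable_funX.
move=> x; have cA : continuous (fun t => primx (primx (p i)) (x, t)).
  exact: continuous_prim (causal_prim (cp i x)).
have iA : rintegrable mu `[a, t] (fun s => primx (primx (p i)) (x, s) ^+ 2).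
  by apply: continuous_rintegrable => s; exact: cvgM (cA s) (cA s).
split=> //; rewrite -mulrA; apply: int_le_const => //; first by rewrite mulr_ge0 ?sqr_ge0.
move=> s /andP[as_ st]; rewrite normrX -exprMn lerXn2r ?nnegrE ?mulr_ge0//.
by apply: primxx_le; rewrite as_ (le_trans st tb).
Qed.

(** Integrating [fixed_time] in time makes the [u] term and the flux terms add up to 0. The former
    is nonnegative by [Rintegral_mul_prim_ge0]; the latter are bounded below by [memory_energy],
    point by point and component by component. *)
Let energy t : a <= t <= b -> c0 / 4 * y t <= C * \int[mu]_(s in `[a, t]) y s.
Proof.
move=> atb; have /andP[at_ tb] := atb.
have iuU : rintegrable mxt (setT `*` `[a, t]) (fun z => u z * primx u z).
  apply: (prod_int _ iN); first by apply: measurable_funM => //; exact: measurable_primx.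
  move=> x; have ix := causal_rintegrable t (cu x) (lexx a).
  have iux : rintegrable mu `[a, t] (fun s => u (x, s) * primx u (x, s)).
    exact: (rintegrable_mul_continuous (continuous_prim (cu x)) ix).
  split=> //=; rewrite expr2.
  apply: (@le_trans _ _ (\int[mu]_(s in `[a, t]) (N x * `|u (x, s)|))).
    apply: le_Rintegral => //; first exact: (rintegrable_norm iux).
      exact: (rintegrableZl _ _ (rintegrable_norm ix)).
    move=> s /=; rewrite in_itv/= => /andP[_ st]; rewrite normrM mulrC ler_wpM2r//.
    by apply: le_trans (uN x); apply: prim_le => //; exact: le_trans st tb.
  rewrite RintegralZl//; last exact: rintegrable_norm.
  by rewrite ler_wpM2l// (le_trans _ (uN x))// int_le_sub.
have iJP i : rintegrable mxt (setT `*` `[a, t]) (fun z => flux i z * primx (p i) z).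
  apply: (prod_int _ (rintegrableZl (L * K) measurableT iN)).
    by apply: measurable_funM => //; exact: measurable_primx.
  move=> x; have K0 : 0 <= K * N x ^+ 2.
    have aab : a <= a <= b by rewrite lexx ltW.
    have := flux_le i x aab; move=> /(le_trans (normr_ge0 _)) H.
    by rewrite expr2 mulrA mulr_ge0.
  have ijx : rintegrable mu `[a, t] (fun s => flux i (x, s) * primx (p i) (x, s)).
    apply: (rintegrable_bounded (M := K * N x ^+ 2)) => //.
    - exact: lebesgue_itv_lty.
    - apply: measurable_funTS.
      exact: (measurable_fun_pair2 x (measurable_funM (mflux i) (measurable_primx (mp i)))).
    - move=> s /=; rewrite in_itv/= => /andP[as_ st].
      have asb : a <= s <= b by rewrite as_ (le_trans st tb).
      rewrite normrM expr2 mulrA ler_pM ?flux_le// primx_le//.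
      by case/andP: asb.
  split=> //=; rewrite -mulrA; apply: int_le_const => // s /andP[as_ st].
  have asb : a <= s <= b by rewrite as_ (le_trans st tb).
  rewrite normrM expr2 mulrA ler_pM ?flux_le// primx_le//.
  by case/andP: asb.
have sum0 : \int[m]_x \int[mu]_(s in `[a, t]) (u (x, s) * primx u (x, s)) +
    \sum_i \int[m]_x \int[mu]_(s in `[a, t]) (flux i (x, s) * primx (p i) (x, s)) = 0.
  have iU21 := rintegrable_Rintegral21 measurableT (itv_meas t) iuU.
  have iJ21 i := rintegrable_Rintegral21 measurableT (itv_meas t) (iJP i).
  rewrite (Fubini_Rintegral measurableT (itv_meas t) iuU).
  under eq_bigr do rewrite (Fubini_Rintegral measurableT (itv_meas t) (iJP _)).
  rewrite -(Rintegral_sum (itv_meas t) iJ21).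
  rewrite -(RintegralD (itv_meas t) iU21 (rintegrable_sum (itv_meas t) iJ21)).
  rewrite (@eq_Rintegral _ _ _ mu `[a, t] (fun=> 0)).
    by rewrite Rintegral_cst// mul0r.
  move=> s /set_mem /=; rewrite in_itv/= => /andP[as_ st].
  by rewrite fixed_time ?addNr// as_ (le_trans st tb).
have uU0 : 0 <= \int[m]_x \int[mu]_(s in `[a, t]) (u (x, s) * primx u (x, s)).
  by apply: Rintegral_ge0 => x _; exact: Rintegral_mul_prim_ge0.
have lower i : c0 / 4 * \int[m]_x (primx (primx (p i)) (x, t) ^+ 2) -
    C * \int[mu]_(s in `[a, t]) \int[m]_x (primx (primx (p i)) (x, s) ^+ 2) <=
    \int[m]_x \int[mu]_(s in `[a, t]) (flux i (x, s) * primx (p i) (x, s)).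
  rewrite -(Fubini_Rintegral measurableT (itv_meas t) (iA2t i atb)).
  have iAA := rintegrable_Rintegral12 measurableT (itv_meas t) (iA2t i atb).
  rewrite -(RintegralZl _ measurableT (iA2 i atb)) -(RintegralZl _ measurableT iAA).
  rewrite -(RintegralB measurableT (rintegrableZl _ measurableT (iA2 i atb))
    (rintegrableZl _ measurableT iAA)).
  apply: (le_Rintegral measurableT).
  - exact: (rintegrableB measurableT (rintegrableZl _ measurableT (iA2 i atb))
      (rintegrableZl _ measurableT iAA)).
  - exact: (rintegrable_Rintegral12 measurableT (itv_meas t) (iJP i)).
  move=> x _; have /andP[cx0 _] := c01 x.
  have c0x : 0 < c0 <= c x by rewrite c0_gt0.
  have taL : t - a <= L by apply: le_trans baL; rewrite lerD2r.
  exact: (memory_energy c0x L0 taL (@dF x) (@cDF x) (@FM x) (cp i x) at_).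
have iyi i : rintegrable mu `[a, t] (fun s => \int[m]_x (primx (primx (p i)) (x, s) ^+ 2)).
  exact: (rintegrable_Rintegral21 measurableT (itv_meas t) (iA2t i atb)).
have : \sum_i (c0 / 4 * \int[m]_x (primx (primx (p i)) (x, t) ^+ 2) -
    C * \int[mu]_(s in `[a, t]) \int[m]_x (primx (primx (p i)) (x, s) ^+ 2)) <=
  \sum_i \int[m]_x \int[mu]_(s in `[a, t]) (flux i (x, s) * primx (p i) (x, s)).
  by apply: ler_sum => i _; exact: lower.
have -> : \int[mu]_(s in `[a, t]) y s =
    \sum_i \int[mu]_(s in `[a, t]) \int[m]_x (primx (primx (p i)) (x, s) ^+ 2).
  exact: (Rintegral_sum (itv_meas t) iyi).
rewrite sumrB -!mulr_sumr -/(y t) => H; rewrite -subr_le0; apply: le_trans H _.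
by rewrite -(addKr (\int[m]_x \int[mu]_(s in `[a, t]) (u (x, s) * primx u (x, s)))
  (\sum_i _)) sum0 addr0 oppr_le0.
Qed.

Let y_eq0 t : a <= t <= b -> y t = 0.
Proof.
move=> atb.
have C0 (x : X) : 0 <= C.
  by rewrite /C !addr_ge0 ?mulr_ge0 ?sqr_ge0 ?invr_ge0 ?(M0 x)// ltW.
have my : measurable_fun `[a, b] (y : measurableTypeR R -> R).
  apply: measurable_funTS; apply: measurable_sum => j.
  apply: (@measurable_Rintegral2 _ _ (measurableTypeR R) X R m
    (fun z => primx (primx (p j)) (z.2, z.1) ^+ 2) setT measurableT).
  apply: measurable_funX.
  by apply: (measurableT_comp (f := primx (primx (p j))) (mA j)); apply: measurable_fun_pair.
(* The sign of [M] is read off at a point of [X]; over an empty [X] all the integrals vanish. *)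
have [X0|/existsNP[x _]] := pselect (forall x : X, False).
  rewrite /y big1// => j _; rewrite (@eq_Rintegral _ _ _ m setT (fun=> 0)).
    by rewrite Rintegral_cst// mul0r.
  by move=> x; have := X0 x.
apply: (@gronwall_eq0 _ y a b _ (C / (c0 / 4)) _ my y_bound _ t atb).
  by rewrite divr_ge0 ?(C0 x)// divr_ge0// ltW.
move=> s asb; rewrite mulrAC ler_pdivlMr ?divr_gt0// mulrC.
exact: energy.
Qed.

Let A2_eq0 i t : a <= t <= b -> \int[m]_x (primx (primx (p i)) (x, t) ^+ 2) = 0.
Proof.
move=> /y_eq0/eqP; rewrite psumr_eq0; last first.
  by move=> j _; apply: Rintegral_ge0 => x _; exact: sqr_ge0.
by move=> /allP/(_ i); rewrite mem_index_enum => /(_ isT)/eqP.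
Qed.

(** The double integral of A^2 vanishes, so for almost every x the function A(x, .) is 0 at almost
    every time. The exceptional points do not depend on t, and a convolution in time ignores the
    exceptional times. *)
Let conv_ae0 i : {ae m, forall x, forall t, t <= b ->
  convx F (primx (primx (p i))) (x, t) = 0}.
Proof.
have abb : a <= b <= b by rewrite lexx ltW.
have iA := iA2t i abb.
have int0 : \int[m]_x \int[mu]_(s in `[a, b]) (primx (primx (p i)) (x, s) ^+ 2) = 0.
  rewrite (Fubini_Rintegral measurableT (itv_meas b) iA).
  rewrite (@eq_Rintegral _ _ _ mu `[a, b] (fun=> 0)); first by rewrite Rintegral_cst// mul0r.
  by move=> s /set_mem /=; rewrite in_itv/= => /A2_eq0.
have := Rintegral_ae0 measurableT (rintegrable_Rintegral12 measurableT (itv_meas b) iA)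
  (fun x _ => Rintegral_ge0 _ (fun s _ => sqr_ge0 _)) int0.
apply: filterS => x /(_ I) intx t tb.
have cA : continuous (fun t => primx (primx (p i)) (x, t)).
  exact: continuous_prim (causal_prim (cp i x)).
have iAx : rintegrable mu `[a, b] (fun s => primx (primx (p i)) (x, s) ^+ 2).
  by apply: continuous_rintegrable => s; exact: cvgM (cA s) (cA s).
have A0 := Rintegral_ae0 (itv_meas b) iAx (fun s _ => sqr_ge0 _) intx.
rewrite /convx /=; transitivity (\int[mu]_(s in `[a, t]) (0 : R)); last first.
  by rewrite Rintegral_cst// mul0r.
apply: ae_eq_Rintegral => //.
  exact: (rintegrable_meas (rintegrable_conv t (@cFx x) (chA i x))).
move: A0; apply: (@filterS _ _ (ae_filter_ringOfSetsType mu)) => s As.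
rewrite /= in_itv/= => /andP[as_ st].
have /eqP : primx (primx (p i)) (x, s) ^+ 2 = 0.
  by apply: As; rewrite /= in_itv/= as_ (le_trans st tb).
by rewrite sqrf_eq0 => /eqP ->; rewrite mulr0.
Qed.

Let flux_ae0 i t : a <= t <= b -> {ae m, forall x, flux i (x, t) = 0}.
Proof.
move=> atb; have /andP[_ tb] := atb.
have := Rintegral_ae0 measurableT (iA2 i atb) (fun x _ => sqr_ge0 _) (A2_eq0 i atb).
move: (conv_ae0 i); apply: filterS2 => x conv0 /(_ I)/eqP; rewrite sqrf_eq0 => /eqP A0.
by rewrite /flux /memory_op A0 mulr0 conv0// subr0.
Qed.

(** Since [flux] vanishes, u(r) is orthogonal to all test functions; [dual], applied with a0 = u(r)
    and al = 0, extends this to orthogonality to u(r) itself. *)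
Lemma energy_unique : {ae mu, forall r, a <= r <= b -> \int[m]_x (u (x, r) ^+ 2) = 0}.
Proof.
have := dual; apply: (@filterS _ _ (ae_filter_ringOfSetsType mu)) => r Hr arb.
have int0 (f : X -> R) : {ae m, forall x, f x = 0} -> measurable_fun setT f ->
    \int[m]_x f x = 0.
  move=> f0 mf; transitivity (\int[m]_(x in setT) (0 : R)); last first.
    by rewrite Rintegral_cst// mul0r.
  by apply: ae_eq_Rintegral => //; apply: filterS f0 => x.
have z2 (i : 'I_n) : rintegrable m setT (fun x => (0 : R) ^+ 2).
  apply: (rintegrable_le measurableT _ _ (iu arb)) => //.
  by move=> x _; rewrite expr0n normr0 sqr_ge0.
have mz (i : 'I_n) : measurable_fun [set: X] (fun=> 0 : R) by [].
have orth psi w : test psi w ->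
    \int[m]_x (u (x, r) * psi x) = - \sum_(i < n) \int[m]_x (0 * w i x).
  move=> Tw; rewrite (test_flux Tw arb); congr (- _); apply: eq_bigr => i _.
  have [_ _ mw _] := test_L2 Tw.
  transitivity (0 : R); last first.
    by under eq_Rintegral do rewrite mul0r; rewrite Rintegral_cst// mul0r.
  apply: int0; last by apply: measurable_funM => //; exact: section_meas.
  by apply: filterS (flux_ae0 i arb) => x ->; rewrite mul0r.
have := Hr arb (fun x => u (x, r)) (fun i x => 0) (section_meas r mu_) (iu arb) mz z2 orth.
rewrite [in RHS]big1 ?oppr0 => [H|i _]; first by under eq_Rintegral do rewrite expr2.
by under eq_Rintegral do rewrite mul0r; rewrite Rintegral_cst// mul0r.
Qed.

End energy_uniqueness.

(** * Weak solutions *)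

Section L2.
Context d (T : measurableType d) (R : realType) (mu : {measure set T -> \bar R}).

Lemma mem_L2P (D : set T) (f : T -> R) : mem_L2 mu D f <->
  measurable_fun D f /\ rintegrable mu D (fun x => f x ^+ 2).
Proof.
have sq : (\int[mu]_(x in D) `|(EFin \o (fun x => (f x ^+ 2)%R)) x|)%E =
    (\int[mu]_(x in D) (f x ^+ 2)%:E)%E.
  by apply: eq_integral => x _; rewrite gee0_abs// lee_fin sqr_ge0.
split=> -[mf i_f]; split=> //.
  apply/integrableP; split; last by rewrite sq.
  by apply/measurable_EFinP; exact: measurable_funX.
by have /integrableP[_] := i_f; rewrite sq.
Qed.

Lemma rintegrable_mulL2 (D : set T) (f g : T -> R) : measurable D ->
  measurable_fun D f -> measurable_fun D g ->
  rintegrable mu D (fun x => f x ^+ 2) -> rintegrable mu D (fun x => g x ^+ 2) ->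
  rintegrable mu D (fun x => f x * g x).
Proof.
move=> mD mf mg i_f ig.
apply: (rintegrable_le mD _ _ (rintegrableD mD i_f ig)).
  exact: measurable_funM.
move=> x _; rewrite normrM; have := sqr_ge0 (`|f x| - `|g x|).
rewrite sqrrB !real_normK ?num_real// => H.
by have := sqr_ge0 (f x); have := sqr_ge0 (g x); nra.
Qed.

Lemma rintegrable_subL2 (D : set T) (f g : T -> R) : measurable D ->
  measurable_fun D f -> measurable_fun D g ->
  rintegrable mu D (fun x => f x ^+ 2) -> rintegrable mu D (fun x => g x ^+ 2) ->
  rintegrable mu D (fun x => (f x - g x) ^+ 2).
Proof.
move=> mD mf mg i_f ig.
apply: (rintegrable_le mD _ _ (rintegrableZl 2 mD (rintegrableD mD i_f ig))).
  by apply: measurable_funX; exact: measurable_funB.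
move=> x _; rewrite ger0_norm ?sqr_ge0//.
by have := sqr_ge0 (f x + g x); nra.
Qed.

(** The inequality yz <= y^2/(2 de) + (de/2) z^2 is used in place of Cauchy-Schwarz. With de = e/(A
    + 1), where [A] is the integral of h^2, the two terms are at most e/2, and the first is
    eventually strictly smaller. *)
Lemma cvg_Rintegral_mulL2 (U : Type) (F : set_system U) {FF : Filter F}
    (D : set T) (f : U -> T -> R) (g h : T -> R) : measurable D ->
  (\forall k \near F, mem_L2 mu D (f k)) -> mem_L2 mu D g -> mem_L2 mu D h ->
  (\int[mu]_(x in D) ((f k x - g x) ^+ 2)%:E)%E @[k --> F] --> 0%E ->
  \int[mu]_(x in D) (f k x * h x) @[k --> F] --> \int[mu]_(x in D) (g x * h x).
Proof.
move=> mD Lf /mem_L2P[mg ig] /mem_L2P[mh ih] fg.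
pose A := \int[mu]_(x in D) h x ^+ 2.
have A0 : 0 <= A by apply: Rintegral_ge0 => x _; exact: sqr_ge0.
apply/cvgrPdist_lt => e e0.
pose de := e / (A + 1); have A1 : 0 < A + 1 by rewrite ltr_wpDl.
have de0 : 0 < de by rewrite divr_gt0.
have /fine_cvgP[_ /cvgrPdist_lt/(_ (de * e))] := fg.
rewrite mulr_gt0// => /(_ isT); rewrite /= => fgk.
near=> k.
have /mem_L2P[mf i_f] : mem_L2 mu D (f k) by near: k.
have ifg := rintegrable_subL2 mD mf mg i_f ig.
have small : \int[mu]_(x in D) (f k x - g x) ^+ 2 < de * e.
  have : `|0 - fine (\int[mu]_(x in D) ((f k x - g x) ^+ 2)%:E)%E| < de * e by near: k.
  by rewrite sub0r normrN; apply: le_lt_trans; exact: ler_norm.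
rewrite distrC -(RintegralB mD (rintegrable_mulL2 mD mf mh i_f ih) (rintegrable_mulL2 mD mg mh ig ih)).
have ifgh : rintegrable mu D (fun x => f k x * h x - g x * h x).
  exact: (rintegrableB mD (rintegrable_mulL2 mD mf mh i_f ih) (rintegrable_mulL2 mD mg mh ig ih)).
apply: le_lt_trans (le_normr_Rintegral mD ifgh) _.
have i1 := rintegrableZl (2 * de)^-1 mD ifg; have i2 := rintegrableZl (de / 2) mD ih.
apply: (@le_lt_trans _ _ (\int[mu]_(x in D)
    ((2 * de)^-1 * (f k x - g x) ^+ 2 + de / 2 * h x ^+ 2))).
  apply: le_Rintegral => //; [exact: (rintegrable_norm ifgh)|exact: (rintegrableD mD i1 i2)|].
  move=> x _; rewrite -mulrBl normrM.
  rewrite -[X in _ <= _ * X + _]real_normK ?num_real// -[X in _ <= _ + _ * X]real_normK ?num_real//.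
  set y := `|_ - _|; set z := `|h x|.
  have -> : (2 * de)^-1 * y ^+ 2 + de / 2 * z ^+ 2 = y * z + (2 * de)^-1 * (y - de * z) ^+ 2.
    by field; rewrite gt_eqF.
  by rewrite lerDl mulr_ge0 ?sqr_ge0// invr_ge0 mulr_ge0// ltW.
rewrite (RintegralD mD i1 i2) (RintegralZl _ mD ifg) (RintegralZl _ mD ih) -/A.
have h1 : (2 * de)^-1 * \int[mu]_(x in D) (f k x - g x) ^+ 2 < e / 2.
  have -> : e / 2 = (2 * de)^-1 * (de * e) by field; rewrite gt_eqF.
  by rewrite ltr_pM2l// invr_gt0 mulr_gt0.
have h2 : de / 2 * A <= e / 2.
  rewrite /de [leLHS](_ : _ = e / 2 * (A / (A + 1))); last by field; rewrite gt_eqF.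
  rewrite ler_piMr//; first by rewrite divr_ge0// ltW.
  by rewrite ler_pdivrMr// mul1r lerDl.
by rewrite [ltRHS]splitr ltr_leD.
Unshelve. all: end_near. Qed.

End L2.

Section rv_open.
Context {R : realType}.

(** An open set is the union of the balls that it contains, with centre on the grid of step 1/(k+1)
    and radius 1/(k+1); there are countably many, and balls are measurable by coordinates. *)
Lemma measurable_open_rv n (A : set 'rV[R]_n) : open A -> measurable A.
Proof.
move=> oA.
pose C := (nat * {ffun 'I_n -> int})%type.
pose q (c : C) : 'rV[R]_n := \row_i ((c.2 i)%:~R / c.1.+1%:R).
pose r (c : C) : R := c.1.+1%:R^-1.
pose F (c : C) := if `[< ball (q c) (r c) `<=` A >] then ball (q c) (r c) else set0.
rewrite (_ : A = \bigcup_c F c); last first.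
  apply/seteqP; split=> [x Ax|x [c _]]; last first.
    by rewrite /F; case: asboolP => // cA /cA.
  have /nbhs_ballP[e /= e0 xe] := open_nbhs_nbhs (conj oA Ax : open_nbhs x A).
  pose k := Num.bound (2 / e).
  have ke : 2 / e < k.+1%:R.
    apply: lt_trans (archi_boundP _) _; first by rewrite divr_ge0// ltW.
    by rewrite ltr_nat.
  have k0 : (0 : R) < k.+1%:R by [].
  pose c : C := (k, [ffun i => Num.floor (x ord0 i * k.+1%:R)]).
  have r0 : 0 < r c by rewrite invr_gt0.
  have re : r c + r c < e.
    move: ke; rewrite ltr_pdivrMr// => ke.
    have -> : r c + r c = 2 / k.+1%:R by rewrite /r /= -mulr2n mulr_natl.
    by rewrite ltr_pdivrMr// mulrC.
  have qx : ball (q c) (r c) x.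
    apply/rv_ballP => // i; rewrite !mxE ffunE /=.
    have /andP[h1 h2] := floor_itv (x ord0 i * k.+1%:R).
    have -> : (Num.floor (x ord0 i * k.+1%:R))%:~R / k.+1%:R - x ord0 i =
        - ((x ord0 i * k.+1%:R - (Num.floor (x ord0 i * k.+1%:R))%:~R) / k.+1%:R).
      by rewrite mulrBl mulfK ?gt_eqF// opprB.
    rewrite normrN ger0_norm ?divr_ge0 ?subr_ge0// /r /= ltr_pdivrMr// mulVf ?gt_eqF//.
    by rewrite ltrBlDr addrC -[X in _ + X]/(1%:~R) -intrD.
  exists c => //; rewrite /F asboolT// => y qy; apply: xe.
  by apply: (le_ball (ltW re)); apply: ball_triangle (ball_sym qx) qy.
apply: countable_bigcupT_measurable => [|c]; first exact: countableP.
by rewrite /F; case: ifP => // _; exact: measurable_rv_ball.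
Qed.

End rv_open.

Section test_functions.
Context {R : realType} {W : normedModType R}.
Implicit Types (U : set W) (psi : W -> R).

Lemma test_function_out U psi x : test_function U psi -> ~ U x -> psi x = 0.
Proof.
move=> [_ _ sU] Ux; apply: contrapT => px; apply: Ux; apply: sU.
by apply: subset_closure => /=; exact/eqP.
Qed.

Lemma test_function_derive U psi v : test_function U psi -> test_function U ('D_v psi).
Proof.
move=> [sp cS sU].
have sub : [set x | 'D_v psi x != 0] `<=` closure [set x | psi x != 0].
  move=> x /= Dx; apply: contrapT => nx; move/eqP: Dx; apply.
  have /open_nbhs_nbhs : open_nbhs x (~` closure [set x | psi x != 0]).
    by split=> //; apply: closed_openC; exact: closed_closure.
  move=> nbx.
  have px0 : \forall y \near x, psi y = 0.
    apply: filterS nbx => y /= ny; apply: contrapT => /eqP py.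
    by apply: ny; exact: subset_closure.
  by rewrite (@near_eq_derive _ _ _ psi (fun=> 0) x v px0) derive_cst.
have csub : closure [set x | 'D_v psi x != 0] `<=` closure [set x | psi x != 0].
  by rewrite closureE => y; apply; split=> //; exact: closed_closure.
split; first exact: smooth_derive.
- by apply: subclosed_compact cS csub; exact: closed_closure.
- exact: subset_trans csub sU.
Qed.

Lemma test_function_subset U U' psi : U `<=` U' -> test_function U psi -> test_function U' psi.
Proof. by move=> UU' [? ? sU]; split=> //; exact: subset_trans sU UU'. Qed.

End test_functions.

(** * Representatives of generalized solutions that are free of exceptional points *)

Section clean.
Context (R : realType) (n : nat).
Local Notation V := 'rV[R]_n.
Local Notation VR := (V * measurableTypeR R)%type.
Local Notation e_ i := (delta_mx ord0 i : V).
Local Notation mux := (lebesgue_rv R n).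
Local Notation mut := (@lebesgue_measure R).
Local Notation muxt := (lebesgue_rv R n \x @lebesgue_measure R)%E.
Implicit Types (Omega : set V) (a b : R) (u : VR -> R) (p : 'I_n -> VR -> R).

Definition grad_test Omega (psi : V -> R) (w : 'I_n -> V -> R) :=
  test_function Omega psi /\ forall i, w i = 'D_(e_ i) psi.

Definition L2fun (f : V -> R) := measurable_fun setT f /\ rintegrable mux setT (fun x => f x ^+ 2).

(* Representatives for which every Fubini and slice integral exists for all [x],
   so that no null set has to be carried along. *)
Record energy_class Omega a b u p : Prop := EnergyClass {
  ec_mu : measurable_fun setT u;
  ec_mp : forall i, measurable_fun setT (p i);
  ec_u0 : forall x t, ~ (Omega x /\ a <= t <= b) -> u (x, t) = 0;
  ec_p0 : forall i x t, ~ (Omega x /\ a <= t <= b) -> p i (x, t) = 0;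
  ec_ux : forall x, rintegrable mut setT (fun t => u (x, t) ^+ 2);
  ec_px : forall i x, rintegrable mut setT (fun t => p i (x, t) ^+ 2);
  ec_u2 : rintegrable muxt setT (fun z => u z ^+ 2);
  ec_p2 : forall i, rintegrable muxt setT (fun z => p i z ^+ 2);
  ec_ut : forall t, a <= t <= b -> rintegrable mux setT (fun x => u (x, t) ^+ 2);
  ec_dual : {ae mut, forall r, a <= r <= b ->
    (forall i, rintegrable mux setT (fun x => p i (x, r) ^+ 2)) /\
    forall (a0 : V -> R) (al : 'I_n -> V -> R), L2fun a0 -> (forall i, L2fun (al i)) ->
    (forall psi w, grad_test Omega psi w ->
       \int[mux]_x (a0 x * psi x) = - \sum_i \int[mux]_x (al i x * w i x)) ->
    \int[mux]_x (a0 x * u (x, r)) = - \sum_i \int[mux]_x (al i x * p i (x, r))};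
  ec_initial : forall psi, test_function Omega psi ->
  [/\ {within `[a, b], continuous (fun t => \int[mux]_x (u (x, t) * psi x))},
      \int[mux]_x (u (x, a) * psi x) = 0 &
      h^-1 * \int[mux]_x (u (x, a + h) * psi x) @[h --> 0^'+] --> (0 : R)] }.

Lemma section_meas (f : VR -> R) (t : R) : measurable_fun setT f ->
  measurable_fun setT (fun x : V => f (x, t)).
Proof.
move=> mf; apply: (measurableT_comp (f := f) mf); exact: measurable_fun_pair.
Qed.

Lemma L2fun_test Omega psi : bounded_set Omega -> test_function Omega psi -> L2fun psi.
Proof.
move=> [B0 [_ HB]] Tpsi; have [sp _ _] := Tpsi.
have cp := smooth_continuous sp.
split; first exact: measurable_continuous_rv.
pose B := `|B0| + 1.
apply: (@rintegrable_bsupp_rv R n _ (B + 1)).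
  by move=> x; under eq_fun do rewrite expr2; exact: cvgM (cp x) (cp x).
move=> x xB; rewrite (test_function_out Tpsi) ?expr0n// => Ox; apply: xB.
have BB : B0 < B by rewrite /B; apply: le_lt_trans (ler_norm _) _; rewrite ltrDl.
have xB : `|x| <= B := HB B BB x Ox.
by rewrite -ball_normE /= sub0r normrN (le_lt_trans xB)// ltrDl.
Qed.

Lemma L2fun_sub f g : L2fun f -> L2fun g -> L2fun (fun x => f x - g x).
Proof.
move=> [mf i_f] [mg ig]; split; first exact: measurable_funB.
exact: rintegrable_subL2.
Qed.

Lemma L2fun_mul f g : L2fun f -> L2fun g -> rintegrable mux setT (fun x => f x * g x).
Proof. by move=> [mf i_f] [mg ig]; exact: rintegrable_mulL2. Qed.

Lemma Rintegral_mulBl f g h : L2fun f -> L2fun g -> L2fun h ->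
  \int[mux]_x ((f x - g x) * h x) = \int[mux]_x (f x * h x) - \int[mux]_x (g x * h x).
Proof.
move=> lf lg lh; rewrite -(RintegralB measurableT (L2fun_mul lf lh) (L2fun_mul lg lh)).
by apply: eq_Rintegral => x _; rewrite mulrBl.
Qed.

Lemma Rintegral_mulBr f g h : L2fun f -> L2fun g -> L2fun h ->
  \int[mux]_x (h x * (f x - g x)) = \int[mux]_x (h x * f x) - \int[mux]_x (h x * g x).
Proof.
move=> lf lg lh; under eq_Rintegral do rewrite mulrC.
by rewrite Rintegral_mulBl//; congr (_ - _); apply: eq_Rintegral => x _; rewrite mulrC.
Qed.

Lemma ec_L2 Omega a b u p : energy_class Omega a b u p -> forall t, L2fun (fun x => u (x, t)).
Proof.
move=> H t; split; first exact: section_meas (ec_mu H).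
have [atb|natb] := boolP (a <= t <= b); first exact: ec_ut H _ atb.
apply: (eq_rintegrable measurableT (f := fun=> 0)); last exact: integrable0.
by move=> x _; rewrite (ec_u0 H) ?expr0n// => -[_]; apply/negP.
Qed.

Lemma energy_classB Omega a b u1 u2 p1 p2 : a < b -> bounded_set Omega ->
  energy_class Omega a b u1 p1 -> energy_class Omega a b u2 p2 ->
  energy_class Omega a b (fun z => u1 z - u2 z) (fun i z => p1 i z - p2 i z).
Proof.
move=> ab bO H1 H2.
split.
- exact: measurable_funB (ec_mu H1) (ec_mu H2).
- by move=> i; exact: measurable_funB (ec_mp H1 i) (ec_mp H2 i).
- by move=> x t xt; rewrite (ec_u0 H1 xt) (ec_u0 H2 xt) subrr.
- by move=> i x t xt; rewrite (ec_p0 H1 i xt) (ec_p0 H2 i xt) subrr.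
- move=> x; apply: (rintegrable_subL2 measurableT _ _ (ec_ux H1 x) (ec_ux H2 x)).
    exact: (measurable_fun_pair2 x (ec_mu H1)).
  exact: (measurable_fun_pair2 x (ec_mu H2)).
- move=> i x; apply: (rintegrable_subL2 measurableT _ _ (ec_px H1 i x) (ec_px H2 i x)).
    exact: (measurable_fun_pair2 x (ec_mp H1 i)).
  exact: (measurable_fun_pair2 x (ec_mp H2 i)).
- exact: (rintegrable_subL2 measurableT (ec_mu H1) (ec_mu H2) (ec_u2 H1) (ec_u2 H2)).
- move=> i.
  exact: (rintegrable_subL2 measurableT (ec_mp H1 i) (ec_mp H2 i) (ec_p2 H1 i) (ec_p2 H2 i)).
- by move=> t _; exact: (L2fun_sub (ec_L2 H1 t) (ec_L2 H2 t)).2.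
- have := ec_dual H1; have := ec_dual H2.
  apply: (@filterS2 _ _ (ae_filter_ringOfSetsType mut)) => r D2 D1 arb.
  have [q1 {}D1] := D1 arb; have [q2 {}D2] := D2 arb.
  have L1 i : L2fun (fun x => p1 i (x, r)) by split; [exact: section_meas (ec_mp H1 i)|exact: q1].
  have L2 i : L2fun (fun x => p2 i (x, r)) by split; [exact: section_meas (ec_mp H2 i)|exact: q2].
  split=> [i|a0 al La0 Lal orth]; first exact: (L2fun_sub (L1 i) (L2 i)).2.
  rewrite (Rintegral_mulBr (ec_L2 H1 r) (ec_L2 H2 r) La0) (D1 _ _ La0 Lal orth) (D2 _ _ La0 Lal orth).
  rewrite -opprD -sumrB; congr (- _); apply: eq_bigr => i _.
  by rewrite (Rintegral_mulBr (L1 i) (L2 i) (Lal i)).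
- move=> psi Tpsi; have Lpsi := L2fun_test bO Tpsi.
  have [c1 i1 l1] := ec_initial H1 Tpsi; have [c2 i2 l2] := ec_initial H2 Tpsi.
  have E t := Rintegral_mulBl (ec_L2 H1 t) (ec_L2 H2 t) Lpsi.
  split.
  + rewrite (_ : (fun t => _) = fun t => \int[mux]_x (u1 (x, t) * psi x) - \int[mux]_x (u2 (x, t) * psi x)).
      by move=> t; apply: cvgB; [exact: c1|exact: c2].
    exact/funext.
  + by rewrite E i1 i2 subrr.
  + have -> : (fun h : R => h^-1 * \int[mux]_x ((u1 (x, a + h) - u2 (x, a + h)) * psi x)) =
        (fun h : R => h^-1 * \int[mux]_x (u1 (x, a + h) * psi x) -
                      h^-1 * \int[mux]_x (u2 (x, a + h) * psi x)).
      by apply/funext => h; rewrite E mulrBr.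
    rewrite -[X in _ --> X](subr0 (0 : R)); apply: cvgB.
      exact: l1.
    exact: l2.
Qed.

End clean.

Section fubini_factor.
Context d1 d2 (T1 : measurableType d1) (T2 : measurableType d2) (R : realType).
Variable m1 : {sigma_finite_measure set T1 -> \bar R}.
Variable m2 : {sigma_finite_measure set T2 -> \bar R}.
Local Notation m12 := (m1 \x m2)%E.

Lemma ae_rintegrable2 (f : T1 * T2 -> R) (D1 : set T1) (D2 : set T2) :
  measurable D1 -> measurable D2 -> rintegrable m12 (D1 `*` D2) f ->
  {ae m2, forall y, D2 y -> rintegrable m1 D1 (fun x => f (x, y))}.
Proof.
move=> mD1 mD2; have mD : measurable (D1 `*` D2) by exact: measurableX.
move=> /(rintegrable_mkcond _ _ mD).1 ig.
have := ae_integrable2 ig; apply: filterS => y iy D2y.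
apply/(rintegrable_mkcond _ _ mD1); apply: (eq_rintegrable measurableT _ iy) => x _.
by rewrite !patchE in_setX /= (mem_set D2y) andbT.
Qed.

(** The factor depending on y alone leaves the inner integral at those y where the section of [f] is
    integrable, which is almost everywhere. *)
Lemma Fubini_Rintegral21_factor (f : T1 * T2 -> R) (k : T2 -> R) (D1 : set T1) (D2 : set T2) :
  measurable D1 -> measurable D2 -> rintegrable m12 (D1 `*` D2) f -> measurable_fun D2 k ->
  rintegrable m12 (D1 `*` D2) (fun z => f z * k z.2) ->
  \int[m12]_(z in D1 `*` D2) (f z * k z.2) =
  \int[m2]_(y in D2) (\int[m1]_(x in D1) f (x, y) * k y).
Proof.
move=> mD1 mD2 i_f mk ifk; rewrite -(Fubini_Rintegral21 mD1 mD2 ifk).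
apply: ae_eq_Rintegral => //.
- exact: (rintegrable_meas (rintegrable_Rintegral21 mD1 mD2 ifk)).
- apply: measurable_funM => //; exact: (rintegrable_meas (rintegrable_Rintegral21 mD1 mD2 i_f)).
- have := ae_rintegrable2 mD1 mD2 i_f; apply: filterS => y iy D2y /=.
  by rewrite (RintegralZr _ mD1 (iy D2y)).
Qed.

End fubini_factor.

(** * The equation tested with products, and uniqueness in the energy class *)

Section weak_form.
Context (R : realType) (n : nat).
Local Notation V := 'rV[R]_n.
Local Notation VR := (V * measurableTypeR R)%type.
Local Notation e_ i := (delta_mx ord0 i : V).
Local Notation mux := (lebesgue_rv R n).
Local Notation mut := (@lebesgue_measure R).
Local Notation muxt := (lebesgue_rv R n \x @lebesgue_measure R)%E.
Implicit Types (Omega : set V) (a b : R) (u : VR -> R) (p : 'I_n -> VR -> R)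
  (c : V -> R) (F : VR -> R).

(** The requirements of [energy_unique], asked at every point of space with bounds uniform in space;
    [L] is the range of delays on which the kernel is controlled. *)
Record coefficients (L : R) c F : Prop := Coefficients {
  co_mc : measurable_fun setT c;
  co_mF : measurable_fun setT F;
  co_c : exists k0 k1 : R, 0 < k0 /\ forall x, k0 <= c x <= k1;
  co_dF : forall x t, derivable (fun t : R => F (x, t)) t 1;
  co_cDF : forall x, continuous ('D_1 (fun t : R => F (x, t)));
  co_FM : exists M, forall x t, 0 <= t <= L ->
    `|F (x, t)| <= M /\ `|'D_1 (fun t : R => F (x, t)) t| <= M }.

(** The pairing of -2 P u with psi(x) th(t). Space integrals run over all of R^n, as [psi] and its
    derivatives vanish off Omega. *)
Definition weak_form a b c F u p (psi : V -> R) (th : R -> R) : R :=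
  \int[muxt]_(z in setT `*` `[a, b]) (u z * psi z.1 * 'D_1 ('D_1 th) z.2) +
  \sum_i \int[muxt]_(z in setT `*` `[a, b])
    (memory_op a c F (p i) z * 'D_(e_ i) psi z.1 * th z.2).

Let itv_meas (a t : R) : measurable (`[a, t]%classic : set (measurableTypeR R)).
Proof. by []. Qed.

Lemma ec_causal_u Omega a b u p x : energy_class Omega a b u p -> causal a (fun t => u (x, t)).
Proof.
move=> H; have mu_ : measurable_fun setT (fun t : measurableTypeR R => u (x, t)).
  exact: (measurable_fun_pair2 x (ec_mu H)).
split=> // [t ta|B]; first by apply: (ec_u0 H) => -[_ /andP[]]; rewrite leNgt ta.
have [aB|Ba] := leP (a - 1) B; last first.
  by rewrite set_itv_ge ?bnd_simp -?ltNge//; exact: integrable_set0.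
apply: (Rintegral_sqr_le aB _ _).1; first exact: measurable_funTS.
exact: rintegrableS (ec_ux H x).
Qed.

Lemma ec_causal_p Omega a b u p i x : energy_class Omega a b u p -> causal a (fun t => p i (x, t)).
Proof.
move=> H; have mp_ : measurable_fun setT (fun t : measurableTypeR R => p i (x, t)).
  exact: (measurable_fun_pair2 x (ec_mp H i)).
split=> // [t ta|B]; first by apply: (ec_p0 H) => -[_ /andP[]]; rewrite leNgt ta.
have [aB|Ba] := leP (a - 1) B; last first.
  by rewrite set_itv_ge ?bnd_simp -?ltNge//; exact: integrable_set0.
apply: (Rintegral_sqr_le aB _ _).1; first exact: measurable_funTS.
exact: rintegrableS (ec_px H i x).
Qed.

(** Cauchy-Schwarz in time: [N] is the square root of (b - a) times the sum of the time integrals of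
    u^2 and of the squares of all gradient components, so that one function dominates everything. *)
Lemma ec_bound Omega a b u p : a <= b -> energy_class Omega a b u p ->
  exists N : V -> R, [/\ measurable_fun setT N,
    rintegrable mux setT (fun x => N x ^+ 2),
    forall x, \int[mut]_(t in `[a, b]) `|u (x, t)| <= N x &
    forall i x, \int[mut]_(t in `[a, b]) `|p i (x, t)| <= N x].
Proof.
move=> ab H.
have mD : measurable ([set: V] `*` (`[a, b] : set (measurableTypeR R))) by exact: measurableX.
pose S (f : VR -> R) x := \int[mut]_(t in `[a, b]) f (x, t) ^+ 2.
have S0 f x : 0 <= S f x by apply: Rintegral_ge0 => t _; exact: sqr_ge0.
have iS f : rintegrable muxt setT (fun z => f z ^+ 2) -> rintegrable mux setT (S f).
  move=> i_f; apply: (rintegrable_Rintegral12 (f := fun z => f z ^+ 2) measurableT (itv_meas a b)).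
  exact: rintegrableS i_f.
pose N2 x := (b - a) * (S u x + \sum_i S (p i) x).
have iN2 : rintegrable mux setT N2.
  apply: rintegrableZl => //; apply: rintegrableD => //; first exact: iS (ec_u2 H).
  by apply: rintegrable_sum => // i; exact: iS (ec_p2 H i).
have sum0 x : 0 <= \sum_i S (p i) x by apply: sumr_ge0.
have N20 x : 0 <= N2 x by rewrite mulr_ge0 ?subr_ge0// addr_ge0.
have le_sqrt (f : VR -> R) x : measurable_fun setT f ->
    rintegrable mut setT (fun t => f (x, t) ^+ 2) -> (b - a) * S f x <= N2 x ->
    \int[mut]_(t in `[a, b]) `|f (x, t)| <= Num.sqrt (N2 x).
  move=> mf i_f fN; have mx : measurable_fun setT (fun t : measurableTypeR R => f (x, t)).
    exact: (measurable_fun_pair2 x mf).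
  have if2 : rintegrable mut `[a, b] (fun t => f (x, t) ^+ 2) by exact: rintegrableS i_f.
  have mx' : measurable_fun `[a, b] (fun t : measurableTypeR R => f (x, t)).
    exact: measurable_funTS.
  have [_ le2] := Rintegral_sqr_le ab mx' if2.
  rewrite -[leLHS]ger0_norm; last by apply: Rintegral_ge0 => t _; exact: normr_ge0.
  by rewrite -sqrtr_sqr ler_wsqrtr// (le_trans le2).
exists (fun x => Num.sqrt (N2 x)); split.
- apply: (measurableT_comp (f := @Num.sqrt R)); last exact: (rintegrable_meas iN2).
  by apply: continuous_measurable_fun; exact: sqrt_continuous.
- by apply: (eq_rintegrable measurableT _ iN2) => x _; rewrite sqr_sqrtr.
- move=> x; apply: le_sqrt; [exact: ec_mu H|exact: ec_ux H x|].
  by rewrite ler_wpM2l ?subr_ge0// lerDl.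
- move=> i x; apply: le_sqrt; [exact: ec_mp H i|exact: ec_px H i x|].
  rewrite /N2 ler_wpM2l ?subr_ge0//; apply: (@le_trans _ _ (\sum_i S (p i) x)); last by rewrite lerDr.
  by rewrite (bigD1 i)//= lerDl; apply: sumr_ge0.
Qed.

Lemma ec_memory_op L Omega a b c F u p i w t : a <= b -> b - a <= L -> coefficients L c F ->
  energy_class Omega a b u p -> L2fun w -> a <= t <= b ->
  rintegrable muxt (setT `*` `[a, t]) (fun z => memory_op a c F (p i) z * w z.1).
Proof.
move=> ab baL K H [mw iw] atb; have [N [mN iN uN pN]] := ec_bound ab H.
have [c0 [c1 [c0_gt0 c01]]] := co_c K; have [M FM] := co_FM K.
have L0 : 0 <= L by apply: le_trans baL; rewrite subr_ge0.
have pN1 x : \int[mut]_(t in `[a, b]) `|p i (x, t)| <= 1 * N x by rewrite mul1r.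
exact: (rintegrable_memory_op mN (co_mc K) (co_mF K) uN iN c0_gt0 c01 L0 baL (co_dF K) FM
  (ec_mp H i) (fun x => ec_causal_p i x H) ler01 pN1 mw iw atb).
Qed.

Let multh (f : VR -> R) (th : R -> R) a t : continuous th ->
  rintegrable muxt (setT `*` `[a, t]) f ->
  rintegrable muxt (setT `*` `[a, t]) (fun z => f z * th z.2).
Proof.
move=> cth i_f; have [M M0 HM] := continuous_bounded_itv a t cth.
have mD : measurable ([set: V] `*` (`[a, t] : set (measurableTypeR R))) by exact: measurableX.
apply: (rintegrable_le mD _ _ (rintegrableZl M mD (rintegrable_norm i_f))).
  apply: measurable_funM; first exact: (rintegrable_meas i_f).
  apply: measurable_funTS; apply: (measurableT_comp (f := th)) => //.
  exact: continuous_measurable_fun.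
move=> z [_ /= zt]; rewrite normrM mulrC ler_wpM2r//; apply: HM.
by rewrite /= in zt.
Qed.

Section terms.
Variables (L : R) (Omega : set V) (a b : R) (c : V -> R) (F : VR -> R).
Hypotheses (ab : a < b) (baL : b - a <= L) (K : coefficients L c F).
Hypothesis bO : bounded_set Omega.
Variables (psi : V -> R) (th : R -> R).
Hypotheses (Tpsi : test_function Omega psi) (Tth : test_function `]a, b[%classic th).

Let abb : a <= b <= b. Proof. by rewrite lexx ltW. Qed.

Let cth : continuous th. Proof. by have [/smooth_continuous] := Tth. Qed.

Let cth2 : continuous ('D_1 ('D_1 th)).
Proof. by have [sth _ _] := Tth; apply: smooth_continuous; do 2 apply: smooth_derive. Qed.

Lemma rintegrable_term0_cst u p : energy_class Omega a b u p ->
  rintegrable muxt (setT `*` `[a, b]) (fun z => u z * psi z.1).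
Proof.
move=> H.
have mD : measurable ([set: V] `*` (`[a, b] : set (measurableTypeR R))) by exact: measurableX.
have [mpsi ipsi] := L2fun_test bO Tpsi.
have mpsi1 : measurable_fun setT (fun z : VR => psi z.1).
  exact: (measurableT_comp mpsi measurable_fst).
apply: (rintegrable_mulL2 mD).
- exact: measurable_funTS (ec_mu H).
- exact: measurable_funTS.
- exact: rintegrableS (ec_u2 H).
- apply: (rintegrable_prod measurableT (itv_meas a b) _ _ _ (rintegrableZl (b - a) measurableT ipsi)).
  + by apply: measurable_funTS; exact: measurable_funX.
  + move=> x _.
    exact: (rintegrable_cst (psi x ^+ 2) (itv_meas a b) (lebesgue_itv_lty a b)).
  + move=> x _ /=; rewrite Rintegral_cst//.
    have E : fine (mut `[a, b]%classic) = b - a by rewrite lebesgue_measure_itv/= lte_fin ab.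
    by rewrite [X in _ * X <= _](_ : _ = b - a)// mulrC ger0_norm ?sqr_ge0.
Qed.

Lemma rintegrable_term0 u p : energy_class Omega a b u p ->
  rintegrable muxt (setT `*` `[a, b]) (fun z => u z * psi z.1 * 'D_1 ('D_1 th) z.2).
Proof.
by move=> H; apply: (multh cth2); exact: rintegrable_term0_cst H.
Qed.

Lemma rintegrable_term i u p : energy_class Omega a b u p ->
  rintegrable muxt (setT `*` `[a, b])
    (fun z => memory_op a c F (p i) z * 'D_(e_ i) psi z.1 * th z.2).
Proof.
move=> H; exact: (multh cth (ec_memory_op i (ltW ab) baL K H
  (L2fun_test bO (test_function_derive _ Tpsi)) abb)).
Qed.

Let convB i u1 u2 p1 p2 : energy_class Omega a b u1 p1 -> energy_class Omega a b u2 p2 ->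
  forall z, memory_op a c F (fun z => p1 i z - p2 i z) z =
    memory_op a c F (p1 i) z - memory_op a c F (p2 i) z.
Proof.
move=> H1 H2 [x t]; rewrite /memory_op /convx /=.
have cF : continuous (fun t : R => F (x, t)).
  by move=> s; apply/differentiable_continuous/derivable1_diffP; exact: co_dF K x s.
have i1 := rintegrable_conv t cF (ec_causal_p i x H1).
have i2 := rintegrable_conv t cF (ec_causal_p i x H2).
under eq_Rintegral do rewrite mulrBr.
by rewrite (RintegralB (itv_meas a t) i1 i2); ring.
Qed.

Let addrB_sum (A B : R) (X Y Z : 'I_n -> R) : (forall i, X i = Y i - Z i) ->
  A - B + \sum_i X i = A + \sum_i Y i - (B + \sum_i Z i).
Proof. by move=> E; rewrite (eq_bigr _ (fun i _ => E i)) sumrB opprD addrACA. Qed.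

Lemma weak_formB u1 u2 p1 p2 : energy_class Omega a b u1 p1 -> energy_class Omega a b u2 p2 ->
  weak_form a b c F (fun z => u1 z - u2 z) (fun i z => p1 i z - p2 i z) psi th =
  weak_form a b c F u1 p1 psi th - weak_form a b c F u2 p2 psi th.
Proof.
move=> H1 H2; rewrite /weak_form.
have mD : measurable ([set: V] `*` (`[a, b] : set (measurableTypeR R))) by exact: measurableX.
have -> : \int[muxt]_(z in setT `*` `[a, b]) ((u1 z - u2 z) * psi z.1 * 'D_1 ('D_1 th) z.2) =
  \int[muxt]_(z in setT `*` `[a, b]) (u1 z * psi z.1 * 'D_1 ('D_1 th) z.2) -
  \int[muxt]_(z in setT `*` `[a, b]) (u2 z * psi z.1 * 'D_1 ('D_1 th) z.2).
  rewrite -(RintegralB mD (rintegrable_term0 H1) (rintegrable_term0 H2)).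
  by apply: eq_Rintegral => z _; rewrite !mulrBl.
have E i : \int[muxt]_(z in setT `*` `[a, b])
      (memory_op a c F (fun z => p1 i z - p2 i z) z * 'D_(e_ i) psi z.1 * th z.2) =
    \int[muxt]_(z in setT `*` `[a, b]) (memory_op a c F (p1 i) z * 'D_(e_ i) psi z.1 * th z.2) -
    \int[muxt]_(z in setT `*` `[a, b]) (memory_op a c F (p2 i) z * 'D_(e_ i) psi z.1 * th z.2).
  rewrite -(RintegralB mD (rintegrable_term i H1) (rintegrable_term i H2)).
  by apply: eq_Rintegral => z _; rewrite (convB i H1 H2) !mulrBl.
exact: addrB_sum E.
Qed.

Lemma weak_formE u p : energy_class Omega a b u p ->
  weak_form a b c F u p psi th =
  \int[mut]_(t in `[a, b]) (\int[mux]_x (u (x, t) * psi x) * 'D_1 ('D_1 th) t) +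
  \int[mut]_(t in `[a, b])
    ((\sum_i \int[mux]_x (memory_op a c F (p i) (x, t) * 'D_(e_ i) psi x)) * th t).
Proof.
move=> H.
have mth : measurable_fun `[a, b] (th : measurableTypeR R -> R).
  by apply: measurable_funTS; exact: continuous_measurable_fun.
have mth2 : measurable_fun `[a, b] ('D_1 ('D_1 th) : measurableTypeR R -> R).
  by apply: measurable_funTS; exact: continuous_measurable_fun.
have i0 := rintegrable_term0_cst H.
rewrite /weak_form (Fubini_Rintegral21_factor measurableT (itv_meas a b) i0 mth2 (rintegrable_term0 H)).
congr (_ + _).
have ii i := ec_memory_op i (ltW ab) baL K H (L2fun_test bO (test_function_derive (e_ i) Tpsi)) abb.
have E i := Fubini_Rintegral21_factor measurableT (itv_meas a b) (ii i) mth (rintegrable_term i H).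
rewrite (eq_bigr _ (fun i _ => E i)) -(Rintegral_sum (itv_meas a b)).
  by apply: eq_Rintegral => t _; rewrite mulr_suml.
move=> i; apply: rintegrable_mul_continuous => //.
exact: (rintegrable_Rintegral21 measurableT (itv_meas a b) (ii i)).
Qed.

End terms.

Let prim_norm_le a (h : R -> R) t b : causal a h -> t <= b ->
  \int[mut]_(s in `[a, t]) `|h s| <= \int[mut]_(s in `[a, b]) `|h s|.
Proof.
move=> [mh h0 ih] tb.
have ch : causal a (fun s => `|h s|).
  split; [exact: measurableT_comp|by move=> s /h0 ->; rewrite normr0|].
  by move=> B; exact: rintegrable_norm.
have := prim_le ch tb; under [X in _ <= X -> _]eq_Rintegral do rewrite normr_id.
by apply: le_trans; exact: ler_norm.
Qed.

(** By causality, memory at a time before T involves only the gradient before T. The solution on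
    [a, b] may thus be restricted to [a, T], where [energy_unique] applies; Fubini turns vanishing
    of almost every slice into vanishing almost everywhere. *)
Lemma energy_class_unique L Omega a b T c F u p : a < T -> T <= b -> b - a <= L ->
  coefficients L c F -> bounded_set Omega -> energy_class Omega a b u p ->
  (forall psi th, test_function Omega psi -> test_function `]a, T[%classic th ->
     weak_form a b c F u p psi th = 0) ->
  {ae muxt, forall z : VR, z.2 <= T -> u z = 0}.
Proof.
move=> aT Tb baL K bO H eqn; have ab := lt_le_trans aT Tb.
have [N [mN iN uN pN]] := ec_bound (ltW ab) H.
have [c0 [c1 [c0_gt0 c01]]] := co_c K; have [M FM] := co_FM K.
have L0 : 0 <= L by apply: le_trans baL; rewrite subr_ge0 ltW.
have cu x := ec_causal_u x H; have cp i x := ec_causal_p i x H.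
have uNT x : \int[mut]_(t in `[a, T]) `|u (x, t)| <= N x.
  exact: le_trans (prim_norm_le (cu x) Tb) (uN x).
have pNT i x : \int[mut]_(t in `[a, T]) `|p i (x, t)| <= N x.
  exact: le_trans (prim_norm_le (cp i x) Tb) (pN i x).
have TaL : T - a <= L by apply: le_trans baL; rewrite lerD2r.
have sub t : a <= t <= T -> a <= t <= b by move=> /andP[-> /le_trans ->].
have subT : (`]a, T[%classic : set R) `<=` `]a, b[%classic.
  by apply: subset_itvl; rewrite bnd_simp.
have testL2 psi w : grad_test Omega psi w ->
    [/\ measurable_fun setT psi, rintegrable mux setT (fun x => psi x ^+ 2),
      forall i, measurable_fun setT (w i) & forall i, rintegrable mux setT (fun x => w i x ^+ 2)].
  move=> [Tpsi wE]; have [mpsi ipsi] := L2fun_test bO Tpsi.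
  have Lw i : L2fun (w i) by rewrite wE; exact: (L2fun_test bO (test_function_derive _ Tpsi)).
  by split=> // i; have [] := Lw i.
have dual : {ae mut, forall r, a <= r <= T ->
  forall (a0 : V -> R) (al : 'I_n -> V -> R),
    measurable_fun setT a0 -> rintegrable mux setT (fun x => a0 x ^+ 2) ->
    (forall i, measurable_fun setT (al i)) ->
    (forall i, rintegrable mux setT (fun x => al i x ^+ 2)) ->
    (forall psi w, grad_test Omega psi w ->
       \int[mux]_x (a0 x * psi x) = - \sum_i \int[mux]_x (al i x * w i x)) ->
    \int[mux]_x (a0 x * u (x, r)) = - \sum_i \int[mux]_x (al i x * p i (x, r))}.
  have := ec_dual H; apply: (@filterS _ _ (ae_filter_ringOfSetsType mut)) => r Hr arT.
  move=> a0 al ma ia mal ial orth; have [_ {}Hr] := Hr (sub _ arT).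
  by apply: Hr => // i; split.
have init psi w : grad_test Omega psi w ->
  [/\ {within `[a, T], continuous (fun t => \int[mux]_x (u (x, t) * psi x))},
      \int[mux]_x (u (x, a) * psi x) = 0 &
      h^-1 * \int[mux]_x (u (x, a + h) * psi x) @[h --> 0^'+] --> (0 : R)].
  move=> [Tpsi _]; have [gc g0 gl] := ec_initial H Tpsi; split=> //.
  by apply: continuous_subspaceW gc; apply: subset_itvl; rewrite bnd_simp.
(* Time test functions supported in ]a, T[ turn integrals over [a, b], as in [weak_form], into
   integrals over [a, T]. *)
have out (f g : R -> R) : test_function `]a, T[%classic g ->
    \int[mut]_(t in `[a, b]) (f t * g t) = \int[mut]_(t in `[a, T]) (f t * g t).
  move=> Tg; rewrite Rintegral_mkcond [RHS]Rintegral_mkcond; apply: eq_Rintegral => t _.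
  rewrite !patchE !mem_setE; have [tT|tT] := boolP (t \in `[a, T]).
    have -> // : t \in `[a, b]; move: tT; rewrite !in_itv/=; exact: sub.
  have -> : g t = 0.
    by apply: (test_function_out Tg) => /subset_itv_oo_cc; exact/negP.
  by rewrite mulr0 if_same.
have eq1 psi w th : grad_test Omega psi w -> test_function `]a, T[%classic th ->
  \int[mut]_(t in `[a, T]) (\int[mux]_x (u (x, t) * psi x) * 'D_1 ('D_1 th) t) +
  \int[mut]_(t in `[a, T]) ((\sum_i \int[mux]_x (memory_op a c F (p i) (x, t) * w i x)) * th t) = 0.
  move=> [Tpsi wE] Tth; have Tth' := test_function_subset subT Tth.
  have Tth2 : test_function `]a, T[%classic ('D_1 ('D_1 th)).
    by do 2 apply: test_function_derive.
  have := eqn _ _ Tpsi Tth; rewrite (weak_formE ab baL K bO Tpsi Tth' H).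
  rewrite (out _ _ Tth) (out _ _ Tth2) => E; rewrite -[RHS]E.
  congr (_ + _); apply: eq_Rintegral => t _; congr (_ * _); apply: eq_bigr => i _.
  by rewrite wE.
have iut t : a <= t <= T -> rintegrable mux setT (fun x => u (x, t) ^+ 2).
  by move=> /sub; exact: ec_ut H t.
have zero := energy_unique aT (ec_mu H) (ec_mp H) mN (co_mc K) (co_mF K) cu cp uNT pNT iN iut
  c0_gt0 c01 L0 TaL (co_dF K) (co_cDF K) FM testL2 dual init eq1.
have mT : measurable (`[a, T]%classic : set (measurableTypeR R)) by [].
have iu2 : rintegrable muxt (setT `*` `[a, T]) (fun z => u z ^+ 2).
  by apply: rintegrableS (ec_u2 H) => //; exact: measurableX.
have int0 : \int[muxt]_(z in setT `*` `[a, T]) u z ^+ 2 = 0.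
  rewrite -(Fubini_Rintegral21 measurableT mT iu2).
  transitivity (\int[mut]_(t in `[a, T]) (0 : R)); last by rewrite Rintegral_cst// mul0r.
  apply: ae_eq_Rintegral => //.
    exact: (rintegrable_meas (rintegrable_Rintegral21 measurableT mT iu2)).
have mXT : measurable ([set: V] `*` (`[a, T] : set (measurableTypeR R))) by exact: measurableX.
have := Rintegral_ae0 mXT iu2 (fun z _ => sqr_ge0 _) int0.
apply: filterS => -[x t] /= H0 tT; have [ta|at_] := ltP t a.
  by have [_ -> //] := cu x.
have /eqP : u (x, t) ^+ 2 = 0 by apply: H0; split=> //=; rewrite in_itv/= at_.
by rewrite sqrf_eq0 => /eqP.
Qed.

End weak_form.

Section null_sets.
Context d (T : measurableType d) (R : realType) (mu : {measure set T -> \bar R}).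

Lemma Rintegral_setD_null (D E : set T) (f : T -> R) : measurable D -> measurable E ->
  mu E = 0%E -> measurable_fun D f ->
  \int[mu]_(x in D) f x = \int[mu]_(x in D `\` E) f x.
Proof.
move=> mD mE E0 mf; have mDE : measurable (D `\` E) by exact: measurableD.
rewrite Rintegral_mkcond [RHS]Rintegral_mkcond; apply: ae_eq_Rintegral => //.
- exact/(measurable_restrictT f mD).
- apply/(measurable_restrictT f mDE); apply: measurable_funS mf => // x [].
- exists E; split=> // x /=; apply: contra_notP => Ex _.
  by rewrite !patchE in_setD (memNset Ex) andbT.
Qed.

Lemma ae_negligible_set (P : T -> Prop) : {ae mu, forall x, P x} ->
  exists E : set T, [/\ measurable E, mu E = 0%E & forall x, ~ E x -> P x].
Proof.
move=> [E [mE E0 PE]]; exists E; split=> // x; apply: contra_notP => nP.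
exact: PE.
Qed.

Lemma Rintegral_eq_supp (D D' : set T) (f g : T -> R) :
  (forall x, D x -> D' x -> f x = g x) -> (forall x, D x -> ~ D' x -> f x = 0) ->
  (forall x, D' x -> ~ D x -> g x = 0) ->
  \int[mu]_(x in D) f x = \int[mu]_(x in D') g x.
Proof.
move=> fg f0 g0; rewrite Rintegral_mkcond [RHS]Rintegral_mkcond; apply: eq_Rintegral => x _.
rewrite !patchE; case: ifPn => [/set_mem Dx|Dx]; case: ifPn => [/set_mem D'x|D'x] //.
- exact: fg.
- by apply: f0 => // /mem_set; exact/negP.
- by apply/esym/g0 => // /mem_set; exact/negP.
Qed.

Lemma Rintegral_zero (D : set T) (f : T -> R) : measurable D -> (forall x, D x -> f x = 0) ->
  \int[mu]_(x in D) f x = 0.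
Proof.
move=> mD f0; rewrite (@eq_Rintegral _ _ _ mu D (fun=> 0)); first by rewrite Rintegral_cst// mul0r.
by move=> x /set_mem; exact: f0.
Qed.

Lemma rintegrable_patch (D : set T) (f : T -> R) : measurable D ->
  rintegrable mu D f -> rintegrable mu setT (f \_ D).
Proof. by move=> mD; exact: (rintegrable_mkcond _ _ mD).1. Qed.

End null_sets.

Section product_test.
Context (R : realType) (n : nat).
Local Notation V := 'rV[R]_n.
Local Notation e_ i := (delta_mx ord0 i : V).
Variables (psi : V -> R) (th : R -> R).
Let phi (z : V * R) := psi z.1 * th z.2.

Lemma test_function_prod (Omega : set V) (a b : R) : test_function Omega psi ->
  test_function `]a, b[%classic th -> test_function (Omega `*` `]a, b[) phi.
Proof.
move=> [sp cp Op] [st ct Ot].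
have sub : closure [set z | phi z != 0] `<=`
    closure [set x | psi x != 0] `*` closure [set t | th t != 0].
  have cl : closed (closure [set x | psi x != 0] `*` closure [set t | th t != 0]).
    rewrite (_ : _ `*` _ = (fst @^-1` closure [set x | psi x != 0]) `&`
      (snd @^-1` closure [set t | th t != 0])); last by apply/seteqP; split.
    by apply: closedI; apply: closed_comp => [z _|]; [exact: cvg_fst|exact: closed_closure|
      exact: cvg_snd|exact: closed_closure].
  rewrite [X in X `<=` _]closureE => z; apply; split=> // y.
  rewrite /phi /= mulf_eq0 negb_or => /andP[p0 t0].
  by split; exact: subset_closure.
split.
- exact: (smoothM (smooth_fst sp) (smooth_snd st)).
- by apply: subclosed_compact (compact_setX cp ct) sub; exact: closed_closure.
- by apply: subset_trans sub _ => z [/Op ? /Ot].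
Qed.

Hypotheses (sp : smooth_on setT psi) (st : smooth_on setT th).

Let d1 z v : derivable (fun z : V * R => psi z.1) z v.
Proof. by apply: smooth_derivable; exact: smooth_fst. Qed.

Let d2 z v : derivable (fun z : V * R => th z.2) z v.
Proof. by apply: smooth_derivable; exact: smooth_snd. Qed.

Lemma Dx_prod i z : Dx i phi z = 'D_(e_ i) psi z.1 * th z.2.
Proof.
have E1 : 'D_((e_ i, 0) : V * R) (fun z : V * R => psi z.1) z = 'D_(e_ i) psi z.1.
  exact: (@derive_affine R V (V * R)%type fst fst).
have E2 : 'D_((e_ i, 0) : V * R) (fun z : V * R => th z.2) z = 0.
  by rewrite (@derive_affine R R (V * R)%type snd snd)// derive0.
rewrite /Dx (deriveM (@d1 z _) (@d2 z _)).
by rewrite E1 E2 scaler0 add0r mulrC.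
Qed.

Lemma Dt_prod z : Dt phi z = psi z.1 * 'D_1 th z.2.
Proof.
have E1 : 'D_((0, 1) : V * R) (fun z : V * R => psi z.1) z = 0.
  by rewrite (@derive_affine R V (V * R)%type fst fst)// derive0.
have E2 : 'D_((0, 1) : V * R) (fun z : V * R => th z.2) z = 'D_1 th z.2.
  exact: (@derive_affine R R (V * R)%type snd snd).
rewrite /Dt (deriveM (@d1 z _) (@d2 z _)).
by rewrite E1 E2 scaler0 addr0.
Qed.

End product_test.

Section solution_class_algebra.
Variable R : realType.
Implicit Types x y d t c p A : R.

Lemma factor_sub x y d t : x * d * t - (x - y) * d * t = y * d * t.
Proof. by ring. Qed.

Lemma factor_subr x y d t : (x - y) * d * t = x * d * t - y * d * t.
Proof. by ring. Qed.

Lemma reassoc c p d t : c * (p * (d * t)) = c * p * d * t.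
Proof. by ring. Qed.

Lemma zero_factor c x d t : x = 0 -> c * x * d * t = 0.
Proof. by move=> ->; rewrite mulr0 !mul0r. Qed.

Lemma mulr_zero c x : x = 0 -> c * x = 0.
Proof. by move=> ->; rewrite mulr0. Qed.

Lemma reassocC c d t : d * t * c = c * d * t.
Proof. by ring. Qed.

Lemma halve (I : finType) A (X Y Z : I -> R) : (forall i, Z i = X i - Y i) ->
  A + \sum_i Z i = - 2 * (- 2^-1 * (A + \sum_i X i - \sum_i Y i)).
Proof. by move=> E; rewrite (eq_bigr _ (fun i _ => E i)) sumrB; lra. Qed.

(** A zero kernel turns [memory_op] into multiplication by the speed. Integrability of the speed
    term is then an instance of the general statement, and that of the memory term follows by
    difference. *)
Lemma coefficients_memoryless n L (c : 'rV[R]_n -> R) F : coefficients L c F ->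
  coefficients L c (fun=> 0).
Proof.
move=> K; have d0 (t : R) : 'D_1 (fun _ : R => 0 : R) t = 0 by exact: derive_cst.
split; [exact: co_mc K|by []|exact: co_c K|by move=> x t; exact: derivable_cst| |].
  by move=> x; rewrite (_ : 'D_(1 : R) _ = fun=> 0); [exact: cst_continuous|exact/funext].
by exists 0 => x t _; rewrite d0 normr0.
Qed.

Lemma memoryless dX (X : measurableType dX) (a : R) (k : X -> R)
  (h : X * measurableTypeR R -> R) (z : X * measurableTypeR R) d t :
  memory_op a k (fun=> 0) h z * d * t = k z.1 * h z * d * t.
Proof.
rewrite /memory_op /convx; congr (_ * _ * _).
by under eq_Rintegral do rewrite mul0r; rewrite Rintegral_cst// mul0r subr0.
Qed.

End solution_class_algebra.

(** * From generalized solutions to the energy class *)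

Section solution_class.
Context (R : realType) (n : nat).
Local Notation V := 'rV[R]_n.
Local Notation VR := (V * measurableTypeR R)%type.
Local Notation e_ i := (delta_mx ord0 i : V).
Local Notation mux := (lebesgue_rv R n).
Local Notation mut := (@lebesgue_measure R).
Local Notation muxt := (lebesgue_rv R n \x @lebesgue_measure R)%E.

Variables (Omega : set V) (a b L : R) (c c' : V -> R) (G F f u : V * R -> R).
Hypotheses (oO : open Omega) (bO : bounded_set Omega) (ab : a < b) (baL : b - a <= L).
Hypothesis K : coefficients L c' F.
Hypothesis cE : forall x, Omega x -> c' x = c x.
Hypothesis FE : forall x t, Omega x -> 0 <= t <= b - a -> F (x, t) = G (x, t).
Variables (p : V * R -> V) (q : V * R -> R).
Hypothesis Hen : energy_space Omega a b u p q.
Hypothesis Heq : viscoacoustic_eq c G Omega a b f u p.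
Hypothesis Hinit : zero_initial_data Omega a u.

Let mab : measurable (`[a, b]%classic : set (measurableTypeR R)). Proof. by []. Qed.
Let mO : measurable Omega. Proof. exact: measurable_open_rv. Qed.
Let Q : set VR := Omega `*` `[a, b].
Let mQ : measurable Q. Proof. exact: measurableX. Qed.
Let pp i : VR -> R := fun z => p z ord0 i.

Let u_L2 : mem_L2 muxt Q u. Proof. by have [] := Hen. Qed.
Let p_L2 i : mem_L2 muxt Q (pp i). Proof. by have [_ [+ _] _ _ _] := Hen; exact. Qed.

Let sq_null (g : VR -> R) : mem_L2 muxt Q g ->
  {ae mux, forall x, Omega x -> rintegrable mut `[a, b] (fun t => g (x, t) ^+ 2)}.
Proof.
move=> /mem_L2P[mg ig]; have := ae_integrable1 (rintegrable_patch mQ ig).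
apply: filterS => x ix Ox; apply/(rintegrable_mkcond _ _ mab).
apply: (eq_rintegrable measurableT _ ix) => t _.
by rewrite !patchE in_setX /= (mem_set Ox).
Qed.

(** Fubini gives square integrable time sections at almost every point; a single null set serves the
    solution and all components of its gradient. *)
Let null_set : exists E : set V, [/\ measurable E, mux E = 0%E &
  forall x, Omega x -> ~ E x -> rintegrable mut `[a, b] (fun t => u (x, t) ^+ 2) /\
    forall i, rintegrable mut `[a, b] (fun t => pp i (x, t) ^+ 2)].
Proof.
have np : {ae mux, forall x, forall i, Omega x -> rintegrable mut `[a, b] (fun t => pp i (x, t) ^+ 2)}.
  by apply: filter_forall => i; exact: sq_null (p_L2 i).
have : {ae mux, forall x, Omega x -> rintegrable mut `[a, b] (fun t => u (x, t) ^+ 2) /\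
    forall i, rintegrable mut `[a, b] (fun t => pp i (x, t) ^+ 2)}.
  apply: filterS2 (sq_null u_L2) np => x h1 h2 Ox; split; first exact: h1.
  by move=> i; exact: h2.
move=> /ae_negligible_set[E [mE E0 HE]]; exists E; split=> // x Ox Ex.
exact: HE.
Qed.

Section with_null_set.
Variable E : set V.
Hypotheses (mE : measurable E) (E0 : mux E = 0%E).
Hypothesis HE : forall x, Omega x -> ~ E x ->
  rintegrable mut `[a, b] (fun t => u (x, t) ^+ 2) /\
  forall i, rintegrable mut `[a, b] (fun t => pp i (x, t) ^+ 2).

Let O := Omega `\` E.
Let mO' : measurable O. Proof. exact: measurableD. Qed.
Let Q' : set VR := O `*` `[a, b].
Let mQ' : measurable Q'. Proof. exact: measurableX. Qed.
Let sub : Q' `<=` Q. Proof. by move=> z [[]]. Qed.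
Let nE : set VR := E `*` setT.
Let mnE : measurable nE. Proof. exact: measurableX. Qed.
Let nE0 : muxt nE = 0%E.
Proof. by rewrite /nE [LHS](@product_measure1E _ _ _ _ R mux mut _ _ mE measurableT) [X in (X * _)%E]E0 mul0e. Qed.
Let Q'E : Q' = Q `\` nE.
Proof.
apply/seteqP; split=> [z [[Oz Ez] zt]|z [[Oz zt] nz]]; split=> //.
  by move=> [].
by split=> // Ez; apply: nz.
Qed.

(** Setting the values to 0 on the exceptional points and outside Omega x [a, b] changes no
    integral, and makes the pointwise fields of [energy_class] hold everywhere. *)
Let u' : VR -> R := u \_ Q'.
Let p' i : VR -> R := pp i \_ Q'.

Let patchQ (g : VR -> R) x t : Omega x -> a <= t <= b -> (g \_ Q) (x, t) = g (x, t).
Proof. by move=> Ox atb; rewrite patchE mem_set. Qed.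

Let patch_in (g : VR -> R) x t : O x -> a <= t <= b -> (g \_ Q') (x, t) = g (x, t).
Proof. by move=> Ox atb; rewrite patchE mem_set. Qed.

Let patch_out (g : VR -> R) x t : ~ (O x /\ a <= t <= b) -> (g \_ Q') (x, t) = 0.
Proof.
move=> H; rewrite patchE memNset// => -[/= Ox]; rewrite in_itv/= => atb.
Qed.

Let patch_in' (g : VR -> R) z : Q' z -> (g \_ Q') z = g z.
Proof. by move=> Qz; rewrite patchE mem_set. Qed.

Let patch_out' (g : VR -> R) z : ~ Q' z -> (g \_ Q') z = 0.
Proof. by move=> Qz; rewrite patchE memNset. Qed.

Let patch_time (g : VR -> R) t : a <= t <= b ->
  (fun x => (g \_ Q') (x, t)) = (fun x => g (x, t)) \_ O.
Proof.
move=> atb; apply/funext => x; rewrite [RHS]patchE; case: ifPn => [/set_mem Ox|Ox].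
  exact: patch_in.
by apply: patch_out => -[/mem_set Ox' _]; rewrite Ox' in Ox.
Qed.

Let patch_sq_x (g : VR -> R) x : (Omega x -> ~ E x -> rintegrable mut `[a, b] (fun t => g (x, t) ^+ 2)) ->
  rintegrable mut setT (fun t => (g \_ Q') (x, t) ^+ 2).
Proof.
move=> ig; have [Ox|Ox] := pselect (O x); last first.
  apply: (eq_rintegrable measurableT (f := fun=> 0)); last exact: integrable0.
  by move=> t _; rewrite patch_out ?expr0n// => -[].
have [h1 h2] := Ox; have := rintegrable_patch mab (ig h1 h2).
apply: eq_rintegrable => // t _; rewrite patchE mem_setE in_itv/=; case: ifPn => atb.
  by rewrite patch_in.
by rewrite patch_out ?expr0n// => -[_]; exact/negP.
Qed.

Let meas_patch (g : VR -> R) : mem_L2 muxt Q g -> measurable_fun setT (g \_ Q').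
Proof.
by move=> -[mg _]; apply/(measurable_restrictT g mQ'); apply: measurable_funS mg.
Qed.

Let patch_sq (g : VR -> R) : mem_L2 muxt Q g -> rintegrable muxt setT (fun z => (g \_ Q') z ^+ 2).
Proof.
move=> /mem_L2P[_ ig]; have := rintegrable_patch mQ' (rintegrableS mQ' mQ sub ig).
apply: eq_rintegrable => // z _; rewrite !patchE; case: ifP => _ //.
by rewrite expr0n.
Qed.

Let patch_sq_t (w : V -> R) : mem_L2 mux Omega w -> rintegrable mux setT (fun x => (w \_ O) x ^+ 2).
Proof.
move=> /mem_L2P[_ ig].
have subO : O `<=` Omega by move=> x [].
have := rintegrable_patch mO' (rintegrableS mO' mO subO ig).
apply: eq_rintegrable => // z _; rewrite !patchE; case: ifP => _ //.
by rewrite expr0n.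
Qed.

Let int_patch (w h : V -> R) : measurable_fun Omega w -> measurable_fun Omega h ->
  \int[mux]_x ((w \_ O) x * h x) = \int[mux]_(x in Omega) (w x * h x).
Proof.
move=> mw mh; rewrite (Rintegral_setD_null mO mE E0); last exact: measurable_funM.
apply: Rintegral_eq_supp => // x; first by move=> _ Ox; rewrite patchE mem_set.
  by move=> _ Ox; rewrite patchE memNset// mul0r.
by move=> _ [].
Qed.

Let int_patchr (w h : V -> R) : measurable_fun Omega w -> measurable_fun Omega h ->
  \int[mux]_x (h x * (w \_ O) x) = \int[mux]_(x in Omega) (h x * w x).
Proof.
move=> mw mh; under eq_Rintegral do rewrite mulrC.
by rewrite int_patch//; apply: eq_Rintegral => x _; rewrite mulrC.
Qed.

Let L2_Omega h : L2fun h -> mem_L2 mux Omega h.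
Proof.
move=> [mh ih]; apply/mem_L2P; split; first exact: measurable_funTS.
exact: rintegrableS ih.
Qed.

(** The relation holds for the test functions that approximate [w] in H^1, and both sides are L2
    pairings with fixed functions, so they pass to the limit. *)
Let H10_dual (w : V -> R) (r : V -> V) (a0 : V -> R) (al : 'I_n -> V -> R) :
  H10 Omega w r -> L2fun a0 -> (forall i, L2fun (al i)) ->
  (forall psi w, grad_test Omega psi w ->
     \int[mux]_x (a0 x * psi x) = - \sum_i \int[mux]_x (al i x * w i x)) ->
  \int[mux]_(x in Omega) (a0 x * w x) =
  - \sum_i \int[mux]_(x in Omega) (al i x * r x ord0 i).
Proof.
move=> [Lw Lr [ph Tph cvgph]] La Lal orth.
have Lph k : mem_L2 mux Omega (ph k) by exact/L2_Omega/(L2fun_test bO).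
have Ldph i k : mem_L2 mux Omega ('D_(e_ i) (ph k)).
  by apply/L2_Omega/(L2fun_test bO (test_function_derive _ (Tph k))).
have nn x : (0 <= x ^+ 2 :> R) by exact: sqr_ge0.
have nns k x : 0 <= \sum_i ('D_(e_ i) (ph k) x - r x ord0 i) ^+ 2 by exact: sumr_ge0.
have mtot k : measurable_fun Omega (fun x => (ph k x - w x) ^+ 2
    + \sum_i ('D_(e_ i) (ph k) x - r x ord0 i) ^+ 2).
  apply: measurable_funD.
    by apply: measurable_funX; apply: measurable_funB; [exact: (Lph k).1|exact: Lw.1].
  apply: measurable_sum => i; apply: measurable_funX.
  by apply: measurable_funB; [exact: (Ldph i k).1|exact: (Lr i).1].
have part (g : nat -> V -> R) : (forall k, measurable_fun Omega (g k)) ->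
    (forall k x, 0 <= g k x <= (ph k x - w x) ^+ 2
    + \sum_i ('D_(e_ i) (ph k) x - r x ord0 i) ^+ 2) ->
    (fun k => \int[mux]_(x in Omega) (g k x)%:E)%E @ \oo --> 0%E.
  move=> mg gle; apply: (squeeze_cvge _ _ cvgph); last exact: cvg_cst.
  apply: nearW => k; apply/andP; split.
    by apply: integral_ge0 => x _; rewrite lee_fin; case/andP: (gle k x).
  apply: ge0_le_integral => //.
  - by move=> x _; rewrite lee_fin; case/andP: (gle k x).
  - exact/measurable_EFinP.
  - exact/measurable_EFinP.
  - by move=> x _; rewrite lee_fin; case/andP: (gle k x).
have c0 : \int[mux]_(x in Omega) (ph k x * a0 x) @[k --> \oo] -->
    \int[mux]_(x in Omega) (w x * a0 x).
  apply: cvg_Rintegral_mulL2 => //; [exact: nearW|exact: L2_Omega|].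
  apply: part => [k|k x].
    by apply: measurable_funX; apply: measurable_funB; [exact: (Lph k).1|exact: Lw.1].
  by rewrite nn /= lerDl nns.
have ci i : \int[mux]_(x in Omega) ('D_(e_ i) (ph k) x * al i x) @[k --> \oo] -->
    \int[mux]_(x in Omega) (r x ord0 i * al i x).
  apply: cvg_Rintegral_mulL2 => //; [exact: nearW|exact: L2_Omega|].
  apply: part => [k|k x].
    apply: measurable_funX.
    by apply: measurable_funB; [exact: (Ldph i k).1|exact: (Lr i).1].
  rewrite nn /= (bigD1 i)//= addrCA lerDl addr_ge0//.
  by apply: sumr_ge0.
have csum : - \sum_i \int[mux]_(x in Omega) ('D_(e_ i) (ph k) x * al i x) @[k --> \oo] -->
    - \sum_i \int[mux]_(x in Omega) (r x ord0 i * al i x).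
  by apply: cvgN; apply: cvg_big => [|i _]; [exact: add_continuous|exact: ci].
have supp (g h : V -> R) : test_function Omega g ->
    \int[mux]_x (h x * g x) = \int[mux]_(x in Omega) (g x * h x).
  move=> Tg; rewrite (@Rintegral_supp _ _ _ mux Omega).
    by apply: eq_Rintegral => x _; rewrite mulrC.
  by move=> x Ox; rewrite (test_function_out Tg)// mulr0.
have eqk k : \int[mux]_(x in Omega) (ph k x * a0 x) =
    - \sum_i \int[mux]_(x in Omega) ('D_(e_ i) (ph k) x * al i x).
  rewrite -supp// (orth (ph k) (fun i => 'D_(e_ i) (ph k))); last by split.
  congr (- _); apply: eq_bigr => i _; apply: supp.
  exact: test_function_derive.
have {}c0 : - \sum_i \int[mux]_(x in Omega) ('D_(e_ i) (ph k) x * al i x) @[k --> \oo] -->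
    \int[mux]_(x in Omega) (w x * a0 x).
  by under eq_fun do rewrite -eqk.
have E2 := cvg_unique (@norm_hausdorff _ _) c0 csum.
under eq_Rintegral do rewrite mulrC.
rewrite E2; congr (- _); apply: eq_bigr => i _.
by apply: eq_Rintegral => x _; rewrite mulrC.
Qed.

Let u_time t : a <= t <= b -> mem_L2 mux Omega (fun x => u (x, t)).
Proof.
by move=> atb; have [_ _ _ _ H] := Hen; have [] := H t; rewrite ?in_itv.
Qed.

Let int_u psi t : test_function Omega psi -> a <= t <= b ->
  \int[mux]_x (u' (x, t) * psi x) = \int[mux]_(x in Omega) (u (x, t) * psi x).
Proof.
move=> Tpsi atb; have /= E1 := patch_time u atb.
transitivity (\int[mux]_x (((fun x => u (x, t)) \_ O) x * psi x)).
  by apply: eq_Rintegral => x _; rewrite -E1.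
apply: int_patch; first exact: (u_time atb).1.
exact: (L2_Omega (L2fun_test bO Tpsi)).1.
Qed.

(** [ec_dual] comes from [H10_dual] at the times whose slice is in H^1_0, and weak continuity in
    time comes from L2 continuity through [cvg_Rintegral_mulL2]. *)
Let class : energy_class Omega a b u' p'.
Proof.
have u0 (g : VR -> R) x t : ~ (Omega x /\ a <= t <= b) -> (g \_ Q') (x, t) = 0.
  by move=> H; apply: patch_out => -[[Ox _] atb]; exact: H.
split.
- exact: meas_patch.
- by move=> i; exact: meas_patch.
- exact: u0.
- by move=> i; exact: u0.
- by move=> x; apply: patch_sq_x => Ox Ex; exact: (HE Ox Ex).1.
- by move=> i x; apply: patch_sq_x => Ox Ex; exact: (HE Ox Ex).2.
- exact: patch_sq.
- by move=> i; exact: patch_sq.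
- move=> t atb; have /= E1 := patch_time u atb.
  apply: (eq_rintegrable measurableT _ (patch_sq_t (u_time atb))) => x _.
  by rewrite -E1.
- have [_ [_ H] _ _ _] := Hen; move: H.
  apply: (@filterS _ _ (ae_filter_ringOfSetsType mut)) => t Ht atb.
  have {}Ht : H10 Omega (fun x => u (x, t)) (fun x => p (x, t)) by apply: Ht; rewrite in_itv.
  have [Lu Lp _] := Ht.
  have Eu := patch_time u atb; have Ep i := patch_time (pp i) atb.
  split=> [i|a0 al La Lal orth].
    apply: (eq_rintegrable measurableT _ (patch_sq_t (Lp i))) => x _.
    by rewrite -(Ep i).
  have H := H10_dual Ht La Lal orth.
  transitivity (\int[mux]_(x in Omega) (a0 x * u (x, t))).
    rewrite -(int_patchr Lu.1 (L2_Omega La).1).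
    by apply: eq_Rintegral => x _; rewrite -Eu.
  rewrite H; congr (- _); apply: eq_bigr => i _.
  rewrite -(int_patchr (Lp i).1 (L2_Omega (Lal i)).1).
  by apply: eq_Rintegral => x _; rewrite -(Ep i).
- move=> psi Tpsi; have Lpsi := L2_Omega (L2fun_test bO Tpsi).
  have aab : a <= a <= b by rewrite lexx ltW.
  have [h0 hd] := Hinit.
  have g0 : \int[mux]_(x in Omega) (u (x, a) * psi x) = 0.
    transitivity (\int[mux]_(x in Omega) (0 : R)); last by rewrite Rintegral_cst// mul0r.
    apply: ae_eq_Rintegral => //.
      by apply: measurable_funM; [exact: (u_time aab).1|exact: Lpsi.1].
    by apply: filterS h0 => x Hx Ox; rewrite Hx// mul0r.
  split.
  + apply/subspace_continuousP => t; rewrite /= in_itv/= => atb.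
    suff : \int[mux]_x (u' (x, s) * psi x) @[s --> within `[a, b] (nbhs t)] -->
      \int[mux]_x (u' (x, t) * psi x) by [].
    rewrite (int_u Tpsi atb).
    have [_ _ _ _ H] := Hen; have [|_ Hc] := H t; first by rewrite in_itv.
    have inab : \forall s \near within `[a, b] (nbhs t), a <= s <= b.
      by rewrite near_withinE; apply: nearW => s /=; rewrite in_itv.
    have Fw : Filter (within `[a, b] (nbhs t)) by exact: within_filter.
    have Lnear : \forall s \near within `[a, b] (nbhs t), mem_L2 mux Omega (fun x => u (x, s)).
      by apply: filterS inab => s; exact: u_time.
    have HH := cvg_Rintegral_mulL2 mO Lnear (u_time atb) Lpsi Hc.
    apply: (cvg_trans _ (HH Fw)).
    by apply: near_eq_cvg; apply: filterS inab => s asb; rewrite int_u.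
  + by rewrite int_u.
  (* The pairing of u(a) with [psi] is 0, so the difference quotient in the initial condition is the
     quotient of the pairing of u(a + h) alone. *)
  + have := hd psi Tpsi; apply: cvg_trans; apply: near_eq_cvg; near=> h.
    have h0' : 0 < h by near: h; exact: nbhs_right_gt.
    have hb : h < b - a by near: h; apply: nbhs_right_lt; rewrite subr_gt0.
    have ahb : a <= a + h <= b by apply/andP; split; lra.
    congr (_ * _); rewrite (int_u Tpsi ahb).
    have i1 : rintegrable mux Omega (fun x => u (x, a + h) * psi x).
      have [m1 i1] := (mem_L2P _ _ _).1 (u_time ahb); have [m2 i2] := (mem_L2P _ _ _).1 Lpsi.
      exact: rintegrable_mulL2.
    have i2 : rintegrable mux Omega (fun x => u (x, a) * psi x).
      have [m1 i2] := (mem_L2P _ _ _).1 (u_time aab); have [m2 i3] := (mem_L2P _ _ _).1 Lpsi.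
      exact: rintegrable_mulL2.
    under eq_Rintegral do rewrite mulrBl.
    by rewrite (RintegralB mO i1 i2) g0 subr0.
Unshelve. all: end_near. Qed.

Let ae_u : {ae muxt, forall z : VR, Q z -> u' z = u z}.
Proof.
exists nE; split=> // z /=; apply: contra_notP => nz Qz.
by rewrite /u' patchE mem_set// Q'E; split.
Qed.

Section weak_equation.
Variables (psi : V -> R) (th : R -> R).
Hypotheses (Tpsi : test_function Omega psi) (Tth : test_function `]a, b[%classic th).
Let phi (z : V * R) := psi z.1 * th z.2.

Let sp : smooth_on setT psi. Proof. by have [] := Tpsi. Qed.
Let st : smooth_on setT th. Proof. by have [] := Tth. Qed.

Let mpsi : measurable_fun setT (fun z : VR => psi z.1).
Proof. exact: (measurableT_comp (L2fun_test bO Tpsi).1 measurable_fst). Qed.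

Let mdpsi i : measurable_fun setT (fun z : VR => 'D_(e_ i) psi z.1).
Proof.
exact: (measurableT_comp (L2fun_test bO (test_function_derive (e_ i) Tpsi)).1 measurable_fst).
Qed.

Let mth (g : R -> R) : continuous g -> measurable_fun setT (fun z : VR => g z.2).
Proof. by move=> cg; apply: (measurableT_comp (f := g)) => //; exact: continuous_measurable_fun. Qed.

Let abb : a <= b <= b. Proof. by rewrite lexx ltW. Qed.
Let mab' : measurable ([set: V] `*` (`[a, b] : set (measurableTypeR R))).
Proof. exact: measurableX. Qed.

Let term0 : \int[muxt]_(z in Q) (u z * Dt (Dt phi) z) =
  \int[muxt]_(z in setT `*` `[a, b]) (u' z * psi z.1 * 'D_1 ('D_1 th) z.2).
Proof.
have cth2 : continuous ('D_1 ('D_1 th)) by apply: smooth_continuous; do 2 apply: smooth_derive.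
transitivity (\int[muxt]_(z in Q) (u z * psi z.1 * 'D_1 ('D_1 th) z.2)).
  apply: eq_Rintegral => z _.
  have -> : Dt phi = fun z => psi z.1 * 'D_1 th z.2 by apply/funext => y; rewrite Dt_prod.
  by rewrite (@Dt_prod R n psi ('D_1 th) sp (smooth_derive (1 : R) st)) mulrA.
rewrite (Rintegral_setD_null mQ mnE nE0); last first.
  apply: measurable_funM; last exact: measurable_funTS (mth cth2).
  by apply: measurable_funM; [exact: u_L2.1|exact: measurable_funTS].
rewrite -Q'E; apply: Rintegral_eq_supp => z.
- by move=> Qz _; rewrite /u' patchE mem_set.
- by move=> [_ zt] []; split.
- by move=> _ Qz; rewrite /u' patchE memNset// !mul0r.
Qed.

Let cth : continuous th. Proof. exact: smooth_continuous. Qed.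

Let i1 i : rintegrable muxt (setT `*` `[a, b])
  (fun z => c' z.1 * p' i z * 'D_(e_ i) psi z.1 * th z.2).
Proof.
have K0 := coefficients_memoryless K.
apply: (eq_rintegrable mab' _ (rintegrable_term ab baL K0 bO Tpsi Tth i class)) => z _.
exact: memoryless.
Qed.

Let i2 i : rintegrable muxt (setT `*` `[a, b])
  (fun z => convx a F (p' i) z * 'D_(e_ i) psi z.1 * th z.2).
Proof.
apply: (eq_rintegrable mab' _ (rintegrableB mab' (i1 i)
  (rintegrable_term ab baL K bO Tpsi Tth i class))) => z _.
exact: factor_sub.
Qed.

Let term1 : \int[muxt]_(z in Q) (c z.1 * \sum_i p z ord0 i * Dx i phi z) =
  \sum_i \int[muxt]_(z in setT `*` `[a, b]) (c' z.1 * p' i z * 'D_(e_ i) psi z.1 * th z.2).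
Proof.
rewrite -(Rintegral_sum mab' i1).
transitivity (\int[muxt]_(z in Q) \sum_i (c' z.1 * pp i z * 'D_(e_ i) psi z.1 * th z.2)).
  apply: eq_Rintegral => z /set_mem[Oz _]; rewrite mulr_sumr; apply: eq_bigr => i _.
  by rewrite (Dx_prod sp st i z) (cE Oz); exact: reassoc.
rewrite (Rintegral_setD_null mQ mnE nE0); last first.
  apply: measurable_sum => i; apply: measurable_funM; last exact: measurable_funTS (mth cth).
  apply: measurable_funM; last exact: measurable_funTS (mdpsi i).
  apply: measurable_funM; last exact: (p_L2 i).1.
  exact: measurable_funTS (measurableT_comp (co_mc K) measurable_fst).
rewrite -Q'E; apply: Rintegral_eq_supp => z.
- by move=> Qz _; apply: eq_bigr => i _; rewrite -(patch_in' (pp i) Qz).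
- by move=> [_ zt] []; split.
- by move=> _ Qz; apply: big1 => i _; exact: (zero_factor _ _ _ (patch_out' (pp i) Qz)).
Qed.

Let term2 : \int[muxt]_(z in Q) \sum_i Dx i phi z *
    \int[mut]_(s in `[a, z.2]) (G (z.1, z.2 - s) * p (z.1, s) ord0 i) =
  \sum_i \int[muxt]_(z in setT `*` `[a, b]) (convx a F (p' i) z * 'D_(e_ i) psi z.1 * th z.2).
Proof.
rewrite -(Rintegral_sum mab' i2).
have mpQ i : measurable_fun setT (pp i \_ Q).
  by apply/(measurable_restrictT (pp i) mQ); exact: (p_L2 i).1.
transitivity (\int[muxt]_(z in Q)
    \sum_i (convx a F (pp i \_ Q) z * 'D_(e_ i) psi z.1 * th z.2)).
  apply: eq_Rintegral => -[x t] /set_mem[/= Ox]; rewrite in_itv/= => /andP[at_ tb].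
  apply: eq_bigr => i _; rewrite (Dx_prod sp st i (x, t)).
  have -> : \int[mut]_(s in `[a, t]) (G (x, t - s) * p (x, s) ord0 i) = convx a F (pp i \_ Q) (x, t).
    apply: eq_Rintegral => s /set_mem /=; rewrite in_itv/= => /andP[as_ st'].
    have ts : 0 <= t - s <= b - a by apply/andP; split; lra.
    have asb : a <= s <= b by rewrite as_ (le_trans st' tb).
    by rewrite (patchQ (pp i) Ox asb) (FE Ox ts).
  exact: reassocC.
rewrite (Rintegral_setD_null mQ mnE nE0); last first.
  apply: measurable_sum => i; apply: measurable_funM; last exact: measurable_funTS (mth cth).
  apply: measurable_funM; last exact: measurable_funTS.
  exact: measurable_funTS (measurable_convx a (co_mF K) (mpQ i)).
rewrite -Q'E; apply: Rintegral_eq_supp => -[x t].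
- move=> [/= Ox]; rewrite in_itv/= => /andP[at_ tb] _; apply: eq_bigr => i _.
  congr (_ * _ * _); apply: eq_Rintegral => s /set_mem /=; rewrite in_itv/= => /andP[as_ st'].
  have asb : a <= s <= b by rewrite as_ (le_trans st' tb).
  congr (_ * _); rewrite (patchQ (pp i) Ox.1 asb); exact/esym/(patch_in (pp i) Ox asb).
- by move=> [_ zt] []; split.
- move=> [_ /= atb] Qz; apply: big1 => i _.
  have Ox : ~ O x by move=> Ox; apply: Qz; split.
  have -> : convx a F (p' i) (x, t) = 0.
    apply: Rintegral_zero => [//|s _]; apply: mulr_zero.
    exact: (patch_out (pp i) (fun H => Ox H.1)).
  by rewrite !mul0r.
Qed.

Let weak : weak_form a b c' F u' p' psi th = - 2 * \int[muxt]_(z in Q) (f z * phi z).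
Proof.
have := Heq (test_function_prod Tpsi Tth); rewrite /= term0 term1 term2 => <-.
apply: halve => i; rewrite -(RintegralB mab' (i1 i) (i2 i)).
by apply: eq_Rintegral => z _; exact: factor_subr.
Qed.

Definition weak_equation := weak.

End weak_equation.

Definition solution_representative := (class, ae_u, weak_equation).

End with_null_set.

Let solution_class : exists u' p', [/\ energy_class Omega a b u' p',
  {ae muxt, forall z : VR, (Omega `*` `[a, b]) z -> u' z = u z} &
  forall psi th, test_function Omega psi -> test_function `]a, b[%classic th ->
    weak_form a b c' F u' p' psi th =
    - 2 * \int[muxt]_(z in Omega `*` `[a, b]) (f z * (psi z.1 * th z.2))].
Proof.
have [E [mE E0 HE]] := null_set; have [[H1 H2] H3] := solution_representative mE E0 HE.
by exists (u \_ ((Omega `\` E) `*` `[a, b])), (fun i => pp i \_ ((Omega `\` E) `*` `[a, b])).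
Qed.

Definition energy_solution_class := solution_class.

End solution_class.

(** The equation sees the coefficients only over Omega and for delays in [0, b - a], so [c] and [G]
    may be exchanged for [c'] and [F], which are controlled on the whole space. *)
Lemma generalized_solution_class (R : realType) (n : nat) (Omega : set 'rV[R]_n) (a b L : R)
  (c c' : 'rV[R]_n -> R) (G F f u : 'rV[R]_n * R -> R) :
  open Omega -> bounded_set Omega -> a < b -> b - a <= L -> coefficients L c' F ->
  (forall x, Omega x -> c' x = c x) ->
  (forall x t, Omega x -> 0 <= t <= b - a -> F (x, t) = G (x, t)) ->
  generalized_solution c G Omega a b f u ->
  exists u' p', [/\ energy_class Omega a b u' p',
    {ae (lebesgue_rv R n \x @lebesgue_measure R)%E,
      forall z : 'rV[R]_n * measurableTypeR R, (Omega `*` `[a, b]) z -> u' z = u z} &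
    forall psi th, test_function Omega psi -> test_function `]a, b[%classic th ->
      weak_form a b c' F u' p' psi th =
      - 2 * \int[(lebesgue_rv R n \x @lebesgue_measure R)%E]_(z in Omega `*` `[a, b])
        (f z * (psi z.1 * th z.2))].
Proof.
move=> oO bO ab baL K cE FE [p [q [Hen Heq Hinit]]].
exact: (energy_solution_class oO bO ab baL K cE FE Hen Heq Hinit).
Qed.

(** * Explicit solutions *)

Section parametric_integral.
Context (R : realType) (W : normedModType R).
Local Notation mu := (@lebesgue_measure R).
Variable L : R.
Hypothesis L0 : 0 <= L.

(** A tube argument: near each r0 joint continuity gives the estimate on a product neighbourhood,
    and compactness of [0, L] makes the neighbourhood of z uniform in r. *)
Lemma uniform_on_segment (g : W * R -> R) (z : W) (e : R) : continuous g -> 0 < e ->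
  \forall z' \near z, forall r, 0 <= r <= L -> `|g (z', r) - g (z, r)| < e.
Proof.
move=> cg e0.
have /compact_near_coveringP/(_ W (nbhs z) (fun z' r => `|g (z', r) - g (z, r)| < e)) :=
  @segment_compact R 0 L.
have H : forall r0, `[0, L]%classic r0 ->
    \forall r \near r0 & z' \near nbhs z, `|g (z', r) - g (z, r)| < e.
  move=> r0 _; have csw : {for (r0, z), continuous (fun y : R * W => g (y.2, y.1))}.
    apply: (@continuous_comp _ _ _ (fun y : R * W => (y.2, y.1)) g); last exact: cg.
    by apply: (@cvg_pair _ _ _ _ (nbhs z) (nbhs r0)); [exact: cvg_snd|exact: cvg_fst].
  have cz : {for r0, continuous (fun r : R => g (z, r))}.
    apply: (@continuous_comp _ _ _ (fun r : R => (z, r)) g); last exact: cg.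
    by apply: (@cvg_pair _ _ _ _ (nbhs z) (nbhs r0)); [exact: cvg_cst|exact: cvg_id].
  have e20 : 0 < e / 2 by rewrite divr_gt0.
  have /cvgrPdist_lt/(_ _ e20) h1 := csw.
  have /cvgrPdist_lt/(_ _ e20) h2 := cz.
  have h3 : \forall y \near (r0, z), `|g (z, r0) - g (z, y.1)| < e / 2.
    have : (fun y : R * W => y.1) @ (r0, z) --> r0 by exact: cvg_fst.
    by move=> H; exact: (H _ h2).
  have : \forall y \near (r0, z), `|g (y.2, y.1) - g (z, y.1)| < e.
    near=> y.
    have a1 : `|g (z, r0) - g (y.2, y.1)| < e / 2 by near: y.
    have a2 : `|g (z, r0) - g (z, y.1)| < e / 2 by near: y.
    rewrite -(subrKA (g (z, r0))) [e]splitr (le_lt_trans (ler_normD _ _))// ltrD//.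
    by rewrite distrC.
  by [].
move=> /(_ _ H); apply: filterS => z' Hz' r r0L; apply: Hz'.
by rewrite /= in_itv.
Unshelve. all: end_near. Qed.

Definition param_int (g : W * R -> R) (z : W) : R := \int[mu]_(r in `[0, L]) g (z, r).

Lemma section_continuous (g : W * R -> R) z : continuous g -> continuous (fun r : R => g (z, r)).
Proof.
move=> cg r; apply: (@continuous_comp _ _ _ (fun r : R => (z, r)) g); last exact: cg.
by apply: (@cvg_pair _ _ _ _ (nbhs z) (nbhs r)); [exact: cvg_cst|exact: cvg_id].
Qed.

Let mL : measurable (`[0, L]%classic : set (measurableTypeR R)). Proof. by []. Qed.

Let int_small (f : R -> R) (e : R) : 0 < e -> rintegrable mu `[0, L] f ->
  (forall r, 0 <= r <= L -> `|f r| <= e / (L + 1)) -> `|\int[mu]_(r in `[0, L]) f r| <= e.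
Proof.
move=> e0 fi fe; apply: le_trans (le_normr_Rintegral mL fi) _.
apply: (@le_trans _ _ (\int[mu]_(r in `[0, L]) (e / (L + 1)))).
  apply: le_Rintegral => //; first exact: (rintegrable_norm fi).
    exact: (rintegrable_cst _ mL (lebesgue_itv_lty 0 L)).
have -> : \int[mu]_(r in `[0, L]) (e / (L + 1)) = e / (L + 1) * L.
  have E : fine (mu `[0, L]%classic) = L.
    rewrite lebesgue_measure_itv/= lte_fin; move: L0; rewrite le_eqVlt.
    by move=> /predU1P[<-|L_gt0]; rewrite ?ltxx// L_gt0 /= subr0.
  by rewrite Rintegral_cst//; congr (_ * _); exact: E.
have L1 : 0 < L + 1 by rewrite ltr_wpDl.
by rewrite mulrAC ler_pdivrMr// ler_pM2l// lerDl.
Qed.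

Lemma continuous_param_int (g : W * R -> R) : continuous g -> continuous (param_int g).
Proof.
move=> cg z; apply/cvgrPdist_le => e e0.
have e1 : 0 < e / (L + 1) by rewrite divr_gt0// ltr_wpDl.
have := uniform_on_segment z cg e1; apply: filterS => z' Hz'.
have iz y : rintegrable mu `[0, L] (fun r => g (y, r)).
  by apply: continuous_rintegrable; exact: section_continuous.
rewrite /param_int distrC -(RintegralB mL (iz z') (iz z)); apply: int_small => //.
  exact: (rintegrableB mL (iz z') (iz z)).
by move=> r /Hz'/ltW.
Qed.

(** The mean value theorem along the direction v writes each difference quotient as a derivative at
    an intermediate point, and [uniform_on_segment] makes its distance to the derivative at z small
    uniformly in r. *)
Lemma is_derive_param_int (g : W * R -> R) z v : smooth_on setT g ->
  is_derive z v (param_int g) (param_int ('D_((v, 0) : W * R) g) z).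
Proof.
move=> sg; pose Dg := 'D_((v, 0) : W * R) g.
have cDg : continuous Dg by apply: smooth_continuous; exact: smooth_derive.
have cg := smooth_continuous sg.
have iz (h : W * R -> R) y : continuous h -> rintegrable mu `[0, L] (fun r => h (y, r)).
  by move=> ch; apply: continuous_rintegrable; exact: section_continuous.
have dline r (s : R) : is_derive s 1 (fun s : R => g (s *: v + z, r)) (Dg (s *: v + z, r)).
  have aff (h w x : R) : ((h *: w + x) *: v + z, r) =
      h *: ((w *: v, 0) : W * R) + (x *: v + z, r).
    by congr pair => /=; rewrite ?scaler0 ?add0r// scalerDl -addrA scalerA.
  have -> : Dg (s *: v + z, r) = 'D_1 (fun s : R => g (s *: v + z, r)) s.
    have := @derive_affine R (W * R)%type R (fun s => (s *: v + z, r)) (fun w => (w *: v, 0)) aff g 1 s.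
    by rewrite scale1r => /esym.
  apply: derivableP.
  apply: (@derivable_affine R (W * R)%type R (fun s => (s *: v + z, r)) (fun w => (w *: v, 0))) => //.
  exact: smooth_derivable.
have cvgk : h^-1 *: (param_int g (h *: v + z) - param_int g z) @[h --> 0^'] --> param_int Dg z.
  apply/cvgrPdist_le => e e0.
  have e1 : 0 < e / (L + 1) by rewrite divr_gt0// ltr_wpDl.
  have cl : (fun h : R => h *: v + z) @ (0 : R) --> z.
    rewrite -[X in _ --> X]add0r -[X in _ --> X + _](scale0r v).
    by apply: cvgD; [apply: cvgZr_tmp; exact: cvg_id|exact: cvg_cst].
  have /nbhs_ballP[de /= de0 Hde] := cl _ (uniform_on_segment z cDg e1).
  near=> h; have h0 : h != 0 by near: h; exact: nbhs_dnbhs_neq.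
  have hde : `|h| < de by near: h; apply: dnbhs0_lt.
  have mvt r : exists2 xi : R, `|xi| <= `|h| & g (h *: v + z, r) - g (z, r) = h * Dg (xi *: v + z, r).
    have cline : continuous (fun s : R => g (s *: v + z, r)).
      by move=> s; apply/differentiable_continuous/derivable1_diffP; have [] := dline r s.
    have [h_gt0|h_lt0|h_eq0] := ltgtP 0 h; last by rewrite -h_eq0 eqxx in h0.
      have [xi + E] := MVT h_gt0 (fun x _ => dline r x) (continuous_subspaceT cline).
      rewrite in_itv/= => /andP[xi0 xih]; exists xi; first by rewrite !ger0_norm ?ltW.
      by move: E; rewrite scale0r add0r subr0 mulrC.
    have [xi + E] := MVT h_lt0 (fun x _ => dline r x) (continuous_subspaceT cline).
    rewrite in_itv/= => /andP[xi0 xih]; exists xi; first by rewrite !ltr0_norm// lerN2 ltW.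
    move: E; rewrite scale0r add0r sub0r mulrN => /eqP; rewrite subr_eq => /eqP ->.
    by rewrite opprD addrC; ring.
  rewrite -(RintegralB mL (iz g _ cg) (iz g _ cg)).
  have ig := rintegrableB mL (iz g (h *: v + z) cg) (iz g z cg).
  rewrite [X in _ - X](_ : _ = \int[mu]_(r in `[0, L]) (h^-1 * (g (h *: v + z, r) - g (z, r)))); last first.
    by rewrite (RintegralZl _ mL ig).
  have ih := rintegrableZl h^-1 mL ig.
  rewrite -(RintegralB mL (iz Dg z cDg) ih); apply: int_small => //.
    exact: (rintegrableB mL (iz Dg z cDg) ih).
  move=> r r0L; have [xi xih ->] := mvt r.
  rewrite mulKf// distrC ltW//; apply: (Hde xi) => //.
  by rewrite -ball_normE /= sub0r normrN (le_lt_trans xih).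
split; first by apply/cvg_ex; exists (param_int Dg z).
exact: cvg_lim cvgk.
Unshelve. all: end_near. Qed.

Lemma smooth_param_int (g : W * R -> R) : smooth_on setT g -> smooth_on setT (param_int g).
Proof.
move=> sg; apply: (@smooth_class R W (fun k => exists2 g, smooth_on setT g & k = param_int g)).
  move=> _ [{sg}g sg ->]; split.
  - by apply: continuous_param_int; exact: smooth_continuous.
  - by move=> z v; have [] := is_derive_param_int z v sg.
  - move=> v; exists ('D_((v, 0) : W * R) g); first exact: smooth_derive.
    by apply/funext => z; have [_ ->] := is_derive_param_int z v sg.
by exists g.
Qed.

End parametric_integral.

(** * The product wave and its smooth source *)

Section explicit_solution.
Context (R : realType) (n : nat).
Local Notation V := 'rV[R]_n.
Local Notation VR := (V * measurableTypeR R)%type.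
Local Notation e_ i := (delta_mx ord0 i : V).
Local Notation mux := (lebesgue_rv R n).
Local Notation mut := (@lebesgue_measure R).
Local Notation muxt := (lebesgue_rv R n \x @lebesgue_measure R)%E.
Variables (Omega : set V) (a b : R).
Hypotheses (oO : open Omega) (bO : bounded_set Omega) (ab : a < b).
Let Q : set VR := Omega `*` `[a, b].
Let mQ : measurable Q.
Proof. by apply: measurableX; [exact: measurable_open_rv|]. Qed.

Lemma bounded_set_ball (A : set V) : bounded_set A -> exists2 B : R, 0 < B & A `<=` ball (0 : V) B.
Proof.
move=> [B0 [_ HB]]; exists (`|B0| + 1 + 1); first by rewrite ltr_pwDr// addr_ge0.
move=> x Ax; have B1 : B0 < `|B0| + 1 by apply: le_lt_trans (ler_norm _) _; rewrite ltrDl.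
have xB : `|x| <= `|B0| + 1 := HB _ B1 x Ax.
by rewrite -ball_normE /= sub0r normrN (le_lt_trans xB)// ltrDl.
Qed.

Let bound_Q : exists B : R, [/\ 0 < B, Omega `<=` ball (0 : V) B &
  forall z, Q z -> ball (0 : V * R) B z].
Proof.
have [B B0 OB] := bounded_set_ball bO; pose B' := Num.max B (Num.max `|a| `|b| + 1).
exists B'; split; first by rewrite lt_max B0.
  by apply: subset_trans OB _; apply: le_ball; rewrite le_max lexx.
move=> [x t] [/= /OB xB]; rewrite in_itv/= => /andP[at_ tb]; split=> /=.
  by apply: (le_ball _ xB); rewrite le_max lexx.
rewrite -ball_normE /= sub0r normrN lt_max; apply/orP; right.
rewrite ltr_pwDr// le_max !ler_norml; have [t0|t0] := leP 0 t.
  apply/orP; right; rewrite (le_trans tb (ler_norm _)) andbT.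
  by rewrite (le_trans _ t0)// oppr_le0.
apply/orP; left; rewrite (le_trans (ltW t0))// andbT.
by rewrite (le_trans _ at_)// lerNl -normrN ler_norm.
Qed.

Let Ooo : (mux Omega < +oo)%E.
Proof.
have [B [B0 OB _]] := bound_Q; apply: (@le_lt_trans _ _ (mux (ball (0 : V) B))).
  by apply: le_measure; rewrite ?inE//; [exact: measurable_open_rv|exact: measurable_rv_ball].
have -> : mux (ball (0 : V) B) = ((B *+ 2) ^+ n)%:E by exact: lebesgue_rv_ball.
exact: ltry.
Qed.

Let Qoo : (muxt Q < +oo)%E.
Proof.
rewrite [X in (X < _)%E](@product_measure1E _ _ _ _ R mux mut _ _ (measurable_open_rv oO) _)//.
rewrite lte_mul_pinfty//; first by rewrite ge0_fin_numE.
exact: lebesgue_itv_lty.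
Qed.

Let iQ (g : V * R -> R) : continuous g -> rintegrable muxt Q g.
Proof.
move=> cg; have [B [B0 _ QB]] := bound_Q; have [M M0 HM] := continuous_bounded_ball B cg.
apply: (rintegrable_bounded mQ Qoo (M := M)).
  by apply: measurable_funTS; exact: measurable_continuous.
by move=> z /QB; exact: HM.
Qed.

Let L2Q (g : V * R -> R) : continuous g -> mem_L2 muxt Q g.
Proof.
move=> cg; apply/mem_L2P; split; first by apply: measurable_funTS; exact: measurable_continuous.
by apply: iQ => z; apply: (@continuous_comp _ _ _ g (fun y => y ^+ 2)); [exact: cg|exact: exprn_continuous].
Qed.

Let cont_time (g : V * R -> R) t : continuous g -> continuous (fun x : V => g (x, t)).
Proof.
move=> cg x; apply: (@continuous_comp _ _ _ (fun x : V => (x, t)) g); last exact: cg.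
by apply: (@cvg_pair _ _ _ (nbhs x) (nbhs x) (nbhs t)); [exact: cvg_id|exact: cvg_cst].
Qed.

Let L2O (w : V -> R) : continuous w -> mem_L2 mux Omega w.
Proof.
move=> cw; have [B [B0 OB _]] := bound_Q.
have cw' : continuous (fun z : V * R => w z.1 ^+ 2).
  move=> z; apply: (@continuous_comp _ _ _ (fun z : V * R => w z.1) (fun y => y ^+ 2)).
    by apply: continuous_comp; [exact: cvg_fst|exact: cw].
  exact: exprn_continuous.
have [M M0 HM] := continuous_bounded_ball B cw'.
apply/mem_L2P; split; first by apply: measurable_funTS; exact: measurable_continuous_rv.
apply: (rintegrable_bounded (M := M)); first exact: measurable_open_rv.
- exact: Ooo.
- by apply: measurable_funTS; apply: measurable_funX; exact: measurable_continuous_rv.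
- move=> x /OB xB; apply: (HM (x, 0)); split=> //=.
  by rewrite -ball_normE /= subr0 normr0.
Qed.

Let test_out (g : V * R -> R) z : test_function (Omega `*` `]a, b[) g -> ~ Q z -> g z = 0.
Proof.
move=> Tg Qz; apply: (test_function_out Tg) => -[Oz zt]; apply: Qz; split=> //.
exact: subset_itv_oo_cc.
Qed.

Let int_derive0 (g : V * R -> R) (v : V * R) : test_function (Omega `*` `]a, b[) g ->
  (v = (0, 1) \/ exists i, v = (e_ i, 0)) -> \int[muxt]_(z in Q) 'D_v g z = 0.
Proof.
move=> Tg vE; have Tdg := test_function_derive v Tg; have [sg _ _] := Tg.
have [B [B0 OB QB]] := bound_Q.
have g0 z : ~ ball 0 B z -> g z = 0 by move=> zB; apply: test_out => // /QB.
have dg0 z : ~ ball 0 B z -> 'D_v g z = 0 by move=> zB; apply: (test_out Tdg) => /QB.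
have cdg : continuous ('D_v g) by case: Tdg => /smooth_continuous.
rewrite -(@Rintegral_supp _ _ _ muxt Q); last by move=> z; exact: (test_out Tdg).
have idg := rintegrable_bsupp_prod cdg dg0.
have mT1 : measurable [set: V] by []; have mT2 : measurable [set: measurableTypeR R] by [].
have idg' : rintegrable muxt (setT `*` setT) ('D_v g) by rewrite setXTT.
case: vE => [vE|[i vE]].
  transitivity (\int[mux]_(x in setT) \int[mut]_(t in setT) 'D_v g (x, t)).
    by rewrite (Fubini_Rintegral12 mT1 mT2 idg') setXTT.
  apply: Rintegral_zero => // x _.
  transitivity (\int[mut]_t 'D_1 (fun t : R => g (x, t)) t).
    apply: eq_Rintegral => t _; rewrite vE.
    rewrite (@derive_affine R (V * R)%type R (fun t => (x, t)) (fun t => (0, t)))//.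
    by move=> h w y; congr pair => /=; rewrite scaler0 add0r.
  have st : smooth_on setT (fun t : R => g (x, t)).
    apply: (@smooth_affine R (V * R)%type R (fun t => (x, t)) (fun t => (0, t))) => //.
      by move=> h w y; congr pair => /=; rewrite scaler0 add0r.
    by move=> t; apply: (@cvg_pair _ _ _ _ (nbhs x) (nbhs t)); [exact: cvg_cst|exact: cvg_id].
  apply: (@Rintegral_derive0 R _ B).
  - by move=> t; exact: smooth_derivable.
  - by apply: smooth_continuous; exact: smooth_derive.
  - by move=> t tB; apply: g0 => -[_] /ball0P; rewrite ltNge tB.
transitivity (\int[mut]_(t in setT) \int[mux]_(x in setT) 'D_v g (x, t)).
  by rewrite (Fubini_Rintegral21 mT1 mT2 idg') setXTT.
apply: Rintegral_zero => // t _.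
have aff (h : R) (w y : V) : (h *: w + y, t) = h *: ((w, 0) : V * R) + (y, t).
  by congr pair => /=; rewrite scaler0 add0r.
transitivity (\int[mux]_x 'D_(e_ i) (fun x : V => g (x, t)) x).
  apply: eq_Rintegral => x _; rewrite vE.
  by rewrite (@derive_affine R (V * R)%type V (fun x => (x, t)) (fun x => (x, 0))).
apply: (@Rintegral_rv_derive0 R n _ i B).
  apply: (@smooth_affine R (V * R)%type V (fun x => (x, t)) (fun x => (x, 0))) => //.
  by move=> x; apply: (@cvg_pair _ _ _ (nbhs x) (nbhs x) (nbhs t)); [exact: cvg_id|exact: cvg_cst].
by move=> x xB; apply: g0 => -[].
Qed.

Let test_mul (h g : V * R -> R) : smooth_on setT h ->
  test_function (Omega `*` `]a, b[) g -> test_function (Omega `*` `]a, b[) (fun z => h z * g z).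
Proof.
move=> sh [sg cg Og].
have sub : closure [set z | h z * g z != 0] `<=` closure [set z | g z != 0].
  by apply: closure_subset => z /=; rewrite mulf_eq0 negb_or => /andP[].
split; first exact: smoothM.
- by apply: subclosed_compact cg sub; exact: closed_closure.
- exact: subset_trans sub Og.
Qed.

Let by_parts (h g : V * R -> R) (v : V * R) : smooth_on setT h ->
  test_function (Omega `*` `]a, b[) g -> (v = (0, 1) \/ exists i, v = (e_ i, 0)) ->
  \int[muxt]_(z in Q) (h z * 'D_v g z) = - \int[muxt]_(z in Q) ('D_v h z * g z).
Proof.
move=> sh Tg vE; have [sg _ _] := Tg.
have := int_derive0 (test_mul sh Tg) vE.
have cM (k l : V * R -> R) : smooth_on setT k -> smooth_on setT l -> rintegrable muxt Q (fun z => k z * l z).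
  by move=> sk sl; apply: iQ; apply: smooth_continuous; exact: smoothM.
have i1 := cM _ _ sh (smooth_derive v sg); have i2 := cM _ _ (smooth_derive v sh) sg.
rewrite [X in X = 0 -> _](_ : _ = \int[muxt]_(z in Q) (h z * 'D_v g z + 'D_v h z * g z)).
  by rewrite (RintegralD mQ i1 i2) => /eqP; rewrite addr_eq0 => /eqP.
apply: eq_Rintegral => z _.
have d1 : derivable h z v by exact: smooth_derivable.
have d2 : derivable g z v by exact: smooth_derivable.
by rewrite (deriveM d1 d2); congr (_ + _); exact: mulrC.
Qed.

Variables (c : V -> R) (G F : V * R -> R) (psi : V -> R) (al : R -> R) (t0 : R).
Hypotheses (sc : smooth_on setT c) (sF : smooth_on setT F).
Hypothesis GF : forall x t, Omega x -> 0 <= t <= b - a -> G (x, t) = F (x, t).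
Hypotheses (Tpsi : test_function Omega psi) (Tal : test_function `]a, b[%classic al).
Hypotheses (at0 : a < t0) (al0 : forall t, t <= t0 -> al t = 0).

Definition wave (z : V * R) : R := psi z.1 * al z.2.
Definition wave_grad (z : V * R) : V := \row_i ('D_(e_ i) psi z.1 * al z.2).
Definition wave_dt (z : V * R) : R := psi z.1 * 'D_1 al z.2.
(** The memory integral in the delay r = t - s, over the fixed range [0, b - a] in place of
    [0, t - a]. The added part is 0 because [al] vanishes before a, and a fixed range makes
    smoothness in z a matter of differentiating under the integral. *)
Definition wave_memory (i : 'I_n) (z : V * R) : R :=
  param_int (b - a) (fun y : (V * R) * R => F (y.1.1, y.2) * al (y.1.2 - y.2)) z *
  'D_(e_ i) psi z.1.
Definition wave_source (z : V * R) : R :=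
  - 2^-1 * (psi z.1 * 'D_1 ('D_1 al) z.2
    - \sum_i Dx i (fun z => c z.1 * ('D_(e_ i) psi z.1 * al z.2)) z
    + \sum_i Dx i (wave_memory i) z).

Let sp : smooth_on setT psi. Proof. by have [] := Tpsi. Qed.
Let sal : smooth_on setT al. Proof. by have [] := Tal. Qed.
Let sdp i : smooth_on setT ('D_(e_ i) psi). Proof. exact: smooth_derive. Qed.
Let sal1 : smooth_on setT ('D_1 al). Proof. exact: smooth_derive. Qed.
Let sal2 : smooth_on setT ('D_1 ('D_1 al)). Proof. exact: smooth_derive. Qed.
Let ba0 : 0 <= b - a. Proof. by rewrite subr_ge0 ltW. Qed.

Let scg i : smooth_on setT (fun z : V * R => c z.1 * ('D_(e_ i) psi z.1 * al z.2)).
Proof. exact: (smoothM (smooth_fst sc) (smoothM (smooth_fst (sdp i)) (smooth_snd sal))). Qed.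

Let smem i : smooth_on setT (wave_memory i).
Proof.
apply: smoothM; last exact: smooth_fst (sdp i).
apply: smooth_param_int => //; apply: smoothM.
  apply: (@smooth_affine R (V * R)%type ((V * R) * R)%type (fun y => (y.1.1, y.2)) (fun y => (y.1.1, y.2))) => //.
  move=> [[x t] r]; apply: (@cvg_pair _ _ _ _ (nbhs x) (nbhs r)); last exact: cvg_snd.
  by apply: (cvg_comp fst fst); exact: cvg_fst.
apply: (@smooth_affine R R ((V * R) * R)%type (fun y => y.1.2 - y.2) (fun y => y.1.2 - y.2) _ al _ sal).
  by move=> h y z /=; rewrite scalerBr; ring.
move=> [[x t] r]; apply: cvgB; last exact: cvg_snd.
by apply: (cvg_comp fst snd); [exact: cvg_fst|exact: cvg_snd].
Qed.

Lemma smooth_wave_source : smooth_on setT wave_source.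
Proof.
apply: smoothM; first exact: (@smooth_cst _ _ (- 2^-1)).
apply: smoothD; last by apply: smooth_sum => i; apply: smooth_derive; exact: smem.
apply: smoothB; last by apply: smooth_sum => i; apply: smooth_derive; exact: scg.
exact: (smoothM (smooth_fst sp) (smooth_snd sal2)).
Qed.

Let near_eq0 t : t < t0 -> \forall s \near t, al s = 0.
Proof. by move=> tt0; near=> s; apply: al0; apply: ltW; near: s; exact: lt_nbhsl. Unshelve. all: end_near. Qed.

Lemma wave_source_out z : z.2 < t0 -> wave_source z = 0.
Proof.
case: z => x t /= tt0; rewrite /wave_source /=.
have d2 : 'D_1 ('D_1 al) t = 0.
  rewrite (@near_eq_derive _ _ _ ('D_1 al) (fun=> 0)) ?derive_cst//.
  near=> s; rewrite (@near_eq_derive _ _ _ al (fun=> 0)) ?derive_cst//.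
  by apply: near_eq0; near: s; exact: lt_nbhsl.
rewrite d2 mulr0 sub0r.
have lx (g : V * R -> R) i : (forall y, g (y, t) = 0) -> Dx i g (x, t) = 0.
  move=> g0; rewrite /Dx /derive (_ : (fun h => _) = fun=> 0); first exact: lim_cst.
  apply/funext => h /=; rewrite (_ : h *: _ + (x, t) = (h *: (e_ i : V) + x, t)) ?g0 ?subrr ?scaler0//.
  by congr pair => /=; rewrite scaler0 add0r.
rewrite big1 => [|i _]; last by apply: lx => y /=; rewrite al0 ?mulr0// ltW.
rewrite big1 => [|i _]; first by rewrite oppr0 addr0 mulr0.
apply: lx => y; rewrite /wave_memory /param_int Rintegral_zero ?mul0r// => r /=.
by rewrite in_itv/= => /andP[r0 _]; rewrite al0 ?mulr0//; lra.
Unshelve. all: end_near. Qed.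

Let swave : smooth_on setT wave. Proof. exact: (smoothM (smooth_fst sp) (smooth_snd sal)). Qed.

Lemma wave_energy_space : energy_space Omega a b wave wave_grad wave_dt.
Proof.
have cw t : continuous (fun x => wave (x, t)) by apply: cont_time; exact: smooth_continuous.
have cg i : continuous (fun z => wave_grad z ord0 i).
  rewrite (_ : (fun z => _) = fun z => 'D_(e_ i) psi z.1 * al z.2).
    by apply: smooth_continuous; exact: (smoothM (smooth_fst (sdp i)) (smooth_snd sal)).
  by apply/funext => z; rewrite mxE.
split.
- by apply: L2Q; exact: smooth_continuous.
- split; first by move=> i; exact: L2Q.
  apply: aeW => t _; split.
  + by apply: L2O; exact: cw.
  + by move=> i; apply: L2O; exact: (@cont_time (fun z => wave_grad z ord0 i) t (cg i)).
  (* Each time slice of the wave is itself a test function, so a constant approximating sequence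
     shows membership in H^1_0. *)
  + exists (fun=> fun x => wave (x, t)).
      move=> _; have [_ cpsi Opsi] := Tpsi.
      have sub : closure [set x | wave (x, t) != 0] `<=` closure [set x | psi x != 0].
        by apply: closure_subset => x /=; rewrite /wave /= mulf_eq0 negb_or => /andP[].
      split.
      * exact: (smoothM sp (@smooth_cst _ _ (al t))).
      * by apply: subclosed_compact cpsi sub; exact: closed_closure.
      * exact: subset_trans sub Opsi.
    rewrite (_ : (fun k => _) = fun=> 0%E); first exact: cvg_cst.
    apply/funext => k; rewrite integral0_eq// => x Ox.
    rewrite subrr expr0n /= add0r big1// => i _.
    rewrite (_ : 'D_(e_ i) (fun x => wave (x, t)) x = wave_grad (x, t) ord0 i).
      by rewrite subrr expr0n.
    rewrite mxE /wave /=.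
    have -> : (fun x => psi x * al t) = al t *: psi by apply/funext => y; exact: mulrC.
    by rewrite (deriveZ (al t) (@smooth_derivable _ _ psi x (e_ i) sp)); exact: mulrC.
- by apply: L2Q; apply: smooth_continuous; exact: (smoothM (smooth_fst sp) (smooth_snd sal1)).
- move=> phi Tphi; rewrite (by_parts swave Tphi); last by left.
  by congr (- _); apply: eq_Rintegral => z _; congr (_ * _); exact: Dt_prod.
- move=> t _; split; first by apply: L2O; exact: cw.
  have Lpsi : mem_L2 mux Omega psi by apply: L2O; exact: smooth_continuous.
  have [_ ipsi] := (mem_L2P _ _ _).1 Lpsi.
  rewrite (_ : (fun s => _) = fun s => (((al s - al t) ^+ 2 * \int[mux]_(x in Omega) psi x ^+ 2))%:E).
    rewrite (_ : 0%E = ((al t - al t) ^+ 2 * \int[mux]_(x in Omega) psi x ^+ 2)%:E); last first.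
      by rewrite subrr expr0n mul0r.
    apply: cvg_EFin; first exact: nearW.
    apply: cvg_within_filter; apply: cvgM; last exact: cvg_cst.
    have cal : {for t, continuous (fun s => al s - al t)}.
      by apply: cvgB; [exact: smooth_continuous|exact: cvg_cst].
    apply: (@continuous_comp _ _ _ (fun s => al s - al t) (fun y : R => y ^+ 2) t) => //.
    exact: exprn_continuous.
  apply/funext => s.
  have i2 : rintegrable mux Omega (fun x => (al s - al t) ^+ 2 * psi x ^+ 2).
    exact: (rintegrableZl _ (measurable_open_rv oO) ipsi).
  rewrite -(RintegralZl _ (measurable_open_rv oO) ipsi) /Rintegral fineK; last exact: (integrable_fin_num (measurable_open_rv oO) i2).
  apply: eq_integral => x _; congr EFin; rewrite /wave /=.
  by rewrite -mulrBr exprMn mulrC.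
Qed.

Lemma Rintegral_translate_reflect (f : R -> R) (l t : R) : l <= t -> continuous f ->
  \int[mut]_(s in `[l, t]) f (t - s) = \int[mut]_(r in `[0, t - l]) f r.
Proof.
rewrite le_eqVlt => /predU1P[->|lt] cf.
  by rewrite subrr !set_itv1 !Rintegral_set1.
have dF x : is_derive x (1 : R) (fun x : R => t - x) (-1).
  by have := is_deriveB (is_derive_cst t x 1) (is_derive_id x 1); rewrite sub0r.
have DF : (fun x => t - x)^`()%classic = cst (-1).
  by apply/funext => x; rewrite derive1E; have [_ ->] := dF x.
have cF : continuous (fun x => t - x).
  by move=> x; apply/differentiable_continuous/derivable1_diffP; have [] := dF x.
have := @integration_by_substitution_decreasing R (fun x => t - x) f l t (ltW lt).
rewrite subrr => H; rewrite /Rintegral [in RHS]H.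
- congr fine; apply: eq_integral => x _ /=.
  by rewrite !fctE DF opprK /cst mulr1.
- by move=> x y _ _ xy; rewrite ltrD2l ltrN2.
- by rewrite DF => x _; exact: cst_continuous.
- by rewrite DF; exact: is_cvg_cst.
- by rewrite DF; exact: is_cvg_cst.
- split; [by move=> x _; have [] := dF x|exact/cvg_at_right_filter/cF|exact/cvg_at_left_filter/cF].
- exact: continuous_subspaceT.
Qed.

(** Reflection of [a, t] passes to the delay variable; for delays beyond t - a the argument of [al]
    is below a, so extending the range to b - a adds nothing. *)
Lemma wave_memoryE i x t : Omega x -> a <= t <= b ->
  \int[mut]_(s in `[a, t]) (G (x, t - s) * wave_grad (x, s) ord0 i) = wave_memory i (x, t).
Proof.
move=> Ox /andP[at_ tb]; pose k r := F (x, r) * al (t - r) * 'D_(e_ i) psi x.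
have cFx : continuous (fun r : R => F (x, r)).
  move=> r; apply: (@continuous_comp _ _ _ (fun r : R => (x, r)) F); last exact: smooth_continuous.
  by apply: (@cvg_pair _ _ _ (nbhs r) (nbhs x) (nbhs r)); [exact: cvg_cst|exact: cvg_id].
have cal : continuous (fun r : R => al (t - r)).
  move=> r; apply: (@continuous_comp _ _ _ (fun r : R => t - r) al); last exact: smooth_continuous.
  by apply: cvgB; [exact: cvg_cst|exact: cvg_id].
have ck0 : continuous (fun r => F (x, r) * al (t - r)) by move=> r; exact: cvgM (cFx r) (cal r).
have ck : continuous k by move=> r; apply: cvgM; [exact: ck0|exact: cvg_cst].
transitivity (\int[mut]_(s in `[a, t]) k (t - s)).
  apply: eq_Rintegral => s /set_mem /=; rewrite in_itv/= => /andP[as_ st].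
  have ts : 0 <= t - s <= b - a by apply/andP; split; lra.
  by rewrite (GF Ox ts) mxE /k /= (_ : t - (t - s) = s); ring.
rewrite (Rintegral_translate_reflect at_ ck) /wave_memory /param_int /=.
rewrite -RintegralZr//; last exact: continuous_rintegrable.
apply: Rintegral_eq_supp => r //=; rewrite !in_itv/= => /andP[r0 rt].
  by move=> H; exfalso; apply: H; rewrite r0 (le_trans rt)// lerD2r.
move=> H; have rta : t - a < r.
  by rewrite ltNge; apply/negP => rta; apply: H; rewrite r0 rta.
have -> : al (t - r) = 0 by apply: al0; move: at0 rta; lra.
by rewrite mulr0 mul0r.
Qed.

Let sum_by_parts (g : 'I_n -> V * R -> R) phi : (forall i, smooth_on setT (g i)) ->
  test_function (Omega `*` `]a, b[) phi ->
  \int[muxt]_(z in Q) (\sum_i g i z * Dx i phi z) =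
  - \int[muxt]_(z in Q) ((\sum_i Dx i (g i) z) * phi z).
Proof.
move=> sg Tphi; have [sphi _ _] := Tphi.
have cM (k l : V * R -> R) : smooth_on setT k -> smooth_on setT l -> rintegrable muxt Q (fun z => k z * l z).
  by move=> sk sl; apply: iQ; apply: smooth_continuous; exact: smoothM.
rewrite (Rintegral_sum mQ (fun i => cM _ _ (sg i) (smooth_derive ((e_ i, 0) : V * R) sphi))).
transitivity (- \sum_i \int[muxt]_(z in Q) (Dx i (g i) z * phi z)).
  rewrite -sumrN; apply: eq_bigr => i _; apply: (by_parts (sg i) Tphi); right; by exists i.
rewrite -(Rintegral_sum mQ (fun i => cM _ _ (smooth_derive ((e_ i, 0) : V * R) (sg i)) sphi)).
by congr (- _); apply: eq_Rintegral => z _; rewrite mulr_suml.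
Qed.

Lemma wave_equation : viscoacoustic_eq c G Omega a b wave_source wave wave_grad.
Proof.
move=> phi Tphi /=; rewrite -/Q; have [sphi _ _] := Tphi.
have cM (k l : V * R -> R) : smooth_on setT k -> smooth_on setT l -> rintegrable muxt Q (fun z => k z * l z).
  by move=> sk sl; apply: iQ; apply: smooth_continuous; exact: smoothM.
have Tdphi : test_function (Omega `*` `]a, b[) (Dt phi) by exact: test_function_derive.
have sdw : smooth_on setT (fun z : V * R => psi z.1 * 'D_1 al z.2).
  exact: (smoothM (smooth_fst sp) (smooth_snd sal1)).
have sdw2 : smooth_on setT (fun z : V * R => psi z.1 * 'D_1 ('D_1 al) z.2).
  exact: (smoothM (smooth_fst sp) (smooth_snd sal2)).
have E0 : \int[muxt]_(z in Q) (wave z * Dt (Dt phi) z) =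
    \int[muxt]_(z in Q) (psi z.1 * 'D_1 ('D_1 al) z.2 * phi z).
  rewrite (by_parts swave Tdphi); last by left.
  transitivity (- \int[muxt]_(z in Q) (psi z.1 * 'D_1 al z.2 * Dt phi z)).
    by congr (- _); apply: eq_Rintegral => z _; congr (_ * _); exact: Dt_prod.
  rewrite (by_parts sdw Tphi); last by left.
  by rewrite opprK; apply: eq_Rintegral => z _; congr (_ * _); exact: (Dt_prod sp sal1).
have E1 : \int[muxt]_(z in Q) (c z.1 * \sum_i wave_grad z ord0 i * Dx i phi z) =
    - \int[muxt]_(z in Q) ((\sum_i Dx i (fun z => c z.1 * ('D_(e_ i) psi z.1 * al z.2)) z) * phi z).
  rewrite -(sum_by_parts scg Tphi); apply: eq_Rintegral => z _; rewrite mulr_sumr.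
  by apply: eq_bigr => i _; rewrite mxE mulrA.
have E2 : \int[muxt]_(z in Q) \sum_i Dx i phi z *
      \int[mut]_(s in `[a, z.2]) (G (z.1, z.2 - s) * wave_grad (z.1, s) ord0 i) =
    - \int[muxt]_(z in Q) ((\sum_i Dx i (wave_memory i) z) * phi z).
  rewrite -(sum_by_parts smem Tphi); apply: eq_Rintegral => -[x t] /set_mem[/= Ox].
  rewrite in_itv/= => atb; apply: eq_bigr => i _.
  by rewrite (wave_memoryE i Ox atb) mulrC.
rewrite E0 E1 E2.
have s1 : smooth_on setT (fun z => \sum_i Dx i (fun z => c z.1 * ('D_(e_ i) psi z.1 * al z.2)) z).
  by apply: smooth_sum => i; apply: smooth_derive; exact: scg.
have s2 : smooth_on setT (fun z => \sum_i Dx i (wave_memory i) z).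
  by apply: smooth_sum => i; apply: smooth_derive; exact: smem.
have i0 := cM _ _ sdw2 sphi; have i1 := cM _ _ s1 sphi; have i2 := cM _ _ s2 sphi.
rewrite opprK -(RintegralB mQ i0 i1) -(RintegralD mQ (rintegrableB mQ i0 i1) i2).
rewrite -(RintegralZl _ mQ (rintegrableD mQ (rintegrableB mQ i0 i1) i2)).
by apply: eq_Rintegral => z _; rewrite -mulrBl -mulrDl mulrA.
Qed.

Lemma wave_initial : zero_initial_data Omega a wave.
Proof.
have w0 x t : t <= t0 -> wave (x, t) = 0 by move=> tt0; rewrite /wave /= al0 ?mulr0.
split; first by apply: aeW => x _; apply: w0; exact: ltW.
move=> xi _; apply: cvg_near_cst; near=> h.
have h0 : 0 < h by near: h; exact: nbhs_right_gt.
have ht : h < t0 - a by near: h; apply: nbhs_right_lt; rewrite subr_gt0.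
rewrite Rintegral_zero ?mulr0//; first exact: measurable_open_rv.
by move=> x _; rewrite !w0 ?subrr ?mul0r//; lra.
Unshelve. all: end_near. Qed.

Lemma wave_solution : generalized_solution c G Omega a b wave_source wave.
Proof.
exists wave_grad, wave_dt; split; [exact: wave_energy_space|exact: wave_equation|exact: wave_initial].
Qed.

End explicit_solution.

(** * Comparison of two operators *)

Section restricted_coefficients.
Context (R : realType) (n : nat).
Local Notation V := 'rV[R]_n.
Local Notation VR := (V * measurableTypeR R)%type.
Variables (Omega : set V) (c : V -> R) (F : V * R -> R) (L : R).
Hypotheses (oO : open Omega) (bO : bounded_set Omega) (L0 : 0 <= L).
Hypotheses (sc : smooth_on setT c) (pc : forall x, 0 < c x) (sF : smooth_on setT F).

(** The value 1 keeps the speed positive and bounded away from 0 off Omega, where the test functions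
    do not see it. *)
Definition restrict_speed (x : V) : R := if x \in Omega then c x else 1.
Definition restrict_kernel : VR -> R := F \_ (Omega `*` setT).

Lemma restrict_speedE x : Omega x -> restrict_speed x = c x.
Proof. by move=> Ox; rewrite /restrict_speed mem_set. Qed.

Lemma restrict_kernelE x t : Omega x -> restrict_kernel (x, t) = F (x, t).
Proof. by move=> Ox; rewrite /restrict_kernel patchE mem_set. Qed.

Lemma restrict_kernel_out x t : ~ Omega x -> restrict_kernel (x, t) = 0.
Proof. by move=> Ox; rewrite /restrict_kernel patchE memNset// => -[]. Qed.

Lemma smooth_section_time (g : V * R -> R) x : smooth_on setT g ->
  smooth_on setT (fun t : R => g (x, t)) /\
  forall t, 'D_1 (fun t : R => g (x, t)) t = 'D_((0, 1) : V * R) g (x, t).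
Proof.
move=> sg; have aff (h w y : R) : (x, h *: w + y) = h *: ((0, w) : V * R) + (x, y).
  by congr pair => /=; rewrite scaler0 add0r.
split; last first.
  by move=> t; rewrite (@derive_affine R (V * R)%type R (fun t => (x, t)) (fun w => (0, w))).
apply: (@smooth_affine R (V * R)%type R (fun t => (x, t)) (fun w => (0, w))) => //.
by move=> t; apply: (@cvg_pair _ _ _ (nbhs t) (nbhs x) (nbhs t)); [exact: cvg_cst|exact: cvg_id].
Qed.

Lemma restricted_coefficients : coefficients L restrict_speed restrict_kernel.
Proof.
have mO := measurable_open_rv oO.
have cc := smooth_continuous sc; have cF := smooth_continuous sF.
have sFt := smooth_derive ((0, 1) : V * R) sF.
have [B0 [_ HB0]] := bO; pose B1 := `|B0| + 1.
have OB1 x : Omega x -> `|x| <= B1.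
  by move=> Ox; apply: HB0 => //; rewrite /B1; apply: le_lt_trans (ler_norm _) _; rewrite ltrDl.
pose B := B1 + L + 1.
have B10 : 0 <= B1 by rewrite addr_ge0.
have inB x t : Omega x -> 0 <= t <= L -> ball (0 : V * R) B (x, t).
  move=> /OB1 xB /andP[t0 tL]; split; rewrite -ball_normE /= sub0r normrN.
    by apply: le_lt_trans xB _; rewrite /B; lra.
  by rewrite ger0_norm// /B; lra.
have Eout x : ~ Omega x -> (fun t => restrict_kernel (x, t)) = fun=> 0.
  by move=> Ox; apply/funext => t; exact: restrict_kernel_out.
have Ein x : Omega x -> (fun t => restrict_kernel (x, t)) = fun t => F (x, t).
  by move=> Ox; apply/funext => t; exact: restrict_kernelE.
have d0 (t : R) : 'D_1 (fun _ : R => 0 : R) t = 0 by exact: derive_cst.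
split.
- rewrite (_ : restrict_speed = fun x => ((fun x => c x - 1) \_ Omega) x + 1).
    apply: measurable_funD => //; apply/(measurable_restrictT _ mO).
    by apply: measurable_funTS; apply: measurable_funB => //; exact: measurable_continuous_rv.
  by apply/funext => x; rewrite /restrict_speed patchE; case: ifP => _; rewrite ?subrK// add0r.
- have mOT : measurable (Omega `*` [set: measurableTypeR R]) by exact: measurableX.
  by apply/(measurable_restrictT F mOT); apply: measurable_funTS; exact: measurable_continuous.
- have cz : continuous (fun z : V * R => c z.1).
    by move=> z; apply: continuous_comp; [exact: cvg_fst|exact: cc].
  have ciz : continuous (fun z : V * R => (c z.1)^-1).
    by move=> z; apply: cvgV; [rewrite gt_eqF|exact: cz].
  have [M1 M10 HM1] := continuous_bounded_ball B cz.
  have [M2 M20 HM2] := continuous_bounded_ball B ciz.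
  have M21 : 0 < M2 + 1 by rewrite ltr_wpDl.
  have t00 : 0 <= (0 : R) <= L by rewrite lexx.
  (* [M2] bounds 1/c and [M1] bounds c over Omega; the added 1 avoids inverting 0 and puts the outer
     value 1 between the two bounds. *)
  exists (M2 + 1)^-1, (M1 + 1); split; first by rewrite invr_gt0.
  move=> x; rewrite /restrict_speed; case: ifPn => [/set_mem Ox|_].
    have := HM1 _ (inB x 0 Ox t00); have := HM2 _ (inB x 0 Ox t00); rewrite /= !gtr0_norm ?invr_gt0//.
    move=> h2 h1; apply/andP; split; last by rewrite (le_trans h1)// lerDl.
    by rewrite invf_ple ?posrE// (le_trans h2)// lerDl.
  by rewrite invf_le1// !lerDr M10 M20.
- move=> x t; have [Ox|Ox] := pselect (Omega x); last by rewrite (Eout _ Ox); exact: derivable_cst.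
  by rewrite (Ein _ Ox); exact: smooth_derivable (smooth_section_time x sF).1.
- move=> x; have [Ox|Ox] := pselect (Omega x); last first.
    rewrite (Eout _ Ox) (_ : 'D_(1 : R) _ = fun=> 0); first exact: cst_continuous.
    exact/funext.
  rewrite (Ein _ Ox); apply: smooth_continuous; apply: smooth_derive.
  exact: (smooth_section_time x sF).1.
- have [M1 M10 HM1] := continuous_bounded_ball B cF.
  have [M2 M20 HM2] := continuous_bounded_ball B (smooth_continuous sFt).
  exists (M1 + M2) => x t tL; have [Ox|Ox] := pselect (Omega x); last first.
    by rewrite (Eout _ Ox) restrict_kernel_out// d0 normr0 addr_ge0.
  rewrite (Ein _ Ox) restrict_kernelE// (smooth_section_time x sF).2; split.
    by apply: le_trans (HM1 _ (inB x t Ox tL)) _; rewrite lerDl.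
  by apply: le_trans (HM2 _ (inB x t Ox tL)) _; rewrite lerDr.
Qed.

End restricted_coefficients.

(** * Vanishing of the gradient of a function that is zero almost everywhere *)

Section weak_gradient.
Context (R : realType) (n : nat).
Local Notation V := 'rV[R]_n.
Local Notation VR := (V * measurableTypeR R)%type.
Local Notation e_ i := (delta_mx ord0 i : V).
Local Notation mux := (lebesgue_rv R n).
Local Notation mut := (@lebesgue_measure R).
Local Notation muxt := (lebesgue_rv R n \x @lebesgue_measure R)%E.
Variables (Omega : set V) (a b L : R) (c : V -> R) (F : V * R -> R).
Hypotheses (oO : open Omega) (bO : bounded_set Omega) (ab : a < b) (baL : b - a <= L).
Hypotheses (sc : smooth_on setT c) (pc : forall x, 0 < c x) (sF : smooth_on setT F).
Variables (u : VR -> R) (p : 'I_n -> VR -> R).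
Hypothesis class : energy_class Omega a b u p.
Hypothesis u0 : {ae muxt, forall z, u z = 0}.

Let mab (t : R) : measurable (`[a, t]%classic : set (measurableTypeR R)). Proof. by []. Qed.

Let bounded_out (g : V -> R) : test_function Omega g ->
  exists B : R, forall v, ~ ball 0 B v -> g v = 0.
Proof.
move=> Tg; have [B0 [_ HB0]] := bO; exists (`|B0| + 1 + 1) => v vB.
apply: (test_function_out Tg) => Ov; apply: vB.
have BB : B0 < `|B0| + 1 by apply: le_lt_trans (ler_norm _) _; rewrite ltrDl.
have xB : `|v| <= `|B0| + 1 := HB0 _ BB v Ov.
by rewrite -ball_normE /= sub0r normrN (le_lt_trans xB)// ltrDl.
Qed.

Let test_parts i (ze psi : V -> R) : test_function Omega ze -> test_function Omega psi ->
  \int[mux]_x ('D_(e_ i) ze x * psi x) = - \int[mux]_x (ze x * 'D_(e_ i) psi x).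
Proof.
move=> Tze Tpsi; have [sz _ _] := Tze; have [sp _ _] := Tpsi.
have [B HB] := bounded_out Tze.
have L1 := L2fun_test bO Tze; have L2 := L2fun_test bO Tpsi.
have L3 := L2fun_test bO (test_function_derive (e_ i) Tze).
have L4 := L2fun_test bO (test_function_derive (e_ i) Tpsi).
have szp : smooth_on setT (fun x => ze x * psi x) by exact: smoothM.
have H : forall v, ~ ball 0 B v -> ze v * psi v = 0 by move=> v /HB ->; rewrite mul0r.
have := Rintegral_rv_derive0 i szp H.
rewrite [X in X = 0 -> _](_ : _ =
    \int[mux]_x ('D_(e_ i) ze x * psi x + ze x * 'D_(e_ i) psi x)); last first.
  apply: eq_Rintegral => x _.
  have d1 : derivable ze x (e_ i) by exact: smooth_derivable.
  have d2 : derivable psi x (e_ i) by exact: smooth_derivable.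
  by rewrite (deriveM d1 d2) addrC; congr (_ + _); exact: mulrC.
rewrite (RintegralD measurableT (L2fun_mul L3 L2) (L2fun_mul L1 L4)).
by move=> /eqP; rewrite addr_eq0 => /eqP.
Qed.

Let u_slice : {ae mut, forall r, forall h : V -> R, L2fun h -> \int[mux]_x (h x * u (x, r)) = 0}.
Proof.
have mT : measurable [set: measurableTypeR R] by [].
have iu2 : rintegrable muxt (setT `*` setT) (fun z => u z ^+ 2) by rewrite setXTT; exact: ec_u2 class.
have int0 : \int[mut]_(t in setT) \int[mux]_(x in setT) u (x, t) ^+ 2 = 0.
  rewrite (Fubini_Rintegral21 measurableT mT iu2).
  transitivity (\int[muxt]_(z in setT `*` setT) (0 : R)); last first.
    by apply: Rintegral_zero => //; exact: measurableX.
  apply: ae_eq_Rintegral => //; first by rewrite setXTT.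
    exact: (rintegrable_meas iu2).
  by apply: filterS u0 => z -> _; rewrite expr0n.
have := Rintegral_ae0 mT (rintegrable_Rintegral21 measurableT mT iu2)
  (fun t _ => Rintegral_ge0 _ (fun x _ => sqr_ge0 _)) int0.
apply: (@filterS _ _ (ae_filter_ringOfSetsType mut)) => r /(_ I) Hr h Lh.
have Lu := ec_L2 class r.
have ux0 := Rintegral_ae0 measurableT Lu.2 (fun x _ => sqr_ge0 _) Hr.
transitivity (\int[mux]_(x in setT) (0 : R)); last exact: Rintegral_zero.
apply: ae_eq_Rintegral => //; first by apply: measurable_funM; [exact: Lh.1|exact: Lu.1].
apply: filterS ux0 => x /(_ I)/eqP; rewrite sqrf_eq0 => /eqP -> _.
by rewrite mulr0.
Qed.

(** For a test function [ze], integration by parts shows that the i-th derivative of [ze], paired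
    with the field whose only component is [ze] in direction i, satisfies the orthogonality in
    [ec_dual]. Hence the integral of ze p_i is minus that of u times the derivative of [ze], which
    is 0. *)
Let p_slice : {ae mut, forall r, a <= r <= b ->
  (forall i, L2fun (fun x => p i (x, r))) /\
  forall i ze, test_function Omega ze -> \int[mux]_x (ze x * p i (x, r)) = 0}.
Proof.
have := ec_dual class; have := u_slice.
apply: (@filterS2 _ _ (ae_filter_ringOfSetsType mut)) => r ur Hr arb.
have [ip {}Hr] := Hr arb; split.
  by move=> i; split; [exact: section_meas (ec_mp class i)|exact: ip].
move=> i ze Tze; pose al j := if j == i then ze else fun=> 0.
have Lze := L2fun_test bO Tze.
have L0 : L2fun (fun _ : V => 0 : R).
  split=> //; apply: (eq_rintegrable measurableT (f := fun=> 0)); last exact: integrable0.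
  by move=> x _; rewrite expr0n.
have Lal j : L2fun (al j) by rewrite /al; case: ifP.
have sum_al (g : 'I_n -> V -> R) : \sum_j \int[mux]_x (al j x * g j x) = \int[mux]_x (ze x * g i x).
  rewrite (bigD1 i)//= /al eqxx big1 ?addr0// => j /negbTE ->.
  by apply: Rintegral_zero => // x _; rewrite mul0r.
have Ldz := L2fun_test bO (test_function_derive (e_ i) Tze).
have := Hr _ al Ldz Lal; rewrite (ur _ Ldz) sum_al => H.
apply/eqP; rewrite -oppr_eq0 -H//= => psi w [Tpsi wE].
by rewrite sum_al wE; exact: test_parts.
Qed.

Variables (psi : V -> R) (th : R -> R).
Hypotheses (Tpsi : test_function Omega psi) (Tth : test_function `]a, b[%classic th).

Let sp : smooth_on setT psi. Proof. by have [] := Tpsi. Qed.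

Let test_mul (h g : V -> R) : smooth_on setT h -> test_function Omega g ->
  test_function Omega (fun x => h x * g x).
Proof.
move=> sh [sg cg Og].
have sub : closure [set z | h z * g z != 0] `<=` closure [set z | g z != 0].
  by apply: closure_subset => z /=; rewrite mulf_eq0 negb_or => /andP[].
split; first exact: smoothM.
- by apply: subclosed_compact cg sub; exact: closed_closure.
- exact: subset_trans sub Og.
Qed.

Let c' := restrict_speed Omega c.
Let F' := restrict_kernel Omega F.
Let L0 : 0 <= L. Proof. by apply: le_trans baL; rewrite subr_ge0 ltW. Qed.
Let K : coefficients L c' F'. Proof. exact: restricted_coefficients. Qed.

Let p_out i x t : ~ Omega x -> p i (x, t) = 0.
Proof. by move=> Ox; apply: (ec_p0 class) => -[]. Qed.

Let Ldpsi i : L2fun ('D_(e_ i) psi).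
Proof. exact: (L2fun_test bO (test_function_derive _ Tpsi)). Qed.

Let speed_term i t : (forall ze, test_function Omega ze -> \int[mux]_x (ze x * p i (x, t)) = 0) ->
  \int[mux]_x (c' x * p i (x, t) * 'D_(e_ i) psi x) = 0.
Proof.
move=> /(_ _ (test_mul sc (test_function_derive (e_ i) Tpsi))) <-; apply: eq_Rintegral => x _.
have [Ox|Ox] := pselect (Omega x); last by rewrite p_out// !mulr0 mul0r.
by rewrite /c' restrict_speedE// mulrAC.
Qed.

Let kernel_integrable i t : a <= t <= b ->
  rintegrable muxt (setT `*` `[a, t])
    (fun z => F' (z.1, t - z.2) * p i z * 'D_(e_ i) psi z.1).
Proof.
move=> /andP[at_ tb]; have mD : measurable ([set: V] `*` (`[a, t] : set (measurableTypeR R))).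
  exact: measurableX.
have [mpsi ipsi] := Ldpsi i; have [M FM] := co_FM K.
have mpsi1 : measurable_fun setT (fun z : VR => 'D_(e_ i) psi z.1).
  exact: (measurableT_comp mpsi measurable_fst).
have mFt : measurable_fun setT (fun z : VR => F' (z.1, t - z.2)).
  apply: (measurableT_comp (f := F') (co_mF K)); apply: measurable_fun_pair => //.
  exact: measurable_funB.
have ipp : rintegrable muxt (setT `*` `[a, t]) (fun z => p i z * 'D_(e_ i) psi z.1).
  apply: (rintegrable_mulL2 mD).
  - exact: measurable_funTS (ec_mp class i).
  - exact: measurable_funTS.
  - exact: rintegrableS (ec_p2 class i).
  - apply: (rintegrable_prod measurableT (mab t) _ _ _ (rintegrableZl (t - a) measurableT ipsi)).
    + by apply: measurable_funTS; exact: measurable_funX.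
    + move=> x _; exact: (rintegrable_cst ('D_(e_ i) psi x ^+ 2) (mab t) (lebesgue_itv_lty a t)).
    + move=> x _ /=; rewrite Rintegral_cst//.
      have E : fine (mut `[a, t]%classic) = t - a.
        rewrite lebesgue_measure_itv/= lte_fin; case: ltgtP at_ => // -> _.
        by rewrite subrr.
      by rewrite [X in _ * X <= _](_ : _ = t - a)// mulrC ger0_norm ?sqr_ge0.
apply: (rintegrable_le mD _ _ (rintegrableZl M mD (rintegrable_norm ipp))).
  apply: measurable_funTS; apply: measurable_funM => //; apply: measurable_funM => //.
  exact: ec_mp class i.
move=> [x s] [_ /=]; rewrite in_itv/= => /andP[as_ st].
rewrite -mulrA normrM ler_wpM2r//; apply: (FM x (t - s) _).1.
by apply/andP; split; move: baL; lra.
Qed.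

Let kernel_test i r : test_function Omega (fun x => F (x, r) * 'D_(e_ i) psi x).
Proof.
apply: test_mul; last exact: test_function_derive.
have aff (h : R) (w y : V) : (h *: w + y, r) = h *: ((w, 0) : V * R) + (y, r).
  by congr pair => /=; rewrite scaler0 add0r.
apply: (@smooth_affine R (V * R)%type V (fun x => (x, r)) (fun x => (x, 0))) => //.
by move=> x; apply: (@cvg_pair _ _ _ (nbhs x) (nbhs x) (nbhs r)); [exact: cvg_id|exact: cvg_cst].
Qed.

Let cF'x x : continuous (fun r : R => F' (x, r)).
Proof. by move=> r; apply/differentiable_continuous/derivable1_diffP; exact: co_dF K x r. Qed.

(** After Fubini, at each past time s the gradient is integrated against F (., t - s) times a
    derivative of [psi]. This is a test function, so [p_slice] gives 0 for almost every s. *)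
Let kernel_term i t : a <= t <= b ->
  rintegrable mux setT (fun x => convx a F' (p i) (x, t) * 'D_(e_ i) psi x) /\
  \int[mux]_x (convx a F' (p i) (x, t) * 'D_(e_ i) psi x) = 0.
Proof.
move=> atb; have /andP[at_ tb] := atb; have ik := kernel_integrable i atb.
have E x : convx a F' (p i) (x, t) * 'D_(e_ i) psi x =
    \int[mut]_(s in `[a, t]) (F' (x, t - s) * p i (x, s) * 'D_(e_ i) psi x).
  by rewrite (RintegralZr _ (mab t) (rintegrable_conv t (@cF'x x) (ec_causal_p i x class))).
split.
  apply: (eq_rintegrable measurableT _ (rintegrable_Rintegral12 measurableT (mab t) ik)) => x _.
  exact/esym/E.
rewrite (eq_Rintegral _ (fun x _ => E x)) (Fubini_Rintegral measurableT (mab t) ik).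
transitivity (\int[mut]_(s in `[a, t]) (0 : R)); last exact: Rintegral_zero.
apply: ae_eq_Rintegral => //.
  exact: (rintegrable_meas (rintegrable_Rintegral21 measurableT (mab t) ik)).
suff Z : {ae mut, forall s, `[a, t]%classic s ->
    \int[mux]_x (F' (x, t - s) * p i (x, s) * 'D_(e_ i) psi x) = 0} by exact: Z.
move: p_slice; apply: (@filterS _ _ (ae_filter_ringOfSetsType mut)) => s Hs.
rewrite /= in_itv/= => /andP[as_ st]; have [|_ {}Hs] := Hs; first by rewrite as_ (le_trans st tb).
rewrite -(Hs i _ (kernel_test i (t - s))); apply: eq_Rintegral => x _.
have [Ox|Ox] := pselect (Omega x); last by rewrite p_out// !mulr0 mul0r.
by rewrite /F' restrict_kernelE// mulrAC.
Qed.

(** The weak form depends on [p], which is not determined by [u] pointwise; this makes it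
    insensitive to changing the solution on a null set. *)
Lemma weak_form_ae0 : weak_form a b c' F' u p psi th = 0.
Proof.
have cth2 : continuous ('D_1 ('D_1 th)).
  by have [sth _ _] := Tth; apply: smooth_continuous; do 2 apply: smooth_derive.
have cth : continuous th by have [/smooth_continuous] := Tth.
have abb : a <= b <= b by rewrite lexx ltW.
have mth (g : R -> R) : continuous g -> measurable_fun `[a, b] (g : measurableTypeR R -> R).
  by move=> cg; apply: measurable_funTS; exact: continuous_measurable_fun.
rewrite (weak_formE ab baL K bO Tpsi Tth class) -[RHS]addr0; congr (_ + _).
  transitivity (\int[mut]_(s in `[a, b]) (0 : R)); last exact: Rintegral_zero.
  apply: ae_eq_Rintegral => //.
    apply: measurable_funM; last exact: mth.
    exact: (rintegrable_meas (rintegrable_Rintegral21 measurableT (mab b)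
      (rintegrable_term0_cst ab bO Tpsi class))).
  suff Z : {ae mut, forall s, `[a, b]%classic s ->
      \int[mux]_x (u (x, s) * psi x) * 'D_1 ('D_1 th) s = 0} by exact: Z.
  move: u_slice; apply: (@filterS _ _ (ae_filter_ringOfSetsType mut)) => s Hs _.
  rewrite (_ : \int[mux]_x (u (x, s) * psi x) = 0) ?mul0r//.
  by under eq_Rintegral do rewrite mulrC; exact: Hs (L2fun_test bO Tpsi).
transitivity (\int[mut]_(s in `[a, b]) (0 : R)); last exact: Rintegral_zero.
apply: ae_eq_Rintegral => //.
  apply: measurable_funM; last exact: mth.
  apply: measurable_sum => i.
  exact: (rintegrable_meas (rintegrable_Rintegral21 measurableT (mab b)
    (ec_memory_op i (ltW ab) baL K class (Ldpsi i) abb))).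
suff Z : {ae mut, forall s, `[a, b]%classic s ->
    (\sum_i \int[mux]_x (memory_op a c' F' (p i) (x, s) * 'D_(e_ i) psi x)) * th s = 0} by exact: Z.
move: p_slice; apply: (@filterS _ _ (ae_filter_ringOfSetsType mut)) => s Hs.
rewrite /= in_itv/= => asb; have [Lp {}Hs] := Hs asb.
rewrite big1 ?mul0r// => i _; have [i2 E2] := kernel_term i asb.
have i1 : rintegrable mux setT (fun x => c' x * p i (x, s) * 'D_(e_ i) psi x).
  have Lze := L2fun_test bO (test_mul sc (test_function_derive (e_ i) Tpsi)).
  apply: (eq_rintegrable measurableT _ (L2fun_mul Lze (Lp i))) => x _.
  have [Ox|Ox] := pselect (Omega x); last by rewrite p_out// !mulr0 mul0r.
  by rewrite /c' restrict_speedE// mulrAC.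
under eq_Rintegral do rewrite mulrBl.
by rewrite (RintegralB measurableT i1 i2) E2 subr0; exact: speed_term (Hs i).
Qed.

End weak_gradient.

(** * Bump functions on boxes *)

Section bump_functions.
Context (R : realType) (n : nat).
Local Notation V := 'rV[R]_n.
Local Notation e_ i := (delta_mx ord0 i : V).
Local Notation mux := (lebesgue_rv R n).
Local Notation mut := (@lebesgue_measure R).
Local Notation muxt := (lebesgue_rv R n \x @lebesgue_measure R)%E.

(** An open set around z contains a product of two balls, which has positive measure. *)
Lemma ae_open_false (U : set (V * R)) (z : V * R) : open U -> U z ->
  {ae muxt, forall z : V * measurableTypeR R, ~ U z} -> False.
Proof.
move=> oU Uz [A [mA A0 UA]].
have /nbhs_ballP[r /= r0 zr] := open_nbhs_nbhs (conj oU Uz : open_nbhs z U).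
have mB1 := measurable_rv_ball z.1 r.
have mB2 : measurable (ball z.2 r : set (measurableTypeR R)) by exact: measurable_ball.
pose B : set (V * measurableTypeR R) := ball z.1 r `*` ball z.2 r.
have mB : measurable B by exact: measurableX.
have BA : B `<=` A by move=> y [y1 y2]; apply: UA => /= nU; apply: nU; apply: zr; split.
have : (muxt B <= 0)%E by rewrite -A0; apply: le_measure; rewrite ?inE.
rewrite leNgt => /negP; apply.
rewrite [X in (_ < X)%E](@product_measure1E _ _ _ _ R mux mut _ _ mB1 mB2).
apply: mule_gt0.
  rewrite [X in (_ < X)%E](_ : _ = ((r *+ 2) ^+ n)%:E); last exact: lebesgue_rv_ball.
  by rewrite lte_fin exprn_gt0// mulrn_wgt0.
rewrite [X in (_ < X)%E](_ : _ = (r *+ 2)%:E); last exact: (lebesgue_measure_ball _ (ltW r0)).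
by rewrite lte_fin mulrn_wgt0.
Qed.

Lemma test_function_bump (x r a b : R) : a < x - r -> x + r < b ->
  test_function `]a, b[%classic (bump x r).
Proof.
move=> ax xb; apply: (test_function_itv ax xb); first exact: smooth_bump.
  by move=> t tx; apply: bump_eq0; rewrite ler_normr; apply/orP; right; lra.
by move=> t tx; apply: bump_eq0; rewrite ler_normr; apply/orP; left; lra.
Qed.

Definition rv_bump (x : V) (r : R) (v : V) : R := \prod_i bump (x ord0 i) r (v ord0 i).

Lemma smooth_rv_bump x r : smooth_on setT (rv_bump x r).
Proof.
apply: smooth_prod => i.
apply: (@smooth_affine R R V (fun v => v ord0 i) (fun v => v ord0 i)).
- by move=> h v y; rewrite !mxE.
- exact: coord_continuous.
- exact: smooth_bump.
Qed.

Lemma rv_bump_gt0 x r : 0 < r -> 0 < rv_bump x r x.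
Proof. by move=> r0; apply: prodr_gt0 => i _; apply: bump_gt0; rewrite subrr normr0. Qed.

Lemma rv_bump_eq0 (x v : V) (r : R) (i : 'I_n) : r <= `|v ord0 i - x ord0 i| -> rv_bump x r v = 0.
Proof. by move=> h; rewrite /rv_bump (bigD1 i)//= bump_eq0 ?mul0r. Qed.

Definition box (x : V) (r : R) : set V := [set v | forall i, `|v ord0 i - x ord0 i| <= r].

Lemma compact_box x r : compact (box x r).
Proof.
rewrite (_ : box x r = [set v : V | forall i, `[x ord0 i - r, x ord0 i + r]%classic (v ord0 i)]).
  by apply: (@rV_compact R n (fun i => `[x ord0 i - r, x ord0 i + r]%classic)) => i; exact: segment_compact.
by apply/seteqP; split=> v H i; have := H i; rewrite /= in_itv/= ler_distl.
Qed.

Lemma closure_rv_bump x r : closure [set v | rv_bump x r v != 0] `<=` box x r.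
Proof.
have cbox : closed (box x r).
  by apply: compact_closed; [exact: norm_hausdorff|exact: compact_box].
rewrite closureE => v; apply; split=> // w /= w0 i; rewrite leNgt; apply/negP => /ltW rw.
by move/eqP: w0; apply; exact: rv_bump_eq0 rw.
Qed.

Lemma test_function_rv_bump Omega x r : box x r `<=` Omega -> test_function Omega (rv_bump x r).
Proof.
move=> bO; split; first exact: smooth_rv_bump.
  apply: (subclosed_compact _ _ (@closure_rv_bump x r)); first exact: closed_closure.
  exact: compact_box.
exact: subset_trans (@closure_rv_bump x r) bO.
Qed.

Lemma derive_rv_bump_out x r i v : ~ box x r v -> 'D_(e_ i) (rv_bump x r) v = 0.
Proof.
by have T := @test_function_rv_bump (box x r) x r (fun _ => id);
  move=> bv; exact: (test_function_out (test_function_derive (e_ i) T) bv).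
Qed.

(** Otherwise the bump would be constant along the line through x in direction i, although it is
    positive at x and 0 at distance r. *)
Lemma rv_bump_gradient x r (i : 'I_n) : 0 < r -> exists v, 'D_(e_ i) (rv_bump x r) v != 0.
Proof.
move=> r0; apply: contrapT => /forallNP H.
have D0 v : 'D_(e_ i) (rv_bump x r) v = 0 by apply/eqP; have /negP := H v; rewrite negbK.
pose f (s : R) := rv_bump x r (s *: e_ i + x).
have aff (h w y : R) : (h *: w + y) *: e_ i + x = h *: (w *: e_ i) + (y *: e_ i + x).
  by rewrite scalerDl -addrA scalerA.
have cl : continuous (fun s : R => s *: e_ i + x).
  by move=> s; apply: cvgD; [apply: cvgZr_tmp; exact: cvg_id|exact: cvg_cst].
have sf : smooth_on setT f.
  exact: (@smooth_affine R V R (fun s => s *: e_ i + x) (fun w => w *: e_ i) aff _ cl (smooth_rv_bump x r)).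
have df s : 'D_1 f s = 0.
  rewrite (@derive_affine R V R (fun s => s *: e_ i + x) (fun w => w *: e_ i) aff (rv_bump x r)).
  by rewrite scale1r D0.
have f0r : f r = f 0.
  apply/eqP; rewrite -subr_eq0; apply/eqP.
  rewrite -(FTC2 (ltW r0)).
  - by apply: Rintegral_zero => // s _; exact: df.
  - by move=> s; exact: smooth_derivable.
  - by apply: smooth_continuous; exact: smooth_derive.
have : 0 < f 0 by rewrite /f scale0r add0r rv_bump_gt0.
rewrite -f0r /f (@rv_bump_eq0 _ _ _ i) ?ltxx//.
by rewrite !mxE !eqxx mulr1 addrK ler_norm.
Qed.

End bump_functions.

Section uniqueness.
Context (R : realType) (n : nat).
Local Notation V := 'rV[R]_n.
Local Notation VR := (V * measurableTypeR R)%type.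
Local Notation e_ i := (delta_mx ord0 i : V).
Local Notation mux := (lebesgue_rv R n).
Local Notation mut := (@lebesgue_measure R).
Local Notation muxt := (lebesgue_rv R n \x @lebesgue_measure R)%E.
Variables (Omega : set V) (a b : R).
Hypotheses (oO : open Omega) (bO : bounded_set Omega) (ab : a < b).

Let ba0 : 0 <= b - a. Proof. by rewrite subr_ge0 ltW. Qed.

Section one_operator.
Variables (c : V -> R) (G F : V * R -> R).
Hypotheses (sc : smooth_on setT c) (pc : forall x, 0 < c x) (sF : smooth_on setT F).
Hypothesis GF : forall x t, Omega x -> 0 <= t <= b - a -> G (x, t) = F (x, t).

Let K := restricted_coefficients oO bO ba0 sc pc sF.
Let cE x : Omega x -> restrict_speed Omega c x = c x. Proof. exact: restrict_speedE. Qed.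
Let FE x t : Omega x -> 0 <= t <= b - a -> restrict_kernel Omega F (x, t) = G (x, t).
Proof. by move=> Ox tab; rewrite restrict_kernelE// GF. Qed.

Lemma generalized_solution_unique f u v :
  generalized_solution c G Omega a b f u -> generalized_solution c G Omega a b f v ->
  {ae muxt, forall z : VR, (Omega `*` `[a, b]) z -> u z = v z}.
Proof.
move=> /(generalized_solution_class oO bO ab (lexx _) K cE FE)[u' [p' [cu eu wu]]].
move=> /(generalized_solution_class oO bO ab (lexx _) K cE FE)[v' [q' [cv ev wv]]].
have cuv := energy_classB ab bO cu cv.
have := energy_class_unique ab (lexx b) (lexx _) K bO cuv.
have wuv psi th : test_function Omega psi -> test_function `]a, b[%classic th ->
    weak_form a b (restrict_speed Omega c) (restrict_kernel Omega F)
      (fun z => u' z - v' z) (fun i z => p' i z - q' i z) psi th = 0.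
  move=> Tpsi Tth; rewrite (weak_formB ab (lexx _) K bO Tpsi Tth cu cv).
  by rewrite wu// wv// subrr.
move=> /(_ wuv); move: eu ev; apply: filterS3 => z uz vz duv Qz.
rewrite -uz// -vz//; apply/eqP; rewrite -subr_eq0; apply/eqP; apply: duv.
by case: Qz => _ /=; rewrite in_itv/= => /andP[].
Qed.

(** Tested in time on ]a, T[ only, the source contributes nothing, so the homogeneous equation holds
    up to T and causal uniqueness applies. *)
Lemma solution_vanishes f T u' p' : a < T -> T <= b -> (forall z, z.2 <= T -> f z = 0) ->
  energy_class Omega a b u' p' ->
  (forall psi th, test_function Omega psi -> test_function `]a, b[%classic th ->
     weak_form a b (restrict_speed Omega c) (restrict_kernel Omega F) u' p' psi th =
     - 2 * \int[muxt]_(z in Omega `*` `[a, b]) (f z * (psi z.1 * th z.2))) ->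
  {ae muxt, forall z : VR, z.2 <= T -> u' z = 0}.
Proof.
move=> aT Tb f0 cu wu; apply: (energy_class_unique aT Tb (lexx _) K bO cu) => psi th Tpsi Tth.
have subT : (`]a, T[%classic : set R) `<=` `]a, b[%classic.
  by apply: subset_itvl; rewrite bnd_simp.
rewrite wu//; last exact: test_function_subset Tth.
rewrite Rintegral_zero ?mulr0//.
  by apply: measurableX => //; exact: measurable_open_rv.
move=> z _; have [zT|Tz] := leP z.2 T; first by rewrite f0// mul0r.
rewrite (test_function_out Tth) ?mulr0// => /=; rewrite in_itv/= => /andP[_].
by rewrite ltNge ltW.
Qed.

End one_operator.

Section two_operators.
Variables (T : R) (c1 c2 : V -> R) (G1 G2 F1 F2 : V * R -> R).
Hypotheses (aT : a < T) (Tb : T < b).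
Hypotheses (sc1 : smooth_on setT c1) (pc1 : forall x, 0 < c1 x).
Hypotheses (sc2 : smooth_on setT c2) (pc2 : forall x, 0 < c2 x).
Hypotheses (sF1 : smooth_on setT F1) (sF2 : smooth_on setT F2).
Hypothesis GF1 : forall x t, Omega x -> 0 <= t <= b - a -> G1 (x, t) = F1 (x, t).
Hypothesis GF2 : forall x t, Omega x -> 0 <= t <= b - a -> G2 (x, t) = F2 (x, t).
Hypothesis same : forall f t0, T < t0 -> smooth_on setT f -> (forall z, z.2 < t0 -> f z = 0) ->
  {ae muxt, forall z : VR, Omega z.1 -> T < z.2 <= b ->
    the_solution c1 G1 Omega a b f z = the_solution c2 G2 Omega a b f z}.

Variables (psi : V -> R) (al : R -> R) (t0 : R) (x1 : V) (t1 : R).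
Hypotheses (Tpsi : test_function Omega psi) (Tal : test_function `]a, b[%classic al).
Hypotheses (Tt0 : T < t0) (al0 : forall t, t <= t0 -> al t = 0).
Hypotheses (px1 : psi x1 != 0) (at1 : al t1 != 0).

Let at0 : a < t0. Proof. exact: lt_trans aT Tt0. Qed.
Let f := wave_source a b c1 F1 psi al.
Let w := wave psi al.
Let f_out z : z.2 < t0 -> f z = 0. Proof. exact: wave_source_out. Qed.
Let w_out z : z.2 <= t0 -> w z = 0.
Proof. by move=> zt; rewrite /w /wave al0// mulr0. Qed.

Let sol1 : generalized_solution c1 G1 Omega a b f w. Proof. exact: (wave_solution oO bO ab sc1 sF1 GF1 Tpsi Tal at0 al0). Qed.

Let the_solutionP c G (g u : V * R -> R) : generalized_solution c G Omega a b g u ->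
  generalized_solution c G Omega a b g (the_solution c G Omega a b g).
Proof. by move=> gu; apply: (@xgetPex _ (fun=> 0)); exists u. Qed.

(** [the_solution] is an unspecified representative even for the first operator; uniqueness
    identifies it with the wave almost everywhere before [same] carries it over to the second
    operator. *)
Let the_solution_eq_wave : {ae muxt, forall z : VR, Omega z.1 -> T < z.2 <= b ->
  the_solution c2 G2 Omega a b f z = w z}.
Proof.
have H1 := generalized_solution_unique sc1 pc1 sF1 GF1 (the_solutionP sol1) sol1.
have H2 := same Tt0 (smooth_wave_source ab sc1 sF1 Tpsi Tal) f_out.
apply: filterS2 H1 H2 => z E1 E2 Oz Tzb; apply: etrans (esym (E2 Oz Tzb)) _; apply: E1.
have /andP[Tz zb] := Tzb; split; first exact: Oz.
by rewrite /= in_itv/= zb andbT; apply: ltW; exact: lt_trans aT Tz.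
Qed.

(** Without any solution, [xget] would return its default 0, and [w] would vanish almost everywhere
    on Omega x ]T, b]. But [w] is continuous, nonzero at (x1, t1), and vanishes outside that region,
    so the set where it is nonzero is open, nonempty and inside the region: a contradiction. *)
Let sol2 : generalized_solution c2 G2 Omega a b f (the_solution c2 G2 Omega a b f).
Proof.
have [[u gu]|no] := pselect (exists u, generalized_solution c2 G2 Omega a b f u).
  exact: the_solutionP gu.
have E : the_solution c2 G2 Omega a b f = fun=> 0.
  by apply: xgetPN => u gu; apply: no; exists u.
exfalso; have sw : continuous w.
  have [sp _ _] := Tpsi; have [sal _ _] := Tal.
  by apply: smooth_continuous; exact: (smoothM (smooth_fst sp) (smooth_snd sal)).
pose U := [set z | w z != 0].
have oU : open U.
  rewrite (_ : U = w @^-1` [set y | y != 0])//.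
  by apply: open_comp; [move=> z _; exact: sw|exact: open_neq].
apply: (@ae_open_false R n U (x1, t1) oU); first by rewrite /U /= /w /wave mulf_neq0.
apply: filterS the_solution_eq_wave => z; rewrite E => Hz Uz; move/eqP: (Uz); apply.
apply/esym/Hz.
  by apply: contrapT => Oz; move/eqP: Uz; apply; rewrite /w /wave (test_function_out Tpsi)// mul0r.
apply/andP; split.
  by rewrite ltNge; apply/negP => zT; move/eqP: Uz; apply; apply: w_out; exact: le_trans zT (ltW Tt0).
rewrite leNgt; apply/negP => bz; move/eqP: Uz; apply.
rewrite /w /wave (test_function_out Tal) ?mulr0//= in_itv/= => /andP[_].
by rewrite ltNge ltW.
Qed.

Let K1 := restricted_coefficients oO bO ba0 sc1 pc1 sF1.
Let K2 := restricted_coefficients oO bO ba0 sc2 pc2 sF2.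
Let c1' := restrict_speed Omega c1.
Let c2' := restrict_speed Omega c2.
Let F1' := restrict_kernel Omega F1.
Let F2' := restrict_kernel Omega F2.
(** The exceptional set is empty, as all time sections of the wave are continuous; the shape is the
    one of [solution_representative]. *)
Let Q : set VR := (Omega `\` set0) `*` `[a, b].
Let w' : VR -> R := w \_ Q.
Let p' i : VR -> R := (fun z : VR => wave_grad psi al z ord0 i) \_ Q.

Let wave_class : energy_class Omega a b w' p' /\
  forall ps th, test_function Omega ps -> test_function `]a, b[%classic th ->
    weak_form a b c1' F1' w' p' ps th =
    - 2 * \int[muxt]_(z in Omega `*` `[a, b]) (f z * (ps z.1 * th z.2)).
Proof.
have c1E x : Omega x -> c1' x = c1 x by exact: restrict_speedE.
have F1E x t : Omega x -> 0 <= t <= b - a -> F1' (x, t) = G1 (x, t).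
  by move=> Ox tab; rewrite /F1' restrict_kernelE// GF1.
have [sal _ _] := Tal; have cal := smooth_continuous sal.
have iw k : rintegrable mut `[a, b] (fun t => (k * al t) ^+ 2).
  apply: continuous_rintegrable => t.
  apply: (@continuous_comp _ _ _ (fun s => k * al s) (fun y : R => y ^+ 2) t).
    by apply: cvgM; [exact: cvg_cst|exact: cal].
  exact: exprn_continuous.
have HE x : Omega x -> ~ (set0 : set V) x ->
    rintegrable mut `[a, b] (fun t => w (x, t) ^+ 2) /\
    forall i, rintegrable mut `[a, b] (fun t => (wave_grad psi al (x, t) ord0 i) ^+ 2).
  move=> _ _; split; first exact: iw (psi x).
  move=> i; apply: (eq_rintegrable _ _ (iw ('D_(e_ i) psi x))) => // t _.
  by rewrite mxE.
have [[H1 _] H3] := solution_representative oO bO ab (lexx _) K1 c1E F1E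
  (wave_energy_space oO bO Tpsi Tal) (wave_equation oO bO ab sc1 sF1 GF1 Tpsi Tal at0 al0)
  (wave_initial oO psi at0 al0) measurable0 (measure0 _) HE.
by split.
Qed.

Let w'E (z : VR) : Omega z.1 -> a <= z.2 <= b -> w' z = w z.
Proof. by move=> Oz zab; rewrite /w' patchE mem_set//; split; [split|rewrite /= in_itv]. Qed.

(** The second solution equals the wave almost everywhere: after T by hypothesis, before T because
    both vanish. [weak_form_ae0] then equates their weak forms for the second operator, and both
    equations have the same source. *)
Let weak_forms_agree ps th : test_function Omega ps -> test_function `]a, b[%classic th ->
  weak_form a b c1' F1' w' p' ps th = weak_form a b c2' F2' w' p' ps th.
Proof.
move=> Tps Tth; have [cw ww] := wave_class.
have c2E x : Omega x -> c2' x = c2 x by exact: restrict_speedE.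
have F2E x t : Omega x -> 0 <= t <= b - a -> F2' (x, t) = G2 (x, t).
  by move=> Ox tab; rewrite /F2' restrict_kernelE// GF2.
have [u [q [cu eu wu]]] := generalized_solution_class oO bO ab (lexx _) K2 c2E F2E sol2.
have f0 z : z.2 <= T -> f z = 0 by move=> zT; apply: f_out; exact: le_lt_trans zT Tt0.
have u0 := solution_vanishes sc2 pc2 sF2 aT (ltW Tb) f0 cu wu.
have diff0 : {ae muxt, forall z : VR, w' z - u z = 0}.
  apply: filterS3 eu u0 the_solution_eq_wave => -[x t] Eu Eu0 Ew.
  have [[Ox tab]|out] := pselect (Omega x /\ a <= t <= b); last first.
    by rewrite (ec_u0 cw out) (ec_u0 cu out) subrr.
  have [tT|Tt] := leP t T.
    by rewrite Eu0// w'E// w_out ?subrr//= (le_trans tT)// ltW.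
  rewrite w'E// Eu; last by split=> //=; rewrite in_itv.
  by rewrite Ew ?subrr//= Tt; case/andP: tab.
have cd := energy_classB ab bO cw cu.
have E1 := weak_formB ab (lexx _) K2 bO Tps Tth cw cu.
have E2 := weak_form_ae0 oO bO ab (lexx _) sc2 pc2 sF2 cd diff0 Tps Tth.
have E3 := subr0_eq (etrans (esym E1) E2).
exact: (etrans (ww _ _ Tps Tth) (esym (etrans E3 (wu _ _ Tps Tth)))).
Qed.

Definition delayed (F : V * R -> R) : V * R -> R :=
  param_int (b - a) (fun y : (V * R) * R => F (y.1.1, y.2) * al (y.1.2 - y.2)).

(** Applied to the gradient of psi al, [memory_op] keeps the gradient of [psi] and replaces the time
    factor [al] by this function. *)
Definition response (c : V -> R) (F : V * R -> R) (z : V * R) : R :=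
  c z.1 * al z.2 - delayed F z.

Let g (x : V) : R := \sum_i 'D_(e_ i) psi x ^+ 2.

Let memory_op_wave c F i x t : smooth_on setT F -> a <= t <= b ->
  memory_op a (restrict_speed Omega c) (restrict_kernel Omega F) (p' i) (x, t) * 'D_(e_ i) psi x =
  response c F (x, t) * 'D_(e_ i) psi x ^+ 2.
Proof.
move=> sF tab; have /andP[at_ tb] := tab.
have [Ox|Ox] := pselect (Omega x); last first.
  by rewrite (test_function_out (test_function_derive (e_ i) Tpsi) Ox) expr0n /= !mulr0.
have p'E s : a <= s <= b -> p' i (x, s) = wave_grad psi al (x, s) ord0 i.
  by move=> sab; rewrite /p' patchE mem_set//; split; [split|rewrite /= in_itv].
have FF y s : Omega y -> 0 <= s <= b - a -> F (y, s) = F (y, s) by [].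
have E := wave_memoryE psi sF FF Tal at0 al0 i Ox tab.
rewrite /memory_op /response /delayed /= restrict_speedE//.
have -> : convx a (restrict_kernel Omega F) (p' i) (x, t) = wave_memory a b F psi al i (x, t).
  rewrite -E; apply: eq_Rintegral => s /set_mem /=; rewrite in_itv/= => /andP[as_ st].
  by rewrite restrict_kernelE// p'E// as_ (le_trans st tb).
rewrite p'E// mxE /wave_memory /=; ring.
Qed.

Section test_in_time.
Variable th : R -> R.
Hypothesis Tth : test_function `]a, b[%classic th.

Let mab : measurable ([set: V] `*` (`[a, b]%classic : set (measurableTypeR R))).
Proof. exact: measurableX. Qed.

Let wave_term c F : smooth_on setT c -> (forall x, 0 < c x) -> smooth_on setT F ->
  rintegrable muxt (setT `*` `[a, b]) (fun z => response c F z * g z.1 * th z.2) /\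
  weak_form a b (restrict_speed Omega c) (restrict_kernel Omega F) w' p' psi th =
  \int[muxt]_(z in setT `*` `[a, b]) (w' z * psi z.1 * 'D_1 ('D_1 th) z.2) +
  \int[muxt]_(z in setT `*` `[a, b]) (response c F z * g z.1 * th z.2).
Proof.
move=> sc pc sF; have [cw _] := wave_class.
have K := restricted_coefficients oO bO ba0 sc pc sF.
have it i := rintegrable_term ab (lexx _) K bO Tpsi Tth i cw.
have E (z : VR) : (setT `*` `[a, b]) z ->
    \sum_i memory_op a (restrict_speed Omega c) (restrict_kernel Omega F) (p' i) z *
      'D_(e_ i) psi z.1 * th z.2 = response c F z * g z.1 * th z.2.
  move: z => [x t] [_ /=]; rewrite in_itv/= => tab.
  rewrite -mulr_suml; congr (_ * _); rewrite /g mulr_sumr; apply: eq_bigr => i _.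
  exact: memory_op_wave.
split.
  apply: (eq_rintegrable mab _ (rintegrable_sum mab it)) => z /set_mem; exact: E.
rewrite /weak_form -(Rintegral_sum mab it); congr (_ + _).
by apply: eq_Rintegral => z /set_mem; exact: E.
Qed.

Lemma response_orthogonal :
  let d z := response c1 F1 z - response c2 F2 z in
  rintegrable muxt (setT `*` `[a, b]) (fun z => d z * g z.1 * th z.2) /\
  \int[muxt]_(z in setT `*` `[a, b]) (d z * g z.1 * th z.2) = 0.
Proof.
have [i1 E1] := wave_term sc1 pc1 sF1; have [i2 E2] := wave_term sc2 pc2 sF2.
have E := weak_forms_agree Tpsi Tth.
move=> d; have dE z : d z * g z.1 * th z.2 =
    response c1 F1 z * g z.1 * th z.2 - response c2 F2 z * g z.1 * th z.2.
  by rewrite /d; exact: factor_subr.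
split.
  by apply: (eq_rintegrable mab _ (rintegrableB mab i1 i2)) => z _; exact/esym/dE.
transitivity (\int[muxt]_(z in setT `*` `[a, b])
    (response c1 F1 z * g z.1 * th z.2 - response c2 F2 z * g z.1 * th z.2)).
  by apply: eq_Rintegral => z _; exact: dE.
rewrite (RintegralB mab i1 i2).
by have := etrans (esym E1) (etrans E E2) => /addrI ->; rewrite subrr.
Qed.

End test_in_time.

(** If [s] times the difference of the responses is at least k > 0 on [S] near time t, then its
    integral against |grad psi|^2 and a bump in time dominates k times that of a continuous
    nonnegative function that is not identically 0, against [response_orthogonal]. The factor [s]
    selects the sign. *)
Lemma response_gap (S : set V) (s t e k : R) :
  (forall x i, ~ S x -> 'D_(e_ i) psi x = 0) ->
  (exists x i, 'D_(e_ i) psi x != 0) -> 0 < e -> a < t - e -> t + e < b -> 0 < k ->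
  (forall x r, S x -> `|r - t| < e ->
     k <= s * (response c1 F1 (x, r) - response c2 F2 (x, r))) -> False.
Proof.
move=> Sout [x [i Dx]] e0 ate teb k0 gap.
have mab : measurable ([set: V] `*` (`[a, b]%classic : set (measurableTypeR R))) by exact: measurableX.
have Tth := test_function_bump ate teb; have [sp _ _] := Tpsi.
have /= [idd' int0'] := response_orthogonal Tth.
pose d (z : V * R) := (response c1 F1 z - response c2 F2 z) * g z.1 * bump t e z.2.
have idd : rintegrable muxt (setT `*` `[a, b]) d := idd'.
have int0 : \int[muxt]_(z in setT `*` `[a, b]) d z = 0 := int0'.
pose h (z : V * R) := g z.1 * bump t e z.2.
have g0 y : 0 <= g y by apply: sumr_ge0 => j _; exact: sqr_ge0.
have h0 z : 0 <= h z by rewrite mulr_ge0// bump_ge0.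
have sg : smooth_on setT g.
  by apply: smooth_sum => j; apply: smoothM; exact: smooth_derive.
have ch : continuous h.
  by apply: smooth_continuous; exact: (smoothM (smooth_fst sg) (smooth_snd (smooth_bump t e))).
have idsh := rintegrableZl s mab idd.
have le z : k * h z <= s * d z.
  have [gz|gz] := eqVneq (g z.1) 0; first by rewrite /d /h gz !(mul0r, mulr0).
  have [bz|bz] := eqVneq (bump t e z.2) 0; first by rewrite /d /h bz !mulr0.
  have Sz : S z.1.
    by apply: contrapT => nS; move/eqP: gz; apply; apply: big1 => j _; rewrite Sout ?expr0n.
  have tz : `|z.2 - t| < e by rewrite ltNge; apply/negP => te; move/eqP: bz; apply; exact: bump_eq0.
  have := gap z.1 z.2 Sz tz; rewrite -surjective_pairing => H.
  have -> : s * d z = s * (response c1 F1 z - response c2 F2 z) * h z by rewrite /d /h -!mulrA.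
  exact: ler_wpM2r (h0 z) _ _ H.
have ih : rintegrable muxt (setT `*` `[a, b]) h.
  apply: (rintegrable_le mab _ _ (rintegrableZl k^-1 mab idsh)).
    by apply: measurable_funTS; exact: measurable_continuous.
  by move=> z _; rewrite ger0_norm// mulrC ler_pdivlMr// mulrC.
have inth : \int[muxt]_(z in setT `*` `[a, b]) h z = 0.
  apply/eqP; rewrite eq_le; apply/andP; split; last by apply: Rintegral_ge0.
  rewrite -(ler_pM2l k0) mulr0 -(RintegralZl _ mab ih).
  apply: (@le_trans _ _ (\int[muxt]_(z in setT `*` `[a, b]) (s * d z))).
    by apply: le_Rintegral => //; exact: (rintegrableZl k mab ih).
  by rewrite (RintegralZl _ mab idd) int0 mulr0.
have hae := Rintegral_ae0 mab ih (fun z _ => h0 z) inth.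
pose U := [set z : V * R | h z != 0].
have oU : open U.
  rewrite (_ : U = h @^-1` [set y | y != 0])//.
  by apply: open_comp; [move=> z _; exact: ch|exact: open_neq].
apply: (@ae_open_false R n U (x, t) oU).
  rewrite /U /= /h mulf_neq0//=; last by rewrite gt_eqF// bump_gt0// subrr normr0.
  rewrite gt_eqF// /g (bigD1 i)//= ltr_pwDl//; first by rewrite exprn_even_gt0.
  by apply: sumr_ge0 => j _; exact: sqr_ge0.
apply: filterS hae => z Hz Uz; move/eqP: (Uz); apply; apply: Hz; split=> //=.
rewrite in_itv/=; have tz : `|z.2 - t| < e.
  by rewrite ltNge; apply/negP => te; move/eqP: Uz; apply; rewrite /h bump_eq0 ?mulr0.
by move: tz; rewrite ltr_distl => /andP[/(lt_trans ate) h1 h2]; rewrite !ltW// (lt_trans h2).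
Qed.

End two_operators.

End uniqueness.

(** * Recovery of the coefficients *)

Section recovery.
Context (R : realType) (n : nat).
Local Notation V := 'rV[R]_n.
Local Notation VR := (V * measurableTypeR R)%type.
Local Notation e_ i := (delta_mx ord0 i : V).
Local Notation mut := (@lebesgue_measure R).
Local Notation muxt := (lebesgue_rv R n \x @lebesgue_measure R)%E.

Lemma Rintegral_bump_gt0 (x r : R) : 0 < r -> 0 < \int[mut]_(t in `[x - r, x + r]) bump x r t.
Proof.
move=> r0; have mD : measurable (`[x - r, x + r]%classic : set (measurableTypeR R)) by [].
rewrite lt_neqAle; apply/andP; split; last by apply: Rintegral_ge0 => t _; exact: bump_ge0.
apply/eqP => /esym int0.
have cb : continuous (bump x r) by apply: smooth_continuous; exact: smooth_bump.
have ib : rintegrable mut `[x - r, x + r] (bump x r) by exact: continuous_rintegrable.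
have [A [mA A0 DA]] := Rintegral_ae0 mD ib (fun t _ => bump_ge0 x r t) int0.
have mB : measurable (ball x r : set (measurableTypeR R)) by exact: measurable_ball.
have BA : ball x r `<=` A.
  move=> t; rewrite /ball /= => xt; apply: DA => /= H.
  have : 0 < bump x r t by apply: bump_gt0; rewrite distrC.
  rewrite H ?ltxx// in_itv/=; move: xt; rewrite ltr_norml => /andP[h1 h2].
  by apply/andP; split; lra.
have : (mut (ball x r) <= 0)%E by rewrite -A0; apply: le_measure; rewrite ?inE.
rewrite [X in (X <= _)%E](_ : _ = (r *+ 2)%:E); last exact: (lebesgue_measure_ball _ (ltW r0)).
by rewrite lee_fin leNgt mulrn_wgt0.
Qed.

Variables (Omega : set V) (a b T : R) (c1 c2 : V -> R) (G1 G2 F1 F2 : V * R -> R) (i0 : 'I_n).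
Hypotheses (oO : open Omega) (bO : bounded_set Omega) (aT : a < T) (Tb : T < b).
Hypotheses (sc1 : smooth_on setT c1) (pc1 : forall x, 0 < c1 x).
Hypotheses (sc2 : smooth_on setT c2) (pc2 : forall x, 0 < c2 x).
Hypotheses (sF1 : smooth_on setT F1) (sF2 : smooth_on setT F2).
Hypothesis GF1 : forall x t, Omega x -> 0 <= t <= b - a -> G1 (x, t) = F1 (x, t).
Hypothesis GF2 : forall x t, Omega x -> 0 <= t <= b - a -> G2 (x, t) = F2 (x, t).
Hypothesis same : forall f t0, T < t0 -> smooth_on setT f -> (forall z, z.2 < t0 -> f z = 0) ->
  {ae muxt, forall z : VR, Omega z.1 -> T < z.2 <= b ->
    the_solution c1 G1 Omega a b f z = the_solution c2 G2 Omega a b f z}.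

Let ab : a < b. Proof. exact: lt_trans aT Tb. Qed.

(* The source is the image of [rv_bump x0 rho (x) bump (T + 2 de) de]; the two
   responses are compared near [(x0, t)]. *)
Let gap (x0 : V) (rho de s t e k : R) : 0 < rho -> 0 < de -> T + 3 * de < b ->
  box x0 rho `<=` Omega -> 0 < e -> a < t - e -> t + e < b -> 0 < k ->
  (forall x r, box x0 rho x -> `|r - t| < e ->
     k <= s * (response a b (bump (T + 2 * de) de) c1 F1 (x, r) -
               response a b (bump (T + 2 * de) de) c2 F2 (x, r))) -> False.
Proof.
move=> rho0 de0 deb bxO e0 ate teb k0 H.
have Tpsi := test_function_rv_bump bxO.
have Tal : test_function `]a, b[%classic (bump (T + 2 * de) de).
  by apply: test_function_bump; [move: aT|]; lra.
have al0 r : r <= T + de -> bump (T + 2 * de) de r = 0.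
  by move=> rT; apply: bump_eq0; rewrite ler_normr; apply/orP; right; lra.
have px : rv_bump x0 rho x0 != 0 by rewrite gt_eqF// rv_bump_gt0.
have pt : bump (T + 2 * de) de (T + 2 * de) != 0 by rewrite gt_eqF// bump_gt0// subrr normr0.
have Tt0 : T < T + de by rewrite ltrDl.
have [v Dv] := rv_bump_gradient x0 i0 rho0.
apply: (response_gap oO bO ab aT Tb sc1 pc1 sc2 pc2 sF1 sF2 GF1 GF2 same Tpsi Tal Tt0 al0 px pt
  (S := box x0 rho) (s := s) (t := t) (e := e) (k := k)) => //.
- by move=> x i; exact: derive_rv_bump_out.
- by exists v, i0.
Qed.

Let delayedB al x r d : smooth_on setT al ->
  d * (delayed a b al F1 (x, r) - delayed a b al F2 (x, r)) =
  \int[mut]_(s in `[0, b - a]) (d * (F1 (x, s) - F2 (x, s)) * al (r - s)).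
Proof.
move=> sal; have cal := smooth_continuous sal.
have mD : measurable (`[0, b - a]%classic : set (measurableTypeR R)) by [].
have i_ F : smooth_on setT F -> rintegrable mut `[0, b - a] (fun s => F (x, s) * al (r - s)).
  move=> sF; apply: continuous_rintegrable => s.
  apply: cvgM; first exact: (@section_continuous R _ F x (smooth_continuous sF)).
  apply: (@continuous_comp _ _ _ (fun s : R => r - s) al); last exact: cal.
  by apply: cvgB; [exact: cvg_cst|exact: cvg_id].
rewrite /delayed /param_int /= -(RintegralB mD (i_ _ sF1) (i_ _ sF2)).
rewrite -(RintegralZl _ mD (rintegrableB mD (i_ _ sF1) (i_ _ sF2))).
by apply: eq_Rintegral => s _; rewrite -mulrBl mulrA.
Qed.

Let box_ball (x : V) e : 0 < e -> box x (e / 2) `<=` ball x e.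
Proof.
move=> e0 v H; apply/rv_ballP => // i; rewrite distrC (le_lt_trans (H i))//.
by rewrite ltr_pdivrMr// ltr_pMr// ltr1n.
Qed.

(** At times near T1 + r0 the source wave, concentrated around T1, is over, so the speeds drop out
    and the memory reads the kernels at delays near r0. If they differed at (x0, r0), then [d] times
    their difference would exceed d^2/2 nearby. The factor passed to [gap] is [- d], since memory
    enters [response] with a minus sign. *)
Let kernels_agree_gt0 x0 r0 : Omega x0 -> 0 < r0 < b - T -> F1 (x0, r0) = F2 (x0, r0).
Proof.
move=> Ox /andP[r00 r0b]; apply: contrapT => ne.
pose d := F1 (x0, r0) - F2 (x0, r0).
have d0 : d != 0 by rewrite subr_eq0; exact/eqP.
have d2 : 0 < d ^+ 2 by rewrite exprn_even_gt0.
have cD : continuous (fun z : V * R => d * (F1 z - F2 z)).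
  apply: smooth_continuous.
  exact: (smoothM (@smooth_cst _ _ d) (smoothB sF1 sF2)).
have near1 : \forall z \near (x0, r0), d ^+ 2 / 2 < d * (F1 z - F2 z) /\ Omega z.1.
  have h1 : \forall z \near (x0, r0), d ^+ 2 / 2 < d * (F1 z - F2 z).
    apply: (cvgr_gt _ (cD (x0, r0))).
    by rewrite -/d -expr2 ltr_pdivrMr// ltr_pMr// ltr1n.
  have h2 : \forall z \near (x0, r0), Omega z.1.
    have : (fun z : V * R => z.1) @ (x0, r0) --> x0 by exact: cvg_fst.
    by move=> H; apply: H; exact: open_nbhs_nbhs.
  by near=> z; split; near: z.
have /nbhs_ballP[e /= e0 He] := near1.
(* [e / 4] keeps the delays that matter, which lie within 2 de of r0, inside the neighbourhood of
   radius [e]; [r0 / 2] places the observation after the end T1 + de of the bump and the delays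
   above 0; the last bound keeps T1 + r0 + de = T + r0 + 3 de below b. *)
pose de := Num.min (e / 4) (Num.min (r0 / 2) ((b - T - r0) / 4)).
have de0 : 0 < de by rewrite !lt_min !divr_gt0//; move: r0b; lra.
have [de1 de2 de3] : [/\ de <= e / 4, de <= r0 / 2 & de <= (b - T - r0) / 4].
  by rewrite /de; split; rewrite !ge_min lexx ?orbT.
pose T1 := T + 2 * de.
pose k0 := \int[mut]_(t in `[T1 - de, T1 + de]) bump T1 de t.
have k00 : 0 < k0 by exact: Rintegral_bump_gt0.
have inb x : box x0 (e / 2) x -> forall r, `|r - r0| < e -> d ^+ 2 / 2 < d * (F1 (x, r) - F2 (x, r)) /\ Omega x.
  move=> bx r rr; apply: (He (x, r)); split; first exact: box_ball bx.
  by rewrite -ball_normE /= distrC.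
apply: (@gap x0 (e / 2) de (- d) (T1 + r0) de (d ^+ 2 / 2 * k0)) => //.
- by rewrite divr_gt0.
- by move: r00 r0b; lra.
- by move=> x bx; apply: (inb x bx r0 _).2; rewrite subrr normr0.
- by rewrite /T1; move: aT; lra.
- by rewrite /T1; lra.
- by rewrite mulr_gt0// divr_gt0.
move=> x r bx; rewrite ltr_distl => /andP[r1 r2].
rewrite -/T1 in r1 r2 *; rewrite /response /=.
have -> : bump T1 de r = 0.
  by apply: bump_eq0; rewrite ler_normr; apply/orP; left; rewrite /T1 in r1 r2 *; lra.
rewrite !mulr0 !sub0r opprK mulNr -mulrN opprD opprK.
rewrite (delayedB _ _ _ (@smooth_bump _ T1 de)).
have sb := @smooth_bump R T1 de; have cb := smooth_continuous sb.
have mD : measurable (`[0, b - a]%classic : set (measurableTypeR R)) by [].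
have cbr : continuous (fun s : R => bump T1 de (r - s)).
  move=> s; apply: (@continuous_comp _ _ _ (fun s : R => r - s) (bump T1 de)); last exact: cb.
  by apply: cvgB; [exact: cvg_cst|exact: cvg_id].
have ibr := continuous_rintegrable 0 (b - a) cbr.
(* The delays s with r - s in the support of the bump all lie in [0, b - a], so its whole mass [k0]
   is seen. *)
have Ek : \int[mut]_(s in `[0, b - a]) bump T1 de (r - s) = k0.
  have rl : r - (b - a) <= r by rewrite gerBl subr_ge0 ltW.
  have := Rintegral_translate_reflect rl cbr; rewrite (_ : r - (r - (b - a)) = b - a); last by ring.
  move=> <-; rewrite /k0; apply: Rintegral_eq_supp => s /=; rewrite !in_itv/=.
  - by move=> _ _; congr bump; ring.
  - move=> _ /negP; rewrite negb_and -!ltNge => H; rewrite bump_eq0//.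
    rewrite (_ : r - (r - s) = s); last by ring.
    by rewrite ler_normr; apply/orP; case/orP: H => H; [right|left]; lra.
  - move=> /andP[h1 h2] H; exfalso; apply: H; apply/andP; split.
      by rewrite /T1 in r1 r2 h1 h2; move: aT; lra.
    by rewrite /T1 in r1 r2 h1 h2; lra.
rewrite -Ek -(RintegralZl _ mD ibr); apply: (le_Rintegral mD).
- exact: (rintegrableZl _ mD ibr).
- apply: continuous_rintegrable => s; apply: cvgM; last exact: cbr.
  exact: (@section_continuous R _ _ x cD).
- move=> s _ /=; have [bs|bs] := eqVneq (bump T1 de (r - s)) 0; first by rewrite bs !mulr0.
  have : `|r - s - T1| < de by rewrite ltNge; apply/negP => H; move/eqP: bs; apply; exact: bump_eq0.
  rewrite ltr_norml => /andP[s1 s2]; apply: (ler_wpM2r (bump_ge0 _ _ _)); apply: ltW.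
  by apply: (inb x bx s _).1; rewrite ltr_norml; apply/andP; split; lra.
Unshelve. all: end_near. Qed.

(** The delay 0 is out of reach of the preceding argument, which needs r0 > 0 to separate
    observation from source; it is recovered by continuity. *)
Lemma kernels_agree x r : Omega x -> 0 <= r < b - T -> F1 (x, r) = F2 (x, r).
Proof.
move=> Ox /andP[r0 rb]; move: r0; rewrite le_eqVlt => /predU1P[<-|r0]; last first.
  by apply: kernels_agree_gt0; rewrite ?r0.
apply/eqP; rewrite -subr_eq0; apply/negPn/negP => ne.
have cD : continuous (fun s : R => F1 (x, s) - F2 (x, s)).
  exact: (@section_continuous R _ _ x (smooth_continuous (smoothB sF1 sF2))).
have := cD 0; move=> /(_ _ (open_nbhs_nbhs (conj (@open_neq R 0) ne : open_nbhs _ _))) H.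
have : \forall s \near 0^'+, F1 (x, s) - F2 (x, s) != 0 by exact: cvg_at_right_filter H.
move=> {}H; near (0 : R)^'+ => s.
have : F1 (x, s) - F2 (x, s) != 0 by near: s.
rewrite kernels_agree_gt0 ?subrr ?eqxx//; apply/andP; split; near: s.
  exact: nbhs_right_gt.
by apply: nbhs_right_lt; rewrite subr_gt0.
Unshelve. all: end_near. Qed.

(** The responses are compared at the peak T1 of the bump. There the memory involves only delays
    below 2 de, at which the kernels are already known to agree, so only the difference of the
    speeds remains. *)
Lemma speeds_agree x0 : Omega x0 -> c1 x0 = c2 x0.
Proof.
move=> Ox; apply: contrapT => ne; pose d := c1 x0 - c2 x0.
have d0 : d != 0 by rewrite subr_eq0; exact/eqP.
have d2 : 0 < d ^+ 2 by rewrite exprn_even_gt0.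
have cD : continuous (fun x : V => d * (c1 x - c2 x)).
  apply: smooth_continuous.
  exact: (smoothM (@smooth_cst _ _ d) (smoothB sc1 sc2)).
have near1 : \forall x \near x0, d ^+ 2 / 2 < d * (c1 x - c2 x) /\ Omega x.
  have h1 : \forall x \near x0, d ^+ 2 / 2 < d * (c1 x - c2 x).
    apply: (cvgr_gt _ (cD x0)).
    by rewrite -/d -expr2 ltr_pdivrMr// ltr_pMr// ltr1n.
  have h2 : \forall x \near x0, Omega x by exact: open_nbhs_nbhs.
  by near=> x; split; near: x.
have /nbhs_ballP[e /= e0 He] := near1.
(* With this choice the bump ends at T + 3 de < b, and the delays below 2 de are within the range b
   - T of [kernels_agree]. *)
pose de := (b - T) / 4; have de0 : 0 < de by rewrite divr_gt0// subr_gt0.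
pose T1 := T + 2 * de.
have sb := @smooth_bump R T1 de; have cb := smooth_continuous sb.
have bT1 : 0 < bump T1 de T1 by rewrite bump_gt0// subrr normr0.
have near2 : \forall t \near T1, bump T1 de T1 / 2 < bump T1 de t.
  apply: (cvgr_gt _ (cb T1)).
  by rewrite ltr_pdivrMr// ltr_pMr// ltr1n.
have /nbhs_ballP[e2 /= e20 He2] := near2.
(* Within [e2] of T1 the bump exceeds half of its peak value; [de / 2] ensures that a delay of at
   least 2 de falls before the support of the bump. *)
pose ep := Num.min e2 (de / 2).
have ep0 : 0 < ep by rewrite lt_min e20 divr_gt0.
have [ep1 ep2] : ep <= e2 /\ ep <= de / 2 by rewrite /ep; split; rewrite !ge_min lexx ?orbT.
have deE : 4 * de = b - T by rewrite /de; field.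
apply: (@gap x0 (e / 2) de d T1 ep (d ^+ 2 / 2 * (bump T1 de T1 / 2))) => //.
- by rewrite divr_gt0.
- by move: Tb; lra.
- by move=> x bx; apply: (He x _).2; exact: box_ball.
- by rewrite /T1; move: aT; lra.
- by rewrite /T1; lra.
- by rewrite mulr_gt0 ?divr_gt0.
move=> x r bx rT1; have [Dx Ox'] := He x (box_ball e0 bx).
have br : bump T1 de T1 / 2 < bump T1 de r.
  by apply: He2; rewrite -ball_normE /= distrC (lt_le_trans rT1).
rewrite -/T1 /response /=.
set D1 := delayed _ _ _ F1 _; set D2 := delayed _ _ _ F2 _.
rewrite [X in d * X](_ : _ = (c1 x - c2 x) * bump T1 de r - (D1 - D2)); last by ring.
have E0 : D1 - D2 = 0.
  rewrite -[LHS]mul1r /D1 /D2 (delayedB _ _ _ sb) Rintegral_zero// => s /=; rewrite in_itv/= => /andP[s0 _].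
  have [sde|sde] := ltP s (2 * de).
    by rewrite kernels_agree ?subrr ?mulr0 ?mul0r// s0; lra.
  rewrite bump_eq0 ?mulr0// ler_normr; apply/orP; right.
  by move: rT1; rewrite ltr_norml => /andP[h1 h2]; lra.
rewrite E0 subr0 [X in _ <= X]mulrA; apply: ler_pM; [apply: ltW; rewrite divr_gt0//|apply: ltW; rewrite divr_gt0//|exact: ltW Dx|exact: ltW br].
Unshelve. all: end_near. Qed.

End recovery.

Section right_derivative.
Context (R : realType).

(** The induction runs over all times of [0, de[, since a right derivative at t uses values at later
    times; the half-open interval is stable under small right shifts. *)
Lemma iter_right_derive_eq (f g : R -> R) (de : R) : (forall t, 0 <= t < de -> f t = g t) ->
  forall j t, 0 <= t < de -> iter j (@right_derive R) f t = iter j (@right_derive R) g t.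
Proof.
move=> fg; elim=> [|j IHj] t tde; first exact: fg.
rewrite !iterS /right_derive; congr lim; apply/funext => A; apply/propext.
have /andP[t0 td] := tde.
have E : \forall h \near 0^'+, h^-1 * (iter j (@right_derive R) f (t + h) - iter j (@right_derive R) f t) =
    h^-1 * (iter j (@right_derive R) g (t + h) - iter j (@right_derive R) g t).
  near=> h; rewrite (IHj t)// (IHj (t + h))//; apply/andP; split.
    by rewrite addr_ge0// ltW//; near: h; exact: nbhs_right_gt.
  by rewrite -ltrBrDl; near: h; apply: nbhs_right_lt; rewrite subr_gt0.
by split=> H; move: E H; apply: filterS2 => h /= ->.
Unshelve. all: end_near. Qed.

End right_derivative.

Lemma bounded_set_closure (R : realType) n (A : set 'rV[R]_n) : bounded_set A -> bounded_set (closure A).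
Proof.
rewrite /bounded_set => -[M [Mr HM]]; exists M; split=> // m Mm /= x.
have cl : closed [set x : 'rV[R]_n | `|x| <= m].
  apply: (@closed_comp _ _ (fun x : 'rV[R]_n => `|x|) [set r : R | r <= m]); last exact: closed_le.
  by move=> y _; exact: norm_continuous.
by move=> /(@closure_subset _ _ [set y | `|y| <= m] (HM m Mm)); rewrite -(closure_id _).1.
Qed.

Lemma source_to_solutionE (R : realType) n c G (Omega : set 'rV[R]_n) a b E f z : E z ->
  source_to_solution c G Omega a b E f z = the_solution c G Omega a b f z.
Proof. by move=> Ez; rewrite /source_to_solution patchE mem_set. Qed.

Unset Implicit Arguments.
Set Printing Implicit Defensive.
Theorem theorem1p3 (R : realType) (n : nat) (hn : (2 <= n)%N)
    (Omega Omega' : set 'rV[R]_n)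
    (oOmega : open Omega) (oOmega' : open Omega')
    (bOmega : bounded_set Omega) (bOmega' : bounded_set Omega')
    (sOmega : smooth_boundary Omega) (sOmega' : smooth_boundary Omega')
    (cOmega : closure Omega `<=` Omega')
    (S' T T' : R) (hS' : - S' < 0) (hT : 0 < T) (hT' : T < T')
    (M M' : set ('rV[R]_n * R)%type)
    (defM : M = closure Omega `*` `[0, T])
    (defM' : M' = closure Omega' `*` `[- S', T'])
    (c1 c2 : 'rV[R]_n -> R)
    (sc1 : smooth_on setT c1) (sc2 : smooth_on setT c2)
    (pc1 : forall x, 0 < c1 x) (pc2 : forall x, 0 < c2 x)
    (c12 : forall x, (closure Omega' `\` Omega) x -> c1 x = c2 x)
    (A1 : forall c, c = c1 \/ c = c2 ->
       strictly_convex (conformal_metric c) Omega)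
    (A2 : forall c, c = c1 \/ c = c2 ->
       n = 2%N -> simple (conformal_metric c) Omega)
    (A3 : forall c, c = c1 \/ c = c2 ->
       (3 <= n)%N -> foliated_by_strictly_convex (conformal_metric c) Omega)
    (G1 G2 : 'rV[R]_n * R -> R)
    (sG1 : smooth_closed (closure Omega' `*` `[0, S' + T']) G1)
    (sG2 : smooth_closed (closure Omega' `*` `[0, S' + T']) G2)
    (G12 : forall x t, (closure Omega' `\` Omega) x -> t \in `[0, S' + T'] ->
       G1 (x, t) = G2 (x, t))
    (S12 : forall f, test_function_closed M' M f ->
       source_to_solution c1 G1 Omega' (- S') T' (M' `\` M) f =
       source_to_solution c2 G2 Omega' (- S') T' (M' `\` M) f
         %[ae (lebesgue_rv R n \x @lebesgue_measure R)%E]) :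
  (forall x, Omega x -> c1 x = c2 x) /\
  (forall (j : nat) x, Omega x ->
     iter j (@right_derive R) (fun t => G1 (x, t)) 0 =
     iter j (@right_derive R) (fun t => G2 (x, t)) 0).
Proof.
have aT : - S' < T by exact: lt_trans hT.
have [F1 sF1 GF1] := sG1; have [F2 sF2 GF2] := sG2.
have itvM t : 0 <= t <= T' - - S' -> t \in `[0, S' + T'] by rewrite opprK addrC in_itv.
have gf1 x t : Omega' x -> 0 <= t <= T' - - S' -> G1 (x, t) = F1 (x, t).
  by move=> Ox /itvM tt; apply: GF1; split=> //; exact: subset_closure.
have gf2 x t : Omega' x -> 0 <= t <= T' - - S' -> G2 (x, t) = F2 (x, t).
  by move=> Ox /itvM tt; apply: GF2; split=> //; exact: subset_closure.
(* A coordinate direction, in which bump functions have a nonzero derivative. *)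
have i0 : 'I_n by exists 0%N; exact: leq_trans hn.
have cptM' : compact M'.
  rewrite defM'; apply: compact_setX; last exact: segment_compact.
  by apply: bounded_closed_compact; [exact: bounded_set_closure|exact: closed_closure].
have clM' : closed M'.
  rewrite defM' (_ : _ `*` _ = (fst @^-1` closure Omega') `&` (snd @^-1` `[- S', T']%classic)); last first.
    by apply/seteqP; split.
  by apply: closedI; apply: closed_comp => [z _|]; [exact: cvg_fst|exact: closed_closure|
    exact: cvg_snd|exact: itv_closed].
(* A source that vanishes before t0 > T has its support in M' at times at least t0, hence off M, and
   is admissible even if its support reaches the boundary of M'. For points of Omega' at times in
   ]T, T'], which lie in M' minus M, the source-to-solution map is the solution itself. *)
have same (f : 'rV[R]_n * R -> R) t0 : T < t0 -> smooth_on setT f -> (forall z, z.2 < t0 -> f z = 0) ->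
    {ae (lebesgue_rv R n \x @lebesgue_measure R)%E, forall z, Omega' z.1 -> T < z.2 <= T' ->
      the_solution c1 G1 Omega' (- S') T' f z = the_solution c2 G2 Omega' (- S') T' f z}.
  move=> Tt0 sf f0.
  have cl : closed (M' `&` [set z | t0 <= z.2]).
    apply: closedI => //; apply: (@closed_comp _ _ snd [set r : R | t0 <= r]); last exact: closed_ge.
    by move=> z _; exact: cvg_snd.
  have sub : closure (M' `&` [set z | f z != 0]) `<=` M' `&` [set z | t0 <= z.2].
    rewrite closureE => z; apply; split=> // y [My fy]; split=> //=.
    by rewrite leNgt; apply/negP => /f0 fy0; move: fy; rewrite /= fy0 eqxx.
  have /S12 : test_function_closed M' M f.
    split; first by exists f.
      by apply: (subclosed_compact _ cptM' (subset_trans sub (@subIsetl _ _ _))); exact: closed_closure.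
    move=> z /sub [Mz t0z]; split=> // Mz'; move: Mz'; rewrite defM => -[_] /=.
    by rewrite in_itv/= => /andP[_ zT]; move: (lt_le_trans Tt0 t0z); rewrite ltNge zT.
  apply: (@filterS _ _ (ae_filter_ringOfSetsType (lebesgue_rv R n \x @lebesgue_measure R)%E)) => z /(_ I) E Oz /andP[Tz zT'].
  have zM : (M' `\` M) z.
    split; first by rewrite defM'; split; [exact: subset_closure|rewrite /= in_itv/= (ltW (lt_trans aT Tz))].
    by rewrite defM => -[_] /=; rewrite in_itv/= => /andP[_]; rewrite leNgt Tz.
  exact: etrans (esym (source_to_solutionE c1 G1 _ _ _ f zM)) (etrans E (source_to_solutionE c2 G2 _ _ _ f zM)).
have sub x : Omega x -> Omega' x by move=> /subset_closure /cOmega.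
split=> [x /sub Ox|j x /sub Ox].
  exact: (speeds_agree i0 oOmega' bOmega' aT hT' sc1 pc1 sc2 pc2 sF1 sF2 gf1 gf2 same Ox).
(* Agreement of the kernels on [0, T' - T[, a right neighbourhood of 0, determines all iterated
   right derivatives at 0. *)
apply: (@iter_right_derive_eq _ _ _ (T' - T)); last by rewrite lexx subr_gt0.
move=> t /andP[t0 tT]; have tt : 0 <= t <= T' - - S'.
  by rewrite t0 (le_trans (ltW tT))// lerD2l lerN2 ltW.
rewrite gf1// gf2//; apply: (kernels_agree i0 oOmega' bOmega' aT hT' sc1 pc1 sc2 pc2 sF1 sF2 gf1 gf2 same Ox).
by rewrite t0.
Qed.
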